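(* Let $p\neq 2$ be a prime, let $\mathfrak m:=\langle p,t+1\rangle\subset\Lambda$, and let $A$ be an $\mathfrak m$-local $\Lambda$-module equipped with an epimorphism $\Lambda^2\twoheadrightarrow A$. If $H(A)\subset\mathrm{Bu}_3$ is genus-zero, then $H(A)$ is conjugate in $\mathrm{Bu}_3$ to one of the following subgroups (defined in the context): - $H_1(7,1),\ H_2(7,1),\ H_3(7,1),\ H(7,0)$; - $H_1(5,1),\ H_2(5,1),\ I(5,1),\ H(5,0),\ \tilde I(5),\ \tilde H(5)$, and $H(25;a)$ with $a\in\mathbb Z_{25}$, $a\equiv-1\pmod 5$, $a\not\equiv-1\pmod{25}$; - $H(3,1),\ I_1(3,1),\ I_2(3,1),\ H(3,0),\ \tilde I(3),\ \tilde H(3)$, and $H(9;a)$ with $a\in\mathbb Z_9$, $a\equiv-1\pmod 3$, $a\not\equiv-1\pmod 9$; - $H_1(9,2),\ H_2(9,2),\ H_3(9,2),\ I_1(9,2),\ I_2(9,2),\ H(9,1),\ I_1(9,1),\ I_2(9,1),\ H(9,0)$; - $H_1'(9,2),\ H_2'(9,2),\ H_3'(9,2),\ H'(9,1),\ \tilde H_1(9),\ \tilde H_2(9)$; - $H(27;a)$ with $a\in\mathbb Z_{27}$, $a\equiv-1\pmod 3$, $a\not\equiv-1\pmod 9$.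
   Context: **Burau group.** $\Lambda:=\mathbb Z[t,t^{-1}]$, $\Gamma:=PSL(2,\mathbb Z)$, $\mathbb Z_n:=\mathbb Z/n$. $\mathrm{Bu}_3\subset GL(2,\Lambda)$ is the subgroup generated by $\mathbb X=\begin{pmatrix}0&-t\\ t&-t\end{pmatrix}$, $\mathbb Y=\begin{pmatrix}0&-t\\ -t^2&0\end{pmatrix}$ and $t\cdot 1$. The epimorphism $\operatorname{c}\colon\mathrm{Bu}_3\to\Gamma$ is evaluation of a matrix at $t=-1$ followed by projectivization. A finite-index subgroup $K\subset\Gamma$ is genus-zero if the modular curve $X_K$ (the standard compactification of $K\backslash\mathbb H$, $\mathbb H$ the upper half plane) has genus $0$. A finite-index subgroup $H\subset\mathrm{Bu}_3$ is called genus-zero if $\operatorname{c}(H)$ is genus-zero. The depth $\operatorname{d}(H)$ of a finite-index subgroup is the least positive integer $d$ with $t^d\cdot1\in H$. **$H(A)$.** For a $\Lambda$-module $A$ with an epimorphism $\phi\colon\Lambda^2\twoheadrightarrow A$, $H(A)=H(\phi):=\{h\in\mathrm{Bu}_3\mid(h-1)\Lambda^2\subset\operatorname{Ker}\phi\}$. For a maximal ideal $\mathfrak m$, an $\mathfrak m$-local module is a non-trivial $\Lambda$-module annihilated by $\mathfrak m^n$ for some $n$. For a subgroup $H\subset \mathrm{Bu}_3$, $A(H):=\Lambda^2/\langle(h-1)u\mid u\in\Lambda^2,h\in H\rangle$. **Stabilizers.** For a $\Lambda$-module $A$ let $\mathcal E(A)=\{(a_1,a_2)\in A^2\mid\Lambda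 a_1+\Lambda a_2=A\}$, with right $\mathrm{Bu}_3$-action $(a_1,a_2)\cdot\begin{pmatrix} x & y \\ z & w \end{pmatrix}=(xa_1+za_2,\,ya_1+wa_2)$. For $(a_1,a_2)\in\mathcal E(A)$ let $\operatorname{St}_A(a_1,a_2)\subset\mathrm{Bu}_3$ be its stabilizer; it equals $H(\phi)$ for the epimorphism $\phi$ sending the standard basis of $\Lambda^2$ to $a_1,a_2$. For a quotient ring $R$ of $\Lambda$ let $\mathcal P(R)$ be the set of $R^*$-orbits in $\mathcal E(R)$ ($(r_1,r_2)\sim(ur_1,ur_2)$, $u\in R^*$), with the induced $\mathrm{Bu}_3$-action; the conjugacy class of $\operatorname{St}_R(r_1,r_2)$ depends only on the $\mathrm{Bu}_3$-orbit of the class of $(r_1,r_2)$ in $\mathcal P(R)$. Put $\lambda:=-1-t$. **The subgroups (each understood up to conjugacy in $\mathrm{Bu}_3$; numbering of indexed families in arbitrary order).** - $H(7,0),H(5,0),H(3,0)$: $\operatorname{St}_R(0,1)$ with $R=\mathbb Z_7,\mathbb Z_5,\mathbb Z_3$ respectively, where $t=-1$. $H(9,0)$: $\operatorname{St}_R(0,1)$ with $R=\mathbb Z_9$, $t=-1$. In each case $\mathcal P(R)$ is one orbit. - $H(25;a),H(9;a),H(27;a)$: $\operatorname{St}_R(0,1)$ with $R=\mathbb Z_{25},\mathbb Z_9,\mathbb Z_{27}$ respectively, where $t=a$. In each case $\mathcal P(R)$ is one orbit. - $H_1(7,1),H_2(7,1),H_3(7,1)$: stabilizers $\operatorname{St}_R(r_1,r_2)$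 for the three orbits in $\mathcal P(R)$, $R=\mathbb F_7[t]/(t+1)^2$. - $I(5,1)$: $\operatorname{St}_R(0,1)$ with $R=\Lambda/(t^4-t^3+t^2-t+1)$. - $H_1(5,1),H_2(5,1)$: stabilizers for the two orbits in $\mathcal P(R)$, $R=\mathbb F_5[t]/(t+1)^2$, other than the orbit of $(0,1)$. - $\tilde I(5)=\{b\in\mathrm{Bu}_3\mid b\equiv1\bmod (t^4-t^3+t^2-t+1)\}$; $\tilde I(3)=\{b\in\mathrm{Bu}_3\mid b\equiv1\bmod (t^2-t+1)\}$; $\tilde H(p)=\{b\in\mathrm{Bu}_3\mid b\equiv1\bmod\langle p,t+1\rangle\}$ for $p=5,3$. - $I_1(3,1)$ and $I_2(3,1)$: $\operatorname{St}_R(0,1)$ and $\operatorname{St}_R(\lambda,1)$ with $R=\Lambda/(t^2-t+1)$. - $H(3,1)$: stabilizer for the orbit in $\mathcal P(R)$, $R=\mathbb F_3[t]/(t+1)^2$, other than those of $(0,1)$ and $(\lambda,1)$. - $I_1(9,1)$ and $I_2(9,1)$: $\operatorname{St}_R(0,1)$ and $\operatorname{St}_R(\lambda,1)$ with $R=\Lambda/\langle3(t^2-t+1),\,t^3+1\rangle$. - $I_1(9,2)$ and $I_2(9,2)$: $\operatorname{St}_R(0,1)$ and $\operatorname{St}_R(\lambda,1)$ with $R=\Lambda/\langle3(t^2-t+1),\,(t^2-t+1)^2\rangle$. - $H(9,1)$: stabilizer for the one orbit in $\mathcal P(R)$, $R=\mathbb Z_9[t]/\langle3(t+1),(t+1)^2\rangle$,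 other than those of $(0,1)$ and $(\lambda,1)$. - $H_1(9,2),H_2(9,2),H_3(9,2)$: stabilizers for the three orbits in $\mathcal P(R)$, $R=\mathbb Z_9[t]/(t+1)^2$, other than those of $(0,1)$ and $(\lambda,1)$. - $H'(9,1)$: stabilizer for the one orbit in $\mathcal P(R)$, $R=\mathbb F_3[t]/(t+1)^3$, other than those of $(0,1)$ and $(\lambda,1)$. - $H_1'(9,2),H_2'(9,2),H_3'(9,2)$: stabilizers for the three orbits in $\mathcal P(R)$, $R=\mathbb F_3[t]/(t+1)^4$, other than those of $(0,1)$ and $(\lambda,1)$. - $\tilde H_1(9),\tilde H_2(9)$: stabilizers $\operatorname{St}_W(a_1,a_2)$ for the two $\mathrm{Bu}_3$-orbits on the set of $t$-orbits ($(a_1,a_2)\sim(t^ka_1,t^ka_2)$) in $\mathcal E(W)$, where $W=\mathbb Z_9e_1\oplus\mathbb Z_3e_2$ with $te_1=-e_1$, $te_2=-e_2-3e_1$. **Invariants recorded in the paper's table** ($A(H)$ is the module used above, except where noted; $\operatorname{c}(H)$ up to conjugacy in $\Gamma$). $\operatorname{c}(H)=\Gamma_1(7)$ for $H_i(7,1)$ (depth 14), $H(7,0)$ (depth 2). $\Gamma_1(5)$ for $H_i(5,1)$, $I(5,1)$ (depth 10), $H(5,0)$ (depth 2). $\Gamma(5)$ for $\tilde I(5)$ (depth 10, $A(H)=\Lambda^2/(t^4-t^3+t^2-t+1)$), $\tilde H(5)$ (depth 2, $A(H)=\mathbb Z_5\oplus\mathbb Z_5$, $t=-1$). $\Gamma_0(25)\cap\Gamma_1(5)$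 for $H(25;a)$ (depth 10). $\Gamma_1(3)$ for $H(3,1),I_1(3,1),I_2(3,1)$ (depth 6), $H(3,0)$ (depth 2). $\Gamma(3)$ for $\tilde I(3)$ (depth 6, $A(H)=\Lambda^2/(t^2-t+1)$), $\tilde H(3)$ (depth 2, $A(H)=\mathbb Z_3\oplus\mathbb Z_3$, $t=-1$). $\Gamma_0(9)$ for $H(9;a)$ (depth 6). $\Gamma_1(9)$ for $H_i(9,2),I_i(9,2)$ (depth 18), $H(9,1),I_i(9,1)$ (depth 6), $H(9,0)$ (depth 2). In the Cummins–Pauli notation for congruence subgroups: $9J^0$ for $H_i'(9,2)$ (depth 18), $H'(9,1)$ (depth 6); $9H^0$ for $\tilde H_1(9),\tilde H_2(9)$ (depth 6); $27A^0$ for $H(27;a)$ (depth 18). *)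

(* Defs.v *)
From HB Require Import structures.
From mathcomp Require Import all_boot all_order all_algebra.
From mathcomp Require Import complex.
From mathcomp Require Import all_classical reals topology normedtype.

Set Implicit Arguments.
Unset Strict Implicit.
Unset Printing Implicit Defensive.

Import Order.TTheory GRing.Theory Num.Theory.
Import numFieldNormedType.Exports.
Local Open Scope classical_set_scope.
Local Open Scope ring_scope.
Local Open Scope quotient_scope.

Local Notation "x %:F" := (tofrac x).

(** * The ring of Laurent polynomials Z[t, 1/t] *)

(* Realized as the subring of Q(t) formed by the fractions p / t^n. *)
Definition laurent_pred : {pred {fraction {poly int}}} :=
  fun x => `[< exists (p : {poly int}) (n : nat), x = p%:F / 'X%:F ^+ n >].

Lemma fracX_neq0 : ('X : {poly int})%:F != 0.
Proof. by rewrite tofrac_eq0 polyX_eq0. Qed.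

Lemma laurent_subring : subring_closed laurent_pred.
Proof.
have nz n : ('X : {poly int})%:F ^+ n != 0 by rewrite expf_neq0 ?fracX_neq0.
split.
- by apply/asboolP; exists 1, 0%N; rewrite tofrac1 expr0 divr1.
- move=> _ _ /asboolP[p [n ->]] /asboolP[q [m ->]]; apply/asboolP.
  exists (p * 'X^m - q * 'X^n), (n + m)%N.
  rewrite -mulNr addf_div ?nz // exprD; congr (_ / _).
  by rewrite tofracB !tofracM !tofracXn mulNr.
- move=> _ _ /asboolP[p [n ->]] /asboolP[q [m ->]]; apply/asboolP.
  by exists (p * q), (n + m)%N; rewrite mulf_div tofracM exprD.
Qed.

HB.instance Definition _ :=
  GRing.isSubringClosed.Build {fraction {poly int}} laurent_pred
    laurent_subring.

Definition Laurent := {x : {fraction {poly int}} | x \in laurent_pred}.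
HB.instance Definition _ := SubChoice.on Laurent.
HB.instance Definition _ := [SubChoice_isSubComNzRing of Laurent by <:].

Lemma laurentP (x : Laurent) :
  exists (p : {poly int}) (n : nat), val x = p%:F / 'X%:F ^+ n.
Proof. exact/asboolP/(valP x). Qed.

Definition laurent_unit : pred Laurent := fun x => `[< exists y, y * x = 1 >].

Definition laurent_inv (x : Laurent) : Laurent :=
  if pselect (exists y, y * x = 1) is left ex then sval (cid ex) else x.

Lemma laurent_mulVx : {in laurent_unit, left_inverse 1 laurent_inv *%R}.
Proof.
move=> x /asboolP ex; rewrite /laurent_inv; case: pselect => // h.
exact: svalP (cid h).
Qed.

Lemma laurent_unitPl (x y : Laurent) : y * x = 1 -> laurent_unit x.
Proof. by move=> h; apply/asboolP; exists y. Qed.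

Lemma laurent_inv_out : {in [predC laurent_unit], laurent_inv =1 id}.
Proof.
move=> x /negP nu; rewrite /laurent_inv; case: pselect => // h.
by case: nu; apply/asboolP.
Qed.

HB.instance Definition _ := GRing.ComNzRing_hasMulInverse.Build Laurent
  laurent_mulVx laurent_unitPl laurent_inv_out.

Lemma laurent_t_subproof : 'X%:F \in laurent_pred.
Proof. by apply/asboolP; exists 'X, 0%N; rewrite expr0 divr1. Qed.

Definition t : Laurent := Sub ('X%:F) laurent_t_subproof.

Lemma t_unit : t \is a GRing.unit.
Proof.
have h : ('X%:F)^-1 \in laurent_pred.
  by apply/asboolP; exists 1, 1%N; rewrite tofrac1 expr1 div1r.
apply/unitrP; exists (Sub ('X%:F)^-1 h : Laurent); split; apply: val_inj => /=.
  by rewrite mulVf ?fracX_neq0.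
by rewrite mulfV ?fracX_neq0.
Qed.

(* Evaluation at t = -1, where 1/t is evaluated to -1 as well. *)
Definition ev (x : Laurent) : int :=
  xget 0 [set k : int | exists (p : {poly int}) (n : nat),
    val x = p%:F / 'X%:F ^+ n /\ k = p.[-1] * (-1) ^+ n].

Lemma evE (x : Laurent) (p : {poly int}) (n : nat) :
  val x = p%:F / 'X%:F ^+ n -> ev x = p.[-1] * (-1) ^+ n.
Proof.
have nz k : ('X : {poly int})%:F ^+ k != 0 by rewrite expf_neq0 ?fracX_neq0.
move=> xE; apply: xget_unique; first by exists p, n.
move=> k [q [m []]]; rewrite xE => /eqP; rewrite eqr_div ?nz // -!tofracXn.
rewrite -!tofracM tofrac_eq => /eqP /(congr1 (fun r => r.[-1])).
rewrite !hornerM !hornerXn => e ->.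
have s k' : (-1) ^+ k' * (-1) ^+ k' = 1 :> int by rewrite -exprMn mulrNN expr1n.
transitivity (q.[-1] * (-1) ^+ n * ((-1) ^+ m * (-1) ^+ n)).
  by rewrite mulrACA s mulr1.
by rewrite -e -mulrA [_ ^+ m * (_ * _)]mulrA s mul1r.
Qed.

Lemma ev_zmod_morphism : zmod_morphism ev.
Proof.
have nz n : ('X : {poly int})%:F ^+ n != 0 by rewrite expf_neq0 ?fracX_neq0.
move=> x y; have [p [n xE]] := laurentP x; have [q [m yE]] := laurentP y.
rewrite (evE xE) (evE yE) (@evE _ (p * 'X^m - q * 'X^n) (n + m)).
  have s k' : (-1) ^+ k' * (-1) ^+ k' = 1 :> int.
    by rewrite -exprMn mulrNN expr1n.
  rewrite hornerD hornerN !hornerM !hornerXn exprD mulrDl mulNr mulrACA s.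
  by rewrite mulr1 [(-1) ^+ n * _]mulrC mulrACA s mulr1.
rewrite /= xE yE -mulNr addf_div ?nz // exprD; congr (_ / _).
by rewrite tofracB !tofracM !tofracXn mulNr.
Qed.

Lemma ev_monoid_morphism : monoid_morphism ev.
Proof.
split=> [|x y].
  by rewrite (@evE _ 1 0) ?hornerC ?mulr1 //= tofrac1 expr0 divr1.
have [p [n xE]] := laurentP x; have [q [m yE]] := laurentP y.
rewrite (evE xE) (evE yE) (@evE _ (p * q) (n + m)).
  by rewrite hornerM exprD mulrACA.
by rewrite /= xE yE mulf_div tofracM exprD.
Qed.

HB.instance Definition _ :=
  GRing.isZmodMorphism.Build Laurent int ev ev_zmod_morphism.
HB.instance Definition _ :=
  GRing.isMonoidMorphism.Build Laurent int ev ev_monoid_morphism.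

Lemma ev_t : ev t = -1.
Proof. by rewrite (@evE _ 'X 0) ?hornerX ?mulr1 //= expr0 divr1. Qed.

(** * The Burau group *)

Definition mx22 (S : Type) (a b c d : S) : 'M[S]_2 :=
  \matrix_(i, j) if i == 0 then if j == 0 then a else b
                 else if j == 0 then c else d.

Definition BX : 'M[Laurent]_2 := mx22 0 (- t) t (- t).
Definition BY : 'M[Laurent]_2 := mx22 0 (- t) (- t ^+ 2) 0.

Inductive Bu3 : set 'M[Laurent]_2 :=
| Bu3_X : Bu3 BX
| Bu3_Y : Bu3 BY
| Bu3_t : Bu3 t%:M
| Bu3_mul a b : Bu3 a -> Bu3 b -> Bu3 (a * b)
| Bu3_inv a : Bu3 a -> Bu3 a^-1.

Lemma det_mx22 (a b c d : Laurent) : \det (mx22 a b c d) = a * d - b * c.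
Proof.
rewrite (expand_det_row _ ord0) !big_ord_recl big_ord0 addr0 /cofactor.
by rewrite !det_mx11 !mxE /= expr0 mul1r expr1 mulN1r mulrN.
Qed.

Lemma Bu3_unit a : Bu3 a -> a \is a GRing.unit.
Proof.
elim=> [||| b c _ bu _ cu|b _ bu]; last by rewrite unitrV.
- by rewrite unitmxE det_mx22 mul0r sub0r mulNr opprK unitrM t_unit.
- by rewrite unitmxE det_mx22 mul0r sub0r mulrNN unitrN unitrM unitrX ?t_unit.
- by rewrite unitmxE det_scalar unitrX ?t_unit.
- by rewrite unitrMl.
Qed.

Definition is_subgroup (H : set 'M[Laurent]_2) : Prop :=
  [/\ H `<=` Bu3, H 1, (forall a b, H a -> H b -> H (a * b))
    & (forall a, H a -> H a^-1)].

Definition finite_index (H : set 'M[Laurent]_2) : Prop :=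
  exists s : seq 'M[Laurent]_2, forall b, Bu3 b ->
    exists h r, [/\ H h, r \in s & b = h * r].

Definition conj_Bu3 (H K : set 'M[Laurent]_2) : Prop :=
  exists2 g, Bu3 g & H = [set g^-1 * k * g | k in K].

(* c(H), a subgroup of PSL(2,Z), encoded by its full preimage in SL(2,Z). *)
Definition cimage (H : set 'M[Laurent]_2) : set 'M[int]_2 :=
  [set g | exists2 h, H h & g = map_mx ev h \/ g = - map_mx ev h].

(** * Quotient modules *)

Section QuotientModule.
Variables (L : comNzRingType) (V : lmodType L) (rs : seq V).

Definition span_pred : {pred V} :=
  fun v => `[< exists c : 'I_(size rs) -> L, v = \sum_i c i *: rs`_i >].

Lemma span_submod : submod_closed span_pred.
Proof.
split=> [|a u v /asboolP[c ->] /asboolP[d ->]]; apply/asboolP.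
  by exists (fun=> 0); rewrite big1 // => i _; rewrite scale0r.
exists (fun i => a * c i + d i); rewrite scaler_sumr -big_split /=.
by apply: eq_bigr => i _; rewrite scalerDl scalerA.
Qed.

HB.instance Definition _ := GRing.isSubmodClosed.Build L V span_pred
  span_submod.

(* V modulo the submodule generated by rs *)
Definition quotmod := Quotient.quot span_pred.
HB.instance Definition _ := GRing.Zmodule.on quotmod.
HB.instance Definition _ := Quotient.on quotmod.

Definition quot_scale (a : L) (x : quotmod) : quotmod :=
  \pi_quotmod (a *: repr x).

Lemma quot_eq (u v : V) :
  (\pi_quotmod u == \pi_quotmod v) = (u - v \in span_pred).
Proof. by rewrite (@Quotient.idealrBE _ span_pred). Qed.

Lemma quot_scaleE a v : quot_scale a (\pi v) = \pi_quotmod (a *: v).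
Proof.
apply/eqP; rewrite quot_eq -scalerBr rpredZ // -quot_eq.
by rewrite reprK.
Qed.

Lemma quot_surj (x : quotmod) : exists v, x = \pi_quotmod v.
Proof. by exists (repr x); rewrite reprK. Qed.

Lemma quot_piD (u v : V) :
  \pi_quotmod (u + v) = \pi_quotmod u + \pi_quotmod v :> quotmod.
Proof. by rewrite piE. Qed.

Lemma quot_scaleA a b (x : quotmod) :
  quot_scale a (quot_scale b x) = quot_scale (a * b) x.
Proof. by have [v ->] := quot_surj x; rewrite [quot_scale b _]quot_scaleE !quot_scaleE scalerA. Qed.

Lemma quot_scale1 : left_id 1 quot_scale.
Proof. by move=> x; have [v ->] := quot_surj x; rewrite quot_scaleE scale1r. Qed.

Lemma quot_scaleDr : right_distributive quot_scale +%R.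
Proof.
move=> a x y; have [u ->] := quot_surj x; have [v ->] := quot_surj y.
by rewrite -quot_piD !quot_scaleE scalerDr quot_piD.
Qed.

Lemma quot_scaleDl (x : quotmod) : {morph quot_scale^~ x : a b / a + b}.
Proof.
by move=> a b; have [v ->] := quot_surj x; rewrite !quot_scaleE scalerDl quot_piD.
Qed.

HB.instance Definition _ := GRing.Zmodule_isLmodule.Build L quotmod
  quot_scaleA quot_scale1 quot_scaleDr quot_scaleDl.

Definition qproj (v : V) : quotmod := \pi_quotmod v.

End QuotientModule.

(** * The subgroups H(A) and the stabilizers *)

Definition Hgrp (A : lmodType Laurent) (phi : 'cV[Laurent]_2 -> A) :
    set 'M[Laurent]_2 :=
  [set h | Bu3 h /\ forall u : 'cV[Laurent]_2, phi ((h - 1) *m u) = 0].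

Definition ideal_pow (I : {pred Laurent}) (n : nat) : set Laurent :=
  [set x | exists (k : nat) (c : 'I_k -> Laurent) (f : 'I_k -> 'I_n -> Laurent),
    (forall i j, f i j \in I) /\ x = \sum_i c i * \prod_j f i j].

(* The ideal generated by gs *)
Definition ideal (gs : seq Laurent) : {pred Laurent} :=
  @span_pred Laurent Laurent^o gs.

Definition local_module (I : {pred Laurent}) (A : lmodType Laurent) : Prop :=
  (exists a : A, a != 0) /\
  (exists n : nat, forall x, ideal_pow I n x -> forall a : A, x *: a = 0).

Definition epairs (A : lmodType Laurent) : set (A * A) :=
  [set a | forall x, exists y z, x = y *: a.1 + z *: a.2].

Definition bact (A : lmodType Laurent) (a : A * A) (b : 'M[Laurent]_2) : A * A :=
  (b 0 0 *: a.1 + b 1 0 *: a.2, b 0 1 *: a.1 + b 1 1 *: a.2).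

Definition St (A : lmodType Laurent) (a : A * A) : set 'M[Laurent]_2 :=
  [set b | Bu3 b /\ bact a b = a].

(* The quotient ring R of Laurent by the ideal generated by gs, as a module *)
Definition quotring (gs : seq Laurent) : lmodType Laurent :=
  @quotmod Laurent Laurent^o gs.

Definition qpair (gs : seq Laurent) (x y : Laurent) :
    quotring gs * quotring gs :=
  (@qproj Laurent Laurent^o gs x, @qproj Laurent Laurent^o gs y).

(* The class of u is a unit of R *)
Definition unit_mod (gs : seq Laurent) (u : Laurent) : Prop :=
  exists v, u * v - 1 \in ideal gs.

(* r and s lie in E(R) and their classes in P(R) are in the same Bu3-orbit *)
Definition same_orbit (gs : seq Laurent) (r s : quotring gs * quotring gs) :
    Prop :=
  exists b u, [/\ Bu3 b, unit_mod gs u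
    & s = (u *: (bact r b).1, u *: (bact r b).2)].

(* Stabilizers for the orbits in P(R) other than those of the pairs in excl *)
Definition other_orbit (gs : seq Laurent) (excl : seq (Laurent * Laurent)) :
    set (quotring gs * quotring gs) :=
  [set r | epairs r /\
    forall e, e \in excl -> ~ same_orbit (qpair gs e.1 e.2) r].

Definition congr_subgroup (gs : seq Laurent) : set 'M[Laurent]_2 :=
  [set b | Bu3 b /\ forall i j, (b - 1) i j \in ideal gs].

(** * Modular curves *)

(* PSL(2,Z) is represented by matrices in SL(2,Z); both signs act alike. *)
Definition SL2Z : set 'M[int]_2 := [set g | \det g = 1].

Section ModularCurve.
Variable R : realType.

Definition upper := {z : R[i] | 0 < complex.Im z}.

Definition moebius (g : 'M[int]_2) (z : R[i]) : R[i] :=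
  ((g 0 0)%:~R * z + (g 0 1)%:~R) / ((g 1 0)%:~R * z + (g 1 1)%:~R).

(* insubd is only a guard here: SL(2,Z) preserves the upper half plane. *)
Definition act_upper (g : 'M[int]_2) (z : upper) : upper :=
  insubd z (moebius g (val z)).

(* Cusps are the points of P^1(Q), with None for the point at infinity. *)
Definition act_cusp (g : 'M[int]_2) (s : option rat) : option rat :=
  if s is Some q then
    if (g 1 0)%:~R * q + (g 1 1)%:~R == 0 then None
    else Some (((g 0 0)%:~R * q + (g 0 1)%:~R)
               / ((g 1 0)%:~R * q + (g 1 1)%:~R))
  else if g 1 0 == 0 then None else Some ((g 0 0)%:~R / (g 1 0)%:~R).

(* The extended upper half plane *)
Definition xupper := (upper + option rat)%type.
HB.instance Definition _ := Choice.on xupper.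

Definition act (g : 'M[int]_2) (z : xupper) : xupper :=
  match z with inl w => inl (act_upper g w) | inr s => inr (act_cusp g s) end.

(* The usual topology: the neighbourhoods of the cusp g(infinity) are
   generated by the horodisks g{Im z > M} with the cusp itself adjoined. *)
Definition xupper_open (U : set xupper) : Prop :=
  open [set p : R * R | exists2 z : upper,
          U (inl z) & p = (complex.Re (val z), complex.Im (val z))] /\
  (forall g, SL2Z g -> U (act g (inr None)) ->
     exists M : R, forall z : upper,
       M < complex.Im (val z) -> U (act g (inl z))).

Lemma xupper_openT : xupper_open setT.
Proof.
split; last by move=> *; exists 0.
rewrite (_ : mkset _ = [set p | 0 < p.2]).
  apply: (@open_comp _ _ (@snd R R) [set x : R | 0 < x]) => [p _|].
    exact: cvg_snd.
  exact: open_gt.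
apply/seteqP; split=> [_ [z _ ->]|[x y] /= y0]; first exact: valP z.
by exists (Sub (Complex x y) y0).
Qed.

Lemma xupper_openI : setI_closed xupper_open.
Proof.
move=> U V [oU hU] [oV hV]; split.
  rewrite (_ : mkset _ = [set p : R * R | exists2 z : upper,
      U (inl z) & p = (complex.Re (val z), complex.Im (val z))] `&`
    [set p : R * R | exists2 z : upper,
      V (inl z) & p = (complex.Re (val z), complex.Im (val z))]).
    exact: openI.
  apply/seteqP; split=> [_ [z [Uz Vz] ->]|p [[z Uz ->]]]; first by split; exists z.
  move=> [w Vw [e1 e2]]; exists z => //; split=> //.
  suff -> : z = w by [].
  apply: val_inj => /=; move: e1 e2 => /=.
  by case: (sval z) (sval w) => [a b] [c d] /= -> ->.
move=> g Sg [Ug Vg]; have [M hM] := hU g Sg Ug; have [N hN] := hV g Sg Vg.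
exists (Num.max M N) => z; rewrite gt_max => /andP[Mz Nz].
by split; [exact: hM|exact: hN].
Qed.

Lemma xupper_open_bigU (I : Type) (f : I -> set xupper) :
  (forall i, xupper_open (f i)) -> xupper_open (\bigcup_i f i).
Proof.
move=> hf; split.
  rewrite (_ : mkset _ = \bigcup_i [set p : R * R | exists2 z : upper,
      f i (inl z) & p = (complex.Re (val z), complex.Im (val z))]).
    by apply: bigcup_open => i _; case: (hf i).
  apply/seteqP; split=> [_ [z [i _ fz] ->]|p [i _ [z fz ->]]].
    by exists i => //; exists z.
  by exists z => //; exists i.
move=> g Sg [i _ fg]; have [M hM] := (hf i).2 g Sg fg.
by exists M => z Mz; exists i => //; exact: hM.
Qed.

HB.instance Definition _ := isOpenTopological.Build xupper
  xupper_openT xupper_openI xupper_open_bigU.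

Section Quotient.
Variable K : set 'M[int]_2.

Definition Korbit (z : xupper) : set xupper := [set act g z | g in K].

Definition orbit_rel : rel xupper := fun z w => `[< Korbit z = Korbit w >].

Lemma orbit_rel_equiv : equiv_class_of orbit_rel.
Proof.
split=> [z|z w|w z v]; first exact/asboolP.
  by apply/asboolP/asboolP => ->.
by move=> /asboolP e1 /asboolP e2; apply/asboolP; rewrite e1.
Qed.

Canonical orbit_equiv := EquivRelPack orbit_rel_equiv.

(* X_K, the quotient of the extended upper half plane by a subgroup K *)
Definition modular_curve : topologicalType :=
  quotient_topology {eq_quot orbit_rel}.

End Quotient.

End ModularCurve.

(** * Genus *)

Section Genus.
Variable R : realType.

Definition cube n : set 'rV[R]_n := [set u | forall i, 0 <= u 0 i <= 1].
Definition open_cube n : set 'rV[R]_n := [set u | forall i, 0 < u 0 i < 1].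

(* A finite cell decomposition with cubes for closed disks; on a Hausdorff
   space this is a finite CW structure. *)
Record cell_decomposition (X : topologicalType) := CellDecomposition {
  cell : finType;
  cell_dim : cell -> nat;
  cell_map : forall c : cell, 'rV[R]_(cell_dim c) -> X;
  cell_map_continuous : forall c,
    {within @cube (cell_dim c), continuous (@cell_map c)};
  cell_map_onto : forall x : X,
    exists c, exists2 u, @open_cube (cell_dim c) u & cell_map u = x;
  cell_map_inj : forall c, {in @open_cube (cell_dim c) &, injective (@cell_map c)};
  cell_disjoint : forall c d u v,
    @open_cube (cell_dim c) u -> @open_cube (cell_dim d) v ->
    cell_map u = cell_map v -> c = d;
  cell_boundary : forall c u,
    @cube (cell_dim c) u -> ~ @open_cube (cell_dim c) u ->
    exists d, [/\ (cell_dim d < cell_dim c)%N &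
      exists2 v, @open_cube (cell_dim d) v & cell_map u = cell_map v]
}.

Definition euler_char (X : topologicalType) (D : cell_decomposition X) : int :=
  \sum_(c : cell D) (-1) ^+ cell_dim c.

(* The genus g of a closed connected orientable surface X is defined by
   V - E + F = 2 - 2g; the alternating sum is the same for all finite cell
   decompositions, and modular curves do have one. *)
Definition has_genus (X : topologicalType) (g : nat) : Prop :=
  inhabited (cell_decomposition X) /\
  forall D : cell_decomposition X, euler_char D = 2 - 2 * g%:Z.

End Genus.

Definition genus_zero (R : realType) (H : set 'M[Laurent]_2) : Prop :=
  [/\ is_subgroup H, finite_index H
    & has_genus R (modular_curve R (cimage H)) 0].

(** * The subgroups in the classification *)

Definition lam : Laurent := - 1 - t.
Definition Phi6 : Laurent := t ^+ 2 - t + 1.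
Definition Phi10 : Laurent := t ^+ 4 - t ^+ 3 + t ^+ 2 - t + 1.

(* Generators of the ideals defining the quotient rings:
   Z_n with t = a, and F_p[t]/(t+1)^k. *)
Definition genZ (n : nat) (a : int) : seq Laurent := [:: n%:R; t - a%:~R].
Definition genF (p k : nat) : seq Laurent := [:: p%:R; (t + 1) ^+ k].

Definition St01 (gs : seq Laurent) := St (qpair gs 0 1).
Definition Stlam1 (gs : seq Laurent) := St (qpair gs lam 1).

(* W = Z_9 e1 + Z_3 e2 with t e1 = - e1 and t e2 = - e2 - 3 e1, presented by
   the relations (t+1) e1 = 0, 9 e1 = 0, 3 e2 = 0, 3 e1 + (t+1) e2 = 0. *)
Definition Wmod : lmodType Laurent :=
  @quotmod Laurent (Laurent^o * Laurent^o)%type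
    [:: (t + 1, 0); (9%:R, 0); (0, 3%:R); (3%:R, t + 1)].

Definition congr_mod (m : nat) (a b : int) : bool := (a == b %[mod m])%Z.

(* An indexed family such as H_1(7,1), ..., H_3(7,1) is given by one
   constructor, whose argument runs over the pairs in all the orbits
   concerned; "tI" and "tH" stand for I and H with a tilde. A class a modulo n
   is represented by an integer. *)
Inductive listed : set 'M[Laurent]_2 -> Prop :=
| H_7_1 r : @epairs (quotring (genF 7 2)) r -> listed (St r)
| H_7_0 : listed (St01 (genZ 7 (-1)))
| H_5_1 r : @other_orbit (genF 5 2) [:: (0, 1)] r -> listed (St r)
| I_5_1 : listed (St01 [:: Phi10])
| H_5_0 : listed (St01 (genZ 5 (-1)))
| tI_5 : listed (congr_subgroup [:: Phi10])
| tH_5 : listed (congr_subgroup [:: 5%:R; t + 1])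
| H_25 a : congr_mod 5 a (-1) -> ~~ congr_mod 25 a (-1) ->
    listed (St01 (genZ 25 a))
| H_3_1 r : @other_orbit (genF 3 2) [:: (0, 1); (lam, 1)] r -> listed (St r)
| I1_3_1 : listed (St01 [:: Phi6])
| I2_3_1 : listed (Stlam1 [:: Phi6])
| H_3_0 : listed (St01 (genZ 3 (-1)))
| tI_3 : listed (congr_subgroup [:: Phi6])
| tH_3 : listed (congr_subgroup [:: 3%:R; t + 1])
| H_9 a : congr_mod 3 a (-1) -> ~~ congr_mod 9 a (-1) ->
    listed (St01 (genZ 9 a))
| H_9_2 r : @other_orbit [:: 9%:R; (t + 1) ^+ 2] [:: (0, 1); (lam, 1)] r ->
    listed (St r)
| I1_9_2 : listed (St01 [:: 3%:R * Phi6; Phi6 ^+ 2])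
| I2_9_2 : listed (Stlam1 [:: 3%:R * Phi6; Phi6 ^+ 2])
| H_9_1 r :
    @other_orbit [:: 9%:R; 3%:R * (t + 1); (t + 1) ^+ 2]
      [:: (0, 1); (lam, 1)] r ->
    listed (St r)
| I1_9_1 : listed (St01 [:: 3%:R * Phi6; t ^+ 3 + 1])
| I2_9_1 : listed (Stlam1 [:: 3%:R * Phi6; t ^+ 3 + 1])
| H_9_0 : listed (St01 (genZ 9 (-1)))
| H'_9_2 r : @other_orbit (genF 3 4) [:: (0, 1); (lam, 1)] r -> listed (St r)
| H'_9_1 r : @other_orbit (genF 3 3) [:: (0, 1); (lam, 1)] r -> listed (St r)
| tH_9 r : @epairs Wmod r -> listed (St r)
| H_27 a : congr_mod 3 a (-1) -> ~~ congr_mod 9 a (-1) ->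
    listed (St01 (genZ 27 a)).

(* Main.v *)
From Stdlib Require Import ZArith.
From HB Require Import structures.
Require Import Defs.
From mathcomp Require Import all_boot all_order all_algebra fingroup perm.
From mathcomp Require Import complex.
From mathcomp Require Import all_classical reals topology normedtype realfun.
From mathcomp Require Import ring lra zify ssrZ.
Set Implicit Arguments.
Unset Strict Implicit.
Unset Printing Implicit Defensive.
Import Order.TTheory GRing.Theory Num.Theory.
Import numFieldNormedType.Exports.
Local Open Scope classical_set_scope.
Local Open Scope ring_scope.
Delimit Scope Z_scope with bZ.

(** The Euler characteristic of the modular curve of a subgroup H is computed
    from the cosets of its image c(H) in PSL(2,Z). The translates of the usual
    fundamental domain form one cell decomposition of the curve, with a face and
    two kinds of edges folded by the elliptic points and with one vertex for
    each cusp, and counting its cells gives [genus0_euler]: in genus zero the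
    numbers of cycles of S, of U and of SU on the cosets add up to the index
    plus two. Everything else is a matter of bounding these numbers.

    The Burau group is generated up to powers of t by words in X and Y, and the
    kernel of its projection to PSL(2,Z) consists of these powers ([ev_kernel],
    by a ping-pong argument on the normal form of words). Labels of words that
    are invariant under H and t are therefore labels of the cosets of c(H); a
    cycle of cosets is at least as long as the cycle of labels below it, so that
    a labelling with at most as many weighted cycles as labels contradicts genus
    zero ([label_bound], [ext_bound]).

    Let K be the kernel of the epimorphism phi, so that H(phi) consists of the h
    with (h - 1) u in K for all u. The submodules M of the free module Lambda^2
    for which H(M) can have genus zero form a finite tree, whose root is the
    whole module. Suppose that H(phi) lies in g H(M) g^-1. If g M lies in K then
    both groups are equal. Otherwise Nakayama's lemma for the local module A
    yields a linear functional modulo p on the generators of M, evaluated at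
    t = -1, whose kernel M' contains what K cuts out of M; then H(phi) lies in
    g H(M') g^-1 ([node_step]). There are finitely many functionals at each node
    of the tree, and for each of them one of two things happens. Either a word
    of the Burau group carries M' into the submodule of a later node, and the
    descent goes on ([match_step]). Or the values of the functional on the
    cosets of H(M) label the cosets of H(M') finely enough to bound the Euler
    characteristic; only one component of these values is needed in most cases,
    which keeps the number of labels small ([label1], [label3]).

    For p = 3, 5, 7 the tree has 30, 11 and 5 nodes. Their coset tables, finite
    quotients that separate the vertices of the tables, and a certificate for
    each functional are checked by computation ([treechk], [tree_sound]), and
    the nodes below the root are identified with the listed subgroups one by one
    ([nodes_listed3] and its companions). For p at least 11 already the
    functionals on the root are excluded, by counting the cosets fixed by SU in
    the action on nonzero vectors modulo p up to sign ([large_prime_bound]). The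
    root itself cannot be reached, since t acts on A as the identity only if
    A = 0: modulo p and t + 1 the element t - 1 is the unit -2. *)


(** * Action of SL(2,Z) on the extended half plane *)

Lemma ord2P (i : 'I_2) : i = 0 \/ i = 1.
Proof.
by case: i => [[|[|//]] i]; [left|right]; apply: val_inj.
Qed.

Section Mat2.
Variable S : comNzRingType.
Implicit Types g h : 'M[S]_2.

Lemma mulmx2E m n (g : 'M[S]_(m, 2)) (h : 'M[S]_(2, n)) i j :
  (g *m h) i j = g i 0 * h 0 j + g i 1 * h 1 j.
Proof.
rewrite mxE !big_ord_recl big_ord0 addr0; congr (_ + g _ _ * h _ _);
  exact: val_inj.
Qed.

Lemma mul22E g h i j : (g * h) i j = g i 0 * h 0 j + g i 1 * h 1 j.
Proof. exact: mulmx2E. Qed.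

Lemma mx22P g h : g 0 0 = h 0 0 -> g 0 1 = h 0 1 -> g 1 0 = h 1 0 ->
  g 1 1 = h 1 1 -> g = h.
Proof.
move=> e1 e2 e3 e4; apply/matrixP=> i j.
by case: (ord2P i) => ->; case: (ord2P j) => ->.
Qed.

Lemma det22E g : \det g = g 0 0 * g 1 1 - g 0 1 * g 1 0.
Proof.
rewrite (expand_det_row _ ord0) !big_ord_recl big_ord0 addr0 /cofactor.
rewrite !det_mx11 !mxE /= expr0 mul1r expr1 mulN1r mulrN.
by congr (g _ _ * g _ _ - g _ _ * g _ _); apply: val_inj.
Qed.

Lemma scalar22E (a : S) i j : (a%:M : 'M[S]_2) i j = a *+ (i == j).
Proof. by rewrite mxE. Qed.

Lemma one22E i j : (1 : 'M[S]_2) i j = (i == j)%:R.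
Proof. by rewrite !mxE. Qed.

End Mat2.

Lemma mx22E (S : Type) (a b c d : S) : (mx22 a b c d 0 0 = a) * (mx22 a b c d 0 1 = b) *
  (mx22 a b c d 1 0 = c) * (mx22 a b c d 1 1 = d).
Proof. by rewrite !mxE. Qed.

Section SL2.
Implicit Types g h k : 'M[int]_2.

Lemma SL2_det g : SL2Z g -> g 0 0 * g 1 1 - g 0 1 * g 1 0 = 1.
Proof. by rewrite /SL2Z /= det22E. Qed.

Lemma SL2Z1 : SL2Z 1.
Proof. exact: det1. Qed.

Lemma SL2ZM g h : SL2Z g -> SL2Z h -> SL2Z (g * h).
Proof. by rewrite /SL2Z /= det_mulmx => -> ->; rewrite mulr1. Qed.

Lemma SL2ZN g : SL2Z g -> SL2Z (- g).
Proof. by rewrite /SL2Z /= !det22E !mxE => <-; ring. Qed.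

Lemma SL2Z_unit g : SL2Z g -> g \is a GRing.unit.
Proof. by rewrite /SL2Z /= unitmxE => ->; rewrite unitr1. Qed.

Lemma SL2ZV g : SL2Z g -> SL2Z g^-1.
Proof. by rewrite /SL2Z /= => e; rewrite det_inv e invr1. Qed.

Lemma SL2Z_mk (a b c d : int) : a * d - b * c = 1 -> SL2Z (mx22 a b c d).
Proof. by rewrite /SL2Z /= det22E !mx22E. Qed.

Lemma SL2_inv g : SL2Z g -> g^-1 = mx22 (g 1 1) (- g 0 1) (- g 1 0) (g 0 0).
Proof.
move=> Sg; have d := SL2_det Sg; apply: (mulrI (SL2Z_unit Sg)).
rewrite mulrV ?SL2Z_unit //.
by apply: mx22P; rewrite mul22E !mx22E !one22E /=; [rewrite -d| | |rewrite -d];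
  ring.
Qed.

End SL2.

Section Action.
Variable R : realType.
Implicit Types (g h : 'M[int]_2) (z w : upper R).
Local Notation Re := complex.Re.
Local Notation Im := complex.Im.

Definition mkup (x y : R) (y0 : 0 < y) : upper R := Sub (Complex x y) y0.

Lemma upper_ext z w : Re (val z) = Re (val w) -> Im (val z) = Im (val w) ->
  z = w.
Proof.
move=> e1 e2; apply: val_inj.
by case: (val z) (val w) e1 e2 => [a b] [c d] /= -> ->.
Qed.

Definition den g z : R :=
  ((g 1 0)%:~R * Re (val z) + (g 1 1)%:~R) ^+ 2
  + ((g 1 0)%:~R * Im (val z)) ^+ 2.

Lemma den_gt0 g z : SL2Z g -> 0 < den g z.
Proof.
move=> Sg; have y0 : 0 < Im (val z) := valP z.
rewrite lt_def addr_ge0 ?sqr_ge0 // andbT; apply/eqP => /eqP.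
rewrite paddr_eq0 ?sqr_ge0 // !sqrf_eq0 mulf_eq0 (gt_eqF y0) orbF.
case/andP => /eqP e1 /eqP e2; move: e1; rewrite e2 mul0r add0r => /eqP e1.
have := SL2_det Sg; move: e1 => /eqP e1; move: e1 e2 => /eqP.
by rewrite !intr_eq0 => /eqP -> /eqP; rewrite intr_eq0 => /eqP ->; rewrite !mulr0 subr0.
Qed.

Lemma moebiusE g z : SL2Z g ->
  Re (moebius g (val z)) =
    (((g 0 0)%:~R * Re (val z) + (g 0 1)%:~R) *
     ((g 1 0)%:~R * Re (val z) + (g 1 1)%:~R)
     + (g 0 0)%:~R * (g 1 0)%:~R * Im (val z) ^+ 2) / den g z
  /\ Im (moebius g (val z)) = Im (val z) / den g z.
Proof.
move=> Sg; have d0 := den_gt0 z Sg.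
have dt : (g 0 0)%:~R * (g 1 1)%:~R - (g 0 1)%:~R * (g 1 0)%:~R = 1 :> R.
  by rewrite -!intrM -intrB SL2_det.
have cast (n : int) : n%:~R = Complex (n%:~R : R) 0.
  by rewrite -(rmorph_int (real_complex R)).
have mulE (p q r s : R) : Complex p q * Complex r s = Complex (p * r - q * s) (p * s + q * r) by [].
have addE (p q r s : R) : Complex p q + Complex r s = Complex (p + r) (q + s) by [].
set xx := (X in Re _ = X / _).
suff -> : moebius g (val z) = Complex (xx / den g z) (Im (val z) / den g z) by [].
have nz : (g 1 0)%:~R * val z + (g 1 1)%:~R != 0.
  apply/eqP => e; move: d0; rewrite /den; move: e.
  case: (val z) => [x y]; rewrite !cast mulE addE => -[]; rewrite !mul0r subr0 !addr0 => -> ->.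
  by rewrite !expr0n addr0 ltxx.
apply: (mulIf nz); rewrite mulfVK //; apply/esym.
move: d0 dt; rewrite {}/xx /den {nz}.
case: (val z) => [x y]; rewrite !cast !mulE !addE /= => d0 dt.
have d1 := lt0r_neq0 d0.
have lin (u v p q D W : R) : D != 0 -> u * p + v * q = W * D -> u / D * p + v / D * q = W.
  move=> D0 e; rewrite mulrAC [v / D * q]mulrAC -mulrDl e mulfK //.
congr Complex; rewrite !mul0r ?addr0 ?subr0.
  rewrite -mulrN; apply: (lin _ _ _ _ _ _ d1).
  apply/eqP; rewrite -subr_eq0; apply/eqP.
  transitivity ((g 1 0)%:~R * y ^+ 2 *
    ((g 0 0)%:~R * (g 1 1)%:~R - (g 0 1)%:~R * (g 1 0)%:~R - 1) : R); first by ring.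
  by rewrite dt subrr mulr0.
apply: (lin _ _ _ _ _ _ d1).
apply/eqP; rewrite -subr_eq0; apply/eqP.
transitivity (- y * ((g 1 0)%:~R * x + (g 1 1)%:~R) *
    ((g 0 0)%:~R * (g 1 1)%:~R - (g 0 1)%:~R * (g 1 0)%:~R - 1) : R); last first.
  by rewrite dt subrr mulr0.
ring.
Qed.


Lemma act_upperE g z : SL2Z g -> val (act_upper g z) = moebius g (val z).
Proof.
move=> Sg; rewrite /act_upper val_insubd (moebiusE z Sg).2.
by rewrite divr_gt0 ?den_gt0 //; exact: valP z.
Qed.

Lemma act_Re g z : SL2Z g -> Re (val (act_upper g z)) =
    (((g 0 0)%:~R * Re (val z) + (g 0 1)%:~R) *
     ((g 1 0)%:~R * Re (val z) + (g 1 1)%:~R)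
     + (g 0 0)%:~R * (g 1 0)%:~R * Im (val z) ^+ 2) / den g z.
Proof. by move=> Sg; rewrite act_upperE // (moebiusE z Sg).1. Qed.

Lemma act_Im g z : SL2Z g ->
  Im (val (act_upper g z)) = Im (val z) / den g z.
Proof. by move=> Sg; rewrite act_upperE // (moebiusE z Sg).2. Qed.

Lemma moebius_den g z : SL2Z g ->
  (g 1 0)%:~R * val z + (g 1 1)%:~R != 0 :> R[i].
Proof.
move=> Sg; have d0 := den_gt0 z Sg.
have cast (n : int) : n%:~R = Complex (n%:~R : R) 0.
  by rewrite -(rmorph_int (real_complex R)).
have mulE (p q r s : R) : Complex p q * Complex r s = Complex (p * r - q * s) (p * s + q * r) by [].
have addE (p q r s : R) : Complex p q + Complex r s = Complex (p + r) (q + s) by [].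
apply/eqP => e; move: d0; rewrite /den; move: e.
case: (val z) => [x y]; rewrite !cast mulE addE => -[]; rewrite !mul0r subr0 !addr0 => -> ->.
by rewrite !expr0n addr0 ltxx.
Qed.

Lemma act_upperM g h z : SL2Z g -> SL2Z h ->
  act_upper (g * h) z = act_upper g (act_upper h z).
Proof.
move=> Sg Sh; apply: val_inj; have Sgh := SL2ZM Sg Sh.
rewrite !act_upperE //=.
have n1 := moebius_den z Sh; have n2 := moebius_den z Sgh.
have := moebius_den (act_upper h z) Sg; rewrite act_upperE //.
move: n1 n2; rewrite /moebius !mul22E !(intrD, intrM).
set Z := val z.
set a := (g 0 0)%:~R; set b := (g 0 1)%:~R; set c := (g 1 0)%:~R; set d := (g 1 1)%:~R.
set a' := (h 0 0)%:~R; set b' := (h 0 1)%:~R; set c' := (h 1 0)%:~R; set d' := (h 1 1)%:~R.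
move=> n1 n2 n3.
have e1 (p q : R[i]) : p * ((a' * Z + b') / (c' * Z + d')) + q =
   ((p * a' + q * c') * Z + (p * b' + q * d')) / (c' * Z + d').
  apply: (mulIf n1); rewrite mulfVK // mulrDl -mulrA mulfVK //; ring.
by rewrite !e1 invf_div mulrA mulfVK.
Qed.

Lemma act_upper1 z : act_upper 1 z = z.
Proof.
apply: val_inj; rewrite act_upperE; last exact: SL2Z1.
by rewrite /moebius !one22E /= mul1r addr0 mul0r add0r divr1.
Qed.

Lemma act_upperN g z : act_upper (- g) z = act_upper g z.
Proof.
rewrite /act_upper; congr (insubd z _).
by rewrite /moebius !mxE !intrN !mulNr -!opprD invrN mulrNN.
Qed.

(** A cusp is the ratio of a nonzero vector, on which matrices act linearly. *)
Definition ratio (u v : rat) : option rat := if v == 0 then None else Some (u / v).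

Lemma ratio_ex (s : option rat) : exists u v, (u, v) != 0 /\ s = ratio u v.
Proof.
case: s => [q|]; last by exists 1, 0; rewrite /ratio eqxx.
exists q, 1; rewrite /ratio oner_eq0 divr1; split=> //.
by apply/eqP => -[_ /eqP]; rewrite oner_eq0.
Qed.

Lemma act_ratio g u v : (u, v) != 0 -> act_cusp g (ratio u v) =
  ratio ((g 0 0)%:~R * u + (g 0 1)%:~R * v) ((g 1 0)%:~R * u + (g 1 1)%:~R * v).
Proof.
rewrite /ratio; have [->|v0] := eqVneq v 0 => n0 /=.
  have u0 : u != 0 by apply: contraNneq n0 => ->.
  rewrite !mulr0 !addr0 mulf_eq0 (negPf u0) orbF intr_eq0.
  by case: ifP => // _; rewrite -mulf_div divff // mulr1.
have e (p q : rat) : p * (u / v) + q = (p * u + q * v) / v by field.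
rewrite !e mulf_eq0 invr_eq0 (negPf v0) orbF; case: ifP => // _.
by rewrite -mulf_div divff ?mulr1 // invr_eq0.
Qed.

Lemma act_cuspM g h s : SL2Z h ->
  act_cusp (g * h) s = act_cusp g (act_cusp h s).
Proof.
move=> Sh; have [u [v [n0 ->]]] := ratio_ex s; rewrite !act_ratio //.
  by rewrite !mul22E; congr ratio; rewrite !(intrD, intrM); ring.
have dt : (h 0 0)%:~R * (h 1 1)%:~R - (h 0 1)%:~R * (h 1 0)%:~R = 1 :> rat.
  by rewrite -!intrM -intrB SL2_det.
apply: contra n0 => /eqP[e1 e2]; rewrite -[u]mul1r -[v]mul1r -dt; apply/eqP.
by congr (_, _);
  [transitivity ((h 1 1)%:~R * 0 - (h 0 1)%:~R * 0 : rat); [rewrite -{1}e1 -e2|]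
  |transitivity ((h 0 0)%:~R * 0 - (h 1 0)%:~R * 0 : rat); [rewrite -{1}e2 -e1|]];
  ring.
Qed.

Lemma act_cusp1 s : act_cusp 1 s = s.
Proof.
case: s => [q|] /=; rewrite !one22E /= ?eqxx //.
by rewrite mul0r add0r oner_eq0 mul1r addr0 divr1.
Qed.

Lemma act_cuspN g s : act_cusp (- g) s = act_cusp g s.
Proof.
have [u [v [n0 ->]]] := ratio_ex s; rewrite !act_ratio //.
rewrite !mxE !intrN !mulNr -!opprD /ratio oppr_eq0; case: ifP => // _.
by rewrite invrN mulrNN.
Qed.

Implicit Type p : xupper R.

Lemma actM g h p : SL2Z g -> SL2Z h -> act (g * h) p = act g (act h p).
Proof.
by case: p => [z|s] Sg Sh /=; [rewrite act_upperM|rewrite act_cuspM].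
Qed.

Lemma act1 p : act 1 p = p.
Proof. by case: p => [z|s] /=; [rewrite act_upper1|rewrite act_cusp1]. Qed.

Lemma actN g p : act (- g) p = act g p.
Proof. by case: p => [z|s] /=; [rewrite act_upperN|rewrite act_cuspN]. Qed.

Lemma actVK g p : SL2Z g -> act g^-1 (act g p) = p.
Proof.
by move=> Sg; rewrite -actM ?mulVr ?act1 ?SL2Z_unit //; exact: SL2ZV.
Qed.

(** ** A fundamental domain *)

(* The translates of [fundom] by SL(2,Z) tile the half plane without overlap:
   only the right half of the boundary is kept. *)
Definition fundom (z : upper R) : Prop :=
  let x := Re (val z) in let n := x ^+ 2 + Im (val z) ^+ 2 in
  [/\ - 2^-1 < x, x <= 2^-1, 1 <= n & n = 1 -> 0 <= x].

Definition pti : upper R := mkup 0 (@ltr01 R).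
Lemma sqrt34_gt0 : 0 < Num.sqrt (3%:R / 4%:R : R).
Proof. by rewrite sqrtr_gt0 divr_gt0. Qed.
Definition ptrho : upper R := mkup 2^-1 sqrt34_gt0.

Definition matS : 'M[int]_2 := map_mx ev BY.
Definition matU : 'M[int]_2 := map_mx ev BX.

End Action.

Section Fund.
Variable R : realType.
Implicit Types (g h : 'M[int]_2) (z w : upper R).
Local Notation Re := complex.Re.
Local Notation Im := complex.Im.

Lemma ev_BY : matS = mx22 0 1 (-1) 0.
Proof.
apply: mx22P; rewrite mxE !mx22E ?rmorph0 //.
  by rewrite (rmorphN ev) /= ev_t opprK.
by rewrite (rmorphN ev) (rmorphXn ev) /= ev_t sqrrN expr1n.
Qed.

Lemma ev_BX : matU = mx22 0 1 (-1) 1.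
Proof.
by apply: mx22P; rewrite mxE !mx22E ?(rmorph0 ev) ?(rmorphN ev) /= ?ev_t ?opprK.
Qed.

Lemma mulz_eq1 (a d : int) : a * d = 1 -> (a = 1 /\ d = 1) \/ (a = -1 /\ d = -1).
Proof.
move=> e; have a2 : a < 2 by case: (ltrP 0 d) => ?; nia.
have a3 : -2 < a by case: (ltrP d 0) => ?; nia.
have : a = 0 \/ a = 1 \/ a = -1 by lia.
by move=> [h|[h|h]]; rewrite h in e *; lia.
Qed.

Lemma int_between0 (n : int) : (-1 < n) && (n < 1) -> n = 0.
Proof. lia. Qed.

Lemma int_between01 (n : int) : (-1 < n) && (n < 2) -> n = 0 \/ n = 1.
Proof. lia. Qed.

Lemma int_small (n : int) : (n%:~R : R) ^+ 2 < 4%:R -> [\/ n = 0, n = 1 | n = -1].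
Proof.
move=> h; have : n ^+ 2 < 4 by rewrite -(ltr_int R) rmorphXn.
move=> h'; have : (-2 < n) && (n < 2) by apply/andP; split; nia.
case/andP => h1 h2; have [e|[e|e]] : n = 0 \/ n = 1 \/ n = -1 by lia.
- by constructor 1.
- by constructor 2.
- by constructor 3.
Qed.

Lemma eq_ptrho z : Re (val z) = 2^-1 -> Re (val z) ^+ 2 + Im (val z) ^+ 2 = 1 ->
  z = ptrho R.
Proof.
move=> e n; apply: upper_ext => //=; have y0 : 0 < Im (val z) := valP z.
apply/eqP; rewrite -(@eqrXn2 _ 2) ?sqrtr_ge0 ?(ltW y0) // sqr_sqrtr; last by lra.
by apply/eqP; move: n; rewrite e; lra.
Qed.

(* The possibilities for g up to sign *)
Definition upto_sign g h := g = h \/ g = - h.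

Lemma fundom_c_small g z : SL2Z g -> fundom z -> Im (val z) <= Im (val (act_upper g z)) ->
  [\/ g 1 0 = 0, g 1 0 = 1 | g 1 0 = -1] /\ den g z <= 1.
Proof.
move=> Sg [x1 x2 n1 _]; have y0 : 0 < Im (val z) := valP z.
rewrite act_Im //= ler_pdivlMr ?den_gt0 // => h.
have d1 : den g z <= 1.
  by rewrite -(ler_pM2l y0) mulr1.
split => //; apply: int_small; move: d1; rewrite /den.
set c := (g 1 0)%:~R; set d := (g 1 1)%:~R => d1.
have xx : Re (val z) ^+ 2 <= 4%:R^-1 by nra.
have yy : 3%:R / 4%:R <= Im (val z) ^+ 2 by move: n1; lra.
have : (c * Im (val z)) ^+ 2 <= 1 by have := sqr_ge0 (c * Re (val z) + d); lra.
rewrite exprMn => cy.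
have : c ^+ 2 * (3%:R / 4%:R) <= c ^+ 2 * Im (val z) ^+ 2 by rewrite ler_wpM2l ?sqr_ge0.
lra.
Qed.



Lemma upto_signN g h : upto_sign (- g) h -> upto_sign g h.
Proof.
case=> [<-|/oppr_inj ->]; last by left.
by right; rewrite opprK.
Qed.

Lemma fundom_shift (x : R) (b : int) : - 2^-1 < x -> x <= 2^-1 ->
  - 2^-1 < x + b%:~R -> x + b%:~R <= 2^-1 -> b = 0.
Proof.
move=> h1 h2 h3 h4.
apply: int_between0.
by apply/andP; split; rewrite -(ltr_int R) ?intrN; lra.
Qed.

Lemma fundom_uniq_c0 g z : SL2Z g -> fundom z -> fundom (act_upper g z) ->
  g 1 0 = 0 -> act_upper g z = z /\ upto_sign g 1.
Proof.
move=> Sg [x1 x2 n1 n2] [X1 X2 _ _] c0.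
have := SL2_det Sg; rewrite c0 mulr0 subr0 => ad.
suff sg : upto_sign g 1.
  by split=> //; case: sg => ->; rewrite ?act_upperN act_upper1.
have [[a1 d1]|[a1 d1]] : (g 0 0 = 1 /\ g 1 1 = 1) \/ (g 0 0 = -1 /\ g 1 1 = -1).
    exact: mulz_eq1.
- have b0 : g 0 1 = 0.
    move: X1 X2; rewrite act_Re // /den c0 a1 d1 !mul0r mulr0 mul0r !add0r !mul1r.
    rewrite expr1n expr0n /= !addr0 divr1 mulr1; exact: fundom_shift.
  by left; apply: mx22P; rewrite one22E /=.
- have b0 : g 0 1 = 0.
    move: X1 X2; rewrite act_Re // /den c0 a1 d1 !mul0r mulr0 mul0r !add0r.
    rewrite intrN sqrrN expr1n expr0n /= !addr0 divr1 mulrN1 mulN1r opprD opprK -intrN.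
    by move=> X1 X2; apply: oppr_inj; rewrite oppr0; exact: (fundom_shift _ _ X1 X2).
  by right; apply: mx22P; rewrite [RHS]mxE one22E /= ?b0 ?c0 ?oppr0.
Qed.

Lemma fundom_uniq_c1 g z : SL2Z g -> fundom z -> fundom (act_upper g z) ->
  Im (val z) <= Im (val (act_upper g z)) -> g 1 0 = 1 ->
  act_upper g z = z /\
  (z = pti R /\ upto_sign g matS \/
      z = ptrho R /\ (upto_sign g matU \/ upto_sign g (matU * matU))).
Proof.
move=> Sg fz fgz le c1; have [_ d1] := fundom_c_small Sg fz le.
have dpos := den_gt0 z Sg.
have y0 : 0 < Im (val z) := valP z.
move: fz fgz => [x1 x2 n1 n2] [X1 X2 N1 N2].
have := SL2_det Sg; rewrite c1 mulr1 => adb.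
move: d1 dpos; rewrite /den c1 !mul1r => d1 dpos.
set x := Re (val z) in x1 x2 n1 n2 d1 dpos *; set y := Im (val z) in n1 n2 d1 dpos y0 *.
have dsm : [\/ g 1 1 = 0, g 1 1 = 1 | g 1 1 = -1].
  apply: int_small; set d : R := (g 1 1)%:~R.
  have := sqr_ge0 (d + 2%:R * x); have xx : x ^+ 2 <= 4%:R^-1 by nra.
  by move: d1; rewrite -/d; lra.
have bE : g 0 1 = g 0 0 * g 1 1 - 1 by rewrite -adb; ring.
have ReE : Re (val (act_upper g z)) = (((g 0 0)%:~R * x + (g 0 1)%:~R) *
     (x + (g 1 1)%:~R) + (g 0 0)%:~R * y ^+ 2) / ((x + (g 1 1)%:~R) ^+ 2 + y ^+ 2).
  by rewrite act_Re // /den c1 !mul1r mulr1.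
have ImE : Im (val (act_upper g z)) = y / ((x + (g 1 1)%:~R) ^+ 2 + y ^+ 2).
  by rewrite act_Im // /den c1 !mul1r.
case: dsm => dE.
- (* d = 0: z lies on the unit circle and g z = a - conj(z) *)
  have nn : x ^+ 2 + y ^+ 2 = 1 by move: d1; rewrite dE addr0; lra.
  have x0 := n2 nn.
  move: ReE ImE; rewrite dE bE dE addr0 nn divr1 mulr0 sub0r intrN !divr1.
  move=> ReE ImE.
  have ReE' : Re (val (act_upper g z)) = (g 0 0)%:~R - x.
    by rewrite ReE mulrDl -mulrA -expr2 addrAC -mulrDr nn; ring.
  have a01 : g 0 0 = 0 \/ g 0 0 = 1.
    apply: int_between01.
      by apply/andP; split; rewrite -(ltr_int R) ?intrN; lra.
  case: a01 => aE.
  + have xE : x = 0.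
      have := N2; rewrite ReE' ImE aE sub0r sqrrN => /(_ nn); lra.
    have yE : y = 1.
      move: nn => /eqP; rewrite xE expr0n add0r sqrf_eq1 => /orP[/eqP//|/eqP y1].
      by move: y0; rewrite y1 oppr_gt0 ltr10.
    have zE : z = pti R by apply: upper_ext.
    split; first by apply: upper_ext; rewrite ?ReE' ?ImE ?aE // -/x xE subr0.
    left; split=> //; by right; apply: mx22P; rewrite [RHS]mxE ev_BY !mx22E ?bE ?aE ?dE ?c1.
  + have xE : x = 2^-1 by move: X2; rewrite ReE' aE mulr1z; lra.
    have zE : z = ptrho R by exact: eq_ptrho.
    split; first by apply: upper_ext; rewrite ?ReE' ?ImE ?aE // -/x xE mulr1z; lra.
    right; split=> //; right; by right; apply: mx22P; rewrite [RHS]mxE mul22E ev_BX !mx22E ?bE ?aE ?dE ?c1.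
- (* d = 1 is excluded by the choice of the right half of the boundary *)
  exfalso; move: d1; rewrite dE; nra.
- have xE : x = 2^-1 by move: d1; rewrite dE intrN; nra.
  have nn : x ^+ 2 + y ^+ 2 = 1 by move: d1; rewrite dE intrN xE; nra.
  have zE : z = ptrho R by exact: eq_ptrho.
  move: ReE ImE; have -> : (x + (g 1 1)%:~R) ^+ 2 + y ^+ 2 = 1.
    by move: nn; rewrite dE intrN xE; lra.
  rewrite !divr1 => ReE ImE.
  have ReE' : Re (val (act_upper g z)) = (g 0 0)%:~R + 2^-1.
    have yy : y ^+ 2 = 3 / 4 by move: nn; rewrite xE; lra.
    by rewrite ReE yy bE dE xE !(intrD, intrM, intrN); lra.
  have aE : g 0 0 = 0.
    apply: int_between0.
      by apply/andP; split; rewrite -(ltr_int R) ?intrN; lra.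
  split; first by apply: upper_ext; rewrite ?ReE' ?ImE ?aE // -/x xE add0r.
  right; split=> //; left; by right; apply: mx22P; rewrite [RHS]mxE ev_BX !mx22E ?bE ?aE ?dE ?c1.
Qed.

(* In each case the stabilizer of the point is identified, too. *)
Lemma fundom_uniq_half g z : SL2Z g -> fundom z -> fundom (act_upper g z) ->
  Im (val z) <= Im (val (act_upper g z)) ->
  act_upper g z = z /\
  [\/ upto_sign g 1, z = pti R /\ upto_sign g matS |
      z = ptrho R /\ (upto_sign g matU \/ upto_sign g (matU * matU))].
Proof.
move=> Sg fz fgz le; have [[c|c|c] _] := fundom_c_small Sg fz le.
- by have [-> ?] := fundom_uniq_c0 Sg fz fgz c; split=> //; constructor 1.
- have [-> [|]] := fundom_uniq_c1 Sg fz fgz le c; split=> //; by [constructor 2|constructor 3].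
- rewrite -act_upperN in fgz le *; have Sg' := SL2ZN Sg.
  have c' : (- g) 1 0 = 1 by rewrite mxE c.
  have [-> [[e /upto_signN h]|[e h]]] := fundom_uniq_c1 Sg' fz fgz le c'; split=> //.
    by constructor 2.
  by constructor 3; split=> //; case: h => /upto_signN; [left|right].
Qed.

Lemma fundom_uniq g z w : SL2Z g -> fundom z -> fundom w -> act_upper g z = w ->
  w = z /\
  [\/ upto_sign g 1, z = pti R /\ upto_sign g matS |
      z = ptrho R /\ (upto_sign g matU \/ upto_sign g (matU * matU))].
Proof.
move=> Sg fz fw e; have [le|lt] := lerP (Im (val z)) (Im (val w)).
  by rewrite -e; apply: fundom_uniq_half; rewrite ?e.
have e' : act_upper g^-1 w = z.
  by rewrite -e -act_upperM ?mulVr ?act_upper1 ?SL2Z_unit //; exact: SL2ZV.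
have [] := @fundom_uniq_half g^-1 w (SL2ZV Sg) fw; rewrite ?e' //; first exact: ltW.
move=> e2 _; by rewrite e2 ltxx in lt.
Qed.

End Fund.

Section Exist.
Variable R : realType.
Implicit Types (g h : 'M[int]_2) (z w : upper R).
Local Notation Re := complex.Re.
Local Notation Im := complex.Im.

Definition matT (n : int) : 'M[int]_2 := mx22 1 n 0 1.

Lemma SL2Z_T n : SL2Z (matT n).
Proof. by apply: SL2Z_mk; rewrite mulr0 subr0 mulr1. Qed.

Lemma SL2Z_S : SL2Z matS.
Proof. by rewrite ev_BY; apply: SL2Z_mk. Qed.

Lemma SL2Z_U : SL2Z matU.
Proof. by rewrite ev_BX; apply: SL2Z_mk. Qed.

Lemma act_T n z : Re (val (act_upper (matT n) z)) = Re (val z) + n%:~R /\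
  Im (val (act_upper (matT n) z)) = Im (val z).
Proof.
rewrite act_Re ?act_Im; try exact: SL2Z_T.
rewrite /den !mx22E !mul0r !add0r mulr0 mul0r addr0 mul1r mulr1.
by rewrite expr1n expr0n addr0 !divr1.
Qed.

Lemma act_S z : Re (val (act_upper matS z)) =
     - Re (val z) / (Re (val z) ^+ 2 + Im (val z) ^+ 2) /\
  Im (val (act_upper matS z)) = Im (val z) / (Re (val z) ^+ 2 + Im (val z) ^+ 2).
Proof.
rewrite act_Re ?act_Im; try exact: SL2Z_S.
rewrite /den ev_BY !mx22E !mul0r !add0r mul1r intrN !mulN1r !addr0.
by rewrite !sqrrN.
Qed.

Lemma sqr_le1_norm (a : R) : a ^+ 2 <= 1 -> `|a| <= 1.
Proof. by rewrite -real_normK ?num_real // expr_le1. Qed.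

Lemma den_box g z (N : nat) : SL2Z g -> den g z <= 1 ->
  (Im (val z))^-1 <= N%:R -> 1 + `|Re (val z)| * N%:R <= N%:R * N%:R ->
  (absz (g 1%R 0%R) <= N)%N /\ (absz (g 1%R 1%R) <= N * N)%N.
Proof.
move=> Sg; have y0 : 0 < Im (val z) := valP z.
rewrite /den; set x := Re _; set y := Im _ in y0 *.
set c : R := (g 1 0)%:~R; set d : R := (g 1 1)%:~R => d1 hN1 hN2.
have cy : (c * y) ^+ 2 <= 1 by have := sqr_ge0 (c * x + d); lra.
have cN : `|c| <= N%:R.
  apply: le_trans hN1; rewrite -[_^-1]mul1r ler_pdivlMr //.
  by rewrite -[y]gtr0_norm // -normrM sqr_le1_norm.
have cxd : `|c * x + d| <= 1.
  by apply: sqr_le1_norm; have := sqr_ge0 (c * y); lra.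
have dN : `|d| <= N%:R * N%:R.
  have -> : d = (c * x + d) - c * x by ring.
  apply: le_trans (ler_normB _ _) _; rewrite normrM.
  have : `|c| * `|x| <= N%:R * `|x| by rewrite ler_wpM2r.
  by lra.
split; rewrite -(ler_nat R).
  by rewrite natr_absz intr_norm.
by rewrite natr_absz intr_norm natrM.
Qed.

(* Some point of each orbit has the greatest height. *)
Lemma max_height z : exists2 g, SL2Z g & forall h, SL2Z h ->
  Im (val (act_upper h z)) <= Im (val (act_upper g z)).
Proof.
have y0 : 0 < Im (val z) := valP z.
have [N hN1 hN2] : exists2 N : nat, (Im (val z))^-1 <= N%:R &
    1 + `|Re (val z)| * N%:R <= N%:R * N%:R :> R.
  pose M : R := (Im (val z))^-1 + `|Re (val z)| + 1.
  have M0 : 0 <= M by rewrite !addr_ge0 ?invr_ge0 ?(ltW y0).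
  exists (Num.truncn M).+1; have h := ltW (truncnS_gt M).
  by apply: le_trans h; rewrite /M -addrA lerDl addr_ge0 ?normr_ge0.
  have y1 : 0 < (Im (val z))^-1 by rewrite invr_gt0.
  set K : R := (_ .+1)%:R in h *; have K1 : 1 <= K by rewrite ler1n.
  have : (`|Re (val z)| + 1) * K <= K * K.
    by rewrite ler_pM2r ?(lt_le_trans ltr01 K1) //; move: h; rewrite /M; lra.
  lra.
pose I : finType := ('I_(2 * N * N).+1 * 'I_(2 * N * N).+1)%type.
pose row (i : I) : int * int := ((i.1 : nat)%:Z - (N * N)%N%:Z, (i.2 : nat)%:Z - (N * N)%N%:Z).
pose P (i : I) := `[< exists2 g, SL2Z g & (g 1 0, g 1 1) = row i >].
pose f (i : I) : R := ((row i).1%:~R * Re (val z) + (row i).2%:~R) ^+ 2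
  + ((row i).1%:~R * Im (val z)) ^+ 2.
have fE g i : (g 1 0, g 1 1) = row i -> f i = den g z.
  by rewrite /f => <-.
have box g : SL2Z g -> den g z <= 1 -> exists i, (g 1 0, g 1 1) = row i.
  move=> Sg /(den_box Sg) /(_ hN1 hN2) [h1 h2].
  have NN : (N <= N * N)%N by case: (N) => // n; rewrite leq_pmulr.
  have b1 : (absz (g 1%R 0%R + (N * N)%N%:Z)%R < (2 * N * N).+1)%N by lia.
  have b2 : (absz (g 1%R 1%R + (N * N)%N%:Z)%R < (2 * N * N).+1)%N by lia.
  exists (Ordinal b1, Ordinal b2); rewrite /row /=; congr (_, _); lia.
have den1 : den 1 z <= 1 by rewrite /den !one22E /= !mul0r add0r expr1n expr0n addr0.
have [i0 Pi0] := box 1 SL2Z1 den1.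
have {}Pi0 : P i0 by apply/asboolP; exists 1 => //; exact: SL2Z1.
case: (arg_minP f Pi0) => i /asboolP[g Sg gi] imin.
have g1 : den g z <= 1.
  rewrite -(fE _ _ gi); have [j Pj] := box 1 SL2Z1 den1.
  apply: le_trans (den1); rewrite -(fE _ _ Pj) imin //.
  by apply/asboolP; exists 1 => //; exact: SL2Z1.
exists g => // h Sh; rewrite !act_Im // ler_pM2l // lef_pV2 ?posrE ?den_gt0 //.
have [h1|h1] := lerP (den h z) 1; last by apply: le_trans (ltW h1).
have [j Pj] := box h Sh h1; rewrite -(fE _ _ gi) -(fE _ _ Pj) imin //.
by apply/asboolP; exists h.
Qed.

Lemma fundom_exists z : exists2 g, SL2Z g & fundom (act_upper g z).
Proof.
have [g Sg gmax] := max_height z.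
pose n : int := - Num.ceil (Re (val (act_upper g z)) - 2^-1).
pose w := act_upper (matT n * g) z.
have wE : w = act_upper (matT n) (act_upper g z).
  by rewrite -act_upperM //; exact: SL2Z_T.
have ImE : Im (val w) = Im (val (act_upper g z)) by rewrite wE (act_T _ _).2.
have y0 : 0 < Im (val w) := valP w.
have [r1 r2] : - 2^-1 < Re (val w) /\ Re (val w) <= 2^-1.
  rewrite wE (act_T _ _).1 /n intrN; set x := Re _.
  have h1 := ceil_ge (x - 2^-1); have h2 := ceilB1_lt (x - 2^-1).
  by rewrite intrB in h2; split; lra.
have n1 : 1 <= Re (val w) ^+ 2 + Im (val w) ^+ 2.
  have SMg := SL2ZM (SL2Z_T n) Sg.
  have := gmax _ (SL2ZM SL2Z_S SMg); rewrite (act_upperM z SL2Z_S SMg) -/w.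
  rewrite (act_S w).2 -ImE; set q := (X in _ / X); have q0 : 0 < q.
    by rewrite ltr_wpDl ?sqr_ge0 ?exprn_gt0.
  by rewrite ler_pdivrMr // ler_pMr.
have [x0|x0] := lerP 0 (Re (val w)).
  by exists (matT n * g); [exact: SL2ZM (SL2Z_T _) Sg|split].
have [nn|nn] := eqVneq (Re (val w) ^+ 2 + Im (val w) ^+ 2) 1; last first.
  exists (matT n * g); first exact: SL2ZM (SL2Z_T _) Sg.
  by split=> // /eqP; rewrite (negPf nn).
exists (matS * (matT n * g)); first exact: SL2ZM SL2Z_S (SL2ZM (SL2Z_T _) Sg).
rewrite (act_upperM z SL2Z_S (SL2ZM (SL2Z_T n) Sg)) -/w.
have [e1 e2] := act_S w; rewrite nn !divr1 in e1 e2.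
rewrite /fundom e1 e2 sqrrN nn; split=> // ; lra.
Qed.

(** Every cusp is a translate of infinity. *)
Lemma cusp_exists (s : option rat) : exists2 g, SL2Z g & act_cusp g None = s.
Proof.
case: s => [q|]; last by exists 1; [exact: SL2Z1|rewrite act_cusp1].
have cop := coprime_num_den q.
have /coprimezP [[u v] /= e] : coprimez (numq q) (denq q) by rewrite coprimezE.
exists (mx22 (numq q) (- v) (denq q) u).
  by apply: SL2Z_mk; rewrite -e; ring.
by rewrite /= !mx22E (negPf (denq_neq0 q)) divq_num_den.
Qed.

Lemma cusp_stab g : SL2Z g -> act_cusp g None = None ->
  exists n, upto_sign g (matT n).
Proof.
move=> Sg /=; case: eqP => // c0 _; have := SL2_det Sg; rewrite c0 mulr0 subr0.
case/mulz_eq1 => -[a1 d1].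
  by exists (g 0 1); left; apply: mx22P; rewrite !mx22E.
exists (- g 0 1); right; apply: mx22P; rewrite [RHS]mxE !mx22E ?opprK //.
Qed.

End Exist.

Section Topo.
Variable R : realType.
Implicit Types (g h : 'M[int]_2) (z w : upper R).
Local Notation Re := complex.Re.
Local Notation Im := complex.Im.

Lemma xupper_openE (U : set (xupper R)) : open U -> xupper_open U.
Proof. by []. Qed.

(* The point x + i y of the upper half plane *)
Definition upt (x y : R) : upper R := insubd (pti R) (Complex x y).

Lemma upt_Re x y : 0 < y -> Re (val (upt x y)) = x.
Proof. by move=> y0; rewrite /upt val_insubd /= y0. Qed.

Lemma upt_Im x y : 0 < y -> Im (val (upt x y)) = y.
Proof. by move=> y0; rewrite /upt val_insubd /= y0. Qed.

Lemma upt_eta z : upt (Re (val z)) (Im (val z)) = z.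
Proof.
have y0 : 0 < Im (val z) := valP z.
by apply: upper_ext; rewrite (upt_Re, upt_Im).
Qed.

(* Neighbourhoods of interior points are those of the plane. *)
Lemma open_upt (U : set (xupper R)) x y : open U -> 0 < y -> U (inl (upt x y)) ->
  \forall p \near ((x, y) : R * R), 0 < p.2 /\ U (inl (upt p.1 p.2)).
Proof.
move=> /xupper_openE [oU _] y0 Uz.
have : nbhs ((x, y) : R * R) [set p : R * R | exists2 z : upper R,
    U (inl z) & p = (Re (val z), Im (val z))].
  apply: open_nbhs_nbhs; split=> //; exists (upt x y) => //.
  by rewrite upt_Re ?upt_Im.
apply: filterS => p [z Uz' ->] /=; rewrite upt_eta; split=> //.
exact: valP z.
Qed.

Lemma act_continuous g : SL2Z g -> continuous (act g : xupper R -> xupper R).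
Proof.
move=> Sg; apply/continuousP => U oU.
suff : xupper_open (act g @^-1` U) by [].
split; last first.
  move=> h Sh; change (U (act g (act h (inr None))) -> exists M : R, forall z,
    M < Im (val z) -> U (act g (act h (inl z)))); rewrite -actM //.
  move=> /((xupper_openE oU).2 _ (SL2ZM Sg Sh)) [M HM]; exists M => z /HM.
  by rewrite actM.
rewrite openE => _ [z Uz ->]; rewrite /interior /=.
have y0 : 0 < Im (val z) := valP z.
set x := Re (val z) in Uz *; set y := Im (val z) in Uz y0 *.
have d0 := den_gt0 z Sg.
pose N (p : R * R) : R := ((g 1 0)%:~R * p.1 + (g 1 1)%:~R) ^+ 2 + ((g 1 0)%:~R * p.2) ^+ 2.
pose F (p : R * R) : R := (((g 0 0)%:~R * p.1 + (g 0 1)%:~R) *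
     ((g 1 0)%:~R * p.1 + (g 1 1)%:~R)
     + (g 0 0)%:~R * (g 1 0)%:~R * p.2 ^+ 2).
have FE (p : R * R) : 0 < p.2 -> act g (inl (upt p.1 p.2)) =
    inl (upt (F p / N p) (p.2 / N p)) :> xupper R.
  move=> p0; rewrite /= -[act_upper g _ in LHS]upt_eta act_Re // act_Im //.
  by rewrite /den upt_Re // upt_Im.
have cst (c : R) : {for (x, y), continuous (fun _ : R * R => c)} by exact: cvg_cst.
have c1 : {for (x, y), continuous (@fst R R)} by exact: cvg_fst.
have c2 : {for (x, y), continuous (@snd R R)} by exact: cvg_snd.
have lin (a b : R) : {for (x, y), continuous (fun p : R * R => a * p.1 + b)}.
  exact: (continuousD (continuousM (cst a) c1) (cst b)).
have mul2 (a : R) : {for (x, y), continuous (fun p : R * R => a * p.2)}.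
  exact: (continuousM (cst a) c2).
have Nc : {for (x, y), continuous N}.
  exact: (continuousD (continuousM (lin _ _) (lin _ _)) (continuousM (mul2 _) (mul2 _))).
have Fc : {for (x, y), continuous F}.
  exact: (continuousD (continuousM (lin _ _) (lin _ _)) (continuousM (cst _) (continuousM c2 c2))).
have N0 : N (x, y) != 0 by rewrite gt_eqF.
have Gc : {for (x, y), continuous (fun p : R * R => (F p / N p, p.2 / N p))}.
  exact: (cvg_pair (continuousM Fc (continuousV N0 Nc)) (continuousM c2 (continuousV N0 Nc))).
have Uz' : U (inl (upt (F (x, y) / N (x, y)) (y / N (x, y)))).
  by rewrite -(FE (x, y)) // upt_eta.
have /Gc := open_upt oU (divr_gt0 y0 d0) Uz'.
have near2 : \forall p \near ((x, y) : R * R), 0 < p.2.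
  by apply: (filterS _ (open_upt (@openT (xupper R)) y0 (I : [set: xupper R] (inl (upt x y))))) => p [].
move: near2; apply: filterS2 => p p0 [_ Up]; exists (upt p.1 p.2).
  by have := FE p p0; rewrite /preimage /= => ->.
by rewrite upt_Re // upt_Im //; case: (p).
Qed.


(* A map to the extended half plane, going to infinity where r = 1 *)
Definition spike (x y r : R) : xupper R :=
  if r < 1 then inl (upt x (y + r / (1 - r))) else inr None.

Lemma spike_continuous (T : topologicalType) (A : set T) (x y r : T -> R) :
  continuous x -> continuous y -> continuous r ->
  (forall u, A u -> 0 < y u /\ 0 <= r u <= 1) ->
  {within A, continuous (fun u => spike (x u) (y u) (r u))}.
Proof.
move=> cx cy cr hA; apply/subspace_continuousP => u Au.
have [y0 /andP[r0 r1]] := hA u Au.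
move=> V; rewrite nbhsE => -[U [oU Uu] UV]; apply: (filterS UV).
have {}Uu : U (spike (x u) (y u) (r u)) := Uu.
rewrite /within /=; have [lt1|ge1] := ltrP (r u) 1.
- have {}Uu : U (inl (upt (x u) (y u + r u / (1 - r u)))).
    by move: Uu; rewrite /spike lt1.
  have Fc : {for u, continuous (fun v => (x v, y v + r v / (1 - r v)))}.
    have c1 : {for u, continuous (fun v => 1 - r v)}.
      have cst : {for u, continuous (fun _ : T => 1 : R)} by exact: cvg_cst.
      exact: (continuousB cst (cr u)).
    have n1 : 1 - r u != 0 by rewrite subr_eq0 gt_eqF.
    have cV : {for u, continuous (fun v => (1 - r v)^-1)} by apply: cvgV => //; exact: c1.
    have cM : {for u, continuous (fun v => r v / (1 - r v))}.
      exact: (cvgM (cr u) cV).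
    have cD : {for u, continuous (fun v => y v + r v / (1 - r v))}.
      exact: (cvgD (cy u) cM).
    exact: (cvg_pair (cx u) cD).
  have Y0 : 0 < y u + r u / (1 - r u).
    by rewrite ltr_wpDr // divr_ge0 // subr_ge0.
  have /Fc := open_upt oU Y0 Uu.
  have near1 : \forall v \near u, r v < 1.
    by apply: (cr u [set s | s < 1]); apply: open_nbhs_nbhs; split=> //; exact: open_lt.
  move: near1; apply: filterS2 => v v1 [_ Uv] _.
  by change (U (spike (x v) (y v) (r v))); rewrite /spike v1.
have r1E : r u = 1 by apply/eqP; rewrite eq_le r1.
have {}Uu : U (inr None) by move: Uu; rewrite /spike r1E ltxx.
have [M HM] := (xupper_openE oU).2 1 SL2Z1 (ltac:(by rewrite act1)).
pose M' := Num.max M 1.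
have M1 : 0 < M' by rewrite lt_max ltr01 orbT.
have near1 : \forall v \near u, 1 - M'^-1 / 2%:R < r v.
  apply: (cr u [set s | 1 - M'^-1 / 2%:R < s]); apply: open_nbhs_nbhs; split; first exact: open_gt.
  by rewrite /= r1E ltrBlDr ltrDl divr_gt0 ?invr_gt0 ?ltr0n.
move: near1; apply: filterS => v rv Av.
change (U (spike (x v) (y v) (r v))); rewrite /spike; case: ifPn => [v1|//].
have [yv /andP[rv0 _]] := hA v Av.
rewrite -[inl _](act1); apply: HM.
have hq : 0 < 1 - r v by rewrite subr_gt0.
have Y0 : 0 < y v + r v / (1 - r v) by rewrite ltr_wpDr // divr_ge0 // ltW.
rewrite upt_Im //; apply: (@le_lt_trans _ _ M'); first by rewrite le_max lexx.
rewrite ltr_wpDl ?(ltW yv) // ltr_pdivlMr //.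
have M2 : M'^-1 <= 1 by rewrite invf_le1 // le_max lexx orbT.
have : M' * (1 - r v) < M' * (M'^-1 / 2%:R) by rewrite ltr_pM2l //; lra.
rewrite mulrA divff ?gt_eqF // mul1r; lra.
Qed.

End Topo.

Inductive kind := Face | Ray | Arc | Cusp | PtI | PtRho.

Definition kind_code (k : kind) : 'I_6 :=
  inord match k with Face => 0 | Ray => 1 | Arc => 2 | Cusp => 3 | PtI => 4 | PtRho => 5 end.

Definition kind_decode (i : 'I_6) : kind :=
  match val i with 0 => Face | 1 => Ray | 2 => Arc | 3 => Cusp | 4 => PtI | _ => PtRho end%N.

Lemma kind_codeK : cancel kind_code kind_decode.
Proof. by case; rewrite /kind_decode /kind_code /= inordK. Qed.

HB.instance Definition _ := Equality.copy kind (can_type kind_codeK).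
HB.instance Definition _ := Choice.copy kind (can_type kind_codeK).
HB.instance Definition _ := Countable.copy kind (can_type kind_codeK).
HB.instance Definition _ : isFinite kind := CanIsFinite kind_codeK.

Lemma big_kind (F : kind -> int) : \sum_k F k =
  F Face + F Ray + F Arc + F Cusp + F PtI + F PtRho.
Proof.
rewrite (reindex kind_decode).
  by rewrite !big_ord_recr /= big_ord0 add0r.
exists kind_code => [i _|k _]; last exact: kind_codeK.
by apply: val_inj; case: i => [[|[|[|[|[|[|//]]]]]] ?]; rewrite /= inordK.
Qed.

Definition kdim (k : kind) : nat :=
  match k with Face => 2 | Ray | Arc => 1 | _ => 0 end.

Definition kgen (k : kind) : 'M[int]_2 :=
  match k with Cusp => matS * matU | PtI => matS | PtRho => matU | _ => 1 end.

Section Std.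
Variable R : realType.
Implicit Types (g h : 'M[int]_2) (z w : upper R).
Local Notation Re := complex.Re.
Local Notation Im := complex.Im.

Definition arcy (x : R) : R := Num.sqrt (1 - x ^+ 2).

Definition std (k : kind) : 'rV[R]_(kdim k) -> xupper R :=
  match k with
  | Face => fun u : 'rV_2 => spike (u 0 0 - 2^-1) (arcy (u 0 0 - 2^-1)) (u 0 1)
  | Ray => fun u : 'rV_1 => spike 2^-1 (arcy 2^-1) (u 0 0)
  | Arc => fun u : 'rV_1 => spike (u 0 0 / 2%:R) (arcy (u 0 0 / 2%:R)) 0
  | Cusp => fun=> inr None
  | PtI => fun=> inl (pti R)
  | PtRho => fun=> inl (ptrho R)
  end.

Lemma arcy_gt0 x : -2^-1 <= x <= 2^-1 -> 0 < arcy x.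
Proof. by case/andP => h1 h2; rewrite sqrtr_gt0; nra. Qed.

Lemma arcy_sq x : -2^-1 <= x <= 2^-1 -> x ^+ 2 + arcy x ^+ 2 = 1.
Proof.
by case/andP => h1 h2; rewrite sqr_sqrtr; [rewrite addrC subrK|nra].
Qed.

Lemma arcy_continuous (T : topologicalType) (f : T -> R) : continuous f ->
  continuous (fun v => arcy (f v)).
Proof.
move=> cf v; apply: (@continuous_comp _ _ _ (fun v => 1 - f v ^+ 2) Num.sqrt); last exact: sqrt_continuous.
have c1 : {for v, continuous (fun _ : T => 1 : R)} by exact: cvg_cst.
exact: (cvgB c1 (cvgM (cf v) (cf v))).
Qed.

Lemma arcy_half : arcy 2^-1 = Num.sqrt (3%:R / 4%:R).
Proof. by congr Num.sqrt; lra. Qed.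

Lemma half_itv (s : R) : 0 <= s <= 1 -> -2^-1 <= s - 2^-1 <= 2^-1.
Proof. by case/andP => *; apply/andP; split; lra. Qed.

Lemma half_itv2 (s : R) : 0 <= s <= 1 -> -2^-1 <= s / 2%:R <= 2^-1.
Proof. by case/andP => *; apply/andP; split; lra. Qed.

Lemma half_itv1 : -2^-1 <= (2^-1 : R) <= (2^-1 : R).
Proof. by apply/andP; split; lra. Qed.

Lemma std_continuous k : {within @cube R (kdim k), continuous (@std k)}.
Proof.
have cc n (i : 'I_n) : continuous (fun u : 'rV[R]_n => u 0 i).
  exact: coord_continuous.
have cst n (c : R) : continuous (fun _ : 'rV[R]_n => c) by move=> u; apply: cst_continuous.
have cs n (i : 'I_n) : continuous (fun u : 'rV[R]_n => u 0 i - 2^-1).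
  by move=> u; exact: (cvgB (cc n i u) (cst n 2^-1 u)).
have ch n (i : 'I_n) : continuous (fun u : 'rV[R]_n => u 0 i / 2%:R).
  by move=> u; exact: (cvgM (cc n i u) (cst n 2%:R^-1 u)).
case: k => /=.
- apply: (spike_continuous (cs 2 0) (arcy_continuous (cs 2 0)) (cc 2 1)) => u Au.
  by rewrite arcy_gt0 ?half_itv.
- apply: (spike_continuous (cst 1 2^-1) (cst 1 (arcy 2^-1)) (cc 1 0)) => u Au.
  by rewrite arcy_gt0 ?half_itv1.
- apply: (spike_continuous (ch 1 0) (arcy_continuous (ch 1 0)) (cst 1 0)) => u Au.
  by rewrite arcy_gt0 ?half_itv2 // lexx ler01.
- by apply: continuous_subspaceT => u; apply: cst_continuous.
- by apply: continuous_subspaceT => u; apply: cst_continuous.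
- by apply: continuous_subspaceT => u; apply: cst_continuous.
Qed.

(** The cell of the tessellation that contains a point of [fundom] *)
Definition kind_of (p : xupper R) : kind :=
  if p is inl z then
    let n := Re (val z) ^+ 2 + Im (val z) ^+ 2 in
    if Re (val z) == 2^-1 then if n == 1 then PtRho else Ray
    else if n == 1 then if Re (val z) == 0 then PtI else Arc else Face
  else Cusp.

Lemma spikeE x y r : r < 1 -> spike x y r = inl (upt x (y + r / (1 - r))) :> xupper R.
Proof. by rewrite /spike => ->. Qed.

Lemma div1_gt0 (r : R) : 0 < r < 1 -> 0 < r / (1 - r).
Proof. by case/andP => ? ?; rewrite divr_gt0 // subr_gt0. Qed.

Lemma ptrho_n : Re (val (ptrho R)) ^+ 2 + Im (val (ptrho R)) ^+ 2 = 1.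
Proof. by rewrite /= sqr_sqrtr; lra. Qed.

Lemma std_kind k u : open_cube u -> kind_of (@std k u) = k /\
  (k <> Cusp -> exists2 z, @std k u = inl z & fundom z).
Proof.
case: k u => u /= ou; try by split.
- have /andP[s0 s1] := ou 0; have /andP[r0 r1] := ou 1.
  set s := u 0 0 in s0 s1 *; set r := u 0 1 in r0 r1 *.
  have hx : -2^-1 <= s - 2^-1 <= 2^-1 by rewrite half_itv ?(ltW s0) ?(ltW s1).
  have y0 := arcy_gt0 hx; have q0 : 0 < r / (1 - r) by rewrite div1_gt0 ?r0.
  have n1 := arcy_sq hx.
  have Y0 : 0 < arcy (s - 2^-1) + r / (1 - r) by lra.
  have N1 : 1 < (s - 2^-1) ^+ 2 + (arcy (s - 2^-1) + r / (1 - r)) ^+ 2 by nra.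
  rewrite spikeE // /kind_of /= upt_Re // upt_Im // (gt_eqF N1).
  rewrite lt_eqF; last by lra.
  split=> // _; exists (upt (s - 2^-1) (arcy (s - 2^-1) + r / (1 - r))) => //.
  rewrite /fundom upt_Re // upt_Im //; split; lra.
- have /andP[r0 r1] := ou 0; set r := u 0 0 in r0 r1 *.
  have y0 := arcy_gt0 half_itv1; have q0 : 0 < r / (1 - r) by rewrite div1_gt0 ?r0.
  have n1 := arcy_sq half_itv1.
  have Y0 : 0 < arcy 2^-1 + r / (1 - r) by lra.
  have N1 : 1 < 2^-1 ^+ 2 + (arcy 2^-1 + r / (1 - r)) ^+ 2 by nra.
  rewrite spikeE // /kind_of /= upt_Re // upt_Im // (gt_eqF N1) eqxx.
  split=> // _; exists (upt 2^-1 (arcy 2^-1 + r / (1 - r))) => //.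
  by rewrite /fundom upt_Re // upt_Im //; split; lra.
- have /andP[s0 s1] := ou 0; set s := u 0 0 in s0 s1 *.
  have hx : -2^-1 <= s / 2%:R <= 2^-1 by rewrite half_itv2 ?(ltW s0) ?(ltW s1).
  have y0 := arcy_gt0 hx; have n1 := arcy_sq hx.
  rewrite spikeE // mul0r addr0 /kind_of /= upt_Re // upt_Im // n1 eqxx.
  rewrite lt_eqF; last by lra.
  rewrite gt_eqF; last by lra.
  split=> // _; exists (upt (s / 2%:R) (arcy (s / 2%:R))) => //.
  by rewrite /fundom upt_Re // upt_Im // n1; split; lra.
- split; last by move=> _; exists (pti R) => //; split=> /=; rewrite ?expr0n ?expr1n /=; lra.
  by rewrite expr0n expr1n add0r !eqxx lt_eqF //; lra.
- split; last by move=> _; exists (ptrho R) => //; split; rewrite ?ptrho_n //=; lra.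
  by have := ptrho_n; rewrite /= eqxx => ->; rewrite eqxx.
Qed.


(* The inverse of r |-> r / (1 - r) on [0, 1[ *)
Lemma div1_surj (q : R) : 0 < q -> exists2 r : R, 0 < r < 1 & r / (1 - r) = q.
Proof.
move=> q0; have d0 : 0 < 1 + q by lra.
have e : 1 - q / (1 + q) = (1 + q)^-1.
  by apply: (mulIf (lt0r_neq0 d0)); rewrite mulrBl mulfVK ?mulVf ?lt0r_neq0 //; lra.
exists (q / (1 + q)); last by rewrite e invrK mulfVK // lt0r_neq0.
by rewrite divr_gt0 //= ltr_pdivrMr //; lra.
Qed.

Lemma div1_inj (r s : R) : r < 1 -> s < 1 -> r / (1 - r) = s / (1 - s) -> r = s.
Proof.
move=> r1 s1 /eqP; rewrite eqr_div; try by rewrite subr_eq0 gt_eqF.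
by move=> /eqP; lra.
Qed.

Lemma upt_arcy z : -2^-1 <= Re (val z) <= 2^-1 -> Re (val z) ^+ 2 + Im (val z) ^+ 2 = 1 ->
  z = upt (Re (val z)) (arcy (Re (val z))).
Proof.
move=> hx n; rewrite -[LHS]upt_eta; congr upt.
have y0 : 0 < Im (val z) := valP z.
by rewrite /arcy -n addrC addKr sqrtr_sqr gtr0_norm.
Qed.

Lemma row1P (a b : 'rV[R]_1) : a 0 0 = b 0 0 -> a = b.
Proof. by move=> e; apply/rowP => i; rewrite ord1. Qed.

Lemma row2P (a b : 'rV[R]_2) : a 0 0 = b 0 0 -> a 0 1 = b 0 1 -> a = b.
Proof. by move=> e1 e2; apply/rowP => i; case: (ord2P i) => ->. Qed.

Lemma row0P (a b : 'rV[R]_0) : a = b.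
Proof. by apply/rowP => -[]. Qed.

Lemma std_inj k (u v : 'rV[R]_(kdim k)) : open_cube u -> open_cube v ->
  std u = std v -> u = v.
Proof.
case: k u v => u v ou ov /=; try by move=> _; exact: row0P.
- have /andP[s0 s1] := ou 0; have /andP[r0 r1] := ou 1.
  have /andP[s0' s1'] := ov 0; have /andP[r0' r1'] := ov 1.
  have hx (w : 'rV[R]_2) : 0 < w 0 0 -> w 0 0 < 1 -> 0 < w 0 1 -> w 0 1 < 1 ->
    0 < arcy (w 0 0 - 2^-1) + w 0 1 / (1 - w 0 1).
    move=> h1 h2 h3 h4; have y0 : 0 < arcy (w 0 0 - 2^-1) by rewrite arcy_gt0 ?half_itv ?(ltW h1) ?(ltW h2).
    have := @div1_gt0 (w 0 1); rewrite h3 h4 => /(_ isT); lra.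
  rewrite !spikeE // => -[e].
  have e1 := congr1 (fun z => Re (val z)) e; have e2 := congr1 (fun z => Im (val z)) e.
  rewrite /= !upt_Re ?hx // in e1; rewrite /= !upt_Im ?hx // in e2.
  have e3 := addIr _ e1; apply: row2P => //.
  by move: e2; rewrite e3 => /addrI /div1_inj; apply.
- have /andP[r0 r1] := ou 0; have /andP[r0' r1'] := ov 0.
  have hx (w : R) : 0 < w < 1 -> 0 < arcy 2^-1 + w / (1 - w).
    by move=> /div1_gt0; have := arcy_gt0 half_itv1; lra.
  rewrite !spikeE // => -[e].
  have e2 := congr1 (fun z => Im (val z)) e.
  rewrite /= !upt_Im ?hx ?r0 ?r0' // in e2; apply: row1P.
  by move: e2 => /addrI /div1_inj; apply.
- have /andP[s0 s1] := ou 0; have /andP[s0' s1'] := ov 0.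
  rewrite !spikeE // mul0r !addr0 => -[e].
  have e1 := congr1 (fun z => Re (val z)) e.
  rewrite /= !upt_Re ?arcy_gt0 ?half_itv2 ?(ltW s0) ?(ltW s1) ?(ltW s0') ?(ltW s1') // in e1.
  by apply: row1P; lra.
Qed.

Lemma std_onto z : fundom z -> exists k, exists2 u : 'rV[R]_(kdim k),
  open_cube u & std u = inl z.
Proof.
move=> [x1 x2 n1 n2]; have y0 : 0 < Im (val z) := valP z.
have hx : -2^-1 <= Re (val z) <= 2^-1 by rewrite x2 ltW.
have a0 := arcy_gt0 hx; have an := arcy_sq hx.
have zE := upt_eta z.
have [nn|nn] := eqVneq (Re (val z) ^+ 2 + Im (val z) ^+ 2) 1.
  have zA := upt_arcy hx nn; have x0 := n2 nn.
  have [xh|xh] := eqVneq (Re (val z)) 2^-1.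
    by exists PtRho, 0; [case|rewrite /= -(eq_ptrho xh nn)].
  have [x00|x00] := eqVneq (Re (val z)) 0.
    exists PtI, 0; first by case.
    congr inl; rewrite zA x00 /arcy expr0n subr0 sqrtr1.
    by apply: upper_ext; rewrite (upt_Re, upt_Im).
  exists Arc, (const_mx (2%:R * Re (val z))).
    by move=> i; rewrite mxE; apply/andP; split; lra.
  by rewrite /= !mxE spikeE // mul0r addr0 mulrAC divff ?pnatr_eq0 // mul1r -zA.
have N1 : 1 < Re (val z) ^+ 2 + Im (val z) ^+ 2 by rewrite lt_def nn n1.
have [r r01 rE] : exists2 r : R, 0 < r < 1 & r / (1 - r) = Im (val z) - arcy (Re (val z)).
  by apply: div1_surj; nra.
have /andP[r0 r1] := r01.
have [xh|xh] := eqVneq (Re (val z)) 2^-1.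
  exists Ray, (const_mx r); first by move=> i; rewrite mxE.
  by rewrite /= mxE spikeE // rE -xh addrC subrK upt_eta.
exists Face, (\row_i if i == 0 then Re (val z) + 2^-1 else r).
  by move=> i; rewrite mxE; case: ifP => _ //; apply/andP; split; lra.
by rewrite /= !mxE /= addrK spikeE // rE addrC subrK upt_eta.
Qed.

(** Every point of the extended half plane lies in the orbit of exactly one
    point of one standard cell, and the stabilizer is cyclic up to sign. *)
Lemma cells_cover (p : xupper R) : exists g k, exists2 u : 'rV[R]_(kdim k),
  SL2Z g & open_cube u /\ p = act g (std u).
Proof.
case: p => [z|s].
  have [g Sg fz] := fundom_exists z; have [k [u ou uE]] := std_onto fz.
  exists g^-1, k, u; [exact: SL2ZV|split=> //].
  by rewrite uE -[inl _](actVK (inl z) Sg).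
have [g Sg gE] := cusp_exists s.
by exists g, Cusp, 0 => //; split; [case|change (inr s = inr (act_cusp g None) :> xupper R); rewrite gE].
Qed.

Lemma kgen_SL k : SL2Z (kgen k).
Proof.
case: k => /=; try exact: SL2Z1; [|exact: SL2Z_S|exact: SL2Z_U].
exact: SL2ZM SL2Z_S SL2Z_U.
Qed.

Lemma kgen_fix k (u : 'rV[R]_(kdim k)) : act (kgen k) (std u) = std u.
Proof.
case: k u => u; rewrite ?[kgen _]/= ?act1 //.
- by rewrite /= mul22E ev_BX ev_BY !mx22E.
- congr inl; apply: upper_ext; rewrite ?(act_S _).1 ?(act_S _).2 /=.
    by rewrite oppr0 mul0r.
  by rewrite expr0n expr1n add0r divr1.
- have n := ptrho_n; have := @act_Re _ matU (ptrho R) SL2Z_U.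
  have := @act_Im _ matU (ptrho R) SL2Z_U.
  have -> : den matU (ptrho R) = 1.
    by rewrite /den ev_BX !mx22E intrN !mulN1r sqrrN mulr1z; move: n => /=; lra.
  rewrite ev_BX !mx22E intrN mul0r add0r !mulN1r !mul0r addr0 mul1r !divr1 => e2 e1.
  congr inl; apply: upper_ext; rewrite ?ev_BX ?e1 ?e2 //=; lra.
Qed.

Definition gen_pow (h : 'M[int]_2) g := exists n : nat, upto_sign g (h ^+ n).

Lemma kgen_cusp : kgen Cusp = - matT (-1).
Proof.
by apply: mx22P; rewrite [RHS]mxE mul22E ev_BX ev_BY !mx22E.
Qed.

Lemma matT_exp (m : int) (n : nat) : matT m ^+ n = matT (m *+ n).
Proof.
elim: n => [|n IH]; first by rewrite expr0 mulr0n; apply: mx22P; rewrite one22E mx22E.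
rewrite exprS IH; apply: mx22P; rewrite mul22E !mx22E; rewrite ?mulrS; ring.
Qed.

Lemma cells_uniq g k k' (u : 'rV[R]_(kdim k)) (v : 'rV[R]_(kdim k')) : SL2Z g ->
  open_cube u -> open_cube v -> act g (std u) = std v ->
  [/\ k = k', std u = std v & gen_pow (kgen k) g \/ gen_pow (kgen k) g^-1].
Proof.
move=> Sg ou ov e.
have [ku hu] := std_kind ou; have [kv hv] := std_kind ov.
have [kc|kc] := eqVneq k Cusp.
  have kc' : k' = Cusp.
    by rewrite -kv -e; move: (u); rewrite kc.
  subst k k'; split=> //; move: e => /= -[] /(cusp_stab Sg)[n].
  have pw (h : 'M_2) m : SL2Z h -> (0 <= m)%R -> upto_sign h (matT (- m)) -> gen_pow (kgen Cusp) h.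
    move=> _; case: m => [m|//] _ hh; exists m; rewrite kgen_cusp exprNn matT_exp.
    have -> : (-1) *+ m = - m%:Z :> int by rewrite mulNrn natz.
    move: hh; rewrite -signr_odd; case: odd; rewrite ?expr1 ?expr0 ?mulN1r ?mul1r //.
    by case=> ->; [right|left]; rewrite ?opprK.
  have [n0|n0] := lerP 0 n; last first.
    by move=> h; left; apply: (pw _ (- n)) => //; [lia|rewrite opprK].
  move=> h; right; apply: (pw _ n (SL2ZV Sg) n0).
  have TV : (matT n)^-1 = matT (- n).
    rewrite SL2_inv; last exact: SL2Z_T.
    by apply: mx22P; rewrite !mx22E ?oppr0.
  by case: h => ->; [left|right]; rewrite ?invrN TV.
have [kc'|kc'] := eqVneq k' Cusp.
  have [z zE _] := hu (elimN eqP kc); move: e; rewrite zE; clear -kc'.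
  by case: k' kc' v.
have [z zE fz] := hu (elimN eqP kc); have [w wE fw] := hv (elimN eqP kc').
move: e; rewrite zE wE => -[e].
have [wz st] := fundom_uniq Sg fz fw e.
have suv : std u = std v by rewrite zE wE wz.
have kk : k = k' by rewrite -ku -kv suv.
split; [by []|by rewrite -zE -wE|left].
case: st => [s1|[zi s1]|[zr s1]].
- by exists 0%N; rewrite expr0.
- have -> : k = PtI.
    by rewrite -ku zE zi; have [] := @std_kind PtI 0 (fun i => match i with Ordinal _ h => ltac:(by []) end).
  by exists 1%N; rewrite expr1.
- have -> : k = PtRho.
    by rewrite -ku zE zr; have [] := @std_kind PtRho 0 (fun i => match i with Ordinal _ h => ltac:(by []) end).
  by case: s1 => s1; [exists 1%N; rewrite expr1|exists 2%N; rewrite expr2].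
Qed.


Lemma open_const (n : nat) (r : R) : 0 < r < 1 -> open_cube (const_mx r : 'rV[R]_n).
Proof. by move=> h i; rewrite mxE. Qed.

Lemma std_boundary k (u : 'rV[R]_(kdim k)) : cube u -> ~ open_cube u ->
  exists k' g (v : 'rV[R]_(kdim k')),
    [/\ (kdim k' < kdim k)%N, SL2Z g, open_cube v & std u = act g (std v)].
Proof.
have atinf (n : nat) : (0 < n)%N -> exists k' g (v : 'rV[R]_(kdim k')),
    [/\ (kdim k' < n)%N, SL2Z g, open_cube v & inr None = act g (std v)].
  by move=> n0; exists Cusp, 1, 0; split; [|exact: SL2Z1|case|rewrite act1].
have atrho (n : nat) : (0 < n)%N -> exists k' g (v : 'rV[R]_(kdim k')),
    [/\ (kdim k' < n)%N, SL2Z g, open_cube v & spike 2^-1 (arcy 2^-1) 0 = act g (std v)].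
  move=> n0; exists PtRho, 1, 0; split; [|exact: SL2Z1|case|rewrite act1] => //.
  rewrite spikeE // mul0r addr0 /= arcy_half; congr inl.
  by apply: upper_ext; rewrite ?upt_Re ?upt_Im ?sqrt34_gt0.
have ati (n : nat) : (0 < n)%N -> exists k' g (v : 'rV[R]_(kdim k')),
    [/\ (kdim k' < n)%N, SL2Z g, open_cube v & spike 0 (arcy 0) 0 = act g (std v)].
  move=> n0; exists PtI, 1, 0; split; [|exact: SL2Z1|case|rewrite act1] => //.
  rewrite spikeE // mul0r addr0 /= /arcy expr0n subr0 sqrtr1; congr inl.
  by apply: upper_ext; rewrite ?upt_Re ?upt_Im.
(* the right edge *)
have edge (r : R) : 0 <= r <= 1 -> exists k' g (v : 'rV[R]_(kdim k')),
    [/\ (kdim k' < 2)%N, SL2Z g, open_cube v & spike 2^-1 (arcy 2^-1) r = act g (std v)].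
  move=> /andP[r0 r1]; have [->|r1'] := eqVneq r 1.
    by rewrite /spike ltxx; exact: atinf.
  have [->|r0'] := eqVneq r 0; first exact: atrho.
  exists Ray, 1, (const_mx r); split; [by []|exact: SL2Z1| |by rewrite act1 /= mxE].
  by apply: open_const; rewrite !lt_def r0' r0 r1 eq_sym r1'.
(* the lower edge *)
have arc (x : R) : - 2^-1 < x -> x < 2^-1 -> exists k' g (v : 'rV[R]_(kdim k')),
    [/\ (kdim k' < 2)%N, SL2Z g, open_cube v & spike x (arcy x) 0 = act g (std v)].
  move=> x1 x2; have hx : -2^-1 <= x <= 2^-1 by rewrite !ltW.
  have a0 := arcy_gt0 hx; have n1 := arcy_sq hx.
  have [x0|x0|->] := ltgtP x 0; last exact: ati.
    exists Arc, matS, (const_mx (- (2%:R * x))); split; [by []|exact: SL2Z_S| |].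
      by apply: open_const; apply/andP; split; lra.
    have e : - (2%:R * x) / 2%:R = - x by rewrite mulNr mulrAC divff ?pnatr_eq0 // mul1r.
    rewrite /= mxE e !spikeE // mul0r !addr0; congr inl.
    have aN : arcy (- x) = arcy x by rewrite /arcy sqrrN.
    by apply: upper_ext; rewrite ?(act_S _).1 ?(act_S _).2 aN !upt_Re ?upt_Im // ?sqrrN n1 divr1 ?opprK.
  exists Arc, 1, (const_mx (2%:R * x)); split; [by []|exact: SL2Z1| |].
    by apply: open_const; apply/andP; split; lra.
  have e : 2%:R * x / 2%:R = x by rewrite mulrAC divff ?pnatr_eq0 // mul1r.
  by rewrite act1 /= mxE e.
case: k u => u cu ou; try by case: ou; case.
- have /andP[s0 s1] := cu 0; have r01 := cu 1; have /andP[r0 r1] := r01; rewrite [std u]/=.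
  set s := u 0 0 in s0 s1 *; set r := u 0 1 in r0 r1 r01 *.
  have [rE|r1'] := eqVneq r 1; first by rewrite rE /spike ltxx; exact: atinf.
  have [sE|s1'] := eqVneq s 1.
    have -> : s - 2^-1 = 2^-1 by lra.
    exact: edge.
  have r1'' : r < 1 by rewrite lt_def eq_sym r1'.
  have [sE|s0'] := eqVneq s 0.
    have [k' [g [v [lt Sg ov e]]]] := edge r r01.
    exists k', (matT (-1) * g), v; split=> //; first exact: SL2ZM (SL2Z_T _) Sg.
    rewrite actM // -?e; last exact: SL2Z_T.
    have -> : s - 2^-1 = - 2^-1 by lra.
    have aN : arcy (- 2^-1) = arcy 2^-1 by rewrite /arcy sqrrN.
    have y0 : 0 < arcy 2^-1 + r / (1 - r).
      by have := arcy_gt0 half_itv1; have : 0 <= r / (1 - r); [rewrite divr_ge0 // subr_ge0|lra].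
    rewrite !spikeE // aN /=; congr inl.
    apply: upper_ext; rewrite ?(act_T _ _).1 ?(act_T _ _).2 ?upt_Re ?upt_Im //.
    by rewrite intrN mulr1z; lra.
  have [rE|r0'] := eqVneq r 0; first by rewrite rE; apply: arc; lra.
  case: ou => i; case: (ord2P i) => ->; rewrite -/s -/r !lt_def.
    by rewrite s0' s0 s1 eq_sym s1'.
  by rewrite r0' r0 r1 eq_sym r1'.
- have /andP[r0 r1] := cu 0; rewrite [std u]/=; set r := u 0 0 in r0 r1 *.
  have [->|r1'] := eqVneq r 1; first by rewrite /spike ltxx; exact: atinf.
  have [->|r0'] := eqVneq r 0; first exact: atrho.
  by case: ou => i; rewrite ord1 -/r !lt_def r0' r0 r1 eq_sym r1'.
- have /andP[r0 r1] := cu 0; rewrite [std u]/=; set r := u 0 0 in r0 r1 *.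
  have [->|r1'] := eqVneq r 1; first by rewrite mul1r; exact: atrho.
  have [->|r0'] := eqVneq r 0; first by rewrite mul0r; exact: ati.
  by case: ou => i; rewrite ord1 -/r !lt_def r0' r0 r1 eq_sym r1'.
Qed.

End Std.

(** * The cell decomposition of a modular curve *)

Local Open Scope quotient_scope.

(** Representatives of the right cosets of a subgroup K of SL(2,Z) *)
Record coset_system (K : set 'M[int]_2) (C : finType) := CosetSystem {
  rep : C -> 'M[int]_2;
  cls : 'M[int]_2 -> C;
  rep_SL : forall c, SL2Z (rep c);
  clsP : forall g h, SL2Z g -> SL2Z h -> cls g = cls h <-> K (g * h^-1);
  repK : forall c, cls (rep c) = c
}.

Section Cosets.
Variables (K : set 'M[int]_2) (C : finType) (E : coset_system K C).
Hypothesis K_SL : K `<=` SL2Z.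
Hypothesis K1 : K 1.
Hypothesis KM : forall g h, K g -> K h -> K (g * h).
Hypothesis KV : forall g, K g -> K g^-1.
Hypothesis KN : forall g, K g -> K (- g).
Local Notation rep := (rep E).
Local Notation cls := (cls E).
Implicit Types (g h : 'M[int]_2) (c : C).

Lemma SL2Z_mulK g h : SL2Z h -> g * h * h^-1 = g.
Proof. by move=> Sh; rewrite -mulrA mulrV ?mulr1 ?SL2Z_unit. Qed.

Lemma cls_mul g h : SL2Z g -> SL2Z h -> cls (rep (cls g) * h) = cls (g * h).
Proof.
move=> Sg Sh; have Sr := rep_SL E (cls g).
apply/(clsP E (SL2ZM Sr Sh) (SL2ZM Sg Sh)).
rewrite invrM ?SL2Z_unit // mulrA SL2Z_mulK //.
by apply/(clsP E Sr Sg); rewrite repK.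
Qed.

Lemma cls_K k g : K k -> SL2Z g -> cls (k * g) = cls g.
Proof.
move=> Kk Sg; apply/(clsP E _ Sg); first exact: SL2ZM (K_SL Kk) Sg.
by rewrite SL2Z_mulK.
Qed.

Lemma cls_N g : SL2Z g -> cls (- g) = cls g.
Proof.
move=> Sg; apply/(clsP E _ Sg); first exact: SL2ZN.
by rewrite mulNr mulrV ?SL2Z_unit //; exact: KN.
Qed.

Definition cmul h c : C := cls (rep c * h).

Lemma cmul_inj h : SL2Z h -> injective (cmul h).
Proof.
move=> Sh c d; rewrite /cmul => /(clsP E _ _) e.
have := e (SL2ZM (rep_SL E c) Sh) (SL2ZM (rep_SL E d) Sh).
rewrite invrM ?SL2Z_unit //; last exact: rep_SL.
rewrite mulrA SL2Z_mulK // => /(clsP E (rep_SL E c) (rep_SL E d)).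
by rewrite !repK.
Qed.

(** Right multiplication by h on the cosets *)
Definition cperm h (Sh : SL2Z h) : {perm C} := perm (cmul_inj Sh).

Lemma cpermE h (Sh : SL2Z h) c : cperm Sh c = cls (rep c * h).
Proof. by rewrite permE. Qed.

Lemma SL2ZX h n : SL2Z h -> SL2Z (h ^+ n).
Proof.
move=> Sh; elim: n => [|n IH]; first by rewrite expr0; exact: SL2Z1.
by rewrite exprS; exact: SL2ZM.
Qed.

Lemma cpermX h (Sh : SL2Z h) n c : (cperm Sh ^+ n)%g c = cls (rep c * h ^+ n).
Proof.
elim: n => [|n IH]; first by rewrite expg0 expr0 perm1 mulr1 repK.
have Sn := SL2ZX n Sh; have Sc := rep_SL E c.
by rewrite expgSr permM IH cpermE cls_mul ?exprSr ?mulrA //; exact: SL2ZM.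
Qed.

Section Cells.
Variable R : realType.

Definition mpi (p : xupper R) : modular_curve R K := \pi_({eq_quot (@orbit_rel R K)}) p.

Lemma mpi_eq p q : mpi p = mpi q <-> exists2 k, K k & act k p = q.
Proof.
have eqO : mpi p = mpi q <-> Korbit K p = Korbit K q.
  split=> [/eqmodP/asboolP //|e]; exact/eqmodP/asboolP.
split=> [/eqO e|[k Kk kE]]; last first.
  subst q; apply/eqO/seteqP; split=> _ [h Kh <-].
    exists (h * k^-1); first exact: KM Kh (KV Kk).
    by rewrite actM ?actVK //; [exact: K_SL|exact: K_SL|exact: SL2ZV (K_SL Kk)].
  by exists (h * k); [exact: KM|rewrite actM //; exact: K_SL].
have : Korbit K q q by exists 1 => //; rewrite act1.
by rewrite -e => -[k Kk kE]; exists k.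
Qed.

Lemma mpi_surj (x : modular_curve R K) : exists p, x = mpi p.
Proof. by exists (generic_quotient.repr x); rewrite /mpi reprK. Qed.

Lemma mpi_continuous : continuous mpi.
Proof. exact: pi_continuous. Qed.

Definition kperm (k : kind) : {perm C} := cperm (kgen_SL k).

Definition mcell_pred := [pred x : kind * {set C} | x.2 \in porbits (kperm x.1)].

Definition mcell : finType := {x : kind * {set C} | x \in mcell_pred}.

Definition mcell_kind (x : mcell) : kind := (val x).1.

Lemma mcell_repP (x : mcell) : exists c, (val x).2 == porbit (kperm (mcell_kind x)) c.
Proof. by have /imsetP[c _ cE] := valP x; exists c; apply/eqP. Qed.

Definition mcell_rep (x : mcell) : C := xchoose (mcell_repP x).

Definition mcell_map (x : mcell) (u : 'rV[R]_(kdim (mcell_kind x))) : modular_curve R K :=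
  mpi (act (rep (mcell_rep x)) (std u)).

(* The standard cell (k, c) does not depend on c within its orbit. *)
Lemma mpi_std_orbit k c d (u : 'rV[R]_(kdim k)) : d \in porbit (kperm k) c ->
  mpi (act (rep d) (std u)) = mpi (act (rep c) (std u)).
Proof.
case/porbitP => n ->; rewrite cpermX; have Sn := SL2ZX n (kgen_SL k).
have Sc := rep_SL E c.
have fx : act (kgen k ^+ n) (std u) = std u.
  elim: n {Sn} => [|n IH]; first by rewrite expr0 act1.
  by rewrite exprS actM ?IH ?kgen_fix //; [exact: kgen_SL|exact: SL2ZX (kgen_SL k)].
set g := rep c * _; have Sg : SL2Z g by exact: SL2ZM.
have Kg : K (rep (cls g) * g^-1).
  by apply/(clsP E (rep_SL E _) Sg); rewrite repK.
apply/esym/mpi_eq; exists (rep (cls g) * g^-1) => //.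
have -> : act (rep c) (std u) = act g (std u) by rewrite /g actM ?fx.
by rewrite -actM ?mulrVK ?SL2Z_unit //; exact: K_SL.
Qed.

Lemma std_same_cell k k' c d (u : 'rV[R]_(kdim k)) (v : 'rV[R]_(kdim k')) :
  open_cube u -> open_cube v ->
  mpi (act (rep c) (std u)) = mpi (act (rep d) (std v)) ->
  [/\ k = k', std u = std v & d \in porbit (kperm k) c].
Proof.
move=> ou ov /mpi_eq[h Kh e]; have Sh := K_SL Kh.
have Sc := rep_SL E c; have Sd := rep_SL E d.
pose g := (rep d)^-1 * (h * rep c).
have Sg : SL2Z g by exact: SL2ZM (SL2ZV Sd) (SL2ZM Sh Sc).
have ge : act g (std u) = std v.
  by rewrite actM ?[act (h * _) _]actM ?e ?actVK //; [exact: SL2ZV|exact: SL2ZM].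
have [kk sE st] := cells_uniq Sg ou ov ge; split=> //.
have cdg : cls (rep d * g) = c.
  by rewrite mulrA mulrV ?SL2Z_unit // mul1r cls_K // repK.
have pw x y f : SL2Z f -> cls (rep x * f) = y -> gen_pow (kgen k) f ->
    y \in porbit (kperm k) x.
  move=> Sf <- [n [->|->]]; apply/porbitP; exists n; rewrite cpermX // mulrN.
  by rewrite cls_N //; apply: SL2ZM (rep_SL E _) (SL2ZX _ (kgen_SL k)).
case: st => [s1|s1]; first by rewrite porbit_sym; exact: pw Sg cdg s1.
apply: (pw _ _ g^-1 (SL2ZV Sg) _ s1).
by rewrite -cdg cls_mul ?SL2Z_mulK ?repK //; [exact: SL2ZM|exact: SL2ZV].
Qed.

Lemma mcell_rep_in (x : mcell) : (val x).2 = porbit (kperm (mcell_kind x)) (mcell_rep x).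
Proof. exact/eqP/(xchooseP (mcell_repP x)). Qed.

Lemma mcell_of k c : (k, porbit (kperm k) c).2 \in porbits (kperm (k, porbit (kperm k) c).1).
Proof. exact: imset_f. Qed.

Definition Mcell k c : mcell := Sub (k, porbit (kperm k) c) (mcell_of k c).

Lemma Mcell_map k c (u : 'rV[R]_(kdim k)) :
  @mcell_map (Mcell k c) u = mpi (act (rep c) (std u)).
Proof.
rewrite /mcell_map; apply: mpi_std_orbit.
have := mcell_rep_in (Mcell k c); rewrite /= => ->.
by rewrite porbit_id.
Qed.

Lemma mcell_continuous x : {within @cube R (kdim (mcell_kind x)), continuous (@mcell_map x)}.
Proof.
rewrite /mcell_map; move: (mcell_kind x) => k.
set g := rep _; have Sg : SL2Z g by exact: rep_SL.
apply/subspace_continuousP => u Au.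
have h : @std R k x0 @[x0 --> within (@cube R (kdim k)) (nbhs u)] --> @std R k u.
  exact: ((subspace_continuousP _ _).1 (@std_continuous R k) u Au).
have h2 : {for (@std R k u), continuous (fun p => mpi (act g p))}.
  apply: (@continuous_comp _ _ _ (act g) mpi); first exact: act_continuous.
  exact: mpi_continuous.
exact: (cvg_comp _ _ h h2).
Qed.

Lemma mcell_onto p : exists x, exists2 u : 'rV[R]_(kdim (mcell_kind x)),
  open_cube u & mcell_map u = p.
Proof.
have [q ->] := mpi_surj p; have [g [k [u Sg [ou ->]]]] := cells_cover q.
exists (Mcell k (cls g)), u => //; rewrite Mcell_map; apply/mpi_eq.
have Sr := rep_SL E (cls g).
exists (g * (rep (cls g))^-1); first by apply/(clsP E Sg Sr); rewrite repK.
by rewrite -actM ?mulrVK ?SL2Z_unit //; exact: SL2ZM Sg (SL2ZV Sr).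
Qed.

Lemma mcell_inj x : {in @open_cube R (kdim (mcell_kind x)) &, injective (@mcell_map x)}.
Proof.
move=> u v; rewrite !inE => ou ov e.
by have [_ /std_inj -> //] := std_same_cell ou ov e.
Qed.

Lemma mcell_disjoint x y (u : 'rV[R]_(kdim (mcell_kind x))) (v : 'rV[R]_(kdim (mcell_kind y))) :
  open_cube u -> open_cube v -> mcell_map u = mcell_map v -> x = y.
Proof.
move=> ou ov e; have [kk _ cd] := std_same_cell ou ov e.
have ex := mcell_rep_in x; have ey := mcell_rep_in y.
apply: val_inj; rewrite [LHS]surjective_pairing [RHS]surjective_pairing.
congr (_, _); first exact: kk.
rewrite ex ey; move: cd; rewrite -kk => cd.
by apply/esym/eqP; rewrite eq_porbit_mem.
Qed.

Lemma mcell_boundary x (u : 'rV[R]_(kdim (mcell_kind x))) : @cube R _ u -> ~ open_cube u ->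
  exists y, [/\ (kdim (mcell_kind y) < kdim (mcell_kind x))%N &
    exists2 v : 'rV[R]_(kdim (mcell_kind y)), open_cube v & mcell_map u = mcell_map v].
Proof.
rewrite /mcell_map; move: (mcell_rep x) (mcell_kind x) u => c k u cu ou.
have [k' [g [v [lt Sg ov e]]]] := std_boundary cu ou.
exists (Mcell k' (cls (rep c * g))); split=> //; exists v => //.
have Sc := rep_SL E c; have Sgc := SL2ZM Sc Sg.
rewrite -/(mcell_map _) Mcell_map e -actM //; apply/mpi_eq.
have Sr := rep_SL E (cls (rep c * g)).
exists (rep (cls (rep c * g)) * (rep c * g)^-1).
  by apply/(clsP E Sr Sgc); rewrite repK.
by rewrite -actM ?mulrVK ?SL2Z_unit //; exact: SL2ZM Sr (SL2ZV Sgc).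
Qed.

Definition modular_cells : cell_decomposition R (modular_curve R K) :=
  CellDecomposition mcell_continuous mcell_onto mcell_inj mcell_disjoint mcell_boundary.

Lemma modular_euler : euler_char modular_cells =
  #|porbits (kperm Cusp)|%:Z + #|porbits (kperm PtI)|%:Z
   + #|porbits (kperm PtRho)|%:Z - #|C|%:Z.
Proof.
rewrite /euler_char /=.
transitivity (\sum_(x : mcell) (-1) ^+ kdim (val x).1 : int); first by [].
rewrite -(big_sub mcell_pred (fun x => (-1) ^+ kdim x.1)) /=.
rewrite (eq_bigl (fun x : kind * {set C} => true && (x.2 \in porbits (kperm x.1)))) //.
rewrite -(pair_big_dep xpredT (fun k o => o \in porbits (kperm k)) (fun k _ => (-1) ^+ kdim k)) /=.
rewrite big_kind !sumr_const /=.
have p1 k : kgen k = 1 -> #|porbits (kperm k)| = #|C|.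
  move=> k1; rewrite (_ : kperm k = 1%g); last first.
    by apply/permP => c; rewrite cpermE k1 mulr1 repK perm1.
  have fE : porbit (1%g : {perm C}) =1 finset.set1.
    move=> c; apply/finset.setP => d; apply/porbitP/finset.set1P => [[n ->]|->].
      by rewrite expg1n perm1.
    by exists 0%N; rewrite expg1n perm1.
  by rewrite /porbits (eq_imset _ fE) card_imset //; exact: finset.set1_inj.
rewrite (p1 Face) // (p1 Ray) // (p1 Arc) //= !(expr0, expr1) (_ : (-1) ^+ 2 = 1 :> int) // mulNrn !natz; ring.
Qed.

(** A genus zero modular curve has V - E + F = 2 for this decomposition. *)
Lemma genus0_euler : has_genus R (modular_curve R K) 0 ->
  (#|porbits (cperm SL2Z_S)| + #|porbits (cperm SL2Z_U)| +
   #|porbits (cperm (SL2ZM SL2Z_S SL2Z_U))| = #|C| + 2)%N.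
Proof.
case=> _ /(_ modular_cells); rewrite modular_euler mulr0 subr0 => e.
have irr g (S1 S2 : SL2Z g) : cperm S1 = cperm S2.
  by apply/permP => c; rewrite !cpermE.
have eI : kperm PtI = cperm SL2Z_S by exact: irr.
have eR : kperm PtRho = cperm SL2Z_U by exact: irr.
have eC : kperm Cusp = cperm (SL2ZM SL2Z_S SL2Z_U) by exact: irr.
move: e; rewrite eI eR eC.
move: #|C| #|porbits _| #|porbits _| #|porbits _| => n a b c; lia.
Qed.

End Cells.
End Cosets.

Local Close Scope quotient_scope.

(** * Words in the Burau group *)

Section Words.
Local Notation M2 := 'M[Laurent]_2.

Definition letter (b : bool) : M2 := if b then BX else BY.
Definition wmat (w : seq bool) : M2 := \prod_(b <- w) letter b.

Lemma wmat_cat v w : wmat (v ++ w) = wmat v * wmat w.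
Proof. by rewrite /wmat big_cat. Qed.

Lemma wmat_rcons w b : wmat (rcons w b) = wmat w * letter b.
Proof. by rewrite -cats1 wmat_cat /wmat big_seq1. Qed.

Lemma wmat_nil : wmat [::] = 1.
Proof. by rewrite /wmat big_nil. Qed.

Lemma wmat_cons b w : wmat (b :: w) = letter b * wmat w.
Proof. by rewrite /wmat big_cons. Qed.

Lemma tX_unit n : t ^+ n \is a GRing.unit.
Proof. by rewrite unitrX ?t_unit. Qed.

Lemma tXI n : injective ( *:%R (t ^+ n) : M2 -> M2).
Proof.
move=> a b e; rewrite -[a]scale1r -[b]scale1r -(mulVr (tX_unit n)) -!scalerA.
by rewrite e.
Qed.

Lemma BX3 : BX * BX * BX = t ^+ 3 *: 1.
Proof.
by apply: mx22P; rewrite [RHS]mxE one22E !mul22E !mx22E /=; ring.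
Qed.

Lemma BY2 : BY * BY = t ^+ 3 *: 1.
Proof.
by apply: mx22P; rewrite [RHS]mxE one22E !mul22E !mx22E /=; ring.
Qed.

Lemma Bu3_wmat w : Bu3 (wmat w).
Proof.
elim: w => [|b w IH]; last first.
  by rewrite wmat_cons; apply: Bu3_mul => //; case: b; [exact: Bu3_X|exact: Bu3_Y].
rewrite wmat_nil; have := Bu3_mul Bu3_X (Bu3_inv Bu3_X).
by rewrite mulrV // Bu3_unit //; exact: Bu3_X.
Qed.

Lemma Bu31 : Bu3 1.
Proof. by have := Bu3_wmat [::]; rewrite wmat_nil. Qed.

(* Equality up to a power of t *)
Definition teq (a b : M2) := exists n m, t ^+ n *: a = t ^+ m *: b.

Lemma teq_refl a : teq a a.
Proof. by exists 0, 0. Qed.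

Lemma teq_sym a b : teq a b -> teq b a.
Proof. by move=> [n [m e]]; exists m, n. Qed.

Lemma teq_trans b a c : teq a b -> teq b c -> teq a c.
Proof.
move=> [n [m e]] [k [l e']]; exists (k + n)%N, (m + l)%N.
by rewrite !exprD -!scalerA e scalerA mulrC -scalerA e' scalerA.
Qed.

Lemma teqM a b c d : teq a b -> teq c d -> teq (a * c) (b * d).
Proof.
move=> [n [m e]] [k [l e']]; exists (n + k)%N, (m + l)%N.
have h (x y : Laurent) (p q : M2) : (x * y) *: (p * q) = (x *: p) * (y *: q).
  by rewrite -scalerA scalerAr scalerAl.
by rewrite !exprD !h e e'.
Qed.

Lemma teq_t n a : teq (t ^+ n *: a) a.
Proof. by exists 0, n; rewrite expr0 scale1r. Qed.

Lemma teq_eq a b : a = b -> teq a b.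
Proof. by move=> ->; exact: teq_refl. Qed.

(** Every element of the Burau group is a word in X and Y up to a power of t. *)
Lemma Bu3_word b : Bu3 b -> exists w, teq b (wmat w).
Proof.
have gen c : exists w, teq (letter c)^-1 (wmat w).
  have uX : BX \is a GRing.unit := Bu3_unit Bu3_X.
  have uY : BY \is a GRing.unit := Bu3_unit Bu3_Y.
  case: c => /=; [exists [:: true; true]|exists [:: false]]; exists 3, 0.
    rewrite expr0 scale1r !wmat_cons wmat_nil mulr1 /= -[BX^-1]mul1r scalerAl -BX3.
    by rewrite mulrK.
  rewrite expr0 scale1r !wmat_cons wmat_nil mulr1 /= -[BY^-1]mul1r scalerAl -BY2.
  by rewrite mulrK.
have winv w : exists v, teq (wmat w)^-1 (wmat v).
  elim: w => [|c w [v e]].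
    by exists [::]; rewrite wmat_nil invr1; exact: teq_refl.
  have [x ex] := gen c; exists (v ++ x); rewrite wmat_cons wmat_cat invrM; first exact: teqM.
    by apply: Bu3_unit; case: c {ex}; [exact: Bu3_X|exact: Bu3_Y].
  exact: Bu3_unit (Bu3_wmat w).
elim=> [||| a c _ [v ev'] _ [w ew]|a ba [v [n [m e]]]].
- by exists [:: true]; rewrite wmat_cons wmat_nil mulr1; exact: teq_refl.
- by exists [:: false]; rewrite wmat_cons wmat_nil mulr1; exact: teq_refl.
- by exists [::]; exists 0, 1; rewrite wmat_nil expr0 scale1r expr1 -scalemx1.
- by exists (v ++ w); rewrite wmat_cat; exact: teqM.
- have [w ew] := winv v; exists w; apply: teq_trans ew; exists m, n.
  have ua := Bu3_unit ba; have uv := Bu3_unit (Bu3_wmat v).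
  apply: (mulrI uv); rewrite -!scalerAr mulrV //.
  by apply: (mulIr ua); rewrite -!scalerAl mulrVK // mul1r e.
Qed.

Definition LR (b : bool) : M2 := if b then BY * BX else BY * BX * BX.
Definition LRs (s : seq bool) : M2 := \prod_(b <- s) LR b.

Lemma LRs_rcons s b : LRs (rcons s b) = LRs s * LR b.
Proof. by rewrite /LRs -cats1 big_cat /= big_seq1. Qed.

(** The normal form for words: X^i (product of YX and YXX) Y^j *)
Lemma word_nf w : exists i s j, [/\ (i < 3)%N, (j < 2)%N & teq (wmat w) (BX ^+ i * LRs s * BY ^+ j)].
Proof.
elim/last_ind: w => [|w b [i [s [j [i3 j2 e]]]]].
  by exists 0%N, [::], 0%N; split=> //; rewrite wmat_nil /LRs big_nil !expr0 !mulr1; exact: teq_refl.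
have go c : teq (BX ^+ i * LRs s * BY ^+ j * letter b) c -> teq (wmat (rcons w b)) c.
  by apply: teq_trans; rewrite wmat_rcons; apply: teqM => //; exact: teq_refl.
case: b go => go; last first.
  case: j j2 e go => [|[|//]] _ _ go.
    exists i, s, 1%N; split=> //; apply/go/teq_eq; by rewrite expr0 mulr1 expr1.
  exists i, s, 0%N; split=> //; apply: go; rewrite expr1 expr0 mulr1 /= -mulrA BY2.
  by rewrite -scalerAr mulr1; exact: teq_t.
case: j j2 e go => [|[|//]] _ _ go; last first.
  exists i, (rcons s true), 0%N; split=> //; apply/go/teq_eq.
  by rewrite LRs_rcons expr0 expr1 mulr1 /= !mulrA.
case/lastP: s go => [|s []] go.
- case: i i3 go => [|[|[|//]]] _ go.
  + exists 1%N, [::], 0%N; split=> //; apply/go/teq_eq.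
    by rewrite /LRs big_nil /= !expr0 !mulr1 mul1r expr1.
  + exists 2, [::], 0%N; split=> //; apply/go/teq_eq.
    by rewrite /LRs big_nil /= !expr0 !mulr1 expr1 expr2.
  + exists 0%N, [::], 0%N; split=> //; apply: go.
    rewrite /LRs big_nil /= !expr0 !mulr1 expr2 BX3; exact: teq_t.
- exists i, (rcons s false), 0%N; split=> //; apply/go/teq_eq.
  by rewrite !LRs_rcons /= !mulr1 !mulrA.
- exists i, s, 1%N; split=> //; apply: go.
  have -> : BX ^+ i * LRs (rcons s false) * BY ^+ 0 * letter true =
      BX ^+ i * LRs s * BY * (BX * BX * BX).
    by rewrite LRs_rcons expr0 mulr1 /= !mulrA.
  rewrite BX3 -scalerAr mulr1 expr1; exact: teq_t.
Qed.

Lemma ev_scale n (a : M2) : map_mx ev (t ^+ n *: a) = (-1) ^+ n *: map_mx ev a.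
Proof.
by apply/matrixP => i j; rewrite !mxE (rmorphM ev) (rmorphXn ev) /= ev_t.
Qed.

Lemma ev_mul (a b : M2) : map_mx ev (a * b) = map_mx ev a * map_mx ev b.
Proof. exact: map_mxM. Qed.

Lemma upto_sym (g h : 'M[int]_2) : upto_sign g h -> upto_sign h g.
Proof. by case=> ->; [left|right]; rewrite ?opprK. Qed.

Lemma upto_trans (g h k : 'M[int]_2) : upto_sign g h -> upto_sign h k -> upto_sign g k.
Proof. by case=> -> [] ->; [left|right|right|left]; rewrite ?opprK. Qed.

Lemma uptoM (g h g' h' : 'M[int]_2) : upto_sign g h -> upto_sign g' h' ->
  upto_sign (g * g') (h * h').
Proof.
by case=> -> [] ->; [left|right|right|left]; rewrite ?mulrN ?mulNr ?opprK.
Qed.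

Lemma upto_refl (g : 'M[int]_2) : upto_sign g g.
Proof. by left. Qed.

Lemma upto_sgn n (g : 'M[int]_2) : upto_sign ((-1) ^+ n *: g) g.
Proof.
rewrite -signr_odd; case: odd; first by right; rewrite expr1 scaleN1r.
by left; rewrite expr0 scale1r.
Qed.

Lemma teq_ev (a b : M2) : teq a b -> upto_sign (map_mx ev a) (map_mx ev b).
Proof.
move=> [n [m e]]; apply: upto_trans (upto_sgn m _); apply: upto_trans (upto_sym (upto_sgn n _)) _.
by left; rewrite -!ev_scale e.
Qed.

(* Products of the matrices -ev(YX), -ev(YXX) are positive up to conjugation
   by diag(1,-1). *)
Lemma LRs_pos s : exists g : 'M[int]_2, [/\ upto_sign (map_mx ev (LRs s)) g,
  [/\ 1 <= g 0 0, 1 <= g 1 1, g 0 1 <= 0 & g 1 0 <= 0] &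
  s != [::] -> g 0 1 + g 1 0 < 0].
Proof.
elim/last_ind: s => [|s b [g [e [a d p q] pq]]].
  exists 1; split; rewrite ?one22E //.
  by left; rewrite /LRs big_nil; exact: map_mx1.
pose h : 'M[int]_2 := if b then mx22 1 (-1) 0 1 else mx22 1 0 (-1) 1.
exists (g * h); split.
- rewrite LRs_rcons ev_mul; apply: uptoM => //; right; rewrite /h.
  by case: b {h}; rewrite /LR !ev_mul -/matS -/matU ev_BX ev_BY;
    apply: mx22P; rewrite [RHS]mxE !mul22E !mx22E.
- by rewrite !mul22E /h; case: b {h} => /=; rewrite !mx22E; split; lia.
- by move=> _; rewrite !mul22E /h; case: b {h} => /=; rewrite !mx22E; lia.
Qed.

(** The projection of the Burau group to PSL(2,Z) has kernel generated by t. *)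
Lemma ev_kernel b : Bu3 b -> upto_sign (map_mx ev b) 1 -> teq b 1.
Proof.
move=> Bb b1; have [w bw] := Bu3_word Bb.
have [i [s [j [i3 j2 e]]]] := word_nf w.
apply: (teq_trans bw); apply: (teq_trans e).
have {b1} : upto_sign (map_mx ev (BX ^+ i * LRs s * BY ^+ j)) 1.
  apply: (upto_trans _ b1); apply: (upto_trans _ (upto_sym (teq_ev bw))).
  exact: upto_sym (teq_ev e).
have [g [sg [a d p q] pq]] := LRs_pos s.
have evX n (c : M2) : map_mx ev (c ^+ n) = map_mx ev c ^+ n.
  by elim: n => [|n IH]; [rewrite !expr0; exact: map_mx1|rewrite !exprS ev_mul IH].
rewrite !ev_mul !evX -/matU -/matS => h.
have {h} : upto_sign (matU ^+ i * g * matS ^+ j) 1.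
  apply: upto_trans h; apply: uptoM (upto_refl _); apply: uptoM (upto_refl _) _.
  exact: upto_sym.
have ent k : upto_sign k 1 -> @eq int (k 0 1) 0 /\ @eq int (k 1 0) 0.
  by case=> ->; rewrite ?mxE ?one22E.
move/ent; clear e; case: i i3 => [|[|[|//]]] _; case: j j2 => [|[|//]] _;
  rewrite ?expr0 ?mulr1 ?mul1r ?expr1 ?expr2 ?mul22E ?ev_BX ?ev_BY ?mul22E ?mx22E => -[h1 h2];
  rewrite ?(mul0r, mulr0, mul1r, mulr1, addr0, add0r, mulN1r, mulrN1, opprD, opprK) in h1 h2;
  try (exfalso; move: h1 h2 a d p q; clear; move: (g 0 0) (g 0 1) (g 1 0) (g 1 1) => x y z v; lia).
have -> : s = [::] by apply/eqP; apply/negPn/negP => /pq; lia.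
by rewrite /LRs big_nil; exact: teq_refl.
Qed.

Lemma ev_wmat w : SL2Z (map_mx ev (wmat w)).
Proof.
elim: w => [|b w IH]; first by rewrite wmat_nil [map_mx _ _]map_mx1; exact: SL2Z1.
rewrite wmat_cons ev_mul; apply: SL2ZM => //.
by case: b; [exact: SL2Z_U|exact: SL2Z_S].
Qed.

Lemma ev_Bu3 b : Bu3 b -> SL2Z (map_mx ev b).
Proof.
move=> /Bu3_word[w /teq_ev[->|->]]; first exact: ev_wmat.
exact/SL2ZN/ev_wmat.
Qed.

(** X and Y generate PSL(2,Z) *)
Lemma SL2Z_gen g : SL2Z g -> exists w, upto_sign g (map_mx ev (wmat w)).
Proof.
pose P g := exists w, upto_sign g (map_mx ev (wmat w)).
have PM g1 g2 : P g1 -> P g2 -> P (g1 * g2).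
  by move=> [v e] [w f]; exists (v ++ w); rewrite wmat_cat ev_mul; exact: uptoM.
have PN g1 g2 : upto_sign g1 g2 -> P g2 -> P g1.
  by move=> e [w f]; exists w; exact: upto_trans e f.
have PS : P matS by exists [:: false]; rewrite wmat_cons wmat_nil mulr1; left.
have PU : P matU by exists [:: true]; rewrite wmat_cons wmat_nil mulr1; left.
have P1 : P 1 by exists [::]; rewrite wmat_nil [map_mx _ _]map_mx1; left.
have PT1 : P (matT (-1)).
  by apply: (PN _ (matS * matU)); [right|exact: PM]; rewrite ev_BX ev_BY; apply: mx22P; rewrite [RHS]mxE mul22E !mx22E.
have PT2 : P (matT 1).
  apply: (PN _ (matU * matU * matS)); last exact: PM (PM _ _ PU PU) PS.
  by right; rewrite ev_BX ev_BY; apply: mx22P; rewrite [RHS]mxE !mul22E !mx22E.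
have TD m n : matT (m + n) = matT m * matT n.
  by apply: mx22P; rewrite !mul22E !mx22E; ring.
have PT n : P (matT n).
  case: n => n; elim: n => [|n IH].
  - by apply: (PN _ 1) => //; left; apply: mx22P; rewrite one22E mx22E.
  - by rewrite intS TD; exact: PM.
  - exact: PT1.
  - by rewrite (_ : Negz n.+1 = -1 + Negz n) ?TD; [exact: PM|lia].
have [m] := ubnP (absz (g 1%R 0%R)); elim: m g => // m IH g lt Sg.
have [c0|c0] := eqVneq (g 1 0) 0.
  have [|n e] := @cusp_stab g Sg; first by rewrite /= c0.
  exact: PN e (PT n).
pose n : int := - (g 0%R 0%R %/ g 1%R 0%R)%Z.
pose h := matS * (matT n * g).
have Sh : SL2Z h by exact: SL2ZM SL2Z_S (SL2ZM (SL2Z_T n) Sg).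
have [|w e] := IH h _ Sh.
  have -> : h 1 0 = - (g 0%R 0%R %% g 1%R 0%R)%Z.
    rewrite /h !mul22E ev_BY !mx22E {1}(divz_eq (g 0 0) (g 1 0)) /n; ring.
  rewrite abszN; apply: leq_trans (_ : (absz (g 1%R 0%R) <= m)%N) => //.
  by have := ltz_mod (g 0 0) c0; have := modz_ge0 (g 0 0) c0; lia.
apply: (PN _ (matT (- n) * (matS * h))); last by apply: (PM _ _ (PT _)); apply: (PM _ _ PS); exists w.
right; rewrite /h [matS * _]mulrA.
have -> : matS * matS = -1 by rewrite ev_BY; apply: mx22P; rewrite [RHS]mxE one22E mul22E !mx22E.
rewrite mulN1r mulrN opprK mulrA -TD addNr.
by rewrite (_ : matT 0 = 1) ?mul1r //; apply: mx22P; rewrite one22E mx22E.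
Qed.

End Words.

(** * Cosets and their labels *)

Section Cimage.
Variable H : set 'M[Laurent]_2.
Hypothesis Hsub : is_subgroup H.
Local Notation K := (cimage H).
Implicit Types g h k : 'M[int]_2.

Lemma H_Bu3 b : H b -> Bu3 b. Proof. by case: Hsub => h _ _ _ /h. Qed.

Lemma cimageP g : K g <-> exists2 h, H h & upto_sign g (map_mx ev h).
Proof. by split=> -[h Hh e]; exists h. Qed.

Lemma cimage_SL : K `<=` SL2Z.
Proof.
move=> g [h /H_Bu3/ev_Bu3 Sh [->|->]] //; exact: SL2ZN.
Qed.

Lemma cimage1 : K 1.
Proof. by case: Hsub => _ h1 _ _; exists 1 => //; left; rewrite [RHS]map_mx1. Qed.

Lemma cimageM g h : K g -> K h -> K (g * h).
Proof.
case: Hsub => _ _ HM _ /cimageP[a Ha ga] /cimageP[b Hb hb]; apply/cimageP.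
by exists (a * b); [exact: HM|rewrite ev_mul; exact: uptoM].
Qed.

Lemma ev_inv (b : 'M[Laurent]_2) : Bu3 b -> map_mx ev b^-1 = (map_mx ev b)^-1.
Proof.
move=> Bb; have ub := Bu3_unit Bb; have Sb := SL2Z_unit (ev_Bu3 Bb).
apply: (mulrI Sb); rewrite -ev_mul !mulrV //; exact: map_mx1.
Qed.

Lemma cimageV g : K g -> K g^-1.
Proof.
case: Hsub => _ _ _ HV /cimageP[a Ha ga]; apply/cimageP; exists a^-1; first exact: HV.
have Ba := H_Bu3 Ha; rewrite (ev_inv Ba).
by case: ga => ->; [left|right]; rewrite ?invrN.
Qed.

Lemma cimageN g : K g -> K (- g).
Proof.
move=> [a Ha ga]; exists a => //; case: ga => ->; [by right|by left; rewrite opprK].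
Qed.

(* The index of the first listed matrix in the coset of g *)
Definition coset_index (s : seq 'M[int]_2) (g : 'M[int]_2) : 'I_(size s).+1 :=
  inord (find (fun r => `[< SL2Z r /\ K (g * r^-1) >]) s).

Lemma cimage_cosets : finite_index H ->
  exists C : finType, inhabited (coset_system K C).
Proof.
move=> [s0 hs]; pose s := [seq map_mx ev r | r <- s0].
have fs g : SL2Z g -> exists2 r, r \in s & SL2Z r /\ K (g * r^-1).
  move=> Sg; have [w gw] := SL2Z_gen Sg.
  have [h [r [Hh rs e]]] := hs _ (Bu3_wmat w).
  have Bh := H_Bu3 Hh.
  have Br : Bu3 r.
    have -> : r = h^-1 * wmat w by rewrite e mulrA mulVr ?mul1r ?Bu3_unit.
    exact: Bu3_mul (Bu3_inv Bh) (Bu3_wmat w).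
  exists (map_mx ev r); first exact: map_f.
  split; first exact: ev_Bu3.
  apply/cimageP; exists h => //.
  have -> : map_mx ev h = map_mx ev (wmat w) * (map_mx ev r)^-1.
    by rewrite e ev_mul mulrK // SL2Z_unit //; exact: ev_Bu3.
  by apply: uptoM => //; left.
pose P g := (fun r => `[< SL2Z r /\ K (g * r^-1) >]).
have fP g : SL2Z g -> has (P g) s.
  by move=> /fs[r rs h]; apply/hasP; exists r => //; apply/asboolP.
have cE g h : SL2Z g -> SL2Z h -> coset_index s g = coset_index s h <-> K (g * h^-1).
  move=> Sg Sh; split=> [e|Kgh].
    have e' : find (P g) s = find (P h) s.
      by have := congr1 val e; rewrite /= !inordK // ltnS find_size.
    have /asboolP[Sr Kg] := nth_find 0 (fP g Sg).
    have /asboolP[_ Kh] := nth_find 0 (fP h Sh).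
    rewrite e' in Sr Kg; set r := nth _ _ _ in Sr Kg Kh.
    have := cimageM Kg (cimageV Kh).
    by rewrite invrM ?invrK ?unitrV ?SL2Z_unit // mulrA mulrVK ?SL2Z_unit.
  congr inord; apply: eq_find => r; apply/asboolP/asboolP => -[Sr h'];
    split=> //.
    have := cimageM (cimageV Kgh) h'.
    by rewrite invrM ?invrK ?unitrV ?SL2Z_unit // mulrA mulrVK ?SL2Z_unit.
  have := cimageM Kgh h'; by rewrite mulrA mulrVK ?SL2Z_unit.
pose Q (i : 'I_(size s).+1) := `[< exists2 g, SL2Z g & coset_index s g = i >].
have Q1 : Q (coset_index s 1) by apply/asboolP; exists 1 => //; exact: SL2Z1.
pose C : finType := {i | Q i}.
pose c1 : C := Sub (coset_index s 1) Q1.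
have Qex (c : C) : exists g, SL2Z g /\ coset_index s g = val c.
  by have /asboolP[g Sg e] := valP c; exists g.
pose rp (c : C) := sval (cid (Qex c)).
have rpP c : SL2Z (rp c) /\ coset_index s (rp c) = val c := svalP (cid (Qex c)).
pose cl g : C := insubd c1 (coset_index s g).
have clE g : SL2Z g -> val (cl g) = coset_index s g.
  by move=> Sg; rewrite val_insubd ifT //; apply/asboolP; exists g.
exists C; constructor; apply: (@CosetSystem K C rp cl) => [c|g h Sg Sh|c].
- exact: (rpP c).1.
- rewrite -cE // -!clE //; split=> [->//|]; exact: val_inj.
- by apply: val_inj; rewrite clE ?(rpP c).2 //; exact: (rpP c).1.
Qed.

End Cimage.

Section Counting.
Variables (C : finType) (T : eqType) (pr : C -> T) (s : seq T).
Hypothesis us : uniq s.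
Hypothesis prs : forall c, pr c \in s.

Lemma sum_fibers (w : T -> nat) :
  (\sum_c w (pr c) = \sum_(i <- s) #|[pred c | pr c == i]| * w i)%N.
Proof.
transitivity (\sum_c \sum_(i <- s | pr c == i) w i)%N.
  apply: eq_bigr => c _; rewrite big_mkcond (bigD1_seq (pr c)) ?prs //=.
  rewrite eqxx big1 ?addn0 // => i.
  by rewrite eq_sym => /negPf ->.
rewrite (exchange_big_dep xpredT) //=; apply: eq_bigr => i _.
by rewrite sum_nat_const.
Qed.

(* The cycles of a permutation lying over f are at least as long as those of f. *)
Lemma porbits_bound (p : {perm C}) (f : T -> T) (l : T -> nat) (D : nat) :
  (forall c, pr (p c) = f (pr c)) ->
  (forall i, i \in s -> [/\ 0 < l i, l i %| D &
     forall k, 0 < k < l i -> iter k f i != i])%N ->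
  (D * #|porbits p| <= \sum_c D %/ l (pr c))%N.
Proof.
move=> pf hl.
have lo c : (l (pr c) <= #|porbit p c|)%N.
  have [_ _ h] := hl _ (prs c); rewrite leqNgt; apply/negP => lt.
  have /h : (0 < #|porbit p c| < l (pr c))%N.
    by rewrite lt andbT; apply/card_gt0P; exists c; exact: porbit_id.
  have it k : iter k f (pr c) = pr (iter k p c).
    by elim: k => //= k ->; rewrite pf.
  by rewrite it iter_porbit eqxx.
rewrite (partition_big (porbit p) (fun o => o \in porbits p)) /=; last first.
  by move=> c _; exact: imset_f.
rewrite mulnC -sum_nat_const; apply: leq_sum => o /imsetP[d _ ->].
have op : (0 < #|porbit p d|)%N by apply/card_gt0P; exists d; exact: porbit_id.
rewrite -(leq_pmul2l op) big_distrr /=.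
apply: (@leq_trans (\sum_(c | porbit p c == porbit p d) D)).
  rewrite (eq_bigl (fun c => c \in porbit p d)) ?sum_nat_const //.
  by move=> c; rewrite eq_porbit_mem porbit_sym.
apply: leq_sum => c /eqP <-; have [l0 /dvdnP[q ->] _] := hl _ (prs c).
by rewrite mulnK // mulnC leq_mul2r lo orbT.
Qed.

End Counting.

Section Labels.
Variable H : set 'M[Laurent]_2.
Hypothesis Hsub : is_subgroup H.
Variables (C : finType) (E : coset_system (cimage H) C).
Local Notation K := (cimage H).

Section Labelling.
Variables (T : Type) (lab : seq bool -> T) (fx fy : T -> T).

(** Equivariant labels of the cosets of H, invariant under t *)
Record labelling := Labelling {
  lab_inv : forall w v a b h, H h -> t ^+ a *: wmat w = t ^+ b *: (h * wmat v) ->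
    lab w = lab v;
  lab_X : forall w, lab (rcons w true) = fx (lab w);
  lab_Y : forall w, lab (rcons w false) = fy (lab w)
}.
Hypothesis L : labelling.

Lemma rep_wordP (c : C) : exists w, upto_sign (rep E c) (map_mx ev (wmat w)).
Proof. exact: SL2Z_gen (rep_SL E c). Qed.

Definition coset_lab (c : C) : T := lab (sval (cid (rep_wordP c))).

Lemma coset_labE c w : K (rep E c * (map_mx ev (wmat w))^-1) -> coset_lab c = lab w.
Proof.
move=> /(cimageP _ _)[h Hh e]; rewrite /coset_lab.
case: cid => v /= ve; have Sw := ev_wmat w; have Sv := ev_wmat v.
have Bh := H_Bu3 Hsub Hh.
have {e} : upto_sign (map_mx ev (wmat v)) (map_mx ev (h * wmat w)).
  apply: (upto_trans (upto_sym ve)); rewrite ev_mul.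
  by have := uptoM e (upto_refl (map_mx ev (wmat w))); rewrite mulrVK ?SL2Z_unit.
move=> e.
have Bv := Bu3_wmat v; have Bw := Bu3_wmat w; have Bhw := Bu3_mul Bh Bw.
have [n [m q]] : teq (wmat v * (h * wmat w)^-1) 1.
  apply: ev_kernel; first exact: Bu3_mul Bv (Bu3_inv Bhw).
  rewrite ev_mul ev_inv //; have uS := SL2Z_unit (ev_Bu3 Bhw).
  by case: e => ->; [left|right]; rewrite ?mulNr mulrV.
apply: (lab_inv L (a := n) (b := m) Hh).
have := congr1 (fun z => z * (h * wmat w)) q.
by rewrite -!scalerAl mul1r mulrVK ?Bu3_unit.
Qed.

Lemma coset_lab_word c w : upto_sign (rep E c) (map_mx ev (wmat w)) -> coset_lab c = lab w.
Proof.
move=> e; apply: coset_labE; have uw := SL2Z_unit (ev_wmat w).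
have K1 := cimage1 Hsub.
case: e => ->; rewrite ?mulNr mulrV //; exact: cimageN.
Qed.

Lemma coset_lab_mul c b : coset_lab (cls E (rep E c * map_mx ev (letter b))) =
  (if b then fx else fy) (coset_lab c).
Proof.
have [w wE] := rep_wordP c; rewrite (coset_lab_word wE).
have Sb : SL2Z (map_mx ev (letter b)) by case: b; [exact: SL2Z_U|exact: SL2Z_S].
have Sc := SL2ZM (rep_SL E c) Sb.
transitivity (lab (rcons w b)); last by case: b {Sb Sc}; [exact: lab_X|exact: lab_Y].
apply: coset_labE; set g := cls E _.
have Kg : K (rep E g * (rep E c * map_mx ev (letter b))^-1).
  by apply/(clsP E (rep_SL E _) Sc); rewrite repK.
have Sw := ev_wmat w.
case: wE => wE; rewrite wmat_rcons ev_mul.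
  by rewrite -wE.
by rewrite -[map_mx ev (wmat w)]opprK -wE mulNr invrN mulrN; exact: cimageN.
Qed.

Lemma coset_lab_U c : coset_lab (cperm E SL2Z_U c) = fx (coset_lab c).
Proof. by rewrite cpermE -(coset_lab_mul c true). Qed.

Lemma coset_lab_S c : coset_lab (cperm E SL2Z_S c) = fy (coset_lab c).
Proof. by rewrite cpermE -(coset_lab_mul c false). Qed.

Lemma cperm_SU c : cperm E (SL2ZM SL2Z_S SL2Z_U) c = cperm E SL2Z_U (cperm E SL2Z_S c).
Proof.
by rewrite !cpermE (cls_mul E (SL2ZM (rep_SL E c) SL2Z_S) SL2Z_U) mulrA.
Qed.

End Labelling.

(** The Euler characteristic is bounded by that of the set of labels. The cycles
    of labels lying over a cycle of the base all have the same length. *)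
Section Bound.
Variables (T Q : eqType) (lab : seq bool -> T * Q) (fx fy : T * Q -> T * Q).
Hypothesis L : labelling lab fx fy.
Variables (gx gy : T -> T) (s : seq T).
Hypotheses (us : uniq s) (lab_in : forall w, (lab w).1 \in s).
Hypotheses (fxE : forall b, (fx b).1 = gx b.1) (fyE : forall b, (fy b).1 = gy b.1).
Hypotheses (gx3 : {in s, forall i, gx (gx (gx i)) = i})
  (gy2 : {in s, forall i, gy (gy i) = i}).
Hypothesis lab_conn : forall P : T -> Prop, P (lab [::]).1 ->
  (forall i, i \in s -> P i -> P (gx i) /\ P (gy i)) -> forall i, i \in s -> P i.

Let base (c : C) := (coset_lab lab c).1.

Lemma base_in c : base c \in s.
Proof. exact: lab_in. Qed.

Lemma base_X c : base (cperm E SL2Z_U c) = gx (base c).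
Proof. by rewrite /base (coset_lab_U L) fxE. Qed.

Lemma base_Y c : base (cperm E SL2Z_S c) = gy (base c).
Proof. by rewrite /base (coset_lab_S L) fyE. Qed.

(* All fibers have the same size. *)
Lemma fiber_card i : i \in s ->
  #|[pred c | base c == i]| = #|[pred c | base c == (lab [::]).1]|.
Proof.
pose n i := #|[pred c | base c == i]|.
have le (p : {perm C}) (f : T -> T) j : (forall c, base (p c) = f (base c)) ->
    (n j <= n (f j))%N.
  move=> pf; rewrite /n -(card_imset _ (@perm_inj _ p)); apply: subset_leq_card.
  by apply/fintype.subsetP => _ /imsetP[c /eqP cj ->]; rewrite inE pf cj.
have leX j := le _ _ j base_X; have leY j := le _ _ j base_Y.
move: i; apply: lab_conn => // i si ni; split; rewrite -[RHS]ni; apply/eqP;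
  rewrite eqn_leq ?leX ?leY ?andbT.
  by rewrite -{2}(gx3 si); exact: leq_trans (leX _) (leX _).
by rewrite -{2}(gy2 si); exact: leY.
Qed.

Definition lengths (f : T * Q -> T * Q) (l : T -> nat) (D : nat) :=
  forall i q, i \in s -> [/\ 0 < l i, l i %| D &
    forall k, 0 < k < l i -> iter k f (i, q) != (i, q)]%N.

Lemma label_bound (lX lY lP : T -> nat) (D : nat) : (0 < D)%N ->
  lengths fx lX D -> lengths fy lY D -> lengths (fx \o fy) lP D ->
  (\sum_(i <- s) (D %/ lX i + D %/ lY i + D %/ lP i) <= D * size s)%N ->
  (#|porbits (cperm E SL2Z_S)| + #|porbits (cperm E SL2Z_U)| +
   #|porbits (cperm E (SL2ZM SL2Z_S SL2Z_U))| <= #|C|)%N.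
Proof.
move=> D0 hX hY hP hs.
have bound (p : {perm C}) f l : (forall c, coset_lab lab (p c) = f (coset_lab lab c)) ->
    lengths f l D -> (D * #|porbits p| <= \sum_c D %/ l (base c))%N.
  move=> pf hl.
  have cin c : coset_lab lab c \in undup (codom (coset_lab lab)).
    by rewrite mem_undup codom_f.
  apply: (porbits_bound cin pf (l := fun b => l b.1)) => b.
  rewrite mem_undup => /codomP[c ->].
  have := hl (base c) (coset_lab lab c).2 (base_in c).
  by rewrite /base; case: (coset_lab lab c).
have bX := bound _ _ _ (coset_lab_U L) hX.
have bY := bound _ _ _ (coset_lab_S L) hY.
have cP c : coset_lab lab (cperm E (SL2ZM SL2Z_S SL2Z_U) c) = (fx \o fy) (coset_lab lab c).
  by rewrite cperm_SU (coset_lab_U L) (coset_lab_S L).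
have bP := bound _ _ _ cP hP.
rewrite -(leq_pmul2l D0) !mulnDr.
apply: leq_trans (_ : \sum_c (D %/ lY (base c) + D %/ lX (base c) + D %/ lP (base c)) <= _)%N.
  by rewrite !big_split /= !leq_add.
pose w i := (D %/ lY i + D %/ lX i + D %/ lP i)%N.
rewrite (sum_fibers us base_in w) big_seq.
rewrite (eq_bigr (fun i => #|[pred c | base c == (lab [::]).1]| * w i)%N); last first.
  by move=> i si; rewrite fiber_card.
rewrite -big_seq -big_distrr /=.
have -> : #|C| = (#|[pred c | base c == (lab [::]).1]| * size s)%N.
  have := sum_fibers us base_in (fun=> 1%N); rewrite sum1_card big_seq.
  rewrite (eq_bigr (fun i => #|[pred c | base c == (lab [::]).1]|)); last first.
    by move=> i si; rewrite fiber_card // muln1.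
  by rewrite -big_seq big_const_seq count_predT iter_addn_0.
rewrite mulnCA leq_mul2l; apply/orP; right; apply: leq_trans hs.
by apply: leq_sum => i _; rewrite /w [(D %/ lY i + _)%N]addnC.
Qed.

End Bound.

End Labels.

(** * Integers in binary, for computing *)

Section ZtoRing.
Variable S : pzRingType.

Definition zr (z : Z) : S := (int_of_Z z)%:~R.

Lemma zrD a b : zr (Z.add a b) = zr a + zr b.
Proof. by rewrite /zr -rmorphD /= -(rmorphD int_of_Z). Qed.
Lemma zrM a b : zr (Z.mul a b) = zr a * zr b.
Proof. by rewrite /zr -rmorphM /= -(rmorphM int_of_Z). Qed.
Lemma zrN a : zr (Z.opp a) = - zr a.
Proof. by rewrite /zr -rmorphN /= -(rmorphN int_of_Z). Qed.
Lemma zrB a b : zr (Z.sub a b) = zr a - zr b.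
Proof. by rewrite -Z.add_opp_r zrD zrN. Qed.
Lemma zr0 : zr Z0 = 0. Proof. by []. Qed.
Lemma zr1 : zr 1%bZ = 1. Proof. by []. Qed.
Lemma zrn n : zr (Z.of_nat n) = n%:R.
Proof. by rewrite /zr (_ : Z.of_nat n = Z_of_int n) // Z_of_intK pmulrn. Qed.
End ZtoRing.

Section Modp.
Variable p : nat.
Hypothesis pp : prime p.
Local Notation Zp := (Z.of_nat p).

Lemma Zp_gt0 : (0 < Zp)%bZ. Proof. by have := prime_gt0 pp; lia. Qed.

Lemma zr_p : zr 'F_p Zp = 0.
Proof. by rewrite zrn; apply/eqP; rewrite -(dvdn_pcharf (pchar_Fp pp)). Qed.

Lemma zr_mod a : zr 'F_p (Z.modulo a Zp) = zr 'F_p a.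
Proof.
rewrite [in RHS](Z.div_mod a Zp); last by have := Zp_gt0; lia.
by rewrite zrD zrM zr_p mul0r add0r.
Qed.

(* The representative in [0, p) *)
Definition zv (x : 'F_p) : Z := Z.of_nat (val x).

Lemma zr_zv x : zr _ (zv x) = x.
Proof. by rewrite /zv zrn natr_Zp. Qed.

Lemma zv_bound x : (0 <= zv x < Zp)%bZ.
Proof.
have : (val x < p)%N by rewrite -[X in (_ < X)%N](Fp_cast pp) ltn_ord.
by rewrite /zv; move: (val x) => y; lia.
Qed.

Lemma zvE x a : zr _ a = x -> zv x = Z.modulo a Zp.
Proof.
move=> <-; rewrite -zr_mod; set b := Z.modulo a Zp.
have hb : (0 <= b < Zp)%bZ by apply: Z.mod_pos_bound; exact: Zp_gt0.
rewrite -(Z2Nat.id b) ?zrn; last by case: hb.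
rewrite /zv; congr Z.of_nat; rewrite [LHS](val_Fp_nat pp) modn_small //; lia.
Qed.

Lemma zr_eq0 a : (zr 'F_p a == 0) = (Z.modulo a Zp == Z0).
Proof.
apply/eqP/eqP => [/zvE <-|h]; first by [].
by rewrite -zr_mod h.
Qed.

End Modp.

(** * Affine labels *)

(* A label consists of a vertex i, a second coordinate in [0, p) and an element
   of F_p; the entry (j, (c, (a, b))) of the table for a letter at i sends the
   label ((i, s), q) to ((j, s + c), q + s a + b). *)
Section Affine.
Variable p : nat.
Hypothesis pp : prime p.
Local Notation Zp := (Z.of_nat p).
Definition base := (nat * Z)%type.
Definition entry := (nat * (Z * (Z * Z)))%type.
Variable tab : seq (entry * entry).

Definition ent (x : bool) (i : nat) : entry :=
  let e := nth ((0%N, (Z0, (Z0, Z0))), (0%N, (Z0, (Z0, Z0)))) tab i in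
  if x then e.1 else e.2.

Definition bstep (x : bool) (b : base) : base :=
  let e := ent x b.1 in (e.1, Z.modulo (Z.add b.2 e.2.1) Zp).

Definition binc (x : bool) (b : base) : Z :=
  let e := ent x b.1 in Z.add (Z.mul b.2 e.2.2.1) e.2.2.2.

Definition estep (x : bool) (l : base * 'F_p) : base * 'F_p :=
  (bstep x l.1, l.2 + zr _ (binc x l.1)).

Definition erun (w : seq bool) : base * 'F_p :=
  foldl (fun l x => estep x l) ((0%N, Z0), 0) w.

Lemma erun_rcons w x : erun (rcons w x) = estep x (erun w).
Proof. by rewrite /erun foldl_rcons. Qed.

(* First return to b of the orbit of c, with the accumulated increment *)
Fixpoint floop (f : base -> base) (g : base -> Z) (b c : base) (n : nat) (h : Z) (fuel : nat) :
    option (nat * Z) :=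
  if fuel is fuel'.+1 then
    let h' := Z.add h (g c) in let c' := f c in
    if c' == b then Some (n.+1, h') else floop f g b c' n.+1 h' fuel'
  else None.

Definition flen (f : base -> base) (g : base -> Z) (fuel : nat) (b : base) : nat :=
  if floop f g b b 0 Z0 fuel is Some (n, h) then
    if Z.modulo h Zp == Z0 then n else (n * p)%N
  else 0%N.

Definition ef (f : base -> base) (g : base -> Z) (l : base * 'F_p) :=
  (f l.1, l.2 + zr _ (g l.1)).

Fixpoint gsum (f : base -> base) (g : base -> Z) (b : base) n : Z :=
  if n is n'.+1 then Z.add (gsum f g b n') (g (iter n' f b)) else Z0.

Lemma iter_ef f g b q n :
  iter n (ef f g) (b, q) = (iter n f b, q + zr _ (gsum f g b n)).
Proof.
elim: n => [|n IH]; first by rewrite /= zr0 addr0.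
by rewrite !iterS IH /ef /= zrD addrA.
Qed.

Lemma floopP f g b c n h fuel m h' :
  c = iter n f b -> h = gsum f g b n ->
  (forall k, (0 < k <= n)%N -> iter k f b != b) ->
  floop f g b c n h fuel = Some (m, h') ->
  [/\ (0 < m)%N, iter m f b = b, h' = gsum f g b m &
      forall k, (0 < k < m)%N -> iter k f b != b].
Proof.
elim: fuel n c h => // fuel IH n c h -> -> hn /=.
case: eqP => [e [<- <-]|/eqP ne]; first by split=> //= k; exact: hn.
apply: IH => //= k /andP[k0]; rewrite leq_eqVlt => /orP[/eqP->//|]; rewrite ltnS => kn.
by apply: hn; rewrite k0.
Qed.

Lemma gsum_period f g b m k r : iter m f b = b ->
  gsum f g b (k * m + r) = Z.add (Z.mul (Z.of_nat k) (gsum f g b m)) (gsum f g b r).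
Proof.
move=> e; have it j : iter (j * m) f b = b.
  by elim: j => // j IH; rewrite mulSn iterD IH.
have add a : gsum f g b (a + k * m) = Z.add (gsum f g b a) (gsum f g b (k * m)) -> True by [].
have gD x y : iter x f b = b -> gsum f g b (x + y) = Z.add (gsum f g b x) (gsum f g b y).
  move=> ex; elim: y => [|y IH]; first by rewrite addn0 /=; lia.
  by rewrite addnS /= IH addnC iterD ex; lia.
rewrite gD ?it //; congr Z.add; elim: k {add} => [|k IH]; first by rewrite mul0n /=; lia.
rewrite mulSn gD // IH; lia.
Qed.

Lemma flenP f g fuel b q k : (0 < k < flen f g fuel b)%N ->
  iter k (ef f g) (b, q) != (b, q).
Proof.
rewrite /flen; case E: floop => [[m h]|]; last by rewrite ltn0 andbF.
have [|m0 mb hE mn] := @floopP f g b b 0%N Z0 fuel m h erefl erefl _ E.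
  by case.
move=> kl; rewrite iter_ef; apply/eqP => -[e1 e2].
have km : k = ((k %/ m) * m)%N.
  have it j : iter (j * m) f b = b by elim: j => // j IH; rewrite mulSn iterD IH.
  have e3 : iter (k %% m) f b = b.
    by rewrite -[RHS]e1 [in RHS](divn_eq k m) addnC iterD it.
  rewrite [in LHS](divn_eq k m); suff -> : (k %% m = 0)%N by rewrite addn0.
  apply/eqP; apply/negPn/negP; rewrite -lt0n => r0.
  by have := mn (k %% m)%N; rewrite r0 ltn_mod m0 e3 eqxx => /(_ isT).
move: e2; rewrite -[RHS]addr0 => /addrI/eqP; rewrite km -[X in gsum _ _ _ X]addn0.
rewrite (gsum_period g (k %/ m) 0 mb) /= Z.add_0_r zr_eq0 // -hE.
set r := (k %/ m)%N in km *.
have k0 : (0 < r)%N by rewrite lt0n; apply/eqP => r0; move: kl; rewrite km r0.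
rewrite -zr_eq0 // zrM mulf_eq0 !zr_eq0 //; move: kl; case: ifP => h0.
  by rewrite km => /andP[_]; rewrite -{2}[m]mul1n ltn_pmul2r // ltnNge k0.
rewrite ?h0 orbF => /andP[_]; rewrite km mulnC ltn_pmul2l // => rp.
move=> /eqP/Z.mod_divide; case; first by have := Zp_gt0 pp; lia.
move=> x ex; have [x0|x1] : (x <= 0 \/ 1 <= x)%bZ by lia.
  by have := Z.mul_nonpos_nonneg x Zp x0 (Nat2Z.is_nonneg p); rewrite -ex; lia.
by have := Z.mul_le_mono_nonneg_r 1 x Zp (Nat2Z.is_nonneg p) x1; rewrite -ex; lia.
Qed.

Definition instate (N m : nat) (b : base) : bool :=
  (b.1 < N)%N && Z.leb Z0 b.2 && Z.ltb b.2 (Z.of_nat m).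

Definition states (N m : nat) : seq base :=
  [seq (i, Z.of_nat s) | i <- iota 0 N, s <- iota 0 m].

Lemma mem_states N m b : (b \in states N m) = instate N m b.
Proof.
apply/allpairsP/idP => [[[i s] [/= hi hs ->]]|/andP[/andP[h1 h2] h3]].
  move: hi hs; rewrite !mem_iota /instate /= => hi hs.
  by rewrite hi /=; lia.
exists (b.1, Z.to_nat b.2); rewrite !mem_iota; split; rewrite //=.
  by lia.
by case: b h1 h2 h3 => i z /= _ h _; congr pair; lia.
Qed.

Lemma states_uniq N m : uniq (states N m).
Proof.
apply: allpairs_uniq; rewrite ?iota_uniq // => -[i s] [j r] _ _ [-> e].
by congr pair; lia.
Qed.

Definition fP (b : base) := bstep true (bstep false b).
Definition gP (b : base) := Z.add (binc false b) (binc true (bstep false b)).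

Definition weight (fuel : nat) (D : Z) (b : base) : Z :=
  let l f g := Z.of_nat (flen f g fuel b) in
  Z.add (Z.add (Z.div D (l (bstep true) (binc true)))
    (Z.div D (l (bstep false) (binc false)))) (Z.div D (l fP gP)).

Definition okb (N m fuel : nat) (D : Z) (b : base) : bool :=
  let l f g := Z.of_nat (flen f g fuel b) in
  let d n := Z.ltb Z0 n && (Z.modulo D n == Z0) in
  let x := bstep true b in let y := bstep false b in
  [&& instate N m x, instate N m y, bstep true (bstep true x) == b,
    bstep false y == b, d (l (bstep true) (binc true)),
    d (l (bstep false) (binc false)) & d (l fP gP)].

(* Every vertex is reached from 0, and a closed path at 0 moves the second
   coordinate when it is not fixed. *)
Definition connb (N m : nat) (par : seq (nat * bool)) (loop : seq bool) : bool :=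
  [&& (0 < N)%N, (size par).+1 == N,
    all (fun i => let e := nth (0%N, true) par i in
      (e.1 <= i)%N && ((ent e.2 e.1).1 == i.+1)) (iota 0 N.-1) &
    (m == 1%N) || (m == p) &&
      (let b := foldl (fun l x => bstep x l) (0%N, Z0) loop in
       (b.1 == 0%N) && (b.2 != Z0))].

Definition extcheck (N m : nat) (par : seq (nat * bool)) (loop : seq bool) (D : Z) :=
  let st := states N m in let fuel := (N * m)%N in
  [&& Z.ltb Z0 D, connb N m par loop, all (okb N m fuel D) st &
    Z.leb (foldr (fun b z => Z.add (weight fuel D b) z) Z0 st)
      (Z.mul D (Z.of_nat (N * m)))].

Section Sound.
Variables (N m : nat) (par : seq (nat * bool)) (loop : seq bool) (D : Z).
Hypothesis chk : extcheck N m par loop D.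
Local Notation st := (states N m).

Lemma ext_okb b : b \in st -> okb N m (N * m) D b.
Proof. by case/and4P: chk => _ _ /allP h _; exact: h. Qed.

Lemma ext_closed x b : b \in st -> bstep x b \in st.
Proof. by move=> /ext_okb/and4P[h1 h2 _ _]; rewrite mem_states; case: x. Qed.

Lemma ext_X3 b : b \in st -> bstep true (bstep true (bstep true b)) = b.
Proof. by move=> /ext_okb/and4P[_ _ /eqP h _]. Qed.

Lemma ext_Y2 b : b \in st -> bstep false (bstep false b) = b.
Proof. by move=> /ext_okb/and4P[_ _ _ /andP[/eqP h _]]. Qed.

Lemma ext0 : (0%N, Z0) \in st.
Proof.
case/and4P: chk => _ /and4P[N0 _ _ m1] _ _; rewrite mem_states /instate /= N0 /=.
by case/orP: m1 => [/eqP->//|/andP[/eqP-> _]]; have := Zp_gt0 pp; lia.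
Qed.

Definition brun (w : seq bool) (b : base) := foldl (fun l x => bstep x l) b w.

Lemma brun_in w b : b \in st -> brun w b \in st.
Proof. by elim: w b => //= x w IH b hb; apply: IH; exact: ext_closed. Qed.

Lemma erun1 w : (erun w).1 = brun w (0%N, Z0).
Proof.
elim/last_ind: w => // w x IH; rewrite erun_rcons /brun foldl_rcons.
by rewrite /estep /= IH.
Qed.

(* The action of a path on the second coordinate is a translation. *)
Lemma brun_shift w i s b : brun w (i, s) = b ->
  forall k, exists z, brun w (i, Z.modulo (Z.add s k) Zp) = (b.1, z) /\
    Z.modulo z Zp = Z.modulo (Z.add b.2 k) Zp.
Proof.
have p0 : Zp <> Z0 by have := Zp_gt0 pp; lia.
elim: w i s b => [|x w IH] i s b /= => [<- k|e k].
  by eexists; split; [reflexivity|rewrite /= Z.mod_mod].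
have [z [h1 h2]] := IH _ _ _ e k; exists z; split=> //.
rewrite -h1; congr brun; rewrite /bstep /=; congr pair.
rewrite !(Z.add_mod_idemp_l _ _ _ p0).
by congr Z.modulo; lia.
Qed.

Lemma ext_back (P : base -> Prop) : (forall b, b \in st -> P b -> P (bstep true b) /\ P (bstep false b)) ->
  forall w b, b \in st -> P (brun w b) -> P b.
Proof.
move=> cl w; elim: w => //= x w IH b hb /(IH _ (ext_closed x hb)) h.
have hx := ext_closed x hb; case: x h hx => h hx.
  rewrite -(ext_X3 hb); have [h' _] := cl _ hx h.
  by have [] := cl _ (ext_closed true hx) h'.
by rewrite -(ext_Y2 hb); have [] := cl _ hx h.
Qed.

Lemma ext_conn (P : base -> Prop) w0 : P (brun w0 (0%N, Z0)) ->
  (forall b, b \in st -> P b -> P (bstep true b) /\ P (bstep false b)) ->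
  forall b, b \in st -> P b.
Proof.
move=> P0 cl; have {w0} P0 := ext_back cl ext0 P0.
have step x b : b \in st -> P b -> P (bstep x b).
  by move=> hb /(cl _ hb)[]; case: x.
have run w b : b \in st -> P b -> P (brun w b).
  elim: w b => //= x w IH b hb Pb; apply: IH; [exact: ext_closed|exact: step].
have p0 : Zp <> Z0 by have := Zp_gt0 pp; lia.
case/and4P: (chk) => _ /and4P[N0 /eqP spar /allP hpar hm] _ _.
have all0 s : (0%N, s) \in st -> P (0%N, s).
  case/orP: hm => [/eqP m1|/andP[/eqP mp /andP[/eqP l1 l2]]] hs.
    by move: hs; rewrite mem_states m1 /instate /= => h; have -> : s = Z0 by lia.
  set b := foldl _ _ _ in l1 l2; have bE : b = (0%N, b.2) by rewrite -l1 -surjective_pairing.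
  have bst : b \in st by exact: (brun_in loop ext0).
  have it k : P (0%N, Z.modulo (Z.mul (Z.of_nat k) b.2) Zp).
    elim: k => [|k IH]; first by rewrite Z.mul_0_l Z.mod_0_l.
    have [z [e1 e2]] := brun_shift (w := loop) (i := 0%N) (s := Z0) (b := b) erefl (Z.mul (Z.of_nat k) b.2).
    have ist : (0%N, Z.modulo (Z.mul (Z.of_nat k) b.2) Zp) \in st.
      rewrite mem_states /instate /= N0 mp /=.
      by have := Z.mod_pos_bound (Z.mul (Z.of_nat k) b.2) Zp (Zp_gt0 pp); lia.
    have := run loop _ ist IH; have := brun_in loop ist.
    rewrite Z.add_0_l in e1; rewrite e1 l1 mem_states mp /instate /= => zb.
    rewrite (_ : z = Z.modulo (Z.mul (Z.of_nat k.+1) b.2) Zp) //.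
    rewrite -(Z.mod_small z Zp) ?e2; last by lia.
    by congr Z.modulo; lia.
  have b20 : zr 'F_p b.2 != 0.
    rewrite zr_eq0 // Z.mod_small //; move: bst; rewrite mem_states mp /instate; lia.
  have := it (val (zr 'F_p s / zr 'F_p b.2)).
  rewrite -/(zv _) -(zvE pp (x := zr _ s)); last by rewrite zrM zr_zv // mulrVK ?unitfE.
  rewrite (zvE pp (a := s)) // Z.mod_small //; move: hs; rewrite mem_states mp /instate /=; lia.
move=> [i s]; have [n le] := ubnP i; elim: n i le s => // n IH [|i] le s hb.
  exact: all0.
have iN : (i.+1 < N)%N by move: hb; rewrite mem_states /instate /= => /andP[/andP[]].
have ii : i \in iota 0 N.-1 by rewrite mem_iota /= add0n; lia.
have /andP[ji /eqP e] := hpar i ii.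
move: ji e; set j := (nth _ _ _).1; set x := (nth _ _ _).2 => ji e.
pose c := (ent x j).2.1.
have [z [hz ez]] : exists z, (j, z) \in st /\ bstep x (j, z) = (i.+1, s).
  have jN : (j < N)%N by apply: leq_ltn_trans ji _; exact: ltnW.
  have inp z : (Z.modulo z Zp = z) -> m = p -> (j, z) \in st.
    move=> <- mp; rewrite mem_states /instate /= jN mp /=.
    by have := Z.mod_pos_bound z Zp (Zp_gt0 pp); lia.
  case/orP: hm => [/eqP m1|/andP[/eqP mp _]].
    have h0 : (j, Z0) \in st by rewrite mem_states /instate /= jN m1.
    exists Z0; split=> //; have := ext_closed x h0.
    rewrite mem_states m1 /bstep /= e -/c /instate /= => h1.
    by move: hb; rewrite mem_states m1 /instate /= => h2; congr pair; lia.
  exists (Z.modulo (Z.sub s c) Zp); split; first by apply: inp => //; rewrite Z.mod_mod.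
  rewrite /bstep /= e -/c; congr pair; rewrite Z.add_mod_idemp_l //.
  rewrite (_ : Z.add _ _ = s); last by lia.
  by rewrite Z.mod_small //; move: hb; rewrite mem_states mp /instate /=; lia.
rewrite -ez; apply: step => //; apply: IH => //; exact: leq_ltn_trans ji le.
Qed.

Variables (H : set 'M[Laurent]_2) (Hsub : is_subgroup H).
Variables (C : finType) (E : coset_system (cimage H) C).
Variable w0 : seq bool.
Hypothesis inv : forall w v a b h, H h ->
  t ^+ a *: wmat w = t ^+ b *: (h * wmat v) -> erun (w0 ++ w) = erun (w0 ++ v).

(** A cycle of base labels lifts to cycles p times as long as soon as its total
    increment does not vanish modulo p. *)
Theorem ext_bound :
  (#|porbits (cperm E SL2Z_S)| + #|porbits (cperm E SL2Z_U)| +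
   #|porbits (cperm E (SL2ZM SL2Z_S SL2Z_U))| <= #|C|)%N.
Proof.
have L : @labelling H _ (fun w => erun (w0 ++ w)) (estep true) (estep false).
  by split=> // w; rewrite -rcons_cat erun_rcons.
have Ef x l : estep x l = ef (bstep x) (binc x) l by [].
have EP l : (estep true \o estep false) l = ef fP gP l.
  by rewrite /= /estep /ef /=; congr pair; rewrite /gP zrD addrA.
have itE (f g : base * 'F_p -> base * 'F_p) : f =1 g -> forall k l, iter k f l = iter k g l.
  by move=> e; elim=> //= k IH l; rewrite IH e.
pose lX := flen (bstep true) (binc true) (N * m).
pose lY := flen (bstep false) (binc false) (N * m).
pose lP := flen fP gP (N * m).
have D0 : (0 < Z.to_nat D)%N by case/and4P: chk; lia.
have dv l : Z.ltb Z0 (Z.of_nat l) && (Z.modulo D (Z.of_nat l) == Z0) ->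
    (0 < l)%N /\ (l %| Z.to_nat D)%N.
  move=> /andP[l0 /eqP h]; split; first lia.
  have /Z.mod_divide[|x hx] := h; first lia.
  by apply/dvdnP; exists (Z.to_nat x); nia.
have ok b := @ext_okb b.
apply: (@label_bound H Hsub C E base 'F_p _ _ _ L (bstep true) (bstep false) st
  (states_uniq N m) _ _ _ _ _ _ lX lY lP (Z.to_nat D) D0) => //.
- move=> w; rewrite erun1; exact: brun_in ext0.
- exact: ext_X3.
- exact: ext_Y2.
- move=> P; rewrite erun1; exact: ext_conn.
- move=> b q /ok/and5P[_ _ _ _ /and3P[/dv[h1 h2] _ _]]; split=> // k.
  by rewrite (itE _ _ (Ef true)); exact: flenP.
- move=> b q /ok/and5P[_ _ _ _ /and3P[_ /dv[h1 h2] _]]; split=> // k.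
  by rewrite (itE _ _ (Ef false)); exact: flenP.
- move=> b q /ok/and5P[_ _ _ _ /and3P[_ _ /dv[h1 h2]]]; split=> // k.
  by rewrite (itE _ _ EP); exact: flenP.
have szst : size st = (N * m)%N by rewrite size_allpairs !size_iota.
rewrite szst; case/and4P: chk => D1 _ _ /Z.leb_le; rewrite -/st.
have sub : {subset st <= st} by [].
suff eqs s : {subset s <= st} -> foldr (fun b z => Z.add (weight (N * m) D b) z) Z0 s =
  Z.of_nat (\sum_(i <- s) (Z.to_nat D %/ lX i + Z.to_nat D %/ lY i + Z.to_nat D %/ lP i)).
  rewrite eqs //; move: (\sum_(i <- st) _)%N => S h; apply/ssrnat.leP/Nat2Z.inj_le.
  by rewrite Nat2Z.inj_mul Z2Nat.id //; move: D1; clear; lia.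
elim: s => [|b s IH] sb; first by rewrite big_nil.
rewrite big_cons /= IH; last by move=> c cs; apply: sb; rewrite inE cs orbT.
rewrite /weight Nat2Z.inj_add; congr Z.add.
have dE n : Z.of_nat (Z.to_nat D %/ n) = Z.div D (Z.of_nat n).
  rewrite -{2}(Z2Nat.id D); last by move: D1; clear; lia.
  case: n => [|n]; first by rewrite divn0 Zdiv_0_r.
  apply: (Z.div_unique _ _ _ (Z.of_nat (Z.to_nat D %% n.+1))).
    by left; have := ltn_mod (Z.to_nat D) n.+1; lia.
  rewrite -Nat2Z.inj_mul -Nat2Z.inj_add; congr Z.of_nat.
  by rewrite {1}(divn_eq (Z.to_nat D) n.+1) mulnC.
by rewrite !Nat2Z.inj_add !dE.
Qed.

End Sound.

End Affine.

Local Notation M2 := 'M[Laurent]_2.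
Local Notation V := 'cV[Laurent]_2.

(** * Functionals modulo p on submodules *)


Definition evp (p : nat) : Laurent -> 'F_p := intmul 1 \o ev.
HB.instance Definition _ p := GRing.RMorphism.copy (evp p) (intmul 1 \o ev).

Lemma evp_t p : evp p t = -1.
Proof. by rewrite /evp /= ev_t rmorphN1. Qed.

Definition HN (N : V -> Prop) : set M2 :=
  [set h | Bu3 h /\ forall u : V, N ((h - 1) *m u)].

Section Psi.
Variable p : nat.
Local Notation rmx := (map_mx (evp p)).

Definition lincomb n (G : seq V) (c : nat -> 'rV[Laurent]_n) : 'M[Laurent]_(2, n) :=
  \sum_(l < size G) nth 0 G l *m c l.

Definition psic n (G : seq V) (v : nat -> 'F_p) (c : nat -> 'rV[Laurent]_n) : 'rV['F_p]_n :=
  \sum_(l < size G) v l *: rmx (c l).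

Section Psi2.
Variables (G : seq V) (v : nat -> 'F_p).

Definition Psi n (D : 'M[Laurent]_(2, n)) (s : 'rV['F_p]_n) : Prop :=
  exists2 c, D = lincomb G c & s = psic G v c.

Lemma Psi_mul n m D s (E : 'M[Laurent]_(n, m)) : Psi D s -> Psi (D *m E) (s *m rmx E).
Proof.
move=> [c -> ->]; exists (fun l => c l *m E).
  by rewrite /lincomb mulmx_suml; apply: eq_bigr => l _; rewrite mulmxA.
by rewrite /psic mulmx_suml; apply: eq_bigr => l _; rewrite map_mxM scalemxAl.
Qed.

Lemma Psi_add n (D D' : 'M_(2, n)) s s' : Psi D s -> Psi D' s' -> Psi (D + D') (s + s').
Proof.
move=> [c -> ->] [c' -> ->]; exists (fun l => c l + c' l).
  by rewrite /lincomb -big_split; apply: eq_bigr => l _; rewrite mulmxDr.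
by rewrite /psic -big_split; apply: eq_bigr => l _; rewrite map_mxD scalerDr.
Qed.

Lemma Psi_scale n a (D : 'M_(2, n)) s : Psi D s -> Psi (a *: D) (evp p a *: s).
Proof.
move=> [c -> ->]; exists (fun l => a *: c l).
  by rewrite /lincomb scaler_sumr; apply: eq_bigr => l _; rewrite scalemxAr.
rewrite /psic scaler_sumr; apply: eq_bigr => l _.
by rewrite map_mxZ !scalerA mulrC.
Qed.

Lemma Psi_t n a (D : 'M_(2, n)) s : Psi D s -> Psi (t ^+ a *: D) ((-1) ^+ a *: s).
Proof. by move=> /(Psi_scale (t ^+ a)); rewrite rmorphXn /= evp_t. Qed.

Lemma Psi_opp n (D : 'M_(2, n)) s : Psi D s -> Psi (- D) (- s).
Proof. by move=> /(Psi_scale (-1)); rewrite rmorphN1 !scaleN1r. Qed.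

Lemma Psi_sub n (D D' : 'M_(2, n)) s s' : Psi D s -> Psi D' s' -> Psi (D - D') (s - s').
Proof. by move=> h /Psi_opp; exact: Psi_add. Qed.

Lemma Psi_0 n : @Psi n 0 0.
Proof.
exists (fun=> 0); first by rewrite /lincomb big1 // => l _; rewrite mulmx0.
by rewrite /psic big1 // => l _; rewrite map_mx0 scaler0.
Qed.

Lemma Psi_cols n (D : 'M_(2, n)) s : (forall u : 'cV_n, Psi (D *m u) (s *m rmx u)) -> Psi D s.
Proof.
move=> h; have {}h k := h (delta_mx k 0).
pose c l : 'rV[Laurent]_n := \row_k sval (cid2 (h k)) l 0 0.
have cE k l : sval (cid2 (h k)) l = col k (c l).
  by apply/matrixP => i j; rewrite !mxE !ord1.
exists c; apply/matrixP => i k; last first.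
  rewrite (ord1 i) {i}.
  have [_ e] := svalP (cid2 (h k)); move: e; set f := sval _ => e.
  have := congr1 (fun A : 'rV_1 => A 0 0) e.
  rewrite map_delta_mx -colE mxE => ->; rewrite !summxE; apply: eq_bigr => l _.
  by rewrite !mxE.
have [e _] := svalP (cid2 (h k)); move: e; set f := sval _ => e.
have := congr1 (fun A : 'cV_2 => A i 0) e.
rewrite -colE mxE => ->; rewrite !summxE; apply: eq_bigr => l _.
by rewrite !mxE; apply: eq_bigr => j _; rewrite !mxE (ord1 j).
Qed.

(** The functional is well defined. *)
Definition wdef := forall s : 'rV_1, Psi 0 s -> s = 0.

Lemma wdef_n n (s : 'rV_n) : wdef -> Psi 0 s -> s = 0.
Proof.
move=> wd h; apply/rowP => k; have := Psi_mul (delta_mx k 0 : 'cV_n) h.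
by rewrite mul0mx map_delta_mx -colE => /wd/matrixP/(_ 0 0); rewrite !mxE.
Qed.

Lemma Psi_uniq n (D : 'M_(2, n)) s s' : wdef -> Psi D s -> Psi D s' -> s = s'.
Proof.
move=> wd h h'; apply/eqP; rewrite -subr_eq0; apply/eqP; apply: (wdef_n wd).
by rewrite -(subrr D); exact: Psi_sub.
Qed.

Definition HPsi : set M2 := [set h | Bu3 h /\ Psi (h - 1) 0].

Lemma HPsiE : HN (fun u => Psi u 0) = HPsi.
Proof.
apply/seteqP; split=> h [Bh hh]; split=> //.
  by apply: Psi_cols => w; rewrite mul0mx; exact: hh.
by move=> u; have := Psi_mul u hh; rewrite mul0mx.
Qed.

End Psi2.

Definition inM (G : seq V) n (D : 'M[Laurent]_(2, n)) : Prop := exists c, D = lincomb G c.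

(** * Running along a table of cosets *)

Definition det2 (a b : 'rV['F_p]_2) : 'F_p := a 0 0 * b 0 1 - a 0 1 * b 0 0.

Lemma det2D a b c : det2 (a + b) c = det2 a c + det2 b c.
Proof. by rewrite /det2 !mxE; ring. Qed.
Lemma det2Dr a b c : det2 a (b + c) = det2 a b + det2 a c.
Proof. by rewrite /det2 !mxE; ring. Qed.
Lemma det2Z k a b : det2 (k *: a) b = k * det2 a b.
Proof. by rewrite /det2 !mxE; ring. Qed.
Lemma det2Zr k a b : det2 a (k *: b) = k * det2 a b.
Proof. by rewrite /det2 !mxE; ring. Qed.
Lemma det2B a b c : det2 (a - b) c = det2 a c - det2 b c.
Proof. by rewrite /det2 !mxE; ring. Qed.

Lemma det2M a b x : det2 (a *m rmx (letter x)) (b *m rmx (letter x)) = det2 a b.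
Proof.
rewrite /det2 !mxE !big_ord_recl !big_ord0 !mxE.
have -> : lift ord0 ord0 = 1 :> 'I_2 by exact: val_inj.
by case: x; rewrite /= !mxE /= ?rmorph0 ?rmorphN ?rmorphXn /= !evp_t; ring.
Qed.

Section Run.
Variables (G : seq V) (v : nat -> 'F_p).
Hypothesis wd : wdef G v.
Local Notation psi := (Psi G v).
Variables (N : nat) (W : nat -> M2) (nx en em : bool -> nat -> nat) (d : nat).
Variables (kap : bool -> nat -> 'rV['F_p]_2) (tau : 'rV['F_p]_2).
Hypotheses (N0 : (0 < N)%N) (W0 : W 0%N = 1).
Hypothesis nxN : forall x i, (i < N)%N -> (nx x i < N)%N.
Hypothesis trans : forall x i, (i < N)%N ->
  psi (t ^+ en x i *: (W i * letter x) - t ^+ em x i *: W (nx x i)) (kap x i).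
Hypothesis dist : forall i j a b, (i < N)%N -> (j < N)%N ->
  inM G (t ^+ a *: W i - t ^+ b *: W j) -> i = j /\ a = b %[mod d].
Hypothesis d_even : ~~ odd d.
Hypothesis tauP : psi (t ^+ d *: 1 - 1) tau.

Definition rstep (l : nat * 'rV['F_p]_2) (x : bool) : nat * 'rV['F_p]_2 :=
  (nx x l.1, (-1) ^+ (en x l.1 + em x l.1) *: (l.2 *m rmx (letter x)) +
             (-1) ^+ em x l.1 *: kap x l.1).

Definition run (w : seq bool) := foldl rstep (0%N, 0) w.

Lemma run_rcons w x : run (rcons w x) = rstep (run w) x.
Proof. by rewrite /run foldl_rcons. Qed.

Lemma sgn_double k : (-1) ^+ (k + k) = 1 :> 'F_p.
Proof. by rewrite addnn -signr_odd odd_double. Qed.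

Lemma run_lt w : ((run w).1 < N)%N.
Proof.
elim/last_ind: w => // w x IH; rewrite run_rcons /=; exact: nxN.
Qed.

Lemma runP w : exists a b,
  psi (t ^+ a *: wmat w - t ^+ b *: W (run w).1) ((-1) ^+ b *: (run w).2).
Proof.
elim/last_ind: w => [|w x [a [b IH]]].
  exists 0%N, 0%N; rewrite wmat_nil /= W0 subrr scaler0; exact: Psi_0.
rewrite run_rcons wmat_rcons; move: IH (run_lt w); case: (run w) => i s /= IH iN.
exists (en x i + a)%N, (b + em x i)%N.
have h1 := Psi_t (en x i) (Psi_mul (letter x) IH).
have h2 := Psi_t b (trans x iN).
have := Psi_add h1 h2; congr (psi _ _).
  rewrite -!mulmxE mulmxBl !scalerBr -!scalemxAl !scalerA -!exprD.
  by rewrite [(en x i + b)%N]addnC addrA subrK.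
rewrite -!scalemxAl !scalerDr !scalerA -!exprD; congr (_ *: _ + _ *: _).
  rewrite (_ : (b + em x i + _)%N = (em x i + em x i + (en x i + b))%N); last by lia.
  by rewrite [RHS]exprD sgn_double mul1r.
rewrite (_ : (b + em x i + _)%N = (em x i + em x i + b)%N); last by lia.
by rewrite [RHS]exprD sgn_double mul1r.
Qed.

Lemma tau_iter n : psi (t ^+ (n * d) *: 1 - 1) (n%:R *: tau).
Proof.
elim: n => [|n IH]; first by rewrite mul0n expr0 scale1r subrr scale0r; exact: Psi_0.
have := Psi_add (Psi_t d IH) tauP.
have -> : (-1) ^+ d = 1 :> 'F_p by rewrite -signr_odd (negPf d_even).
rewrite scale1r mulrS scalerDl scale1r [tau + _]addrC mulSn exprD.
by rewrite scalerBr !scalerA addrA subrK.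
Qed.

Lemma tau_W x y i : x = y %[mod d] ->
  exists k : 'F_p, psi (t ^+ x *: W i - t ^+ y *: W i) (k *: (tau *m rmx (W i))).
Proof.
wlog le : x y / (y <= x)%N => [hw e|e].
  have [le|/ltnW le] := leqP y x; first exact: hw.
  have [k hk] := hw _ _ le (esym e); exists (- k).
  by rewrite -opprB scaleNr; exact: Psi_opp.
have {e} dv : (d %| x - y)%N by rewrite -eqn_mod_dvd //; apply/eqP.
have -> : x = (y + (x - y) %/ d * d)%N by rewrite divnK // subnKC.
set n := (_ %/ _)%N; exists ((-1) ^+ y * n%:R).
have := Psi_t y (Psi_mul (W i) (tau_iter n)).
by rewrite mulmxBl -!scalemxAl mul1mx scalerBr !scalerA -exprD.
Qed.

(** Words in the same coset have the same label, up to a power of t. *)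
Lemma run_inv w w' a b h : psi (h - 1) 0 ->
  t ^+ a *: wmat w = t ^+ b *: (h * wmat w') ->
  (run w).1 = (run w').1 /\
  exists k, (run w').2 = (run w).2 + k *: (tau *m rmx (W (run w).1)).
Proof.
move=> hh e; have [a1 [b1]] := runP w; have [a2 [b2]] := runP w'.
move: (run_lt w) (run_lt w'); case: (run w) => i s; case: (run w') => i' s' /= iN iN' h2 h1.
have h3 := Psi_t b (Psi_mul (wmat w') hh).
have h3' : psi (t ^+ a *: wmat w - t ^+ b *: wmat w') 0.
  by move: h3; rewrite mul0mx scaler0 mulmxBl mul1mx scalerBr e.
have := Psi_sub (Psi_sub (Psi_t (a + a2) h1) (Psi_t (a1 + a2) h3')) (Psi_t (b + a1) h2).
set x' := (b + a1 + b2)%N; set x := (a + a2 + b1)%N.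
have -> : t ^+ (a + a2) *: (t ^+ a1 *: wmat w - t ^+ b1 *: W i) -
   t ^+ (a1 + a2) *: (t ^+ a *: wmat w - t ^+ b *: wmat w') -
   t ^+ (b + a1) *: (t ^+ a2 *: wmat w' - t ^+ b2 *: W i') = t ^+ x' *: W i' - t ^+ x *: W i.
  by apply/matrixP => k l; rewrite !mxE /x /x' !exprD; ring.
rewrite scaler0 subr0 !scalerA -!exprD -/x -/x' => h4.
have [ii xx] : i' = i /\ x' = x %[mod d].
  by apply: dist => //; case: h4 => c h4 _; exists c.
rewrite {}ii in h4 *; split=> //.
have [k hk] := tau_W i xx.
have e2 := Psi_uniq wd h4 hk.
have px : (-1) ^+ x' = (-1) ^+ x :> 'F_p.
  rewrite -signr_odd -[RHS]signr_odd; congr (_ ^+ nat_of_bool _).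
  have dE : (2 %| d)%N by rewrite dvdn2.
  have : (x' %% 2 = x %% 2)%N by rewrite -(modn_dvdm x' dE) xx modn_dvdm.
  by rewrite !modn2; case: (odd x') (odd x) => -[].
move: e2; rewrite px -scalerBr => e2.
exists (- ((-1) ^+ x * k)); rewrite scaleNr -scalerA -e2 scalerA -exprD sgn_double.
by rewrite scale1r opprB addrC subrK.
Qed.

(** A quantity computed from the label of a word and insensitive to tau bounds
    the Euler characteristic for every conjugate of a subgroup of HPsi. *)
Section Affine.
Hypothesis pp : prime p.
Variables (tab : seq (entry * entry)) (lam : nat * 'rV['F_p]_2 -> base * 'F_p).
Hypothesis lam0 : lam (0%N, 0) = ((0%N, Z0), 0).
Hypothesis lamS : forall x i s, (i < N)%N -> (lam (i, s)).1.1 = i ->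
  lam (rstep (i, s) x) = estep tab x (lam (i, s)) /\ (lam (rstep (i, s) x)).1.1 = nx x i.
Hypothesis lam_tau : forall i s k, (i < N)%N ->
  lam (i, s + k *: (tau *m rmx (W i))) = lam (i, s).

Lemma erun_lam w : erun p tab w = lam (run w) /\ (lam (run w)).1.1 = (run w).1.
Proof.
elim/last_ind: w => [|w x [IH1 IH2]]; first by rewrite /= lam0.
rewrite erun_rcons run_rcons IH1; move: IH2 (run_lt w); case: (run w) => i s /= h iN.
by have [-> e2] := lamS x iN h.
Qed.

Lemma lam_inv w w' a b h : psi (h - 1) 0 ->
  t ^+ a *: wmat w = t ^+ b *: (h * wmat w') -> erun p tab w = erun p tab w'.
Proof.
move=> hh e; have [e1 [k e2]] := run_inv hh e.
rewrite !(proj1 (erun_lam _)); move: e1 e2 (run_lt w); case: (run w) (run w') => i s [i' s'] /= <- -> iN.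
by rewrite lam_tau.
Qed.

Theorem lam_bound m par loop D (H : set M2) (g : M2)
    (C : finType) (E : coset_system (cimage H) C) :
  extcheck p tab N m par loop D -> is_subgroup H -> Bu3 g ->
  (forall h, H h -> HPsi G v (g^-1 * h * g)) ->
  (#|porbits (cperm E SL2Z_S)| + #|porbits (cperm E SL2Z_U)| +
   #|porbits (cperm E (SL2ZM SL2Z_S SL2Z_U))| <= #|C|)%N.
Proof.
move=> chk Hsub Bg Hg; have [w0 [n [m0 e0]]] := Bu3_word (Bu3_inv Bg).
apply: (@ext_bound p pp tab N m par loop D chk H Hsub C E w0) => w w' a b h Hh e.
have [_ hh] := Hg _ Hh; apply: (lam_inv (a := n + (m0 + a)) (b := n + (m0 + b)) hh).
have ug := Bu3_unit Bg.
have step k u : t ^+ (n + (m0 + k)) *: wmat (w0 ++ u) = t ^+ n *: (t ^+ n *: g^-1 * (t ^+ k *: wmat u)).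
  by rewrite wmat_cat e0 -scalerAl -scalerAr !scalerA -!exprD addnA.
rewrite step e scalerAr (_ : t ^+ (n + (m0 + b)) *: (g^-1 * h * g * wmat (w0 ++ w')) = g^-1 * h * g * (t ^+ (n + (m0 + b)) *: wmat (w0 ++ w'))); last by rewrite scalerAr.
rewrite step; do 4?rewrite -?scalerAl -?scalerAr.
by rewrite !mulrA mulrK.
Qed.

End Affine.

Section Labels13.
Hypothesis pp : prime p.
Variable rho : nat -> 'rV['F_p]_2.
Hypothesis rhoP : forall x i, (i < N)%N ->
  (-1) ^+ (en x i + em x i) *: (rho i *m rmx (letter x)) = rho (nx x i).
Variable tab : seq (entry * entry).
Let kap' x i := (-1) ^+ em x i *: kap x i.

Lemma sgn_sq k : (-1) ^+ k * (-1) ^+ k = 1 :> 'F_p.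
Proof. by rewrite -exprD sgn_double. Qed.

Lemma rho_step x i s : (i < N)%N ->
  det2 (rstep (i, s) x).2 (rho (nx x i)) = det2 s (rho i) + det2 (kap' x i) (rho (nx x i)).
Proof.
move=> iN; rewrite /= det2D; congr (_ + _).
by rewrite -rhoP // det2Z det2Zr det2M mulrA sgn_sq mul1r.
Qed.

(** Only the component of s transverse to rho is kept. *)
Lemma label1 (lam := fun l => ((l.1, Z0), det2 l.2 (rho l.1))) :
  (forall i, (i < N)%N -> det2 (tau *m rmx (W i)) (rho i) = 0) ->
  (forall x i, (i < N)%N -> exists b, ent tab x i = (nx x i, (Z0, (Z0, b))) /\
     zr _ b = det2 (kap' x i) (rho (nx x i))) ->
  [/\ lam (0%N, 0) = ((0%N, Z0), 0),
    forall x i s, (i < N)%N -> (lam (i, s)).1.1 = i ->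
      lam (rstep (i, s) x) = estep tab x (lam (i, s)) /\ (lam (rstep (i, s) x)).1.1 = nx x i
   & forall i s k, (i < N)%N -> lam (i, s + k *: (tau *m rmx (W i))) = lam (i, s)].
Proof.
move=> tau1 tabP; split=> [|x i s iN _|i s k iN].
- by rewrite /lam /= /det2 !mxE !mul0r subrr.
- split=> //; have [b [e1 e2]] := tabP x _ iN.
  rewrite /lam /estep /bstep /binc /= e1 /= rho_step // Z.mod_0_l; last first.
    by have := Zp_gt0 pp; lia.
  by rewrite e2.
- by rewrite /lam /= det2D det2Z tau1 // mulr0 addr0.
Qed.

Variable eta : nat -> 'rV['F_p]_2.
Hypothesis etaP : forall i, (i < N)%N -> det2 (eta i) (rho i) = 1.

Lemma det2_dec i s : (i < N)%N -> s = det2 s (rho i) *: eta i + det2 (eta i) s *: rho i.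
Proof.
move=> /etaP; rewrite /det2 => h; apply/rowP => j; rewrite !mxE.
have [->|->] : j = 0 \/ j = 1 by case: j => [[|[|]]] //= hj; [left|right]; exact: val_inj.
  rewrite -[LHS]mul1r -h; ring.
rewrite -[LHS]mul1r -h; ring.
Qed.

(** Both components of s are kept, in a basis adapted to the vertex. *)
Lemma label3 (lam := fun l => ((l.1, zv (det2 l.2 (rho l.1))), det2 (eta l.1) l.2)) :
  tau = 0 ->
  (forall x i, (i < N)%N -> exists c a b, [/\ ent tab x i = (nx x i, (c, (a, b))),
     zr _ c = det2 (kap' x i) (rho (nx x i)),
     zr _ a = (-1) ^+ (en x i + em x i) * det2 (eta (nx x i)) (eta i *m rmx (letter x)) &
     zr _ b = det2 (eta (nx x i)) (kap' x i)]) ->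
  [/\ lam (0%N, 0) = ((0%N, Z0), 0),
    forall x i s, (i < N)%N -> (lam (i, s)).1.1 = i ->
      lam (rstep (i, s) x) = estep tab x (lam (i, s)) /\ (lam (rstep (i, s) x)).1.1 = nx x i
   & forall i s k, (i < N)%N -> lam (i, s + k *: (tau *m rmx (W i))) = lam (i, s)].
Proof.
move=> tau0 tabP; split=> [|x i s iN _|i s k iN].
- by rewrite /lam /= /det2 !mxE !(mul0r, mulr0) subrr.
- split=> //; have [c [a [b [e1 ec ea eb]]]] := tabP x _ iN.
  rewrite /lam /estep /bstep /binc /= e1 /=; congr ((_, _), _).
    have := rho_step x s iN; rewrite /= => ->; apply: zvE => //.
    by rewrite zrD zr_zv ec.
  rewrite det2Dr zrD zrM zr_zv // ea eb [RHS]addrA.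
  apply: (congr1 (fun z => z + det2 (eta (nx x i)) (kap' x i))).
  have hr : (-1) ^+ (en x i + em x i) * det2 (eta (nx x i)) (rho i *m rmx (letter x)) = 1.
    by rewrite -det2Zr rhoP // etaP // nxN.
  rewrite [in LHS](det2_dec s iN) mulmxDl -!scalemxAl scalerDr !scalerA det2Dr !det2Zr.
  move: hr; move: (_ ^+ _) (det2 _ (rho i *m _)) (det2 (eta i) s) (det2 _ (eta i *m _)) => e a1 a2 a3 hr.
  transitivity ((e * a1) * a2 + det2 s (rho i) * (e * a3)); first by ring.
  by rewrite hr mul1r.
- by rewrite /lam tau0 mul0mx scaler0 addr0.
Qed.

End Labels13.

End Run.
End Psi.


(** * Polynomials inside the Laurent polynomials *)

Definition lpoly (q : {poly int}) : Laurent := (map_poly intr q).[t].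

Lemma valD (x y : Laurent) : val (x + y) = val x + val y. Proof. by []. Qed.
Lemma valM (x y : Laurent) : val (x * y) = val x * val y. Proof. by []. Qed.
Lemma valX (x : Laurent) n : val (x ^+ n) = val x ^+ n.
Proof. by elim: n => // n IH; rewrite !exprS valM IH. Qed.
Lemma valz (c : int) : val (c%:~R : Laurent) = c%:~R.
Proof.
have hn n : val (n%:R : Laurent) = n%:R by elim: n => // n IH; rewrite !mulrS valD IH.
by case: c => n; rewrite ?NegzE ?mulrNz -?pmulrn; [|rewrite -[RHS]/(- _)]; rewrite -hn.
Qed.

Lemma val_lpoly q : val (lpoly q) = tofrac q.
Proof.
rewrite /lpoly; elim/poly_ind: q => [|q c IH]; first by rewrite rmorph0 horner0 tofrac0.
rewrite rmorphD rmorphM /= map_polyX map_polyC /= hornerMXaddC.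
rewrite valD valM IH valz tofracD tofracM; congr (_ + _).
by rewrite -[c in RHS]intz !rmorph_int.
Qed.

Lemma laurent_lpoly (x : Laurent) : exists n q, t ^+ n * x = lpoly q.
Proof.
have [q [n e]] := laurentP x; exists n, q; apply: val_inj; rewrite val_lpoly.
by rewrite valM valX e mulrC divfK // expf_neq0 // fracX_neq0.
Qed.

Lemma ev_lpoly q : ev (lpoly q) = q.[-1].
Proof. by rewrite (@evE _ q 0) ?mulr1 // val_lpoly expr0 divr1. Qed.

(* t + 1 divides every element vanishing at -1. *)
Lemma ev_decomp (x : Laurent) : exists b, x = (ev x)%:~R + b * (t + 1).
Proof.
have [n [q e]] := laurent_lpoly x.
have [r hr] : exists r, q - (q.[-1])%:P = r * ('X - (-1)%:P).
  by apply/factor_theorem; rewrite /root hornerD hornerN hornerC subrr.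
have tu := tX_unit n.
have e1 : lpoly q = (q.[-1])%:~R + lpoly r * (t + 1).
  have {hr} -> : q = r * ('X - (-1)%:P) + (q.[-1])%:P by rewrite -hr subrK.
  set c := q.[-1]; rewrite /lpoly rmorphD rmorphM /= rmorphB /= map_polyX !map_polyC /=.
  rewrite !(hornerD, hornerM, hornerN, hornerX, hornerC) rmorphN1 opprK addrC.
  by rewrite subrr mulr0 add0r.
have [s hs] : exists s : Laurent, t ^+ n - (-1) ^+ n = s * (t + 1).
  by eexists; rewrite subrXX mulrC opprK.
have evx : q.[-1] = (-1) ^+ n * ev x.
  by rewrite -ev_lpoly -e rmorphM rmorphXn /= ev_t.
exists ((t ^+ n)^-1 * (lpoly r - s * (ev x)%:~R)).
apply: (mulrI tu); rewrite e e1 evx [RHS]mulrDr -[_^-1 * _ * _]mulrA mulVKr //.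
rewrite rmorphM rmorphXn rmorphN1 /=; set E := (ev x)%:~R.
have -> : (lpoly r - s * E) * (t + 1) = lpoly r * (t + 1) - E * (s * (t + 1)) by ring.
by rewrite -hs; ring.
Qed.

(** The ideal <p, t + 1> is the kernel of the evaluation at t = -1 modulo p. *)
Lemma evp_ker p (pp : prime p) (x : Laurent) : evp p x = 0 ->
  exists a b : Laurent, x = a * p%:R + b * (t + 1).
Proof.
have [b hb] := ev_decomp x => h.
have : (p %| `|ev x|)%N.
  have := h; rewrite /evp /=; case: (ev x) => k /= h'.
    by rewrite (dvdn_pcharf (pchar_Fp pp)) -pmulrn in h' *; rewrite h'.
  rewrite (dvdn_pcharf (pchar_Fp pp)); move: h'; rewrite NegzE rmorphN /= -pmulrn.
  by move/eqP; rewrite oppr_eq0.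
move=> /dvdnP[k hk]; exists (sgz (ev x) * k%:Z)%:~R, b; rewrite {1}hb; congr (_ + _).
rewrite -[p%:R]/(p%:Z%:~R) -rmorphM /= -mulrA; congr (_%:~R).
by rewrite -PoszM -hk -intEsg.
Qed.

(** * Submodules and a form of Nakayama's lemma *)

Record submod (N : V -> Prop) : Prop := Submod {
  submod0 : N 0;
  submodD : forall u v, N u -> N v -> N (u + v);
  submodZ : forall a u, N u -> N (a *: u)
}.

Lemma submod_sum N (I : finType) (f : I -> V) : submod N ->
  (forall i, N (f i)) -> N (\sum_i f i).
Proof.
move=> sN h; elim/big_ind: _ => //; [exact: submod0|exact: submodD].
Qed.

Lemma submodN N u : submod N -> N u -> N (- u).
Proof. by move=> sN h; rewrite -scaleN1r; exact: submodZ. Qed.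

Lemma submodB N u v : submod N -> N u -> N v -> N (u - v).
Proof. by move=> sN h h'; apply: submodD => //; exact: submodN. Qed.

Lemma submod_t N n u : submod N -> N (t ^+ n *: u) -> N u.
Proof.
move=> sN h; rewrite -[u]scale1r -(mulVr (tX_unit n)) -scalerA; exact: submodZ.
Qed.

Lemma lincomb_submod N G (c : nat -> 'rV[Laurent]_1) : submod N ->
  (forall l, (l < size G)%N -> N (nth 0 G l)) -> N (lincomb G c).
Proof.
move=> sN h; apply: submod_sum => // l.
by rewrite [c l]mx11_scalar mul_mx_scalar; apply: submodZ => //; exact: h.
Qed.


(** If the combinations of G in N do not reach every value at t = -1 modulo p,
    a functional vanishes on them. If they do, some matrix C of coefficients is
    the identity modulo <p, t + 1>; then det C multiplies the generators into N,
    while 1 - det C lies in <p, t + 1> and has a power acting as zero modulo N. *)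
Lemma nakayama p (pp : prime p) (N : V -> Prop) (G : seq V) (n : nat) : submod N ->
  (forall x, ideal_pow (ideal [:: p%:R; t + 1]) n x -> forall u, N (x *: u)) ->
  (forall l, (l < size G)%N -> N (nth 0 G l)) \/
  exists v : nat -> 'F_p, (exists2 l, (l < size G)%N & v l != 0) /\
    forall c : nat -> 'rV[Laurent]_1, N (lincomb G c) -> psic G v c = 0.
Proof.
move=> sN kill; set r := size G.
pose red (c : nat -> 'rV[Laurent]_1) : 'rV['F_p]_r := \row_l evp p (c l 0 0).
pose W (w : 'rV['F_p]_r) := exists2 c, N (lincomb G c) & w = red c.
have lcD c c' : lincomb G (fun l => c l + c' l) = lincomb G c + lincomb G c'.
  by rewrite /lincomb -big_split; apply: eq_bigr => l _; rewrite mulmxDr.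
have lcZ a c : lincomb G (fun l => a *: c l) = a *: lincomb G c.
  by rewrite /lincomb scaler_sumr; apply: eq_bigr => l _; rewrite scalemxAr.
have W0 : W 0.
  exists (fun=> 0); last by apply/rowP => l; rewrite !mxE rmorph0.
  suff -> : lincomb G (fun=> 0 : 'rV[Laurent]_1) = 0 by exact: submod0.
  by rewrite /lincomb big1 // => l _; rewrite mulmx0.
have WD w w' : W w -> W w' -> W (w + w').
  move=> [c Nc ->] [c' Nc' ->]; exists (fun l => c l + c' l).
    by rewrite lcD; exact: submodD.
  by apply/rowP => l; rewrite !mxE rmorphD.
have WZ (a : 'F_p) w : W w -> W (a *: w).
  move=> [c Nc ->]; exists (fun l => (val a)%:R *: c l).
    by rewrite lcZ; exact: submodZ.
  by apply/rowP => l; rewrite !mxE rmorphM rmorph_nat natr_Zp.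
pose Wm : 'M['F_p]_(#|{: 'rV['F_p]_r}|, r) :=
  \matrix_(i, j) (if `[<W (enum_val i)>] then enum_val i 0 j else 0).
have rowWm i : row i Wm = if `[<W (enum_val i)>] then enum_val i else 0.
  by apply/rowP => j; rewrite !mxE; case: ifP => // _; rewrite mxE.
have [full|nfull] := boolP (row_full Wm).
  left=> l lr; have h k : W (delta_mx 0 k).
    have /submxP[u ->] : ((delta_mx 0 k : 'rV['F_p]_r) <= Wm)%MS by rewrite submx_full.
    rewrite mulmx_sum_row; elim/big_ind: _ => // i _; apply: WZ.
    by rewrite rowWm; case: asboolP.
  have {}h k := cid2 (h k).
  pose C : 'M[Laurent]_r := \matrix_(i, k) sval (h k) i 0 0.
  have C1 : map_mx (evp p) C = 1%:M.
    apply/matrixP => i k; rewrite !mxE; have [_ e] := svalP (h k).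
    by have := congr1 (fun A : 'rV_r => A 0 i) e; rewrite !mxE eqxx /= => <-.
  have [a [b e]] : exists a b : Laurent, 1 - \det C = a * p%:R + b * (t + 1).
    apply: evp_ker => //; rewrite rmorphB rmorph1 -det_map_mx C1 det1 subrr //.
  set x := 1 - \det C in e.
  have xI : x \in ideal [:: p%:R; t + 1].
    apply/asboolP; exists (fun i : 'I_2 => if i == 0 then a else b).
    by rewrite !big_ord_recl big_ord0 addr0 e.
  pose Gm : 'M[Laurent]_(2, r) := \matrix_(i, j) nth 0 G j i 0.
  have GC k : N (col k (Gm *m C)).
    have [Nk _] := svalP (h k); move: Nk; congr N.
    apply/colP => i; rewrite !mxE summxE; apply: eq_bigr => j _; rewrite !mxE.
    by rewrite big_ord_recl big_ord0 addr0.
  have Nd : N (\det C *: nth 0 G l).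
    have -> : \det C *: nth 0 G l = \sum_k (\adj C) k (Ordinal lr) *: col k (Gm *m C).
      have -> : \det C *: nth 0 G l = col (Ordinal lr) (Gm *m C *m \adj C).
        rewrite -mulmxA mul_mx_adj mul_mx_scalar.
        by apply/colP => i; rewrite !mxE.
      apply/colP => i; rewrite summxE mxE mxE; apply: eq_bigr => k _.
      by rewrite !mxE mulrC.
    by apply: submod_sum => // k; exact: submodZ.
  have Nx : N (x ^+ n *: nth 0 G l).
    apply: kill; exists 1%N, (fun=> 1), (fun _ _ => x); split=> //.
    by rewrite big_ord_recl big_ord0 addr0 mul1r prodr_const card_ord.
  have -> : nth 0 G l = (\sum_(i < n) x ^+ i) *: (\det C *: nth 0 G l) + x ^+ n *: nth 0 G l.
    rewrite scalerA -scalerDl -[LHS]scale1r; congr (_ *: _).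
    have -> : \det C = 1 - x by rewrite /x opprB addrC subrK.
    by rewrite mulrC -[X in X * _]opprB mulNr -subrX1 opprB subrK.
  by apply: submodD => //; exact: submodZ.
right; have nz : cokermx Wm != 0.
  apply: contra nfull => /eqP e; have := mxrank_coker Wm; rewrite e mxrank0.
  by move/eqP; rewrite eq_sym subn_eq0 /row_full eqn_leq rank_leq_col.
have [i [j ij]] : exists i j, cokermx Wm i j != 0.
  apply: contrapT => hn; move/eqP: nz; apply; apply/matrixP => i j; rewrite [RHS]mxE.
  by apply: contrapT => hij; apply: hn; exists i, j; apply/eqP.
have := mulmx_coker Wm; move: (cokermx Wm) ij => Q ij WQ.
exists (fun l => if insub l is Some k then Q k j else 0); split.
  by exists i => //; rewrite valK.
move=> c Nc; have Wc : W (red c) by exists c.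
have : row (enum_rank (red c)) Wm *m Q = 0 by rewrite -row_mul WQ row0.
rewrite rowWm enum_rankK (asboolT Wc) => /rowP/(_ j); rewrite !mxE => e.
apply/rowP => k; rewrite (ord1 k) /psic summxE [RHS]mxE -[RHS]e; apply: eq_bigr => l _.
by rewrite !mxE valK mulrC.
Qed.


(** * Computing with polynomial vectors *)

Definition pol := seq Z.
Definition lp (q : pol) : Laurent := foldr (fun a x => zr _ a + t * x) 0 q.

Fixpoint padd (a b : pol) : pol :=
  match a, b with
  | [::], _ => b
  | _, [::] => a
  | x :: a', y :: b' => Z.add x y :: padd a' b'
  end.
Definition pscal (c : Z) (a : pol) : pol := [seq Z.mul c x | x <- a].
Definition pshift (n : nat) (a : pol) : pol := ncons n Z0 a.
Definition pmul (a b : pol) : pol := foldr (fun x r => padd (pscal x b) (Z0 :: r)) [::] a.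
Definition pev (a : pol) : Z := foldr (fun x r => Z.sub x r) Z0 a.
Definition pzero (a : pol) : bool := all (fun x => x == Z0) a.

Lemma lp_add a b : lp (padd a b) = lp a + lp b.
Proof.
elim: a b => [|x a IH] [|y b] /=; rewrite ?add0r ?addr0 //.
by rewrite IH zrD; ring.
Qed.

Lemma lp_scal c a : lp (pscal c a) = zr _ c * lp a.
Proof. by elim: a => [|x a IH] /=; rewrite ?mulr0 // IH zrM; ring. Qed.

Lemma lp_shift n a : lp (pshift n a) = t ^+ n * lp a.
Proof. by elim: n => [|n IH] /=; rewrite ?mul1r // IH zr0 add0r exprS mulrA. Qed.

Lemma lp_mul a b : lp (pmul a b) = lp a * lp b.
Proof.
elim: a => [|x a IH] /=; first by rewrite mul0r.
by rewrite lp_add lp_scal /= IH zr0; ring.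
Qed.

Lemma lp_zero a : pzero a -> lp a = 0.
Proof. by elim: a => //= x a IH /andP[/eqP-> /IH->]; rewrite zr0 mulr0 addr0. Qed.

Lemma evp_zr p z : evp p (zr _ z) = zr _ z.
Proof. by rewrite /zr rmorph_int. Qed.

Lemma evp_lp p a : evp p (lp a) = zr _ (pev a).
Proof.
elim: a => [|x a IH] /=; first by rewrite rmorph0.
by rewrite rmorphD rmorphM /= evp_zr evp_t IH zrB mulN1r.
Qed.

Lemma nth_padd a b l : nth Z0 (padd a b) l = Z.add (nth Z0 a l) (nth Z0 b l).
Proof.
elim: a b l => [|x a IH] [|y b] [|l] //=; rewrite ?nth_nil ?Z.add_0_r //; lia.
Qed.

Lemma nth_pscal c a l : nth Z0 (pscal c a) l = Z.mul c (nth Z0 a l).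
Proof. by elim: a l => [|x a IH] [|l] //=; rewrite ?nth_nil ?Z.mul_0_r. Qed.

Definition pvec := (pol * pol)%type.
Definition pv (x : pvec) : V := \col_i if i == 0 then lp x.1 else lp x.2.
Definition vadd (x y : pvec) : pvec := (padd x.1 y.1, padd x.2 y.2).
Definition vscal (c : Z) (x : pvec) : pvec := (pscal c x.1, pscal c x.2).
Definition vshift (n : nat) (x : pvec) : pvec := (pshift n x.1, pshift n x.2).
Definition vmul (a : pol) (x : pvec) : pvec := (pmul a x.1, pmul a x.2).
Definition vzero (x : pvec) : bool := pzero x.1 && pzero x.2.

Lemma pv_add x y : pv (vadd x y) = pv x + pv y.
Proof. by apply/colP => i; rewrite !mxE; case: ifP; rewrite lp_add. Qed.
Lemma pv_scal c x : pv (vscal c x) = zr _ c *: pv x.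
Proof. by apply/colP => i; rewrite !mxE; case: ifP; rewrite lp_scal. Qed.
Lemma pv_shift n x : pv (vshift n x) = t ^+ n *: pv x.
Proof. by apply/colP => i; rewrite !mxE; case: ifP; rewrite lp_shift. Qed.
Lemma pv_mul a x : pv (vmul a x) = lp a *: pv x.
Proof. by apply/colP => i; rewrite !mxE; case: ifP; rewrite lp_mul. Qed.
Lemma pv_zero x : vzero x -> pv x = 0.
Proof. by move=> /andP[h1 h2]; apply/colP => i; rewrite !mxE; case: ifP; rewrite lp_zero. Qed.

Section Reduction.
Variables (p : nat) (G : seq pvec).
Local Notation Gs := (map pv G).

(* x - y is a combination of the generators with coefficients congruent to k *)
Definition congr_by (x y : pvec) (k : seq Z) : Prop :=
  exists c : nat -> Laurent, pv x = pv y + \sum_(l < size G) c l *: nth 0 Gs l /\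
    forall l, evp p (c l) = zr _ (nth Z0 k l).

Lemma congr_refl x : congr_by x x [::].
Proof.
exists (fun=> 0); split=> [|l]; last by rewrite rmorph0 nth_nil.
by rewrite big1 ?addr0 // => l _; rewrite scale0r.
Qed.

Lemma congr_trans x y z k k' : congr_by x y k -> congr_by y z k' -> congr_by x z (padd k k').
Proof.
move=> [c [e hc]] [c' [e' hc']]; exists (fun l => c l + c' l); split=> [|l].
  rewrite e e' -addrA -big_split /=; congr (_ + _); apply: eq_bigr => l _.
  by rewrite scalerDl addrC.
by rewrite rmorphD /= hc hc' nth_padd zrD.
Qed.

Lemma sum_seqs (comb : seq pol) :
  pv (foldr vadd ([::], [::]) [seq vmul x.1 x.2 | x <- zip comb G]) =
  \sum_(l < size G) lp (nth [::] comb l) *: nth 0 Gs l.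
Proof.
elim: G comb => [|g G' IH] [|c comb] /=.
- by rewrite big_ord0 pv_zero.
- by rewrite big_ord0 pv_zero.
- rewrite pv_zero // big1 // => l _; by rewrite nth_nil scale0r.
- by rewrite pv_add pv_mul IH big_ord_recl.
Qed.

(* An element of a reduction basis: a combination of the generators with its
   leading coordinate, degree and coefficient, and the values at t = -1 of
   its coefficients. *)
Record belt := Belt { bvec : pvec; bcomp : bool; bdeg : nat; blead : Z; bev : seq Z }.

Definition ptrim (a : pol) : pol :=
  foldr (fun x r => if (x == Z0) && nilp r then [::] else x :: r) [::] a.

Definition mkbelt (cb : seq pol * bool) : belt :=
  let b := foldr vadd ([::], [::]) [seq vmul x.1 x.2 | x <- zip cb.1 G] in
  let q := ptrim (if cb.2 then b.2 else b.1) in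
  Belt b cb.2 (size q).-1 (last Z0 q) (map pev cb.1).

Definition red1 (b : belt) (x : pvec * seq Z) (s : nat) : pvec * seq Z :=
  let a := nth Z0 (if bcomp b then x.1.2 else x.1.1) (bdeg b + s) in
  let q := Z.div a (blead b) in
  if q == Z0 then x else
    (vadd x.1 (vscal (Z.opp q) (vshift s (bvec b))),
     padd x.2 (pscal (if odd s then Z.opp q else q) (bev b))).

Definition redb (x : pvec * seq Z) (b : belt) : pvec * seq Z :=
  let n := (size (if bcomp b then x.1.2 else x.1.1) - bdeg b)%N in
  foldl (red1 b) x (rev (iota 0 n)).

Definition reduce (B : seq belt) (x : pvec) : pvec * seq Z := foldl redb (x, [::]) B.

Lemma red1P cb x0 x s : congr_by x0 x.1 x.2 ->
  congr_by x0 (red1 (mkbelt cb) x s).1 (red1 (mkbelt cb) x s).2.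
Proof.
rewrite /red1; case: eqP => // _ /=; set q := Z.div _ _ => h.
apply: (congr_trans h); exists (fun l => (zr _ q * t ^+ s) * lp (nth [::] cb.1 l)); split=> [|l].
  rewrite pv_add pv_scal pv_shift zrN sum_seqs scaleNr !scaler_sumr -addrA.
  rewrite -sumrN -big_split big1 ?addr0 // => l _.
  by rewrite /= !scalerA ?mulrA addrC subrr.
rewrite nth_pscal !rmorphM /= evp_zr rmorphXn /= evp_t evp_lp zrM.
have -> : nth Z0 [seq pev i | i <- cb.1] l = pev (nth [::] cb.1 l).
  by elim: cb.1 l => [|a c IH] [|l] /=; rewrite ?nth_nil.
congr (_ * _); rewrite -signr_odd; case: (odd s); by rewrite ?zrN ?expr1 ?mulrN1 ?mulr1.
Qed.

Lemma redbP cb x0 x : congr_by x0 x.1 x.2 ->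
  congr_by x0 (redb x (mkbelt cb)).1 (redb x (mkbelt cb)).2.
Proof.
rewrite /redb; move: (rev _) => s; elim: s x => //= n s IH x h.
by apply: IH; exact: red1P.
Qed.

Lemma reduceP (cbs : seq (seq pol * bool)) x (r := reduce (map mkbelt cbs) x) :
  congr_by x r.1 r.2.
Proof.
rewrite /r /reduce; have : congr_by x (x, [::] : seq Z).1 (x, [::] : seq Z).2 by exact: congr_refl.
rewrite {r}; move: (x, [::]) => y; elim: cbs y => //= cb cbs IH y h.
by apply: IH; exact: redbP.
Qed.

End Reduction.

(** * Matrices of words *)

Definition pmat := (pvec * pvec)%type.
Definition pm (x : pmat) : M2 := \matrix_(i, j) (if j == 0 then pv x.1 else pv x.2) i 0.
Definition vneg (x : pvec) := vscal (-1)%bZ x.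
Definition mletter (b : bool) (x : pmat) : pmat :=
  if b then (vshift 1 x.2, vneg (vshift 1 (vadd x.1 x.2)))
  else (vneg (vshift 2 x.2), vneg (vshift 1 x.1)).
Definition pm1 : pmat := (([:: 1%bZ], [::]), ([::], [:: 1%bZ])).

Lemma col_pm x : (col 0 (pm x) = pv x.1) * (col 1 (pm x) = pv x.2).
Proof. by split; apply/colP => i; rewrite !mxE. Qed.

Lemma mx_cols (A B : M2) : col 0 A = col 0 B -> col 1 A = col 1 B -> A = B.
Proof.
move=> /colP h0 /colP h1; apply/matrixP => i j.
have [->|->] : j = 0 \/ j = 1 by case: j => [[|[|]]] //= hj; [left|right]; exact: val_inj.
  by have := h0 i; rewrite !mxE.
by have := h1 i; rewrite !mxE.
Qed.

Lemma pm_1 : pm pm1 = 1.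
Proof.
apply: mx_cols; rewrite !col_pm; apply/colP => i; rewrite !mxE /=;
  case: i => [[|[|]]] //= hi; by rewrite /lp /= ?zr1 ?mulr0 ?addr0.
Qed.

Lemma zrN1 S : zr S (-1)%bZ = -1. Proof. by []. Qed.

Lemma pm_letter b x : pm (mletter b x) = pm x * letter b.
Proof.
have c2 (A B : M2) j : col j (A * B) = B 0 j *: col 0 A + B 1 j *: col 1 A.
  apply/colP => i; rewrite !mxE !big_ord_recl big_ord0 addr0.
  have -> : lift ord0 ord0 = 1 :> 'I_2 by exact: val_inj.
  by rewrite ![A i _ * _]mulrC.
apply: mx_cols; rewrite c2 !col_pm; case: b; rewrite /= /vneg ?pv_scal ?pv_shift ?pv_add ?zrN1 !mxE /=.
- by rewrite scale0r add0r expr1.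
- by rewrite !scale0r add0r scaleN1r scaleNr.
- by rewrite scaleN1r expr1 scalerDr opprD !scaleNr.
- by rewrite scale0r addr0 scaleN1r expr1 scaleNr.
Qed.

Definition mats (par : seq (nat * bool)) : seq pmat :=
  foldl (fun ws e => rcons ws (mletter e.2 (nth pm1 ws e.1))) [:: pm1] par.
Definition words (par : seq (nat * bool)) : seq (seq bool) :=
  foldl (fun ws e => rcons ws (rcons (nth [::] ws e.1) e.2)) [:: [::]] par.

Lemma mats_words par : [/\ size (mats par) = (size par).+1,
  size (words par) = (size par).+1 &
  forall i, pm (nth pm1 (mats par) i) = wmat (nth [::] (words par) i)].
Proof.
elim/last_ind: par => [|par e [IH1 IH2 IH3]].
  by split=> //; case=> [|i]; rewrite /= ?nth_nil pm_1 wmat_nil.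
rewrite /mats /words !foldl_rcons -/(mats par) -/(words par) !size_rcons IH1 IH2.
split=> // i; rewrite !nth_rcons IH1 IH2; case: ltnP => // _.
by case: eqP => _; rewrite ?pm_1 ?wmat_nil // pm_letter wmat_rcons IH3.
Qed.

(** * Submodules of index p *)

(* Generators of the combinations of G whose coefficients at t = -1 are
   orthogonal to v modulo p. The first nonzero entry of v has to be 1. *)
Fixpoint child (p : nat) (G : seq pvec) (v : seq Z) : seq pvec :=
  match G, v with
  | g :: G', z :: v' =>
    if z == Z0 then g :: child p G' v' else
    vscal (Z.of_nat p) g :: vmul [:: 1%bZ; 1%bZ] g ::
      [seq vadd x.1 (vscal (Z.opp x.2) g) | x <- zip G' v']
  | _, _ => [::]
  end.

(* Representatives of the lines in F_p^r *)
Definition vecs (p r : nat) : seq (seq Z) :=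
  iter r (fun s => [seq Z.of_nat i :: w | i <- iota 0 p, w <- s]) [:: [::]].
Fixpoint proj (p r : nat) : seq (seq Z) :=
  if r is r'.+1 then [seq 1%bZ :: w | w <- vecs p r'] ++ [seq Z0 :: w | w <- proj p r']
  else [::].

Section Child.
Variable p : nat.
Hypothesis pp : prime p.
Definition zf (v : seq Z) (l : nat) : 'F_p := zr _ (nth Z0 v l).

Lemma vecsP r (v : nat -> 'F_p) : exists2 w, w \in vecs p r &
  size w = r /\ forall l, (l < r)%N -> v l = zf w l.
Proof.
elim: r v => [|r IH] v; first by exists [::].
have [w wr [sw hw]] := IH (fun l => v l.+1).
exists (Z.of_nat (val (v 0%N)) :: w).
  rewrite /vecs iterS; apply/allpairsP; exists (val (v 0%N), w); split=> //.
  rewrite mem_iota /= add0n.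
  by have [_ /Nat2Z.inj_lt/ssrnat.ltP] := zv_bound pp (v 0%N).
split; first by rewrite /= sw.
by case=> [|l] h; [rewrite /zf /= -/(zv _) zr_zv|rewrite /zf /= hw].
Qed.

Lemma projP r (v : nat -> 'F_p) : (exists2 l, (l < r)%N & v l != 0) ->
  exists2 w, w \in proj p r & size w = r /\ exists2 a, a != 0 & forall l, (l < r)%N -> v l = a * zf w l.
Proof.
elim: r v => [|r IH] v; first by case.
have [v0|v0] := eqVneq (v 0%N) 0.
  move=> [[|l] lr vl]; first by rewrite v0 eqxx in vl.
  have [w wr [sw [a a0 hw]]] := IH (fun l => v l.+1) (ex_intro2 _ _ l lr vl).
  exists (Z0 :: w); first by rewrite /= mem_cat map_f ?orbT.
  split; first by rewrite /= sw.
  by exists a => //; case=> [|k] hk; [rewrite v0 /zf /= zr0 mulr0|rewrite hw].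
move=> _; have [w wr [sw hw]] := vecsP r (fun l => v l.+1 / v 0%N).
exists (1%bZ :: w); first by rewrite /= mem_cat map_f.
split; first by rewrite /= sw.
exists (v 0%N) => //; case=> [|k] hk; first by rewrite /zf /= zr1 mulr1.
have -> : zf (1%bZ :: w) k.+1 = zf w k by [].
by rewrite -hw // mulrC mulfVK.
Qed.

Lemma proj_head r w : w \in proj p r -> forall z w', w = z :: w' -> z != Z0 -> z = 1%bZ.
Proof.
by case: r => //= r; rewrite mem_cat => /orP[] /mapP[u _ ->] z w' [<- _].
Qed.

Lemma lincomb_cons n g (G : seq V) (c : nat -> 'rV[Laurent]_n) :
  lincomb (g :: G) c = g *m c 0%N + lincomb G (fun l => c l.+1).
Proof. by rewrite /lincomb big_ord_recl. Qed.

Lemma psic_cons n g (G : seq V) (v : nat -> 'F_p) (c : nat -> 'rV[Laurent]_n) :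
  psic (g :: G) v c = v 0%N *: map_mx (evp p) (c 0%N) + psic G (fun l => v l.+1) (fun l => c l.+1).
Proof. by rewrite /psic big_ord_recl. Qed.

(** A combination killed by the functional lies in every submodule containing
    the generators of the child. *)
Lemma childP (M : V -> Prop) (G : seq pvec) (w : seq Z) r (x : V) : submod M ->
  size w = size G -> w \in proj p r ->
  (forall y, y \in child p G w -> M (pv y)) ->
  Psi (map pv G) (zf w) x 0 -> M x.
Proof.
move=> sM; elim: G w r x => [|g G IH] [|z w] r x //= => [_ _ _|[sw] wr].
  by move=> [c -> _]; rewrite /lincomb big_ord0; exact: submod0.
case: eqP => [z0|/eqP z0] hM [c -> e].
  rewrite lincomb_cons; apply: submodD => //.
    rewrite [c 0%N]mx11_scalar mul_mx_scalar; apply: submodZ => //.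
    by apply: hM; rewrite inE eqxx.
  case: r wr => //= r; rewrite mem_cat => /orP[/mapP[u _ [e1]]|/mapP[u ur [_ uw]]].
    by rewrite z0 in e1.
  rewrite -{}uw {u} in ur; apply: (IH w r) => // [y hy|].
    by apply: hM; rewrite inE hy orbT.
  exists (fun l => c l.+1) => //; rewrite e psic_cons /zf /= z0 zr0 scale0r add0r.
  by apply: eq_bigr => l _.
have {}z0 : z = 1%bZ := proj_head wr erefl z0.
pose a l := c l 0 0; have cE l : c l = (a l)%:M by exact: mx11_scalar.
have e0 : evp p (a 0%N + \sum_(l < size G) zr _ (nth Z0 w l) * a l.+1) = 0.
  have := congr1 (fun A : 'rV_1 => A 0 0) e; rewrite psic_cons /psic size_map [LHS]mxE => ->.
  rewrite mxE summxE rmorphD rmorph_sum; congr (_ + _).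
    by rewrite !mxE /zf /= z0 zr1 mul1r.
  by apply: eq_bigr => l _; rewrite rmorphM /= evp_zr !mxE.
have [b1 [b2 eb]] := evp_ker pp e0.
have Mpg : M (p%:R *: pv g) by rewrite -zrn -pv_scal; apply: hM; rewrite inE eqxx.
have Mtg : M ((t + 1) *: pv g).
  have := hM (vmul [:: 1%bZ; 1%bZ] g); rewrite inE inE eqxx orbT pv_mul => /(_ isT).
  by congr (M (_ *: _)); rewrite /lp /= zr1; ring.
have Ml (l : 'I_(size G)) : M (nth 0 (map pv G) l - zr _ (nth Z0 w l) *: pv g).
  have : M (pv (vadd (nth ([::], [::]) G l) (vscal (Z.opp (nth Z0 w l)) g))).
    apply: hM; rewrite !inE; apply/orP; right; apply/orP; right.
    apply/mapP; exists (nth ([::], [::]) G l, nth Z0 w l) => //.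
    by rewrite -nth_zip // mem_nth // size_zip sw minnn.
  by rewrite pv_add pv_scal zrN scaleNr (nth_map ([::], [::])).
rewrite lincomb_cons cE mul_mx_scalar /lincomb size_map.
have -> : a 0%N *: pv g + \sum_(l < size G) nth 0 (map pv G) l *m c l.+1 =
  (b1 *: (p%:R *: pv g) + b2 *: ((t + 1) *: pv g)) +
  \sum_(l < size G) a l.+1 *: (nth 0 (map pv G) l - zr _ (nth Z0 w l) *: pv g).
  rewrite !scalerA -scalerDl -eb scalerDl -addrA; congr (_ + _).
  rewrite scaler_suml -big_split; apply: eq_bigr => l _ /=.
  by rewrite cE mul_mx_scalar scalerBr scalerA [a _ * _]mulrC addrC subrK.
apply: submodD => //; first by apply: submodD => //; exact: submodZ.
by apply: submod_sum => // l; exact: submodZ.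
Qed.

End Child.


(** * Descending along submodules *)

Lemma inM_submod G : submod (@inM G 1).
Proof.
split=> [|u v [c ->] [c' ->]|a u [c ->]].
- by exists (fun=> 0); rewrite /lincomb big1 // => l _; rewrite mulmx0.
- exists (fun l => c l + c' l); rewrite /lincomb -big_split.
  by apply: eq_bigr => l _; rewrite mulmxDr.
- exists (fun l => a *: c l); rewrite /lincomb scaler_sumr.
  by apply: eq_bigr => l _; rewrite scalemxAr.
Qed.

Lemma inM_gen G l : (l < size G)%N -> @inM G 1 (nth 0 G l).
Proof.
move=> h; exists (fun k => if k == l then 1%:M else 0).
rewrite /lincomb (bigD1 (Ordinal h)) //= eqxx mulmx1 big1 ?addr0 // => k.
by rewrite -val_eqE /= => /negPf ->; rewrite mulmx0.
Qed.

Lemma inM_sub G (M : V -> Prop) u : submod M -> (forall l, (l < size G)%N -> M (nth 0 G l)) ->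
  @inM G 1 u -> M u.
Proof. by move=> sM h [c ->]; exact: lincomb_submod. Qed.

Lemma submod_pull (K : V -> Prop) (g : M2) : submod K -> submod (fun u => K (g *m u)).
Proof.
move=> sK; split=> [|u v hu hv|a u hu].
- by rewrite mulmx0; exact: submod0.
- by rewrite mulmxDr; exact: submodD.
- by rewrite -scalemxAr; exact: submodZ.
Qed.

Lemma conj_sub1 (g h : M2) (u : V) : g \is a GRing.unit ->
  (g^-1 * h * g - 1) *m u = g^-1 *m ((h - 1) *m (g *m u)).
Proof.
move=> ug; rewrite !mulmxA; congr (_ *m _).
by rewrite -!mulmxE !mulmxE mulrBr mulrBl mulr1 mulVr.
Qed.

Section Step.
Variables (p : nat) (pp : prime p) (K : V -> Prop) (n : nat).
Hypothesis sK : submod K.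
Hypothesis kill : forall x, ideal_pow (ideal [:: p%:R; t + 1]) n x -> forall u, K (x *: u).
Variables (G : seq pvec) (g : M2).
Hypothesis Bg : Bu3 g.
Local Notation Gs := (map pv G).
Hypothesis below : forall h, HN K h -> HN (@inM Gs 1) (g^-1 * h * g).

(** Either the subgroup is found, or it lies in one of index p smaller module. *)
Lemma node_step : conj_Bu3 (HN K) (HN (@inM Gs 1)) \/
  exists w, [/\ w \in proj p (size G), size w = size G, wdef Gs (zf p w) &
    forall h, HN K h -> HPsi Gs (zf p w) (g^-1 * h * g)].
Proof.
have ug := Bu3_unit Bg; pose N u := K (g *m u); have sN : submod N := submod_pull g sK.
have killN x : ideal_pow (ideal [:: p%:R; t + 1]) n x -> forall u, N (x *: u).
  by move=> hx u; rewrite /N -scalemxAr; exact: kill.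
have [all|[v [vnz hv]]] := nakayama pp Gs sN killN.
  left; exists g^-1; first exact: Bu3_inv.
  apply/seteqP; split=> h.
    move=> Hh; exists (g^-1 * h * g); first exact: below.
    by rewrite invrK !mulrA divrr // mul1r mulrK.
  move=> [k [Bk hk] <-]; rewrite invrK.
  split=> [|u]; first exact: Bu3_mul (Bu3_mul Bg Bk) (Bu3_inv Bg).
  have := conj_sub1 k u (_ : g^-1 \is a GRing.unit); rewrite invrK unitrV => /(_ ug) ->.
  by apply: (inM_sub sN all); exact: hk.
have [l lG vl] := vnz; rewrite size_map in lG.
have [w wp [sw [a a0 hw]]] := projP pp (ex_intro2 _ _ l lG vl).
have hw' (c : nat -> 'rV[Laurent]_1) : N (lincomb Gs c) -> psic Gs (zf p w) c = 0.
  move=> /hv e; apply/eqP; have : a *: psic Gs (zf p w) c = 0.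
    rewrite -[RHS]e /psic scaler_sumr; apply: eq_bigr => k _.
    by rewrite scalerA hw // -(size_map pv).
  by move/eqP; rewrite scaler_eq0 (negPf a0).
right; exists w; split=> // [s [c e ->]|h Hh].
  by apply: hw'; rewrite -e; exact: submod0.
have [Bh hh] := below Hh; rewrite -HPsiE; split=> // u.
have [c e] := hh u; exists c => //; apply/esym/hw'; rewrite -e conj_sub1 // /N (mulmxA g).
have gg : g *m g^-1 = 1%:M by exact: mulrV.
by rewrite gg mul1mx; have [_] := Hh; exact.
Qed.

End Step.

(** A word carrying the smaller module into M conjugates its group into that
    of M, which moves the descent to another node. *)
Lemma match_step p (pp : prime p) (G : seq pvec) w (M : V -> Prop) (u h : M2) : submod M ->
  Bu3 u -> size w = size G -> w \in proj p (size G) ->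
  (forall y, y \in child p G w -> M (u *m pv y)) ->
  HPsi (map pv G) (zf p w) h -> HN M (u * h * u^-1).
Proof.
move=> sM Bu sw wp hy; rewrite -HPsiE => -[Bh hh]; split=> [|x].
  exact: Bu3_mul (Bu3_mul Bu Bh) (Bu3_inv Bu).
have uu := Bu3_unit Bu; have := @conj_sub1 u^-1 h x; rewrite invrK unitrV => -> //.
by apply: (childP pp (submod_pull u sM) sw wp hy); exact: hh.
Qed.

(** * Tables of cosets *)

Section Table.
Variables (G : seq V) (N : nat) (W : nat -> M2) (nx en em : bool -> nat -> nat) (d : nat).
Hypotheses (N0 : (0 < N)%N) (W0 : W 0%N = 1).
Hypothesis nxN : forall x i, (i < N)%N -> (nx x i < N)%N.
Hypothesis transM : forall x i, (i < N)%N ->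
  inM G (t ^+ en x i *: (W i * letter x) - t ^+ em x i *: W (nx x i)).
Hypothesis d_even : ~~ odd d.
Hypothesis tauM : inM G (t ^+ d *: 1 - 1 : M2).
Variable F : V -> Prop.
Hypotheses (sF : submod F) (FG : forall l, (l < size G)%N -> F (nth 0 G l)).
Hypothesis F_dist : forall j a b, (j < N)%N ->
  (forall u, F ((t ^+ a *: W j - t ^+ b *: 1) *m u)) -> j = 0%N /\ a = b %[mod d].

Lemma inM_mul n m (D : 'M_(2, n)) (E : 'M_(n, m)) : inM G D -> inM G (D *m E).
Proof.
move=> [c ->]; exists (fun l => c l *m E).
by rewrite /lincomb mulmx_suml; apply: eq_bigr => l _; rewrite mulmxA.
Qed.

Lemma inM_B n (D D' : 'M_(2, n)) : inM G D -> inM G D' -> inM G (D - D').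
Proof.
move=> [c ->] [c' ->]; exists (fun l => c l - c' l).
by rewrite /lincomb -sumrB; apply: eq_bigr => l _; rewrite mulmxBr.
Qed.

Lemma inM_Z n a (D : 'M_(2, n)) : inM G D -> inM G (a *: D).
Proof.
move=> [c ->]; exists (fun l => a *: c l).
by rewrite /lincomb scaler_sumr; apply: eq_bigr => l _; rewrite scalemxAr.
Qed.

Lemma inM_F n (D : 'M_(2, n)) : inM G D -> forall u, F (D *m u).
Proof. by move=> h u; apply: (inM_sub sF FG); exact: inM_mul. Qed.

Lemma inM_cols n (D : 'M_(2, n)) : (forall u : 'cV_n, inM G (D *m u)) -> inM G D.
Proof.
move=> h; have zw c : psic G (fun=> 0 : 'F_2) c = 0 :> 'rV_n.
  by rewrite /psic big1 // => l _; rewrite scale0r.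
have [|c e _] := @Psi_cols 2 G (fun=> 0) n D 0; last by exists c.
move=> u; have [c e] := h u; exists c => //.
by rewrite mul0mx /psic big1 // => l _; rewrite scale0r.
Qed.

(* All words starting at a vertex *)
Lemma table_run i w : (i < N)%N -> exists a b,
  inM G (t ^+ a *: (W i * wmat w) - t ^+ b *: W (foldl (fun j x => nx x j) i w)).
Proof.
move=> iN; elim/last_ind: w => [|w x [a [b IH]]].
  by exists 0%N, 0%N; rewrite wmat_nil mulr1 /= subrr; exists (fun=> 0); rewrite /lincomb big1 // => l _; rewrite mulmx0.
rewrite foldl_rcons wmat_rcons; set j := foldl _ _ _ in IH *.
have jN : (j < N)%N by rewrite /j; elim: (w) i iN {j IH} => //= y w' IH' i /nxN-/(_ y) /IH'.
exists (en x j + a)%N, (b + em x j)%N.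
have := inM_B (inM_Z (t ^+ en x j) (inM_mul (letter x) IH)) (inM_Z (- t ^+ b) (transM x jN)).
congr (inM G _); rewrite mulmxBl -!scalemxAl !mulmxE !mulrA.
move: (W i * wmat w * letter x) (W j * letter x) (W (nx x j)) => A B C.
by apply/matrixP => k l; rewrite !mxE !exprD; ring.
Qed.

Lemma tauM_iter n : inM G (t ^+ (n * d) *: 1 - 1 : M2).
Proof.
elim: n => [|n IH].
  by rewrite mul0n expr0 scale1r subrr; exists (fun=> 0); rewrite /lincomb big1 // => l _; rewrite mulmx0.
have := inM_B (inM_Z (t ^+ d) IH) (inM_Z (-1) tauM).
rewrite scalerBr scalerA -exprD scaleN1r opprK mulSn; congr (inM G _).
by rewrite addrA subrK.
Qed.

Lemma tauM_W x y : x = y %[mod d] -> inM G (t ^+ x *: 1 - t ^+ y *: 1 : M2).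
Proof.
wlog le : x y / (y <= x)%N => [hw e|e].
  have [le|/ltnW le] := leqP y x; first exact: hw.
  by rewrite -opprB -scaleN1r; apply: inM_Z; exact: hw.
have dv : (d %| x - y)%N by rewrite -eqn_mod_dvd //; apply/eqP.
have -> : x = (y + (x - y) %/ d * d)%N by rewrite divnK // subnKC.
by have := inM_Z (t ^+ y) (tauM_iter ((x - y) %/ d)); rewrite scalerBr scalerA -exprD.
Qed.

(** A finite quotient separating the vertices of the table determines the group. *)
Lemma HN_table h : HN F h -> HN (@inM G 1) h.
Proof.
move=> [Bh Fh]; split=> //; have [w [n [m e]]] := Bu3_word Bh.
have [a [b]] := table_run w N0; set k := foldl _ _ _; rewrite W0 mul1r => hab.
have kN : (k < N)%N by rewrite /k; elim: (w) 0%N N0 => //= y w' IH' i /nxN-/(_ y) /IH'.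
have {e} e : t ^+ (a + n) *: h = t ^+ (m + a) *: wmat w.
  by rewrite exprD -scalerA e scalerA -exprD addnC.
have h1 : inM G (t ^+ (a + n) *: h - t ^+ (m + b) *: W k).
  by have := inM_Z (t ^+ m) hab; rewrite scalerBr !scalerA -!exprD e.
have [k0 eqd] : k = 0%N /\ (m + b)%N = (a + n)%N %[mod d].
  apply: F_dist => // u.
  have -> : (t ^+ (m + b) *: W k - t ^+ (a + n) *: 1) *m u =
     t ^+ (a + n) *: ((h - 1) *m u) - (t ^+ (a + n) *: h - t ^+ (m + b) *: W k) *m u.
    rewrite scalemxAl -mulmxBl; congr (_ *m _); rewrite scalerBr.
    by rewrite opprB [RHS]addrC addrA subrK.
  by apply: (submodB sF); [apply: submodZ|exact: inM_F].
have h2 := tauM_W eqd; rewrite k0 W0 in h1 => u.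
apply: (submod_t (n := a + n) (inM_submod G)).
have -> : t ^+ (a + n) *: ((h - 1) *m u) =
  ((t ^+ (a + n) *: h - t ^+ (m + b) *: 1) + (t ^+ (m + b) *: 1 - t ^+ (a + n) *: 1)) *m u.
  by rewrite scalemxAl scalerBr addrA subrK.
by rewrite mulmxDl; apply: (submodD (inM_submod G)); exact: inM_mul.
Qed.

Hypothesis nx3 : forall i, (i < N)%N -> nx true (nx true (nx true i)) = i.
Hypothesis nx2 : forall i, (i < N)%N -> nx false (nx false i) = i.
Hypothesis reach : forall j, (j < N)%N -> exists w, foldl (fun j x => nx x j) 0%N w = j.
Local Notation go := (foldl (fun j x => nx x j)).

Lemma go_lt w i : (i < N)%N -> (go i w < N)%N.
Proof. by elim: w i => //= x w IH i iN; apply: IH; exact: nxN. Qed.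

Lemma go_back w i : (i < N)%N -> exists u, go (go i w) u = i.
Proof.
elim: w i => [|x w IH] i iN /=; first by exists [::].
have [u hu] := IH _ (nxN x iN).
exists (u ++ (if x then [:: true; true] else [:: false])).
by rewrite foldl_cat hu; case: x {hu} => /=; [exact: nx3|exact: nx2].
Qed.

Lemma go_inj w i j : (i < N)%N -> (j < N)%N -> go i w = go j w -> i = j.
Proof.
elim: w i j => //= x w IH i j iN jN /(IH _ _ (nxN x iN) (nxN x jN)).
by case: x => e; [rewrite -(nx3 iN) e nx3|rewrite -(nx2 iN) e nx2].
Qed.

(** It is enough to separate the vertices from the initial one: a word leading
    from j to the initial vertex carries a coincidence at i and j to one there,
    and words act injectively on vertices. *)
Lemma table_dist i j a b : (i < N)%N -> (j < N)%N ->
  inM G (t ^+ a *: W i - t ^+ b *: W j) -> i = j /\ a = b %[mod d].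
Proof.
move=> iN jN h; have [w wj] := reach jN; have [u hu] := go_back w N0; rewrite wj in hu.
have [a1 [b1 h1]] := table_run u iN; have [a2 [b2]] := table_run u jN.
rewrite hu W0 => h2; set k := go i u in h1.
have key : inM G (t ^+ (b1 + (a + a2)) *: W k - t ^+ (a1 + (b + b2)) *: 1).
  have e3 := inM_Z (t ^+ (a1 + a2)) (inM_mul (wmat u) h).
  have := inM_B (inM_B e3 (inM_Z (t ^+ (a + a2)) h1)) (inM_Z (- t ^+ (a1 + b)) h2).
  congr (inM G _); rewrite mulmxE mulrBl -!scalerAl.
  by apply/matrixP => x y; rewrite !mxE !exprD; ring.
have [k0 ab] : k = 0%N /\ (b1 + (a + a2))%N = (a1 + (b + b2))%N %[mod d].
  by apply: F_dist; [exact: go_lt|exact: inM_F].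
have ij : i = j by apply: (go_inj (w := u)) => //; rewrite hu -k0.
split=> //; rewrite -ij in h2.
have key2 : inM G (t ^+ (b1 + a2) *: 1 - t ^+ (a1 + b2) *: 1 : M2).
  rewrite k0 W0 in h1; have := inM_B (inM_Z (t ^+ a1) h2) (inM_Z (t ^+ a2) h1).
  congr (inM G _).
  by apply/matrixP => x y; rewrite !mxE !exprD; ring.
have [_ e] : 0%N = 0%N /\ (b1 + a2)%N = (a1 + b2)%N %[mod d].
  by apply: F_dist => //; rewrite W0; exact: inM_F.
apply/eqP; rewrite -(eqn_modDl (a1 + b2)) -modnDml -e modnDml.
by move/eqP: ab; rewrite !addnA; congr (_ %% _ == _ %% _)%N; lia.
Qed.

End Table.


(** * Evaluation at an invertible matrix *)

Lemma lpolyD a b : lpoly (a + b) = lpoly a + lpoly b.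
Proof. by rewrite /lpoly rmorphD hornerD. Qed.
Lemma lpolyM a b : lpoly (a * b) = lpoly a * lpoly b.
Proof. by rewrite /lpoly rmorphM hornerM. Qed.
Lemma lpolyXn n : lpoly 'X^n = t ^+ n.
Proof. by rewrite /lpoly map_polyXn hornerXn. Qed.
Lemma lpolyC c : lpoly c%:P = c%:~R.
Proof. by rewrite /lpoly map_polyC hornerC. Qed.
Lemma lpoly_inj : injective lpoly.
Proof.
move=> a b /(congr1 val); rewrite !val_lpoly => /eqP; rewrite tofrac_eq => /eqP //.
Qed.

Section Evaluation.
Variables (R : comUnitRingType) (m : nat) (T : 'M[R]_m.+1).
Hypothesis uT : T \is a GRing.unit.

Definition hpoly (q : {poly int}) : 'M[R]_m.+1 := horner_mx T (map_poly intr q).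

Lemma hpolyD a b : hpoly (a + b) = hpoly a + hpoly b.
Proof. by rewrite /hpoly !rmorphD. Qed.
Lemma hpolyM a b : hpoly (a * b) = hpoly a * hpoly b.
Proof. by rewrite /hpoly !rmorphM. Qed.
Lemma hpolyXn n : hpoly 'X^n = T ^+ n.
Proof. by rewrite /hpoly map_polyXn rmorphXn /= horner_mx_X. Qed.

Definition hom (x : Laurent) : 'M[R]_m.+1 :=
  xget 0 [set k | exists n q, t ^+ n * x = lpoly q /\ T ^+ n * k = hpoly q].

(** The value is well defined because t is mapped to an invertible matrix and
    Laurent polynomials have a unique numerator for a given power of t. *)
Lemma homE x n q : t ^+ n * x = lpoly q -> T ^+ n * hom x = hpoly q.
Proof.
move=> e; have uTn k : T ^+ k \is a GRing.unit by exact: unitrX.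
suff <- : T ^- n * hpoly q = hom x by rewrite mulVKr.
symmetry; apply: xget_unique; first by exists n, q; rewrite mulVKr.
move=> k [n' [q' [e' e2]]]; apply: (mulrI (uTn n)); rewrite mulVKr //.
apply: (mulrI (uTn n')); rewrite mulrA -exprD addnC exprD -mulrA e2.
rewrite -!hpolyXn -!hpolyM; congr hpoly; apply: lpoly_inj.
by rewrite !lpolyM !lpolyXn -e -e' mulrCA.
Qed.

Lemma homD x y : hom (x + y) = hom x + hom y.
Proof.
have [n [q e]] := laurent_lpoly x; have [n' [q' e']] := laurent_lpoly y.
apply: (mulrI (unitrX (n + n') uT)).
rewrite (@homE _ _ ('X^n' * q + 'X^n * q')); last first.
  by rewrite lpolyD !lpolyM !lpolyXn -e -e' exprD; ring.
rewrite hpolyD !hpolyM !hpolyXn -(homE e) -(homE e') mulrDr !mulrA -!exprD.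
by rewrite [(n' + n)%N]addnC.
Qed.

Lemma homM x y : hom (x * y) = hom x * hom y.
Proof.
have [n [q e]] := laurent_lpoly x; have [n' [q' e']] := laurent_lpoly y.
apply: (mulrI (unitrX (n + n') uT)).
rewrite (@homE _ _ (q * q')); last by rewrite lpolyM -e -e' exprD; ring.
rewrite hpolyM -(homE e') [(n + n')%N]addnC exprD -mulrA (mulrA (T ^+ n)) (homE e).
by rewrite !mulrA -!hpolyXn -!hpolyM [q * _]mulrC.
Qed.

Lemma homC x y : hom x * hom y = hom y * hom x.
Proof. by rewrite -!homM mulrC. Qed.

Lemma hom_t : hom t = T.
Proof.
have := @homE t 0 'X; rewrite !expr0 !mul1r => ->.
  by rewrite -[X in hpoly X]expr1 hpolyXn expr1.
by rewrite -[X in lpoly X]expr1 lpolyXn expr1.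
Qed.

Lemma hom_zr z : hom (zr _ z) = (zr R z)%:M.
Proof.
have := @homE (zr _ z) 0 (int_of_Z z)%:P; rewrite !expr0 !mul1r lpolyC => -> //.
by rewrite /hpoly map_polyC /= horner_mx_C.
Qed.

Lemma hom_tn n : hom (t ^+ n) = T ^+ n.
Proof.
elim: n => [|n IH]; last by rewrite !exprS homM IH hom_t.
by rewrite !expr0 -[1](zr1 Laurent) hom_zr zr1.
Qed.

(** The image of a vector in the module over the Laurent polynomials generated
    by two columns *)
Definition Fh (a : 'cV[R]_m.+1 * 'cV[R]_m.+1) (x : V) : 'cV[R]_m.+1 :=
  hom (x 0 0) *m a.1 + hom (x 1 0) *m a.2.

Lemma FhD a x y : Fh a (x + y) = Fh a x + Fh a y.
Proof. by rewrite /Fh !mxE !homD !mulmxDl addrACA. Qed.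

Lemma hom0 : hom 0 = 0.
Proof. by rewrite -[X in hom X](zr0 Laurent) hom_zr zr0 raddf0. Qed.

Lemma homN x : hom (- x) = - hom x.
Proof. by apply/eqP; rewrite -addr_eq0 -homD addNr hom0. Qed.

Lemma FhB a x y : Fh a (x - y) = Fh a x - Fh a y.
Proof. by rewrite FhD; congr (_ + _); rewrite /Fh !mxE !homN !mulNmx opprD. Qed.

Lemma FhZ a c x : Fh a (c *: x) = hom c *m Fh a x.
Proof. by rewrite /Fh !mxE !homM mulmxDr !mulmxA. Qed.

Lemma Fh_submod a : submod (fun x => Fh a x = 0).
Proof.
split=> [|x y hx hy|c x hx].
- by rewrite /Fh !mxE hom0 !mul0mx addr0.
- by rewrite FhD hx hy addr0.
- by rewrite FhZ hx mulmx0.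
Qed.

Definition Fm (a : 'cV[R]_m.+1 * 'cV[R]_m.+1) (D : M2) :=
  (Fh a (col 0 D), Fh a (col 1 D)).

Lemma Fh_mul a (D : M2) x : Fh a (D *m x) = Fh (Fm a D) x.
Proof.
have -> : D *m x = x 0 0 *: col 0 D + x 1 0 *: col 1 D.
  apply/colP => i; rewrite !mxE !big_ord_recl big_ord0 addr0.
  have -> : lift ord0 ord0 = 1 :> 'I_2 by exact: val_inj.
  by rewrite ![D i _ * _]mulrC.
by rewrite FhD !FhZ.
Qed.

Lemma Fm_mul a (D E : M2) : Fm a (D * E) = Fm (Fm a D) E.
Proof. by rewrite /Fm; congr pair; rewrite -Fh_mul -mulmxE colE -mulmxA -colE. Qed.

Lemma Fm1 a : Fm a 1 = a.
Proof.
rewrite /Fm /Fh !mxE /= hom0 -[1](zr1 Laurent) hom_zr zr1 !mul1mx !mul0mx.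
by rewrite addr0 add0r -surjective_pairing.
Qed.

Lemma Fm_t a n (D : M2) : Fm a (t ^+ n *: D) = (T ^+ n *m (Fm a D).1, T ^+ n *m (Fm a D).2).
Proof.
by rewrite /Fm /= -!hom_tn -!FhZ; congr (Fh _ _, Fh _ _); apply/colP => i; rewrite !mxE.
Qed.

Definition Fletter (b : bool) (a : 'cV[R]_m.+1 * 'cV[R]_m.+1) :=
  if b then (T *m a.2, - (T *m (a.1 + a.2)))
  else (- (T *m (T *m a.2)), - (T *m a.1)).

Lemma Fm_letter a b : Fm a (letter b) = Fletter b a.
Proof.
rewrite /Fm /Fh; case: b; rewrite /= !mxE /= ?homN ?hom0 ?hom_t ?hom_tn ?mul0mx ?mulNmx ?addr0 ?add0r.
  by rewrite mulmxDr opprD.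
by rewrite expr2 mulmxA.
Qed.

Lemma Fm_power a d D x y (e := ((x + d.-1 * y) %% d)%N) : (0 < d)%N ->
  T ^+ d *m a.1 = a.1 -> T ^+ d *m a.2 = a.2 ->
  (forall u, Fh a ((t ^+ x *: D - t ^+ y *: 1) *m u) = 0) ->
  T ^+ e *m (Fm a D).1 = a.1 /\ T ^+ e *m (Fm a D).2 = a.2.
Proof.
move=> d0 per1 per2 h.
have hc u : Fh a ((t ^+ x *: D) *m u) = Fh a ((t ^+ y *: 1) *m u).
  by apply/eqP; rewrite -subr_eq0 -FhB -mulmxBl h.
have : Fm a (t ^+ x *: D) = Fm a (t ^+ y *: 1) by rewrite /Fm !colE !hc.
rewrite !Fm_t Fm1 => -[e1 e2].
have key (z w : 'cV_m.+1) : T ^+ x *m z = T ^+ y *m w -> T ^+ d *m w = w -> T ^+ e *m z = w.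
  move=> hxy hy; have hy' k : T ^+ (k * d) *m w = w.
    elim: k => [|k IH]; first by rewrite mul0n mul1mx.
    by rewrite mulSn exprD -mulmxE -mulmxA IH.
  have uk : T ^+ ((x + d.-1 * y) %/ d * d) \in unitmx by exact: unitrX.
  apply: (can_inj (mulKmx uk)); rewrite hy' mulmxA mulmxE -exprD -divn_eq addnC exprD.
  rewrite -mulmxE -mulmxA hxy mulmxA mulmxE -exprD -mulSnr (prednK d0) mulnC.
  exact: hy'.
by split; apply: key.
Qed.

End Evaluation.

(** * Finite modules given by lists of integers *)

Section ZnLists.
Variable n : nat.
Hypothesis n1 : (1 < n)%N.
Local Notation Zn := (Z.of_nat n).

Lemma zrn_mod a : zr 'Z_n (Z.modulo a Zn) = zr 'Z_n a.
Proof.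
rewrite [in RHS](Z.div_mod a Zn); last by move: n1; lia.
by rewrite zrD zrM zrn pchar_Zp // mul0r add0r.
Qed.

Lemma zrn_eq0 a : (zr 'Z_n a == 0) = (Z.modulo a Zn == Z0).
Proof.
have hb : (0 <= Z.modulo a Zn < Zn)%bZ by apply: Z.mod_pos_bound; move: n1; lia.
rewrite -zrn_mod; move: (Z.modulo a Zn) hb => b hb.
rewrite -(Z2Nat.id b) ?zrn; last by case: hb.
have bn : (Z.to_nat b < n)%N by lia.
rewrite -val_eqE [X in X == _](val_Zp_nat n1) modn_small //=; lia.
Qed.

Variable m : nat.

Definition zvec (v : seq Z) : 'cV['Z_n]_m.+1 := \col_i zr _ (nth Z0 v i).
Definition zmat (A : seq (seq Z)) : 'M['Z_n]_m.+1 := \matrix_(i, j) zr _ (nth Z0 (nth [::] A i) j).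

Definition dotz (r v : seq Z) : Z := foldr (fun x s => Z.add (Z.mul x.1 x.2) s) Z0 (zip r v).
Definition mulv (A : seq (seq Z)) (v : seq Z) : seq Z := [seq Z.modulo (dotz r v) Zn | r <- A].
Definition vz (v : seq Z) : bool := all (fun a => Z.modulo a Zn == Z0) v.

Lemma zvec_add u v : zvec (padd u v) = zvec u + zvec v.
Proof. by apply/colP => i; rewrite !mxE nth_padd zrD. Qed.

Lemma zvec_scal c u : zvec (pscal c u) = zr _ c *: zvec u.
Proof. by apply/colP => i; rewrite !mxE nth_pscal zrM. Qed.

Lemma zvec_opp u : zvec (pscal (-1)%bZ u) = - zvec u.
Proof. by rewrite zvec_scal zrN1 scaleN1r. Qed.

Lemma zvec_nil : zvec [::] = 0.
Proof. by apply/colP => i; rewrite !mxE nth_nil zr0. Qed.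

Lemma zr_dotz (S : pzRingType) r v k : (size v <= k)%N ->
  zr S (dotz r v) = \sum_(j < k) zr S (nth Z0 r j) * zr S (nth Z0 v j).
Proof.
elim: r v k => [|a r IH] [|b v] k sv; rewrite /dotz /=.
- by rewrite big1 ?zr0 // => j _; rewrite !nth_nil zr0 mul0r.
- by rewrite big1 ?zr0 // => j _; rewrite !nth_nil zr0 mul0r.
- by rewrite big1 ?zr0 // => j _; rewrite !nth_nil zr0 mulr0.
case: k sv => // k sv; rewrite big_ord_recl zrD zrM -/(dotz r v) (IH v k) //.
Qed.

Lemma zvec_mul A v : (size v <= m.+1)%N -> zvec (mulv A v) = zmat A *m zvec v.
Proof.
move=> sv; apply/colP => i; rewrite !mxE.
rewrite (_ : nth Z0 (mulv A v) i = Z.modulo (dotz (nth [::] A i) v) Zn); last first.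
  have [iA|iA] := ltnP i (size A); first by rewrite (nth_map [::]).
  by rewrite !nth_default ?size_map //; case: (v) => [|? ?]; rewrite /dotz /= Z.mod_0_l //; move: n1; lia.
rewrite zrn_mod (zr_dotz _ _ sv); apply: eq_bigr => j _; by rewrite !mxE.
Qed.

Lemma vz0 v : vz v -> zvec v = 0.
Proof.
move=> h; apply/colP => i; rewrite !mxE; apply/eqP; rewrite zrn_eq0.
have [iv|iv] := ltnP i (size v); first exact: (all_nthP Z0 h).
by rewrite nth_default // Z.mod_0_l //; move: n1; lia.
Qed.

Lemma vzP v : (size v <= m.+1)%N -> zvec v = 0 -> vz v.
Proof.
move=> sv e; apply/(all_nthP Z0) => i iv; rewrite -zrn_eq0.
have := congr1 (fun A : 'cV_m.+1 => A (Ordinal (leq_trans iv sv)) 0) e.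
by rewrite !mxE => ->.
Qed.

End ZnLists.

(* A finite quotient of the free module on two generators: the ring Z/n, the
   matrix of t with its inverse, and the images of the generators *)
Record model := Model {
  mod_n : nat; mod_T : seq (seq Z); mod_V : seq (seq Z);
  mod_1 : seq Z; mod_2 : seq Z
}.

Section ModelComputing.
Variable M : model.
Local Notation n := (mod_n M).
Variable m : nat.

Definition fpair := (seq Z * seq Z)%type.
Definition mt (v : seq Z) : seq Z := mulv n (mod_T M) v.
Definition vneg' (v : seq Z) := pscal (-1)%bZ v.
Definition fletter (b : bool) (a : fpair) : fpair :=
  if b then (mt a.2, vneg' (mt (padd a.1 a.2))) else (vneg' (mt (mt a.2)), vneg' (mt a.1)).
Definition pact (q : pol) (v : seq Z) : seq Z := foldr (fun a w => padd (pscal a v) (mt w)) [::] q.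
Definition fval (a : fpair) (x : pvec) : seq Z := padd (pact x.1 a.1) (pact x.2 a.2).
Definition fzero (a : fpair) (x : pvec) : bool := vz n (fval a x).
Definition f0 : fpair := (mod_1 M, mod_2 M).
Definition fstates (par : seq (nat * bool)) : seq fpair :=
  foldl (fun ws e => rcons ws (fletter e.2 (nth f0 ws e.1))) [:: f0] par.

Definition model_ok : bool :=
  [&& (1 < n)%N, (0 < size (mod_T M))%N, size (mod_1 M) == size (mod_T M),
    size (mod_2 M) == size (mod_T M) &
    (size (mod_V M) == size (mod_T M)) && all (fun i => let e := mkseq (fun j => if i == j then 1%bZ else Z0) (size (mod_T M)) in
      vz n (padd (mt (mulv n (mod_V M) e)) (vneg' e))) (seq.iota 0 (size (mod_T M)))].

Hypothesis ok : model_ok.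

Lemma mn1 : (1 < n)%N. Proof. by case/and5P: ok. Qed.
Hypothesis mS : m.+1 = size (mod_T M).

Definition mT : 'M['Z_n]_m.+1 := zmat n m (mod_T M).
Local Notation zv_ := (@zvec n m).
Definition zp (a : fpair) := (zv_ a.1, zv_ a.2).
Definition small (a : fpair) := (size a.1 <= m.+1)%N && (size a.2 <= m.+1)%N.

Lemma size_padd a b : size (padd a b) = maxn (size a) (size b).
Proof. by elim: a b => [|x a IH] [|y b] //=; rewrite ?max0n ?maxn0 // IH maxnSS. Qed.

Lemma size_mt v : size (mt v) = m.+1.
Proof. by rewrite size_map mS. Qed.

Lemma zmt v : (size v <= m.+1)%N -> zv_ (mt v) = mT *m zv_ v.
Proof. by move=> h; apply: zvec_mul => //; exact: mn1. Qed.

Lemma mT_unit : mT \is a GRing.unit.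
Proof.
suff e : mT *m zmat n m (mod_V M) = 1%:M.
  by apply/unitrP; exists (zmat n m (mod_V M)); split=> //; exact: mulmx1C.
case/and5P: (ok) => _ _ _ _ /andP[/eqP sV /allP h].
apply/matrixP => i j; have jm : (j < size (mod_T M))%N by rewrite -mS.
have := h j; rewrite mem_iota /= add0n => /(_ jm) /(vz0 mn1 m).
set e := mkseq _ _; have se : (size e <= m.+1)%N by rewrite size_mkseq mS.
rewrite zvec_add zvec_opp zmt ?size_map ?sV ?mS // zvec_mul ?mn1 //.
have -> : zv_ e = delta_mx j 0.
  apply/colP => k; rewrite !mxE nth_mkseq ?eqxx ?andbT -?mS //.
  by rewrite eq_sym -val_eqE; case: eqP => _; rewrite ?zr1 ?zr0.
move/eqP; rewrite subr_eq0 mulmxA -colE => /eqP/colP/(_ i); rewrite !mxE => ->.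
by rewrite eqxx andbT.
Qed.

Lemma small_letter b a : small a -> small (fletter b a).
Proof.
by move=> _; case: b; rewrite /small /= /vneg' /pscal /mt /mulv !size_map mS leqnn.
Qed.

Lemma zp_letter b a : small a -> zp (fletter b a) = Fletter mT b (zp a).
Proof.
move=> /andP[h1 h2]; have h3 : (size (padd a.1 a.2) <= m.+1)%N by rewrite size_padd geq_max h1.
case: b; rewrite /zp /Fletter /fletter /= /vneg' !zvec_opp.
  by rewrite (zmt h2) (zmt h3) zvec_add.
have h4 : (size (mt a.2) <= m.+1)%N by rewrite size_mt.
by rewrite (zmt h4) (zmt h1) (zmt h2).
Qed.

Lemma size_pact q v : (size v <= m.+1)%N -> (size (pact q v) <= m.+1)%N.
Proof.
by move=> h; case: q => //= x q; rewrite size_padd geq_max size_map h size_mt leqnn.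
Qed.

Lemma zv_pact q v : (size v <= m.+1)%N -> zv_ (pact q v) = hom mT (lp q) *m zv_ v.
Proof.
have uT := mT_unit; move=> h; elim: q => [|x q IH] /=; first by rewrite hom0 // mul0mx zvec_nil.
rewrite zvec_add zvec_scal zmt ?size_pact // IH homD // homM // hom_t // hom_zr //.
by rewrite mulmxDl mulmxA mul_scalar_mx.
Qed.

Lemma zv_fval a x : small a -> zv_ (fval a x) = Fh mT (zp a) (pv x).
Proof.
move=> /andP[h1 h2]; rewrite /fval zvec_add (zv_pact _ h1) (zv_pact _ h2) /Fh.
by rewrite [pv x 0 0]mxE [pv x 1 0]mxE.
Qed.

Lemma fzeroP a x : small a -> fzero a x <-> Fh mT (zp a) (pv x) = 0.
Proof.
move=> sa; have /andP[h1 h2] := sa; rewrite -zv_fval //; split=> [/(vz0 mn1 m)//|].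
by apply: (vzP mn1); rewrite size_padd geq_max !size_pact.
Qed.

Lemma small0 : small f0.
Proof. by case/and5P: ok => _ _ /eqP e1 /eqP e2 _; rewrite /small /= e1 e2 mS leqnn. Qed.

(** The states of the table are the images of the matrices of its words. *)
Lemma fstatesP par i : small (nth f0 (fstates par) i) /\
  zp (nth f0 (fstates par) i) = Fm mT (zp f0) (pm (nth pm1 (mats par) i)).
Proof.
have uT := mT_unit; move: i; elim/last_ind: par => [|par e IH] i.
  have -> : nth f0 (fstates [::]) i = f0 by case: i => // i; rewrite /= nth_nil.
  have -> : nth pm1 (mats [::]) i = pm1 by case: i => // i; rewrite /= nth_nil.
  by rewrite pm_1 (Fm1 uT); split; [exact: small0|].
have szf q : size (fstates q) = (size q).+1.
  by elim/last_ind: q => // q e' IHq; rewrite /fstates foldl_rcons size_rcons IHq size_rcons.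
have [szm _ _] := mats_words par.
rewrite /fstates /mats !foldl_rcons -/(fstates par) -/(mats par) !nth_rcons szf szm.
case: ltnP => // _; case: eqP => _; last first.
  by rewrite pm_1 (Fm1 uT); split; [exact: small0|].
have [sm e1] := IH e.1; split; first exact: small_letter.
by rewrite (zp_letter _ sm) e1 pm_letter (Fm_mul uT) (Fm_letter uT).
Qed.

Definition fpt (a : fpair) : fpair := (mt a.1, mt a.2).
Definition fpeq (a b : fpair) : bool :=
  vz n (padd a.1 (vneg' b.1)) && vz n (padd a.2 (vneg' b.2)).

Lemma small_iter k a : small a -> small (iter k fpt a).
Proof. by case: k => // k _; rewrite iterS /small /= !size_mt leqnn. Qed.

Lemma zp_iter k a : small a ->
  zp (iter k fpt a) = (mT ^+ k *m (zp a).1, mT ^+ k *m (zp a).2).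
Proof.
move=> sa; elim: k => [|k IH]; first by rewrite !mul1mx.
have /andP[h1 h2] := small_iter k sa.
rewrite iterS /zp /= !zmt // exprS; move: IH => [-> ->].
by rewrite /= !mulmxA.
Qed.

Lemma fpeqP a b : small a -> small b -> fpeq a b <-> zp a = zp b.
Proof.
move=> /andP[h1 h2] /andP[h3 h4]; have mn := mn1.
have q u v : (size u <= m.+1)%N -> (size v <= m.+1)%N ->
    vz n (padd u (vneg' v)) <-> zv_ u = zv_ v.
  move=> hu hv; split=> [/(vz0 mn m)|e].
    by rewrite zvec_add zvec_opp => /eqP; rewrite subr_eq0 => /eqP.
  by apply: (vzP mn (m := m)); rewrite ?size_padd ?size_map ?geq_max ?hu // zvec_add zvec_opp e subrr.
rewrite /zp /fpeq; split=> [/andP[/(q _ _ h1 h3)-> /(q _ _ h2 h4)->]//|[e1 e2]].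
by apply/andP; split; [apply/(q _ _ h1 h3)|apply/(q _ _ h2 h4)].
Qed.

(* The states of the table and their multiples by powers of t meet the initial
   state only once. *)
Definition fdist (par : seq (nat * bool)) (d : nat) : bool :=
  [&& (0 < d)%N, fpeq (iter d fpt f0) f0 &
  all (fun j => let s := nth f0 (fstates par) j in
     all (fun e => (j == 0%N) && (e == 0%N) || ~~ fpeq (iter e fpt s) f0) (seq.iota 0 d))
   (seq.iota 0 (size par).+1)].

Lemma fdistP par d : fdist par d -> forall j a b, (j < (size par).+1)%N ->
  (forall u, Fh mT (zp f0) ((t ^+ a *: pm (nth pm1 (mats par) j) - t ^+ b *: 1) *m u) = 0) ->
  j = 0%N /\ a = b %[mod d].
Proof.
have uT := mT_unit; move=> /and3P[d0 per /allP hall] j a b jN h.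
set D := pm _ in h; have [ss es] := fstatesP par j; set s := nth _ _ _ in ss es.
have s0 := small0.
have {}per : zp (iter d fpt f0) = zp f0.
  by apply/(fpeqP _ s0); [exact: small_iter|exact: per].
have := zp_iter d s0; rewrite {}per => -[per1 per2].
have [e1 e2] := @Fm_power _ _ _ uT (zp f0) d _ _ _ d0 (esym per1) (esym per2) h.
pose e := ((a + d.-1 * b) %% d)%N; rewrite -/e -es in e1 e2.
have ee : fpeq (iter e fpt s) f0.
  apply/(fpeqP _ s0); first exact: small_iter.
  by rewrite (zp_iter e ss) e1 e2.
have jm : j \in seq.iota 0 (size par).+1 by rewrite mem_iota.
have em : e \in seq.iota 0 d by rewrite mem_iota /= add0n ltn_mod.
have /allP/(_ e em) := hall j jm; rewrite -/s ee orbF => /andP[/eqP j0 /eqP e0].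
split=> //; apply/eqP; rewrite -(eqn_modDr (d.-1 * b)) -mulSn prednK // modnMr.
exact/eqP.
Qed.

End ModelComputing.


(** * Certificates *)

(* What becomes of a submodule of index p: it is carried by the word of vertex i
   into the submodule of a later node k, as tested in a finite quotient of that
   node or exactly, or its coset labels bound the Euler characteristic. *)
Inductive cert :=
| Fin (k f i : nat) | Exact (k i : nat)
| Lab1 (r : Z * Z) | Lab3 (m : nat) (r : Z * Z) (loop : seq bool).

(* A submodule of the free module on two generators with generators nG, a
   reduction basis nB, and the table of the cosets of its group: the tree nP of
   words, the transitions nT with the exponents of t, the depth nd, and finite
   quotients nM separating the vertices *)
Record node := Node {
  nG : seq pvec; nB : seq (seq pol * bool); nP : seq (nat * bool);
  nT : seq ((nat * (nat * nat)) * (nat * (nat * nat))); nd : nat;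
  nM : seq model; nC : seq (nat * cert)
}.

Section Node.
Variable p : nat.
Hypothesis pp : prime p.
Local Notation Zp := (Z.of_nat p).
Local Notation rmx := (map_mx (evp p)).

Section Defs.
Variable nd0 : node.
Definition nN := (size (nP nd0)).+1.
Definition ntr (x : bool) (i : nat) : nat * (nat * nat) :=
  let e := nth ((0%N, (0%N, 0%N)), (0%N, (0%N, 0%N))) (nT nd0) i in if x then e.1 else e.2.
Definition nnx x i := (ntr x i).1.
Definition nen x i := (ntr x i).2.1.
Definition nem x i := (ntr x i).2.2.
Definition basis := map (mkbelt (nG nd0)) (nB nd0).
Definition nW i := wmat (nth [::] (words (nP nd0)) i).

Definition rpair := ((pvec * seq Z) * (pvec * seq Z))%type.
Definition redm (B : seq belt) (a b : pmat) (n m : nat) : rpair :=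
  (reduce B (vadd (vshift n a.1) (vneg (vshift m b.1))),
   reduce B (vadd (vshift n a.2) (vneg (vshift m b.2)))).
Definition rok (r : rpair) := vzero r.1.1 && vzero r.2.1.

Definition nred (B : seq belt) (ms : seq pmat) (x : bool) (i : nat) : rpair :=
  redm B (mletter x (nth pm1 ms i)) (nth pm1 ms (nnx x i)) (nen x i) (nem x i).
Definition ntau (B : seq belt) : rpair := redm B pm1 pm1 (nd nd0) 0.

Definition nfin (f : model) : bool :=
  [&& model_ok f, all (fzero f (f0 f)) (nG nd0) & fdist f (nP nd0) (nd nd0)].

Definition nodeok : bool :=
  let N := nN in let ms := mats (nP nd0) in let B := basis in
  [&& ~~ odd (nd nd0), rok (ntau B),
    all (fun i => [&& (nnx true i < N)%N, (nnx false i < N)%N,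
      nnx true (nnx true (nnx true i)) == i, nnx false (nnx false i) == i,
      rok (nred B ms true i) & rok (nred B ms false i)]) (seq.iota 0 N),
    all (fun i => let e := nth (0%N, true) (nP nd0) i in
      (e.1 <= i)%N && (nnx e.2 e.1 == i.+1)) (seq.iota 0 N.-1),
    (0 < size (nM nd0))%N & all nfin (nM nd0)].

End Defs.

Definition row2 (a b : 'F_p) : 'rV['F_p]_2 := \row_j if j == 0 then a else b.
Definition zrow (x : Z * Z) : 'rV['F_p]_2 := row2 (zr _ x.1) (zr _ x.2).
Definition zdet (x y : Z * Z) : Z := Z.sub (Z.mul x.1 y.2) (Z.mul x.2 y.1).
Definition zlet (b : bool) (x : Z * Z) : Z * Z :=
  (Z.opp x.2, if b then Z.add x.1 x.2 else x.1).
Definition zsgn (m : nat) (x : Z * Z) : Z * Z := if odd m then (Z.opp x.1, Z.opp x.2) else x.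
Definition zact (r : Z * Z) (c : pmat) : Z * Z :=
  (Z.add (Z.mul r.1 (pev c.1.1)) (Z.mul r.2 (pev c.1.2)),
   Z.add (Z.mul r.1 (pev c.2.1)) (Z.mul r.2 (pev c.2.2))).
Definition zkap (v : seq Z) (r : rpair) : Z * Z := (dotz r.1.2 v, dotz r.2.2 v).
Definition zeq0 (a : Z) : bool := Z.modulo a Zp == Z0.
Definition zreq (x y : Z * Z) : bool := zeq0 (Z.sub x.1 y.1) && zeq0 (Z.sub x.2 y.2).

Lemma det2_zrow x y : det2 (zrow x) (zrow y) = zr _ (zdet x y).
Proof. by rewrite /det2 !mxE /= /zdet zrB !zrM. Qed.

Lemma row2_eq (s : 'rV['F_p]_2) a b : s 0 0 = a -> s 0 1 = b -> s = row2 a b.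
Proof.
move=> h0 h1; apply/rowP => j; rewrite !mxE.
have [->|->] : j = 0 \/ j = 1 by case: j => [[|[|]]] //= hj; [left|right]; exact: val_inj.
  by rewrite h0.
by rewrite h1.
Qed.

Lemma zrow_letter b x : zrow x *m rmx (letter b) = zrow (zlet b x).
Proof.
have l1 : lift ord0 ord0 = 1 :> 'I_2 by exact: val_inj.
apply: row2_eq; rewrite !mxE !big_ord_recl big_ord0 ?l1 !mxE /= addr0;
  case: b; rewrite /= ?mxE /= ?rmorph0 ?rmorphN ?rmorphXn /= !evp_t ?zrD ?zrN; ring.
Qed.

Lemma zrow_sgn m x : (-1) ^+ m *: zrow x = zrow (zsgn m x).
Proof.
rewrite -signr_odd /zsgn; case: (odd m); rewrite ?expr0 ?scale1r // expr1 scaleN1r.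
by apply: row2_eq; rewrite !mxE /= zrN.
Qed.

Lemma zrow_act r c : zrow r *m rmx (pm c) = zrow (zact r c).
Proof.
have l1 : lift ord0 ord0 = 1 :> 'I_2 by exact: val_inj.
by apply: row2_eq; rewrite !mxE !big_ord_recl big_ord0 ?l1 !mxE /= addr0 !evp_lp zrD !zrM.
Qed.

Lemma zreqP x y : zreq x y -> zrow x = zrow y.
Proof.
rewrite /zreq /zeq0 -!(zr_eq0 pp) !zrB !subr_eq0 => /andP[/eqP h1 /eqP h2].
by apply: row2_eq; rewrite !mxE /= ?h1 ?h2.
Qed.

Lemma det2_word a b w : det2 (a *m rmx (wmat w)) (b *m rmx (wmat w)) = det2 a b.
Proof.
elim/last_ind: w a b => [|w x IH] a b; first by rewrite wmat_nil map_mx1 !mulmx1.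
by rewrite wmat_rcons map_mxM !mulmxA det2M.
Qed.

Lemma redmP (cbs : seq (seq pol * bool)) G v a b n m :
  size v = size G -> let r := redm (map (mkbelt G) cbs) a b n m in rok r ->
  Psi (map pv G) (zf p v) (t ^+ n *: pm a - t ^+ m *: pm b) (zrow (zkap v r)).
Proof.
move=> sv r /andP[z1 z2].
have [c1 [e1 h1]] := @reduceP p G cbs (vadd (vshift n a.1) (vneg (vshift m b.1))).
have [c2 [e2 h2]] := @reduceP p G cbs (vadd (vshift n a.2) (vneg (vshift m b.2))).
rewrite [X in X + _]pv_zero // add0r in e1; rewrite [X in X + _]pv_zero // add0r in e2.
exists (fun l => \row_j if j == 0 then c1 l else c2 l).
  have colE' j : col j (lincomb (map pv G) (fun l => \row_j if j == 0 then c1 l else c2 l)) =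
      \sum_(l < size G) (if j == 0 then c1 l else c2 l) *: nth 0 (map pv G) l.
    apply/colP => i; rewrite mxE /lincomb size_map !summxE; apply: eq_bigr => l _.
    by rewrite !mxE big_ord_recl big_ord0 addr0 !mxE mulrC.
  have cB j : col j (t ^+ n *: pm a - t ^+ m *: pm b) =
      t ^+ n *: col j (pm a) - t ^+ m *: col j (pm b).
    by apply/colP => i; rewrite !mxE.
  move: e1 e2; rewrite /vneg !pv_add !pv_scal !pv_shift zrN1 !scaleN1r => e1 e2.
  by apply: mx_cols; rewrite colE' cB !col_pm /= ?e1 ?e2.
have dotE k (c : nat -> Laurent) : (forall l, evp p (c l) = zr _ (nth Z0 k l)) ->
    zr 'F_p (dotz k v) = \sum_(l < size G) zf p v l * evp p (c l).
  move=> h; rewrite (@zr_dotz _ _ _ (size G)) ?sv //; apply: eq_bigr => l _.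
  by rewrite h mulrC.
symmetry; apply: row2_eq; rewrite /psic size_map summxE.
  by rewrite (dotE _ c1) //; apply: eq_bigr => l _; rewrite !mxE.
by rewrite (dotE _ c2) //; apply: eq_bigr => l _; rewrite !mxE.
Qed.

Lemma psi_inM G (v : nat -> 'F_p) n (D : 'M_(2, n)) s : Psi G v D s -> inM G D.
Proof. by case=> c e _; exists c. Qed.

Section NodeTheory.
Variable nd0 : node.
Hypothesis ok : nodeok nd0.
Local Notation N := (nN nd0).
Local Notation Gs := (map pv (nG nd0)).
Local Notation W := (nW nd0).
Local Notation ms := (mats (nP nd0)).

Lemma nW_pm i : W i = pm (nth pm1 ms i).
Proof. by rewrite /nW; have [_ _ ->] := mats_words (nP nd0). Qed.

Lemma nW0 : W 0%N = 1.
Proof.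
rewrite nW_pm (_ : nth pm1 ms 0 = pm1) ?pm_1 //.
elim/last_ind: (nP nd0) => // q e IH; rewrite /mats foldl_rcons -/(mats q) nth_rcons.
by have [-> _ _] := mats_words q.
Qed.

Lemma nd_even : ~~ odd (nd nd0). Proof. by case/and5P: ok. Qed.

Lemma ok_vertex i : (i < N)%N -> [&& (nnx nd0 true i < N)%N, (nnx nd0 false i < N)%N,
      nnx nd0 true (nnx nd0 true (nnx nd0 true i)) == i, nnx nd0 false (nnx nd0 false i) == i,
      rok (nred nd0 (basis nd0) ms true i) & rok (nred nd0 (basis nd0) ms false i)].
Proof. by move=> iN; case/and5P: ok => _ _ /allP h _ _; apply: h; rewrite mem_iota. Qed.

Lemma nnxN x i : (i < N)%N -> (nnx nd0 x i < N)%N.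
Proof. by move=> /ok_vertex/and5P[h1 h2 _ _ _]; case: x. Qed.

Lemma nnx3 i : (i < N)%N -> nnx nd0 true (nnx nd0 true (nnx nd0 true i)) = i.
Proof. by move=> /ok_vertex/and5P[_ _ /eqP h _ _]. Qed.

Lemma nnx2 i : (i < N)%N -> nnx nd0 false (nnx nd0 false i) = i.
Proof. by move=> /ok_vertex/and5P[_ _ _ /eqP h _]. Qed.

Lemma ntransP v x i : size v = size (nG nd0) -> (i < N)%N ->
  Psi Gs (zf p v) (t ^+ nen nd0 x i *: (W i * letter x) - t ^+ nem nd0 x i *: W (nnx nd0 x i))
    (zrow (zkap v (nred nd0 (basis nd0) ms x i))).
Proof.
move=> sv /ok_vertex/and5P[_ _ _ _ /andP[rX rY]].
rewrite !nW_pm -pm_letter; apply: redmP => //; by case: x.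
Qed.

Lemma ntauP v : size v = size (nG nd0) ->
  Psi Gs (zf p v) (t ^+ nd nd0 *: 1 - 1) (zrow (zkap v (ntau nd0 (basis nd0)))).
Proof.
move=> sv; case/and5P: ok => _ h _ _ _.
have := @redmP (nB nd0) (nG nd0) v pm1 pm1 (nd nd0) 0 sv h.
by rewrite expr0 scale1r pm_1.
Qed.

Lemma nreach j : (j < N)%N -> exists w, foldl (fun j x => nnx nd0 x j) 0%N w = j.
Proof.
case/and5P: ok => _ _ _ /allP hpar _.
have [k le] := ubnP j; elim: k j le => // k IH [|j] le jN; first by exists [::].
have ij : j \in seq.iota 0 N.-1 by rewrite mem_iota.
have /andP[ji /eqP e] := hpar j ij.
have [w hw] := IH _ (leq_ltn_trans ji le) (leq_ltn_trans ji (ltnW jN)).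
by exists (rcons w (nth (0%N, true) (nP nd0) j).2); rewrite foldl_rcons hw.
Qed.

Section Model.
Variable f : model.
Hypothesis nfinP : nfin nd0 f.

Let m := (size (mod_T f)).-1.
Lemma nmS : m.+1 = size (mod_T f).
Proof. by case/and3P: nfinP => /and5P[_ h _ _ _] _ _; rewrite /m prednK. Qed.

Definition fker (x : V) : Prop := Fh (mT f m) (zp f m (f0 f)) x = 0.

Lemma fker_submod : submod fker.
Proof. by apply: Fh_submod; case/and3P: nfinP => h _ _; exact: (mT_unit h nmS). Qed.

Lemma fker_gen l : (l < size Gs)%N -> fker (nth 0 Gs l).
Proof.
case/and3P: nfinP => h /allP hG _; rewrite size_map => lG.
rewrite (nth_map ([::], [::])) //; apply/(fzeroP h nmS); first exact: small0 nmS.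
by apply: hG; exact: mem_nth.
Qed.

Lemma fker_dist j a b : (j < N)%N ->
  (forall u, fker ((t ^+ a *: W j - t ^+ b *: 1) *m u)) -> j = 0%N /\ a = b %[mod nd nd0].
Proof.
case/and3P: nfinP => h _ hd jN; rewrite nW_pm => hu.
exact: (fdistP h nmS hd jN hu).
Qed.

Lemma nHN h : HN fker h -> HN (@inM Gs 1) h.
Proof.
have sv : size (nseq (size (nG nd0)) Z0) = size (nG nd0) by rewrite size_nseq.
have tr x i : (i < N)%N -> inM Gs (t ^+ nen nd0 x i *: (W i * letter x) -
    t ^+ nem nd0 x i *: W (nnx nd0 x i)).
  by move=> iN; exact: psi_inM (ntransP x sv iN).
have tau := psi_inM (ntauP sv).
exact: (HN_table (N := N) (isT : (0 < N)%N) nW0 nnxN tr tau fker_submod fker_gen fker_dist).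
Qed.

Lemma ndist i j a b : (i < N)%N -> (j < N)%N ->
  inM Gs (t ^+ a *: W i - t ^+ b *: W j) -> i = j /\ a = b %[mod nd nd0].
Proof.
have sv : size (nseq (size (nG nd0)) Z0) = size (nG nd0) by rewrite size_nseq.
have tr x k : (k < N)%N -> inM Gs (t ^+ nen nd0 x k *: (W k * letter x) -
    t ^+ nem nd0 x k *: W (nnx nd0 x k)).
  by move=> kN; exact: psi_inM (ntransP x sv kN).
exact: (table_dist (N := N) (isT : (0 < N)%N) nW0 nnxN tr nd_even fker_submod fker_gen fker_dist
  nnx3 nnx2 nreach).
Qed.

End Model.

(** ** Coset labels attached to a functional *)

Section Functional.
Variable v : seq Z.
Hypothesis sv : size v = size (nG nd0).
Variable r0 : Z * Z.
Hypothesis wd : wdef Gs (zf p v).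

Let kap x i := zrow (zkap v (nred nd0 (basis nd0) ms x i)).
Let tau := zrow (zkap v (ntau nd0 (basis nd0))).
Let rho i := zrow r0 *m rmx (W i).

Lemma rhoE i : rho i = zrow (zact r0 (nth pm1 ms i)).
Proof. by rewrite /rho nW_pm zrow_act. Qed.

Lemma ndist' : forall i j a b, (i < N)%N -> (j < N)%N ->
  inM Gs (t ^+ a *: W i - t ^+ b *: W j) -> i = j /\ a = b %[mod nd nd0].
Proof.
case/and5P: ok => _ _ _ _ /andP[M0 hM] i j a b.
case: (nM nd0) M0 hM => // f fs _ /andP[hf _] iN jN h.
exact: (ndist hf iN jN h).
Qed.

Let nodekap (x : bool) i := zkap v (nred nd0 (basis nd0) ms x i).

(* The conditions for keeping the component of the labels transverse to rho *)
(** The labels of [label1] for a vector r0 that the table preserves up to sign *)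
Lemma lab1_bound tab m par loop D (H : set M2) (g : M2)
    (C : finType) (E : coset_system (cimage H) C) :
  (forall x i, (i < N)%N -> zreq (zsgn (nen nd0 x i + nem nd0 x i) (zlet x (zact r0 (nth pm1 ms i))))
     (zact r0 (nth pm1 ms (nnx nd0 x i)))) ->
  (forall i, (i < N)%N -> zeq0 (zdet (zact (zkap v (ntau nd0 (basis nd0))) (nth pm1 ms i))
     (zact r0 (nth pm1 ms i)))) ->
  (forall x i, (i < N)%N -> ent tab x i = (nnx nd0 x i, (Z0, (Z0,
     zdet (zsgn (nem nd0 x i) (nodekap x i)) (zact r0 (nth pm1 ms (nnx nd0 x i))))))) ->
  extcheck p tab N m par loop D -> is_subgroup H -> Bu3 g ->
  (forall h, H h -> HPsi Gs (zf p v) (g^-1 * h * g)) ->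
  (#|porbits (cperm E SL2Z_S)| + #|porbits (cperm E SL2Z_U)| +
   #|porbits (cperm E (SL2ZM SL2Z_S SL2Z_U))| <= #|C|)%N.
Proof.
move=> hrho htau htab chk Hsub Bg Hg.
have rhoP x i : (i < N)%N ->
    (-1) ^+ (nen nd0 x i + nem nd0 x i) *: (rho i *m rmx (letter x)) = rho (nnx nd0 x i).
  by move=> iN; rewrite !rhoE zrow_letter zrow_sgn; apply: zreqP; exact: hrho.
have tau1 i : (i < N)%N -> det2 (tau *m rmx (W i)) (rho i) = 0.
  move=> /htau; rewrite /zeq0 -(zr_eq0 pp) => /eqP h.
  by rewrite rhoE nW_pm zrow_act det2_zrow.
have tabP x i : (i < N)%N -> exists b, ent tab x i = (nnx nd0 x i, (Z0, (Z0, b))) /\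
    zr _ b = det2 ((-1) ^+ nem nd0 x i *: kap x i) (rho (nnx nd0 x i)).
  move=> iN; rewrite htab //; eexists; split; first reflexivity.
  by rewrite -det2_zrow rhoE /kap zrow_sgn.
have [l0 lS lt] := label1 (isT : (0 < N)%N) nd_even pp rhoP tau1 tabP.
have tr := fun x i iN => @ntransP v x i sv iN.
have LB := lam_bound wd (isT : (0 < N)%N) nW0 nnxN tr ndist' nd_even (ntauP sv) pp (lam := fun l => ((l.1, Z0), det2 l.2 (rho l.1))) l0 lS lt.
exact: (LB _ _ _ _ _ _ _ E chk Hsub Bg Hg).
Qed.

Variable e0 : Z * Z.
Let eta i := zrow e0 *m rmx (W i).

Lemma etaE i : eta i = zrow (zact e0 (nth pm1 ms i)).
Proof. by rewrite /eta nW_pm zrow_act. Qed.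

(** The labels of [label3] in the basis obtained from e0 and r0 by transport
    along the words of the table *)
Lemma lab3_bound tab m par loop D (H : set M2) (g : M2)
    (C : finType) (E : coset_system (cimage H) C) :
  zeq0 (Z.sub (zdet e0 r0) 1) ->
  zreq (zkap v (ntau nd0 (basis nd0))) (Z0, Z0) ->
  (forall x i, (i < N)%N -> zreq (zsgn (nen nd0 x i + nem nd0 x i) (zlet x (zact r0 (nth pm1 ms i))))
     (zact r0 (nth pm1 ms (nnx nd0 x i)))) ->
  (forall x i, (i < N)%N -> ent tab x i = (nnx nd0 x i,
     (zdet (zsgn (nem nd0 x i) (nodekap x i)) (zact r0 (nth pm1 ms (nnx nd0 x i))),
     (zdet (zact e0 (nth pm1 ms (nnx nd0 x i)))
        (zsgn (nen nd0 x i + nem nd0 x i) (zlet x (zact e0 (nth pm1 ms i)))),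
      zdet (zact e0 (nth pm1 ms (nnx nd0 x i))) (zsgn (nem nd0 x i) (nodekap x i)))))) ->
  extcheck p tab N m par loop D -> is_subgroup H -> Bu3 g ->
  (forall h, H h -> HPsi Gs (zf p v) (g^-1 * h * g)) ->
  (#|porbits (cperm E SL2Z_S)| + #|porbits (cperm E SL2Z_U)| +
   #|porbits (cperm E (SL2ZM SL2Z_S SL2Z_U))| <= #|C|)%N.
Proof.
move=> hdet htau hrho htab chk Hsub Bg Hg.
have rhoP x i : (i < N)%N ->
    (-1) ^+ (nen nd0 x i + nem nd0 x i) *: (rho i *m rmx (letter x)) = rho (nnx nd0 x i).
  by move=> iN; rewrite !rhoE zrow_letter zrow_sgn; apply: zreqP; exact: hrho.
have tau0 : tau = 0.
  by rewrite /tau (zreqP htau); apply/rowP => j; rewrite !mxE /= zr0; case: ifP.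
have etaP i : (i < N)%N -> det2 (eta i) (rho i) = 1.
  move=> _; rewrite det2_word det2_zrow.
  by move: hdet; rewrite /zeq0 -(zr_eq0 pp) zrB zr1 subr_eq0 => /eqP.
have tabP x i : (i < N)%N -> exists c a b, [/\ ent tab x i = (nnx nd0 x i, (c, (a, b))),
     zr _ c = det2 ((-1) ^+ nem nd0 x i *: kap x i) (rho (nnx nd0 x i)),
     zr _ a = (-1) ^+ (nen nd0 x i + nem nd0 x i) * det2 (eta (nnx nd0 x i)) (eta i *m rmx (letter x)) &
     zr _ b = det2 (eta (nnx nd0 x i)) ((-1) ^+ nem nd0 x i *: kap x i)].
  move=> iN; rewrite htab //; do 3!eexists; split; first reflexivity.
  - by rewrite -det2_zrow rhoE /kap zrow_sgn.
  - by rewrite -det2_zrow !etaE -det2Zr zrow_letter zrow_sgn.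
  - by rewrite -det2_zrow etaE /kap zrow_sgn.
have [l0 lS lt] := label3 W nnxN pp rhoP (fun i iN => etaP i iN) tau0 tabP.
have tr := fun x i iN => @ntransP v x i sv iN.
have LB := lam_bound wd (isT : (0 < N)%N) nW0 nnxN tr ndist' nd_even (ntauP sv) pp (lam := fun l => ((l.1, zv (det2 l.2 (rho l.1))), det2 (eta l.1) l.2)) l0 lS lt.
exact: (LB _ _ _ _ _ _ _ E chk Hsub Bg Hg).
Qed.

End Functional.

End NodeTheory.
End Node.


(** * The tree of submodules *)

Section Tree.
Variable p : nat.
Hypothesis pp : prime p.

Definition zmx := ((Z * Z) * (Z * Z))%type.
Definition evm (c : pmat) : zmx := ((pev c.1.1, pev c.1.2), (pev c.2.1, pev c.2.2)).
Definition zacte (r : Z * Z) (e : zmx) : Z * Z :=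
  (Z.add (Z.mul r.1 e.1.1) (Z.mul r.2 e.1.2), Z.add (Z.mul r.1 e.2.1) (Z.mul r.2 e.2.2)).

Definition z00 : Z * Z := (Z0, Z0).
Definition rp0 : rpair := ((([::], [::]), [::]), (([::], [::]), [::])).

Section Labels.
Variables (nd0 : node) (kt : seq (rpair * rpair)) (es : seq zmx) (tau : rpair) (D : Z).
Variable v : seq Z.
Local Notation N := (nN nd0).

Definition kapv x i : Z * Z :=
  zsgn (nem nd0 x i) (zkap v (let e := nth (rp0, rp0) kt i in if x then e.1 else e.2)).

Definition rhochk (rl : seq (Z * Z)) : bool :=
  all (fun i => let c x := zreq p (zsgn (nen nd0 x i + nem nd0 x i) (zlet x (nth z00 rl i)))
        (nth z00 rl (nnx nd0 x i)) in c true && c false) (seq.iota 0 N).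

Definition lab1chk (r : Z * Z) : bool :=
  let rl := map (zacte r) es in
  let tl := map (zacte (zkap v tau)) es in
  let ent x i := (nnx nd0 x i, (Z0, (Z0, zdet (kapv x i) (nth z00 rl (nnx nd0 x i))))) in
  let tab := map (fun i => (ent true i, ent false i)) (seq.iota 0 N) in
  [&& rhochk rl, all (fun i => zeq0 p (zdet (nth z00 tl i) (nth z00 rl i))) (seq.iota 0 N) &
    extcheck p tab N 1 (nP nd0) [::] D].

Definition lab3chk (m : nat) (r : Z * Z) (loop : seq bool) : bool :=
  let e0 := if r.1 == Z0 then (1%bZ, Z0) else (Z0, (-1)%bZ) in
  let rl := map (zacte r) es in
  let el := map (zacte e0) es in
  let ent x i := let j := nnx nd0 x i in let k := kapv x i in
    (j, (zdet k (nth z00 rl j),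
        (zdet (nth z00 el j) (zsgn (nen nd0 x i + nem nd0 x i) (zlet x (nth z00 el i))),
         zdet (nth z00 el j) k))) in
  let tab := map (fun i => (ent true i, ent false i)) (seq.iota 0 N) in
  [&& zeq0 p (Z.sub (zdet e0 r) 1), zreq p (zkap v tau) z00, rhochk rl &
    extcheck p tab N m (nP nd0) loop D].

End Labels.

Variables (nodes : seq node) (D : Z).
Definition node0 := Node [::] [::] [::] [::] 0 [::] [::].
Local Notation gn k := (nth node0 nodes k).
Definition mod0 := Model 0 [::] [::] [::] [::].

Definition wact (c : pmat) (y : pvec) : pvec := vadd (vmul y.1 c.1) (vmul y.2 c.2).

Definition certchk (sts : seq (seq (seq fpair))) (mss : seq (seq pmat)) (bs : seq (seq belt))
    (j : nat) (kt : seq (rpair * rpair)) (es : seq zmx) (tau : rpair) (v : seq Z) (c : cert) : bool :=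
  match c with
  | Fin k f i =>
    [&& (j < k)%N, (k < size nodes)%N, (f < size (nM (gn k)))%N &
      let M := nth mod0 (nM (gn k)) f in
      let st := nth (f0 M) (nth [::] (nth [::] sts k) f) i in
      all (fzero M st) (child p (nG (gn j)) v)]
  | Exact k i =>
    [&& (j < k)%N, (k < size nodes)%N &
      let c := nth pm1 (nth [::] mss k) i in let B := nth [::] bs k in
      all (fun y => vzero (reduce B (wact c y)).1) (child p (nG (gn j)) v)]
  | Lab1 r => (j != 0%N) && lab1chk (gn j) kt es tau D v r
  | Lab3 m r loop => (j != 0%N) && lab3chk (gn j) kt es tau D v m r loop
  end.

Definition nodechk sts mss bs (j : nat) : bool :=
  let nd := gn j in
  let cs := flatten [seq nseq c.1 c.2 | c <- nC nd] in
  let vs := proj p (size (nG nd)) in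
  let B := basis nd in let ms := mats (nP nd) in
  let kt := map (fun i => (nred nd B ms true i, nred nd B ms false i)) (seq.iota 0 (nN nd)) in
  let es := map evm ms in let tau := ntau nd B in
  [&& (j == 0%N) || nodeok nd, size cs == size vs &
    all (fun vc => certchk sts mss bs j kt es tau vc.1 vc.2) (zip vs cs)].

Definition treechk : bool :=
  let sts := map (fun nd => map (fun f => fstates f (nP nd)) (nM nd)) nodes in
  let mss := map (fun nd => mats (nP nd)) nodes in
  let bs := map basis nodes in
  all (nodechk sts mss bs) (seq.iota 0 (size nodes)).

Hypothesis chk : treechk.
Let sts := map (fun nd => map (fun f => fstates f (nP nd)) (nM nd)) nodes.
Let mss := map (fun nd => mats (nP nd)) nodes.
Let bs := map basis nodes.

Lemma nodechkP j : (j < size nodes)%N -> nodechk sts mss bs j.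
Proof. by move=> jn; have /allP := chk; apply; rewrite mem_iota. Qed.

Lemma nodeokP j : (0 < j)%N -> (j < size nodes)%N -> nodeok (gn j).
Proof. by move=> j0 /nodechkP/and3P[]; rewrite (gtn_eqF j0). Qed.

Lemma pm_wact c y : pv (wact c y) = pm c *m pv y.
Proof.
rewrite /wact pv_add !pv_mul; apply/colP => i; rewrite !mxE !big_ord_recl big_ord0 addr0.
have -> : lift ord0 ord0 = 1 :> 'I_2 by exact: val_inj.
by rewrite !mxE /= ![lp _ * _]mulrC.
Qed.

Variables (K : V -> Prop) (n : nat).
Hypothesis sK : submod K.
Hypothesis kill : forall x, ideal_pow (ideal [:: p%:R; t + 1]) n x -> forall u, K (x *: u).
Hypothesis Hsub : is_subgroup (HN K).
Variables (C : finType) (E : coset_system (cimage (HN K)) C).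
Hypothesis big : (#|C| < #|porbits (cperm E SL2Z_S)| + #|porbits (cperm E SL2Z_U)| +
   #|porbits (cperm E (SL2ZM SL2Z_S SL2Z_U))|)%N.

Local Notation Gs k := (map pv (nG (gn k))).

(** Induction on the nodes from the last one: certificates only lead to later
    nodes, and the bounds on labels are incompatible with genus zero. *)
Theorem tree_sound j g : (j < size nodes)%N -> Bu3 g ->
  (forall h, HN K h -> HN (@inM (Gs j) 1) (g^-1 * h * g)) ->
  exists2 k, (k < size nodes)%N & conj_Bu3 (HN K) (HN (@inM (Gs k) 1)).
Proof.
have [d le] := ubnP (size nodes - j); elim: d j g le => // d IH j g le jn Bg below.
have [|[w [wp sw wd Hw]]] := node_step pp sK kill Bg below; first by exists j.
have next k u : (j < k)%N -> (k < size nodes)%N -> Bu3 u ->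
    (forall h, HPsi (Gs j) (zf p w) h -> HN (@inM (Gs k) 1) (u * h * u^-1)) ->
    exists2 k, (k < size nodes)%N & conj_Bu3 (HN K) (HN (@inM (Gs k) 1)).
  move=> jk kn Bu hu; apply: (IH k (g * u^-1)) => //.
  - by move: le jk kn; rewrite ltnS; lia.
  - exact: Bu3_mul Bg (Bu3_inv Bu).
  - move=> h /Hw/hu; have uu := Bu3_unit Bu; have ug := Bu3_unit Bg.
    by rewrite invrM ?unitrV // invrK !mulrA.
have /and3P[ok /eqP scs /(all_nthP ([::], Exact 0 0)) hall] := nodechkP jn.
set cs := flatten _ in scs hall; set vs := proj _ _ in scs hall.
have wi : (index w vs < size vs)%N by rewrite index_mem.
pose c := nth (Exact 0 0) cs (index w vs).
have cc : (w, c) = nth ([::], Exact 0 0) (zip vs cs) (index w vs).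
  by rewrite nth_zip ?scs // nth_index.
have {hall} hc : certchk sts mss bs j
   (map (fun i => (nred (gn j) (basis (gn j)) (mats (nP (gn j))) true i,
                   nred (gn j) (basis (gn j)) (mats (nP (gn j))) false i)) (seq.iota 0 (nN (gn j))))
   (map evm (mats (nP (gn j)))) (ntau (gn j) (basis (gn j))) w c.
  by have := hall (index w vs); rewrite -cc size_zip scs minnn => /(_ wi).
have Bw k i : Bu3 (pm (nth pm1 (mats (nP (gn k))) i)).
  by have [_ _ ->] := mats_words (nP (gn k)); exact: Bu3_wmat.
move: hc; case: c cc => [k f i|k i|r|m r loop] _ /=.
- case/and4P=> jk kn fk; have okk := nodeokP (leq_trans (ltn0Sn j) jk) kn.
  rewrite /sts (nth_map node0) // (nth_map mod0) //; set M := nth mod0 _ _ => hz.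
  have hf : nfin (gn k) M.
    by case/and5P: okk => _ _ _ _ /andP[_ /(all_nthP mod0) h]; exact: h.
  apply: (next k _ jk kn (Bw k i)) => h hh; apply: (nHN p okk hf).
  apply: (match_step pp (fker_submod hf) (Bw k i) sw wp _ hh) => y hy.
  case/and3P: (hf) => mok _ _; have uT := mT_unit mok (nmS hf).
  have [ss es] := fstatesP mok (nmS hf) (nP (gn k)) i.
  rewrite /fker (Fh_mul uT) -es; apply/(fzeroP mok (nmS hf) _ ss).
  by move/allP: hz; apply.
- case/and3P=> jk kn; rewrite /mss /bs !(nth_map node0) // => /allP hz.
  apply: (next k _ jk kn (Bw k i)) => h.
  apply: (match_step pp (inM_submod _) (Bw k i) sw wp) => y hy.
  have := hz y hy; rewrite /basis; set x := wact _ _ => /pv_zero z0.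
  have [c0 [e _]] := @reduceP p (nG (gn k)) (nB (gn k)) x.
  rewrite -pm_wact e z0 add0r; exists (fun l => (c0 l)%:M).
  by rewrite /lincomb size_map; apply: eq_bigr => l _; rewrite mul_mx_scalar.
- case/andP=> j0 /and3P[hrho htau hext]; exfalso; move: big; rewrite ltnNge => /negP; apply.
  have {}ok : nodeok (gn j) by move: ok; rewrite (negPf j0).
  have [szm _ _] := mats_words (nP (gn j)).
  have rlE rr i : (i < nN (gn j))%N ->
      nth z00 (map (zacte rr) (map evm (mats (nP (gn j))))) i = zact rr (nth pm1 (mats (nP (gn j))) i).
    by move=> iN; rewrite -map_comp (nth_map pm1) ?szm.
  have kE x i : (i < nN (gn j))%N -> kapv (gn j) (map (fun i => (nred (gn j) (basis (gn j)) (mats (nP (gn j))) true i,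
                   nred (gn j) (basis (gn j)) (mats (nP (gn j))) false i)) (seq.iota 0 (nN (gn j)))) w x i =
      zsgn (nem (gn j) x i) (zkap w (nred (gn j) (basis (gn j)) (mats (nP (gn j))) x i)).
    by move=> iN; rewrite /kapv (nth_map 0%N) ?size_iota // nth_iota // add0n; case: x.
  apply: (lab1_bound pp ok sw wd (r0 := r) E _ _ _ hext Hsub Bg Hw) => [x i iN|i iN|x i iN].
  + move/allP: hrho => /(_ i); rewrite mem_iota add0n => /(_ iN).
    by move=> /andP[h1 h2]; rewrite -!rlE ?nnxN //; case: x; [exact: h1|exact: h2].
  + by move/allP: htau => /(_ i); rewrite mem_iota add0n => /(_ iN); rewrite !rlE.
  + rewrite /ent (nth_map 0%N) ?size_iota // nth_iota // add0n.
    by case: x; rewrite /= rlE ?nnxN // kE.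
- case/andP=> j0 /and4P[hdet htau hrho hext]; exfalso; move: big; rewrite ltnNge => /negP; apply.
  have {}ok : nodeok (gn j) by move: ok; rewrite (negPf j0).
  have [szm _ _] := mats_words (nP (gn j)).
  have rlE rr i : (i < nN (gn j))%N ->
      nth z00 (map (zacte rr) (map evm (mats (nP (gn j))))) i = zact rr (nth pm1 (mats (nP (gn j))) i).
    by move=> iN; rewrite -map_comp (nth_map pm1) ?szm.
  have kE x i : (i < nN (gn j))%N -> kapv (gn j) (map (fun i => (nred (gn j) (basis (gn j)) (mats (nP (gn j))) true i,
                   nred (gn j) (basis (gn j)) (mats (nP (gn j))) false i)) (seq.iota 0 (nN (gn j)))) w x i =
      zsgn (nem (gn j) x i) (zkap w (nred (gn j) (basis (gn j)) (mats (nP (gn j))) x i)).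
    by move=> iN; rewrite /kapv (nth_map 0%N) ?size_iota // nth_iota // add0n; case: x.
  apply: (lab3_bound pp ok sw wd (r0 := r) E hdet htau _ _ hext Hsub Bg Hw) => [x i iN|x i iN].
  + move/allP: hrho => /(_ i); rewrite mem_iota add0n => /(_ iN).
    by move=> /andP[h1 h2]; rewrite -!rlE ?nnxN //; case: x; [exact: h1|exact: h2].
  + rewrite /ent (nth_map 0%N) ?size_iota // nth_iota // add0n.
    by case: x; rewrite /= !rlE ?nnxN // kE.
Qed.

End Tree.


(** * The nodes *)

(* Trees of words: 2 j + x stands for the word of vertex j followed by X when
   x = 1 and by Y when x = 0. *)
Definition unpar (s : seq nat) : seq (nat * bool) := [seq (k./2, odd k) | k <- s].

(* Transitions: 100 j + 50 + e stands for the vertex j with t^e, the values for X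
   and Y alternating along the list. *)
Definition untr1 (z : Z) : nat * (nat * nat) :=
  let e := Z.sub (Z.modulo z 100) 50 in
  (Z.to_nat (Z.div z 100), (Z.to_nat (Z.opp e), Z.to_nat e)).
Fixpoint untr (s : seq Z) : seq ((nat * (nat * nat)) * (nat * (nat * nat))) :=
  if s is a :: b :: s' then (untr1 a, untr1 b) :: untr s' else [::].

Local Notation X := true.
Local Notation Y := false.
Local Open Scope Z_scope.
Arguments Model (mod_n)%_nat_scope (mod_T mod_V mod_1 mod_2).
Arguments Fin (k f i)%_nat_scope.
Arguments Exact (k i)%_nat_scope.
Arguments Lab3 (m)%_nat_scope r loop.
Arguments Node nG nB nP nT (nd)%_nat_scope nM nC.
(* root3 *)
Definition node3_0 : node := Node
 [:: ([::1],[::]); ([::],[::1])]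
 [:: ([::[::1];[::]],false); ([::[::];[::1]],true)]
 (unpar [::]%N)
 (untr [::])
 1
 [::]
 [::(1%N,Fin 1 0 2); (1%N,Fin 1 0 3); (1%N,Fin 1 0 1); (1%N,Fin 1 0 0)].
(* H30 *)
Definition node3_1 : node := Node
 [:: ([::1],[::]); ([::],[::3]); ([::],[::1;1])]
 [:: ([::[::1];[::];[::]],false); ([::[::];[::];[::1]],true); ([::[::];[::1];[::]],true)]
 (unpar [::1;0;2]%N)
 (untr [::150;250;250;350;51;51;351;151])
 2
 [::Model 3 [::[::-1]] [::[::-1]] [::0] [::1]]
 [::(1%N,Fin 5 0 0); (1%N,Fin 2 0 3); (1%N,Fin 4 0 0); (1%N,Fin 9 0 10); (1%N,Fin 6 0 10); (1%N,Fin 7 0 10); (1%N,Fin 9 0 12); (1%N,Fin 7 0 11); (1%N,Fin 6 0 11); (1%N,Fin 9 0 0); (1%N,Fin 6 0 0); (1%N,Fin 7 0 0); (1%N,Fin 3 0 0)].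
(* H31_0 *)
Definition node3_2 : node := Node
 [:: ([::1],[::0;-1]); ([::],[::3]); ([::],[::1;2;1])]
 [:: ([::[::1];[::];[::]],false); ([::[::];[::];[::1]],true); ([::[::];[::1];[::]],true)]
 (unpar [::1;0;3]%N)
 (untr [::150;250;350;352;251;53;53;151])
 6
 [::Model 3 [::[::0;-1];[::1;1]] [::[::1;1];[::-1;0]] [::0;1] [::1;0]]
 [::(1%N,Fin 3 0 1); (1%N,Fin 11 0 6); (1%N,Fin 11 0 10); (1%N,Fin 6 0 7); (1%N,Lab1 (1,2)); (1%N,Fin 8 0 0); (1%N,Fin 6 0 1); (1%N,Fin 8 0 9); (1%N,Lab1 (1,2)); (1%N,Fin 6 0 6); (1%N,Lab1 (1,2)); (1%N,Fin 8 0 7); (1%N,Fin 11 0 0)].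
(* I1_31 *)
Definition node3_3 : node := Node
 [:: ([::1],[::]); ([::],[::1;-1;1])]
 [:: ([::[::1];[::]],false); ([::[::];[::1]],true)]
 (unpar [::1;0;2]%N)
 (untr [::150;250;250;350;53;53;353;153])
 6
 [::Model 3 [::[::0;-1];[::1;1]] [::[::1;1];[::-1;0]] [::0;0] [::1;0]]
 [::(1%N,Fin 4 0 0); (1%N,Fin 6 0 10); (1%N,Fin 6 0 11); (1%N,Fin 6 0 0)].
(* I2_31 *)
Definition node3_4 : node := Node
 [:: ([::1],[::1;1]); ([::],[::1;-1;1])]
 [:: ([::[::1];[::]],false); ([::[::];[::1]],true)]
 (unpar [::1;0;2]%N)
 (untr [::150;250;248;350;49;53;349;153])
 6
 [::Model 3 [::[::0;-1];[::1;1]] [::[::1;1];[::-1;0]] [::2;2] [::1;0]]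
 [::(1%N,Fin 5 0 0); (1%N,Fin 6 0 0); (1%N,Fin 6 0 10); (1%N,Fin 6 0 11)].
(* tH3 *)
Definition node3_5 : node := Node
 [:: ([::3],[::]); ([::1;1],[::]); ([::],[::3]); ([::],[::1;1])]
 [:: ([::[::];[::1];[::];[::]],false); ([::[::1];[::];[::];[::]],false); ([::[::];[::];[::];[::1]],true); ([::[::];[::];[::1];[::]],true)]
 (unpar [::1;0;3;2;5;6;9;11;10;13;15]%N)
 (untr [::150;250;350;450;550;51;51;650;750;151;850;950;1050;351;1150;851;251;750;651;551;950;1151;451;1050])
 2
 [::Model 3 [::[::-1;0];[::0;-1]] [::[::-1;0];[::0;-1]] [::1;0] [::0;1]]
 [::(1%N,Fin 9 0 2); (1%N,Fin 14 0 2); (1%N,Fin 15 0 0); (1%N,Fin 9 0 3); (1%N,Fin 14 0 7); (1%N,Fin 15 0 6); (1%N,Fin 9 0 1); (1%N,Fin 14 0 1); (1%N,Fin 15 0 5); (1%N,Fin 6 0 2); (1%N,Fin 14 0 9); (1%N,Fin 15 0 8); (1%N,Fin 15 0 9); (1%N,Fin 6 0 3); (1%N,Fin 14 0 11); (1%N,Fin 14 0 8); (1%N,Fin 15 0 11); (1%N,Fin 6 0 1); (1%N,Fin 7 0 2); (1%N,Fin 14 0 3); (1%N,Fin 15 0 4); (1%N,Fin 14 0 4); (1%N,Fin 15 0 10); (1%N,Fin 7 0 3); (1%N,Fin 15 0 3); (1%N,Fin 7 0 1); (1%N,Fin 14 0 10); (1%N,Fin 8 1 0); (1%N,Fin 8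 1 6); (1%N,Fin 8 1 3); (1%N,Fin 15 0 2); (1%N,Fin 15 0 7); (1%N,Fin 15 0 1); (1%N,Fin 14 0 0); (1%N,Fin 14 0 6); (1%N,Fin 14 0 5); (1%N,Fin 9 0 0); (1%N,Fin 6 0 0); (1%N,Fin 7 0 0); (1%N,Fin 8 1 1)].
(* H9_2 *)
Definition node3_6 : node := Node
 [:: ([::1],[::]); ([::],[::9]); ([::],[::-2;1])]
 [:: ([::[::1];[::];[::]],false); ([::[::];[::];[::1]],true); ([::[::];[::1];[::]],true)]
 (unpar [::1;0;2;7;9;8;10;13;15;17;19]%N)
 (untr [::150;250;250;350;53;53;450;153;550;650;353;750;850;453;950;553;1050;1052;1150;1148;653;851;753;949])
 6
 [::Model 9 [::[::2]] [::[::-4]] [::0] [::5]]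
 [::(1%N,Lab3 1 (0,1) [::]); (1%N,Fin 7 0 10); (1%N,Fin 7 0 11); (1%N,Fin 22 0 32); (1%N,Fin 24 0 32); (1%N,Fin 26 0 32); (1%N,Fin 22 0 35); (1%N,Fin 26 0 35); (1%N,Fin 24 0 35); (1%N,Fin 22 0 0); (1%N,Fin 24 0 0); (1%N,Fin 26 0 0); (1%N,Fin 7 0 0)].
(* H9_5 *)
Definition node3_7 : node := Node
 [:: ([::1],[::]); ([::],[::9]); ([::],[::-5;1])]
 [:: ([::[::1];[::];[::]],false); ([::[::];[::];[::1]],true); ([::[::];[::1];[::]],true)]
 (unpar [::1;0;2;7;9;8;10;13;15;17;19]%N)
 (untr [::150;250;250;350;53;53;450;153;550;650;353;750;850;453;950;553;1050;1048;1150;1152;653;849;753;951])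
 6
 [::Model 9 [::[::-4]] [::[::2]] [::0] [::2]]
 [::(1%N,Lab3 1 (0,1) [::]); (1%N,Fin 9 0 10); (1%N,Fin 9 0 12); (1%N,Fin 23 0 29); (1%N,Fin 25 0 29); (1%N,Fin 27 0 29); (1%N,Fin 23 0 34); (1%N,Fin 27 0 34); (1%N,Fin 25 0 34); (1%N,Fin 23 0 0); (1%N,Fin 25 0 0); (1%N,Fin 27 0 0); (1%N,Fin 9 0 0)].
(* tI3 *)
Definition node3_8 : node := Node
 [:: ([::1;-1;1],[::]); ([::],[::1;-1;1])]
 [:: ([::[::1];[::]],false); ([::[::];[::1]],true)]
 (unpar [::1;0;3;2;5;6;9;11;10;13;15]%N)
 (untr [::150;250;350;450;550;53;53;650;750;153;850;950;1050;353;1150;853;253;750;653;553;950;1153;453;1050])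
 6
 [::Model 9 [::[::-1;-3];[::1;2]] [::[::2;3];[::-1;-1]] [::3;2] [::3;7];Model 3 [::[::1;1;0];[::-1;0;0];[::0;0;-1]] [::[::0;-1;0];[::1;1;0];[::0;0;-1]] [::0;1;0] [::0;0;2]]
 [::(1%N,Fin 9 0 2); (1%N,Fin 9 0 3); (1%N,Fin 9 0 1); (1%N,Fin 9 0 0)].
(* H90 *)
Definition node3_9 : node := Node
 [:: ([::1],[::]); ([::],[::9]); ([::],[::1;1])]
 [:: ([::[::1];[::];[::]],false); ([::[::];[::];[::1]],true); ([::[::];[::1];[::]],true)]
 (unpar [::1;0;2;7;9;8;10;13;15;17;16;19;18;20;23;24;27;29;31;30;33;35;34;37;41;43;47;48;51;54;58;61;63;65;67]%N)
 (untr [::150;250;250;350;51;51;450;151;550;650;351;750;850;451;950;551;1050;1150;1250;1350;651;1450;1550;851;751;1650;1750;951;1850;1051;1950;2050;2150;1251;2250;2350;2450;1951;1151;1850;2550;1551;2650;2251;1351;2150;2750;1751;1451;2850;2950;2650;1651;2551;2850;3050;2351;2451;2051;3150;3250;2751;3350;2951;3450;3450;3550;3550;3051;3251;3151;3351])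
 2
 [::Model 9 [::[::-1]] [::[::-1]] [::0] [::1]]
 [::(1%N,Lab3 1 (0,1) [::]); (1%N,Fin 10 0 3); (1%N,Fin 13 0 0); (9%N,Lab1 (0,1)); (1%N,Fin 12 0 0)].
(* H91_0 *)
Definition node3_10 : node := Node
 [:: ([::1],[::0;-1]); ([::],[::9]); ([::],[::3;3]); ([::],[::1;2;1])]
 [:: ([::[::1];[::];[::];[::]],false); ([::[::];[::];[::];[::1]],true); ([::[::];[::];[::1];[::]],true); ([::[::];[::1];[::];[::]],true)]
 (unpar [::1;0;3;5;9;8;10;13;15;17;16;19;18;20;23;24;27;29;31;30;33;35;34;37;41;43;47;48;51;54;58;61;63;65;67]%N)
 (untr [::150;250;350;352;450;53;53;151;550;650;253;750;850;453;950;553;1050;1150;1250;1350;653;1450;1550;853;753;1650;1750;953;1850;1053;1950;2050;2150;1253;2250;2350;2450;1953;1153;1850;2550;1553;2650;2253;1353;2150;2750;1753;1453;2850;2950;2648;1653;2549;2848;3050;2349;2453;2053;3150;3250;2753;3350;2953;3450;3452;3550;3552;3053;3251;3153;3351])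
 6
 [::Model 9 [::[::-1;-3];[::0;-1]] [::[::-1;3];[::0;-1]] [::0;1] [::3;8]]
 [::(1%N,Fin 12 0 1); (1%N,Fin 11 0 6); (1%N,Fin 11 0 10); (1%N,Fin 17 0 4); (2%N,Lab1 (1,2)); (1%N,Fin 18 0 12); (6%N,Lab1 (1,2)); (1%N,Fin 22 0 14); (2%N,Lab1 (1,2)); (1%N,Fin 23 0 7); (6%N,Lab1 (1,2)); (1%N,Fin 23 0 14); (2%N,Lab1 (1,2)); (1%N,Fin 22 0 18); (4%N,Lab1 (1,2)); (1%N,Fin 22 0 6); (2%N,Lab1 (1,2)); (1%N,Fin 23 0 18); (1%N,Lab1 (1,2)); (1%N,Fin 16 0 0); (2%N,Lab1 (1,2)); (1%N,Fin 11 0 0)].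
(* H'91_0 *)
Definition node3_11 : node := Node
 [:: ([::1],[::0;-1]); ([::],[::3]); ([::],[::1;3;3;1])]
 [:: ([::[::1];[::];[::]],false); ([::[::];[::];[::1]],true); ([::[::];[::1];[::]],true)]
 (unpar [::1;0;3;2;6;9;11;13;12;15;19;20;23;22;25;26;29;31;30;33;35;34;36;39;41;40;42;47;48;50;55;59;63;64;66]%N)
 (untr [::150;250;350;450;251;53;53;550;650;153;750;353;850;950;1050;853;453;750;1150;653;553;1250;1350;1450;1550;1053;953;1650;1750;1153;1850;1950;2050;1353;2150;2250;1253;2350;2450;1553;2550;2650;1453;2750;2349;1753;2850;1853;2652;2950;1653;3050;1951;2053;3150;2153;2248;3151;3250;2453;2951;2553;3350;2852;3052;3450;2753;3550;3451;3253;3551;3353])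
 6
 [::Model 3 [::[::0;0;-1];[::1;0;0];[::0;1;0]] [::[::0;1;0];[::0;0;1];[::-1;0;0]] [::0;1;0] [::1;0;0]]
 [::(1%N,Lab3 1 (1,2) [::]); (1%N,Fin 21 0 10); (1%N,Fin 20 0 1); (9%N,Lab1 (1,2)); (1%N,Fin 19 0 0)].
(* I1_91 *)
Definition node3_12 : node := Node
 [:: ([::1],[::]); ([::],[::3;-3;3]); ([::],[::1;0;0;1])]
 [:: ([::[::1];[::];[::]],false); ([::[::];[::];[::1]],true); ([::[::];[::1];[::]],true)]
 (unpar [::1;0;2;7;9;8;10;13;15;17;16;19;18;20;23;24;27;29;31;30;33;35;34;37;41;43;47;48;51;54;58;61;63;65;67]%N)
 (untr [::150;250;250;350;53;53;450;153;550;650;353;750;850;453;950;553;1050;1150;1250;1350;653;1450;1550;853;753;1650;1750;953;1850;1053;1950;2050;2150;1253;2250;2350;2450;1953;1153;1850;2550;1553;2650;2253;1353;2150;2750;1753;1453;2850;2950;2650;1653;2553;2850;3050;2353;2453;2053;3150;3250;2753;3350;2953;3450;3450;3550;3550;3053;3253;3153;3353])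
 6
 [::Model 9 [::[::-1;-3];[::0;-1]] [::[::-1;3];[::0;-1]] [::0;0] [::3;8]]
 [::(1%N,Fin 13 0 0); (1%N,Exact 28 34); (1%N,Exact 28 35); (1%N,Lab1 (0,1)); (1%N,Fin 22 0 32); (1%N,Fin 23 0 29); (1%N,Lab1 (0,1)); (1%N,Fin 23 0 34); (1%N,Fin 22 0 35); (1%N,Lab1 (0,1)); (1%N,Fin 22 0 0); (1%N,Fin 23 0 0); (1%N,Exact 28 0)].
(* I2_91 *)
Definition node3_13 : node := Node
 [:: ([::1],[::1;1]); ([::],[::3;-3;3]); ([::],[::1;0;0;1])]
 [:: ([::[::1];[::];[::]],false); ([::[::];[::];[::1]],true); ([::[::];[::1];[::]],true)]
 (unpar [::1;0;2;7;9;8;10;13;15;17;16;19;18;20;23;24;27;29;31;30;33;35;34;37;41;43;47;48;51;54;58;61;63;65;67]%N)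
 (untr [::150;250;248;350;49;53;450;153;550;650;353;750;850;453;950;553;1050;1150;1250;1350;653;1450;1550;853;753;1650;1750;953;1850;1053;1950;2050;2150;1253;2250;2350;2450;1953;1153;1850;2550;1553;2650;2253;1353;2150;2750;1753;1453;2850;2950;2652;1653;2551;2852;3050;2351;2453;2053;3150;3250;2753;3350;2953;3450;3448;3550;3548;3053;3249;3153;3349])
 6
 [::Model 9 [::[::-1;-3];[::0;-1]] [::[::-1;3];[::0;-1]] [::6;0] [::3;8]]
 [::(1%N,Lab3 1 (0,1) [::]); (1%N,Exact 29 35); (1%N,Exact 29 34); (1%N,Lab1 (0,1)); (1%N,Fin 22 0 12); (1%N,Fin 23 0 10); (1%N,Lab1 (0,1)); (1%N,Fin 23 0 32); (1%N,Fin 22 0 29); (1%N,Lab1 (0,1)); (1%N,Fin 22 0 34); (1%N,Fin 23 0 35); (1%N,Exact 29 0)].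
(* tH9_0 *)
Definition node3_14 : node := Node
 [:: ([::1;1],[::3]); ([::3],[::]); ([::],[::1;1])]
 [:: ([::[::1];[::];[::]],false); ([::[::];[::1];[::]],false); ([::[::];[::];[::1]],true); ([::[::3];[::-1;-1];[::]],true)]
 (unpar [::1;0;3;2;5;6;9;11;10;13;15;20;22;25;27;29;28;31;30;32;35;36;39;41;43;42;45;47;46;49;53;55;59;60;64]%N)
 (untr [::150;250;350;450;550;53;53;650;750;153;850;950;1050;353;1150;851;253;752;653;553;950;1250;453;1350;1450;1053;1550;1153;1650;1750;1850;1950;1253;2050;2150;1453;1353;2250;2350;1553;2450;1653;2550;2650;2750;1853;2850;2950;3050;2551;1753;2452;3150;2153;3250;2853;1953;2750;3350;2353;2053;3450;3449;3351;2253;3550;3549;3152;2648;3053;2948;3253])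
 6
 [::Model 9 [::[::-1;0];[::-1;-1]] [::[::-1;0];[::1;-1]] [::3;3] [::0;1]]
 [::(1%N,Fin 15 0 2); (1%N,Fin 15 0 1); (1%N,Fin 15 0 7); (1%N,Fin 15 0 3); (1%N,Lab1 (0,1)); (1%N,Fin 15 0 6); (1%N,Fin 15 0 9); (1%N,Fin 15 0 4); (1%N,Lab1 (0,1)); (1%N,Lab1 (1,0)); (1%N,Fin 15 0 10); (1%N,Fin 15 0 0); (1%N,Lab1 (1,0))].
(* tH9_1 *)
Definition node3_15 : node := Node
 [:: ([::3],[::1;1]); ([::],[::3]); ([::1;1],[::])]
 [:: ([::[::1];[::];[::]],true); ([::[::];[::1];[::]],true); ([::[::];[::];[::1]],false); ([::[::3];[::-1;-1];[::]],false)]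
 (unpar [::1;0;3;2;5;6;9;11;10;13;15;20;22;25;27;29;28;31;30;32;35;36;39;41;43;42;45;47;46;49;53;55;59;60;64]%N)
 (untr [::150;250;350;450;550;53;53;650;750;153;850;950;1050;353;1150;853;253;750;649;553;948;1250;453;1350;1450;1053;1550;1153;1650;1750;1850;1950;1253;2050;2150;1453;1353;2250;2350;1553;2450;1653;2550;2650;2750;1853;2850;2950;3050;2553;1753;2450;3150;2153;3250;2849;1953;2748;3350;2353;2053;3450;3451;3349;2253;3550;3551;3148;2652;3053;2952;3253])
 6
 [::Model 9 [::[::-1;0];[::-1;-1]] [::[::-1;0];[::1;-1]] [::0;7] [::3;6]]
 [::(1%N,Lab1 (1,0)); (12%N,Lab1 (0,1))].
(* H92_0 *)
Definition node3_16 : node := Node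
 [:: ([::1],[::0;-1]); ([::],[::9]); ([::],[::1;2;1])]
 [:: ([::[::1];[::];[::]],false); ([::[::];[::];[::1]],true); ([::[::];[::1];[::]],true)]
 (unpar [::1;0;3;5;9;8;10;13;15;17;16;19;18;20;23;24;27;29;31;30;33;35;34;37;41;43;47;48;51;54;58;61;63;65;67]%N)
 (untr [::150;250;350;358;450;53;53;145;550;650;253;750;850;453;950;553;1050;1150;1250;1350;653;1450;1550;853;753;1650;1750;953;1850;1053;1950;2050;2150;1253;2250;2350;2450;1947;1153;1856;2550;1553;2650;2247;1353;2156;2750;1753;1453;2850;2950;2648;1653;2555;2848;3050;2355;2453;2053;3150;3250;2753;3350;2953;3450;3458;3550;3558;3053;3245;3153;3345])
 18
 [::Model 9 [::[::0;-1];[::1;-2]] [::[::-2;1];[::-1;0]] [::0;1] [::1;0]]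
 [::(1%N,Fin 17 0 4); (3%N,Lab1 (1,2)); (1%N,Fin 22 0 14); (3%N,Lab1 (1,2)); (1%N,Fin 22 0 18); (1%N,Lab1 (1,2)); (1%N,Fin 22 0 6); (2%N,Lab1 (1,2))].
(* H92_1 *)
Definition node3_17 : node := Node
 [:: ([::1],[::-1;-3]); ([::],[::9]); ([::],[::1;2;1])]
 [:: ([::[::1];[::];[::]],false); ([::[::];[::];[::1]],true); ([::[::];[::1];[::]],true)]
 (unpar [::1;0;3;2;5;6;9;11;10;13;15;16;19;21;20;25;27;26;28;31;33;37;39;41;40;42;45;44;47;53;57;60;63;65;69]%N)
 (untr [::150;250;350;450;550;53;53;650;750;153;850;950;1050;353;1150;1146;253;1250;1350;553;1450;1550;453;757;1650;853;1750;1850;653;1950;2050;1053;2150;1747;953;1656;2250;1353;2350;1453;2450;2550;1253;2650;2750;2850;2950;2447;1553;2356;2642;2053;3050;2153;1853;2942;3150;2253;1953;2743;2543;3250;3350;3346;3450;3053;2853;3157;3550;3546;3253;3457])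
 18
 [::Model 9 [::[::0;-1];[::1;-2]] [::[::-2;1];[::-1;0]] [::1;3] [::1;0]]
 [::(1%N,Fin 18 0 4); (3%N,Lab1 (1,1)); (1%N,Fin 22 0 26); (3%N,Lab1 (1,1)); (1%N,Fin 22 0 3); (1%N,Lab1 (1,1)); (1%N,Fin 22 0 21); (2%N,Lab1 (1,1))].
(* H92_2 *)
Definition node3_18 : node := Node
 [:: ([::1],[::-1;-4]); ([::],[::9]); ([::],[::1;2;1])]
 [:: ([::[::1];[::];[::]],false); ([::[::];[::];[::1]],true); ([::[::];[::1];[::]],true)]
 (unpar [::1;0;3;2;5;6;9;11;10;13;15;14;16;20;22;25;27;29;31;33;35;34;37;36;39;38;42;45;46;49;50;55;57;61;63]%N)
 (untr [::150;250;350;450;550;53;53;650;750;153;850;950;1050;353;1150;1250;253;1350;647;553;956;1450;453;1550;1650;753;1750;853;1850;1053;1950;1153;2050;2052;2150;2250;2350;2450;2550;2650;1253;1651;1353;2750;2850;1753;1453;2950;3050;1853;1553;3150;2754;1953;3250;2153;3350;3352;3154;2353;3450;3452;3550;2553;2649;3552;2253;2851;2453;3051;2949;3251])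
 18
 [::Model 9 [::[::0;-1];[::1;-2]] [::[::-2;1];[::-1;0]] [::1;4] [::1;0]]
 [::(1%N,Lab3 1 (0,1) [::]); (3%N,Lab1 (0,1)); (1%N,Fin 22 0 35); (3%N,Lab1 (0,1)); (1%N,Fin 22 0 0); (1%N,Lab1 (0,1)); (1%N,Fin 22 0 32); (2%N,Lab1 (0,1))].
(* H'92_0 *)
Definition node3_19 : node := Node
 [:: ([::1],[::0;-1]); ([::],[::3]); ([::],[::1;4;6;4;1])]
 [:: ([::[::1];[::];[::]],false); ([::[::];[::];[::1]],true); ([::[::];[::1];[::]],true)]
 (unpar [::1;0;3;2;6;9;11;13;12;15;19;20;23;22;25;26;29;31;30;33;35;34;36;39;41;40;42;47;48;50;55;59;63;64;66]%N)
 (untr [::150;250;350;450;251;53;53;550;650;153;750;353;850;950;1050;847;453;756;1150;653;553;1250;1350;1450;1550;1053;953;1650;1750;1153;1850;1950;2050;1353;2150;2250;1253;2350;2450;1553;2550;2650;1453;2750;2355;1753;2850;1853;2646;2950;1653;3050;1957;2053;3150;2153;2248;3151;3250;2453;2951;2553;3350;2852;3052;3450;2753;3550;3451;3253;3551;3353])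
 18
 [::Model 3 [::[::0;0;0;-1];[::1;0;0;-1];[::0;1;0;0];[::0;0;1;-1]] [::[::-1;1;0;0];[::0;0;1;0];[::-1;0;0;1];[::-1;0;0;0]] [::0;1;0;0] [::1;0;0;0]]
 [::(1%N,Fin 20 0 1); (12%N,Lab1 (1,2))].
(* H'92_1 *)
Definition node3_20 : node := Node
 [:: ([::1],[::0;0;0;-2]); ([::],[::3]); ([::],[::1;4;6;4;1])]
 [:: ([::[::1];[::];[::]],false); ([::[::];[::];[::1]],true); ([::[::];[::1];[::]],true)]
 (unpar [::0;3;5;4;6;9;11;13;12;15;19;20;23;22;25;26;29;31;30;33;35;34;36;39;41;40;42;47;48;50;55;59;63;64;66]%N)
 (untr [::57;150;250;53;350;450;153;550;650;253;750;353;850;950;1050;847;453;756;1150;653;553;1250;1350;1450;1550;1053;953;1650;1750;1153;1850;1950;2050;1353;2150;2250;1253;2350;2450;1553;2550;2650;1453;2750;2349;1753;2850;1853;2658;2950;1653;3050;1945;2053;3150;2153;2254;3157;3250;2453;2957;2553;3350;2846;3046;3450;2753;3550;3457;3253;3557;3353])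
 18
 [::Model 3 [::[::0;0;0;-1];[::1;0;0;-1];[::0;1;0;0];[::0;0;1;-1]] [::[::-1;1;0;0];[::0;0;1;0];[::-1;0;0;1];[::-1;0;0;0]] [::0;0;0;2] [::1;0;0;0]]
 [::(1%N,Fin 21 0 14); (12%N,Lab1 (1,1))].
(* H'92_2 *)
Definition node3_21 : node := Node
 [:: ([::1],[::-1;-1]); ([::],[::3]); ([::],[::1;4;6;4;1])]
 [:: ([::[::1];[::];[::]],false); ([::[::];[::];[::1]],true); ([::[::];[::1];[::]],true)]
 (unpar [::1;0;3;2;5;6;9;11;10;13;15;14;16;20;22;25;27;31;33;32;35;34;37;36;38;41;42;45;49;51;53;52;57;59;58]%N)
 (untr [::150;250;350;450;550;53;53;650;750;153;850;950;1050;353;1150;1250;253;1350;647;553;956;1450;453;1550;1650;753;1750;853;1445;1053;1850;1153;1950;2050;2150;2250;2350;2450;1253;2550;2650;1653;1353;2750;2850;1753;1553;2845;2950;1853;3050;1953;3150;3250;2545;2153;3350;2358;3450;3550;2758;3147;2053;3056;3245;2653;2253;3452;2453;3351;3545;2953])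
 18
 [::Model 3 [::[::0;0;0;-1];[::1;0;0;-1];[::0;1;0;0];[::0;0;1;-1]] [::[::-1;1;0;0];[::0;0;1;0];[::-1;0;0;1];[::-1;0;0;0]] [::1;1;0;0] [::1;0;0;0]]
 [::(1%N,Lab3 1 (0,1) [::]); (12%N,Lab1 (0,1))].
(* H27_2 *)
Definition node3_22 : node := Node
 [:: ([::1],[::]); ([::],[::27]); ([::],[::-2;1])]
 [:: ([::[::1];[::];[::]],false); ([::[::];[::];[::1]],true); ([::[::];[::1];[::]],true)]
 (unpar [::1;0;2;7;9;8;10;13;15;17;16;19;20;23;27;29;28;31;35;36;39;38;41;42;45;47;46;49;51;52;55;57;61;63;67]%N)
 (untr [::150;250;250;350;53;53;450;153;550;650;353;750;850;453;950;553;1050;1150;1250;1248;653;1350;1450;853;753;955;1550;1053;1650;1750;1850;1647;1153;1556;1950;1453;1353;2050;2150;2250;2350;1853;1753;2450;2550;1953;2650;2750;2850;2153;2950;2954;2053;3050;3150;2353;3250;3256;2253;2549;3350;2653;3450;3442;2453;2847;3550;3544;2753;3143;3053;3359])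
 18
 [::Model 27 [::[::2]] [::[::-13]] [::0] [::7]]
 [::(1%N,Lab3 1 (0,1) [::]); (1%N,Fin 24 0 32); (1%N,Fin 24 0 35); (9%N,Lab1 (0,1)); (1%N,Fin 24 0 0)].
(* H27_5 *)
Definition node3_23 : node := Node
 [:: ([::1],[::]); ([::],[::27]); ([::],[::-5;1])]
 [:: ([::[::1];[::];[::]],false); ([::[::];[::];[::1]],true); ([::[::];[::1];[::]],true)]
 (unpar [::1;0;2;7;9;8;10;13;15;17;19;18;22;25;27;29;28;31;35;36;39;38;41;42;45;47;46;49;51;52;55;57;61;63;67]%N)
 (untr [::150;250;250;350;53;53;450;153;550;650;353;750;850;453;950;553;1050;1054;1150;1250;653;849;753;1350;1450;953;1550;1153;1650;1750;1850;1647;1253;1556;1950;1453;1353;2050;2150;2250;2350;1853;1753;2450;2550;1953;2650;2750;2850;2153;2950;2944;2053;3050;3150;2353;3250;3248;2253;2559;3350;2653;3450;3456;2453;2855;3550;3542;2753;3147;3053;3343])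
 18
 [::Model 27 [::[::5]] [::[::11]] [::0] [::13]]
 [::(1%N,Lab3 1 (0,1) [::]); (1%N,Fin 25 0 29); (1%N,Fin 25 0 34); (9%N,Lab1 (0,1)); (1%N,Fin 25 0 0)].
(* H27_11 *)
Definition node3_24 : node := Node
 [:: ([::1],[::]); ([::],[::27]); ([::],[::-11;1])]
 [:: ([::[::1];[::];[::]],false); ([::[::];[::];[::1]],true); ([::[::];[::1];[::]],true)]
 (unpar [::1;0;2;7;9;8;10;13;15;17;16;19;20;23;27;29;28;31;35;36;39;38;41;42;45;47;46;49;51;52;55;57;61;63;67]%N)
 (untr [::150;250;250;350;53;53;450;153;550;650;353;750;850;453;950;553;1050;1150;1250;1254;653;1350;1450;853;753;949;1550;1053;1650;1750;1850;1647;1153;1556;1950;1453;1353;2050;2150;2250;2350;1853;1753;2450;2550;1953;2650;2750;2850;2153;2950;2942;2053;3050;3150;2353;3250;3256;2253;2543;3350;2653;3450;3448;2453;2847;3550;3544;2753;3155;3053;3359])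
 18
 [::Model 27 [::[::11]] [::[::5]] [::0] [::25]]
 [::(1%N,Lab3 1 (0,1) [::]); (1%N,Fin 26 0 32); (1%N,Fin 26 0 35); (9%N,Lab1 (0,1)); (1%N,Fin 26 0 0)].
(* H27_14 *)
Definition node3_25 : node := Node
 [:: ([::1],[::]); ([::],[::27]); ([::],[::-14;1])]
 [:: ([::[::1];[::];[::]],false); ([::[::];[::];[::1]],true); ([::[::];[::1];[::]],true)]
 (unpar [::1;0;2;7;9;8;10;13;15;17;19;18;22;25;27;29;28;31;35;36;39;38;41;42;45;47;46;49;51;52;55;57;61;63;67]%N)
 (untr [::150;250;250;350;53;53;450;153;550;650;353;750;850;453;950;553;1050;1048;1150;1250;653;855;753;1350;1450;953;1550;1153;1650;1750;1850;1647;1253;1556;1950;1453;1353;2050;2150;2250;2350;1853;1753;2450;2550;1953;2650;2750;2850;2153;2950;2944;2053;3050;3150;2353;3250;3242;2253;2559;3350;2653;3450;3456;2453;2843;3550;3554;2753;3147;3053;3349])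
 18
 [::Model 27 [::[::-13]] [::[::2]] [::0] [::4]]
 [::(1%N,Lab3 1 (0,1) [::]); (1%N,Fin 27 0 29); (1%N,Fin 27 0 34); (9%N,Lab1 (0,1)); (1%N,Fin 27 0 0)].
(* H27_20 *)
Definition node3_26 : node := Node
 [:: ([::1],[::]); ([::],[::27]); ([::],[::-20;1])]
 [:: ([::[::1];[::];[::]],false); ([::[::];[::];[::1]],true); ([::[::];[::1];[::]],true)]
 (unpar [::1;0;2;7;9;8;10;13;15;17;16;19;20;23;27;29;28;31;35;36;39;38;41;42;45;47;46;49;51;52;55;57;61;63;67]%N)
 (untr [::150;250;250;350;53;53;450;153;550;650;353;750;850;453;950;553;1050;1150;1250;1242;653;1350;1450;853;753;943;1550;1053;1650;1750;1850;1647;1153;1556;1950;1453;1353;2050;2150;2250;2350;1853;1753;2450;2550;1953;2650;2750;2850;2153;2950;2948;2053;3050;3150;2353;3250;3256;2253;2555;3350;2653;3450;3454;2453;2847;3550;3544;2753;3149;3053;3359])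
 18
 [::Model 27 [::[::-7]] [::[::-4]] [::0] [::16]]
 [::(3%N,Lab3 1 (0,1) [::]); (9%N,Lab1 (0,1)); (1%N,Lab3 1 (0,1) [::])].
(* H27_23 *)
Definition node3_27 : node := Node
 [:: ([::1],[::]); ([::],[::27]); ([::],[::-23;1])]
 [:: ([::[::1];[::];[::]],false); ([::[::];[::];[::1]],true); ([::[::];[::1];[::]],true)]
 (unpar [::1;0;2;7;9;8;10;13;15;17;19;18;22;25;27;29;28;31;35;36;39;38;41;42;45;47;46;49;51;52;55;57;61;63;67]%N)
 (untr [::150;250;250;350;53;53;450;153;550;650;353;750;850;453;950;553;1050;1042;1150;1250;653;843;753;1350;1450;953;1550;1153;1650;1750;1850;1647;1253;1556;1950;1453;1353;2050;2150;2250;2350;1853;1753;2450;2550;1953;2650;2750;2850;2153;2950;2944;2053;3050;3150;2353;3250;3254;2253;2559;3350;2653;3450;3456;2453;2849;3550;3548;2753;3147;3053;3355])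
 18
 [::Model 27 [::[::-4]] [::[::-7]] [::0] [::22]]
 [::(3%N,Lab3 1 (0,1) [::]); (9%N,Lab1 (0,1)); (1%N,Lab3 1 (0,1) [::])].
(* I1_92 *)
Definition node3_28 : node := Node
 [:: ([::1],[::]); ([::],[::3;-3;3]); ([::],[::1;-2;3;-2;1])]
 [:: ([::[::1];[::];[::]],false); ([::[::];[::];[::1]],true); ([::[::];[::1];[::]],true)]
 (unpar [::1;0;2;7;9;8;10;13;15;17;16;19;18;20;23;24;27;29;31;30;33;35;34;37;41;43;47;48;51;54;58;61;63;65;67]%N)
 (untr [::150;250;250;350;53;53;450;153;550;650;353;750;850;453;950;553;1050;1150;1250;1350;653;1450;1550;853;753;1650;1750;953;1850;1053;1950;2050;2150;1253;2250;2350;2450;1953;1153;1850;2550;1553;2650;2253;1353;2150;2750;1753;1453;2850;2950;2656;1653;2547;2850;3050;2353;2453;2053;3150;3250;2753;3350;2953;3450;3456;3550;3544;3053;3247;3153;3359])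
 18
 [::Model 9 [::[::-1;-1;0;-3];[::0;-1;0;-3];[::0;1;0;2];[::0;1;1;1]] [::[::-1;1;0;0];[::0;2;3;0];[::0;-1;-2;1];[::0;-1;-1;0]] [::0;0;0;0] [::3;0;0;8]]
 [::(1%N,Lab3 1 (0,1) [::]); (2%N,Lab3 3 (0,1) [::X;Y;X;X;Y;X;Y;X;Y;X;X;Y;X;Y;X;Y;X;X;Y;X;X]); (9%N,Lab1 (0,1)); (1%N,Lab3 3 (0,1) [::X;Y;X;X;Y;X;Y;X;Y;X;X;Y;X;Y;X;Y;X;X;Y;X;X])].
(* I2_92 *)
Definition node3_29 : node := Node
 [:: ([::1],[::1;1]); ([::],[::3;-3;3]); ([::],[::1;-2;3;-2;1])]
 [:: ([::[::1];[::];[::]],false); ([::[::];[::];[::1]],true); ([::[::];[::1];[::]],true)]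
 (unpar [::1;0;2;7;9;8;10;13;15;17;16;19;18;20;23;24;27;29;31;30;33;35;34;37;41;43;47;48;51;54;58;61;63;65;67]%N)
 (untr [::150;250;242;350;43;53;450;153;550;650;353;750;850;453;950;553;1050;1150;1250;1350;653;1450;1550;853;753;1650;1750;953;1850;1053;1950;2050;2150;1253;2250;2350;2450;1959;1153;1844;2550;1553;2650;2259;1353;2144;2750;1753;1453;2850;2950;2646;1653;2557;2852;3050;2351;2453;2053;3150;3250;2753;3350;2953;3450;3454;3550;3548;3053;3249;3153;3355])
 18
 [::Model 9 [::[::-1;-1;0;-3];[::0;-1;0;-3];[::0;1;0;2];[::0;1;1;1]] [::[::-1;1;0;0];[::0;2;3;0];[::0;-1;-2;1];[::0;-1;-1;0]] [::6;6;2;2] [::3;0;0;8]]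
 [::(1%N,Lab3 1 (0,1) [::]); (2%N,Lab3 3 (0,1) [::X;Y;X;X;Y;X;Y;X;Y;X;X;Y;X;Y;X;Y;X;X;Y;X;X]); (9%N,Lab1 (0,1)); (1%N,Lab3 3 (0,1) [::X;Y;X;X;Y;X;Y;X;Y;X;X;Y;X;Y;X;Y;X;X;Y;X;X])].
Definition nodes3 : seq node := [:: node3_0; node3_1; node3_2; node3_3; node3_4; node3_5; node3_6; node3_7; node3_8; node3_9; node3_10; node3_11; node3_12; node3_13; node3_14; node3_15; node3_16; node3_17; node3_18; node3_19; node3_20; node3_21; node3_22; node3_23; node3_24; node3_25; node3_26; node3_27; node3_28; node3_29].

(* root5 *)
Definition node5_0 : node := Node
 [:: ([::1],[::]); ([::],[::1])]
 [:: ([::[::1];[::]],false); ([::[::];[::1]],true)]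
 (unpar [::]%N)
 (untr [::])
 1
 [::]
 [::(1%N,Fin 1 0 2); (1%N,Fin 1 0 3); (1%N,Fin 1 0 5); (1%N,Fin 1 0 4); (1%N,Fin 1 0 1); (1%N,Fin 1 0 0)].
(* H50 *)
Definition node5_1 : node := Node
 [:: ([::1],[::]); ([::],[::5]); ([::],[::1;1])]
 [:: ([::[::1];[::];[::]],false); ([::[::];[::];[::1]],true); ([::[::];[::1];[::]],true)]
 (unpar [::1;0;2;7;9;8;10;15;16;19;21]%N)
 (untr [::150;250;250;350;51;51;450;151;550;650;351;750;751;451;850;551;650;950;1050;851;1150;1150;951;1051])
 2
 [::Model 5 [::[::-1]] [::[::-1]] [::0] [::1]]
 [::(1%N,Fin 5 0 0); (1%N,Fin 2 0 3); (1%N,Fin 2 0 11); (1%N,Fin 3 0 3); (1%N,Fin 4 0 11); (1%N,Lab3 5 (0,1) [::X;Y;X;Y;X;Y;X;Y;X;X]); (1%N,Fin 6 0 23); (1%N,Fin 7 0 22); (1%N,Fin 8 0 29); (1%N,Fin 9 0 29); (1%N,Lab3 5 (0,1) [::X;Y;X;Y;X;Y;X;Y;X;X]); (1%N,Fin 8 0 47); (1%N,Fin 6 0 46); (1%N,Fin 9 0 23); (1%N,Fin 7 0 57); (1%N,Lab3 5 (0,1) [::X;Y;X;Y;X;Y;X;Y;X;X]); (1%N,Fin 7 0 46); (1%N,Fin 9 0 47); (1%N,Fin 6 0 22); (1%N,Fin 8 0 52); (1%N,Lab3 5 (0,1) [::X;Y;X;Y;X;Y;X;Y;X;X]); (1%N,Fin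 9 0 22); (1%N,Fin 8 0 23); (1%N,Fin 7 0 39); (1%N,Fin 6 0 39); (1%N,Lab3 5 (0,1) [::X;Y;X;Y;X;Y;X;Y;X;X]); (1%N,Fin 6 0 0); (1%N,Fin 7 0 0); (1%N,Fin 8 0 0); (1%N,Fin 9 0 0); (1%N,Fin 4 0 0)].
(* H51_0 *)
Definition node5_2 : node := Node
 [:: ([::1],[::0;-1]); ([::],[::5]); ([::],[::1;2;1])]
 [:: ([::[::1];[::];[::]],false); ([::[::];[::];[::1]],true); ([::[::];[::1];[::]],true)]
 (unpar [::1;0;3;5;9;8;10;15;16;19;21]%N)
 (untr [::150;250;350;354;450;53;53;149;550;650;253;750;749;453;850;553;654;950;1050;853;1150;1152;953;1051])
 10
 [::Model 5 [::[::0;-1];[::1;-2]] [::[::-2;1];[::-1;0]] [::0;1] [::1;0]]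
 [::(1%N,Fin 3 0 0); (1%N,Fin 10 0 0); (1%N,Fin 10 0 15); (1%N,Fin 10 0 24); (1%N,Fin 10 0 7); (1%N,Fin 6 0 13); (4%N,Lab1 (1,4)); (1%N,Fin 6 0 30); (4%N,Lab1 (1,4)); (1%N,Fin 6 0 36); (4%N,Lab1 (1,4)); (1%N,Fin 6 0 1); (4%N,Lab1 (1,4)); (1%N,Fin 6 0 14); (4%N,Lab1 (1,4)); (1%N,Fin 10 0 30)].
(* H51_1 *)
Definition node5_3 : node := Node
 [:: ([::1],[::-1;-2]); ([::],[::5]); ([::],[::1;2;1])]
 [:: ([::[::1];[::];[::]],false); ([::[::];[::];[::1]],true); ([::[::];[::1];[::]],true)]
 (unpar [::1;0;3;5;9;8;10;15;16;19;21]%N)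
 (untr [::150;250;350;348;450;53;53;155;550;650;253;750;755;453;850;553;648;950;1050;853;1150;1148;953;1055])
 10
 [::Model 5 [::[::0;-1];[::1;-2]] [::[::-2;1];[::-1;0]] [::1;2] [::1;0]]
 [::(1%N,Fin 4 0 1); (1%N,Fin 10 1 0); (1%N,Fin 10 1 30); (1%N,Fin 10 1 15); (1%N,Fin 10 1 24); (1%N,Fin 6 0 36); (4%N,Lab1 (1,4)); (1%N,Fin 6 0 1); (4%N,Lab1 (1,4)); (1%N,Fin 6 0 30); (4%N,Lab1 (1,4)); (1%N,Fin 6 0 14); (4%N,Lab1 (1,4)); (1%N,Fin 6 0 13); (4%N,Lab1 (1,4)); (1%N,Fin 10 1 7)].
(* I51 *)
Definition node5_4 : node := Node
 [:: ([::1],[::]); ([::],[::1;-1;1;-1;1])]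
 [:: ([::[::1];[::]],false); ([::[::];[::1]],true)]
 (unpar [::1;0;2;7;9;8;10;15;16;19;21]%N)
 (untr [::150;250;250;350;53;53;450;153;550;650;353;750;753;453;850;553;650;950;1050;853;1150;1146;953;1047])
 10
 [::Model 5 [::[::0;-1];[::1;-2]] [::[::-2;1];[::-1;0]] [::0;0] [::2;0]]
 [::(1%N,Fin 5 0 0); (1%N,Fin 6 0 23); (1%N,Fin 6 0 46); (1%N,Fin 6 0 22); (1%N,Fin 6 0 39); (1%N,Fin 6 0 0)].
(* tH5 *)
Definition node5_5 : node := Node
 [:: ([::5],[::]); ([::1;1],[::]); ([::],[::5]); ([::],[::1;1])]
 [:: ([::[::];[::1];[::];[::]],false); ([::[::1];[::];[::];[::]],false); ([::[::];[::];[::];[::1]],true); ([::[::];[::];[::1];[::]],true)]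
 (unpar [::1;0;3;2;5;6;9;11;10;13;15;14;16;19;21;20;22;25;27;29;28;30;33;35;37;36;38;40;45;47;46;48;50;55;57;58;60;65;67;69;68;70;73;75;77;76;78;80;85;87;86;88;90;97;99;107;108;110;112]%N)
 (untr [::150;250;350;450;550;51;51;650;750;151;850;950;1050;351;1150;1250;251;1350;1450;551;1550;1650;451;1750;1850;751;1950;851;2050;2150;651;2250;2350;1051;2450;1151;2550;2650;2651;2750;951;2850;2251;1451;2950;1551;3050;3150;3151;3250;1251;3350;1350;1851;3450;1951;3550;2051;2150;3650;1651;3750;1750;2351;3850;2451;3950;2551;4050;4150;4151;4250;4350;2951;4450;3051;4550;4650;4651;4750;2751;4850;2850;3451;4950;3551;5050;5150;5151;5250;3251;5350;3350;3851;4850;3951;5450;4051;5550;5050;3651;4951;3750;4351;5350;4451;5650;4551;4751;5750;4251;5850;5251;5950;5850;5451;5951;5551;5750;5651])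
 2
 [::Model 5 [::[::-1;0];[::0;-1]] [::[::-1;0];[::0;-1]] [::1;0] [::0;1]]
 [::(25%N,Lab1 (0,1)); (1%N,Fin 6 0 2); (1%N,Lab1 (1,1)); (1%N,Lab1 (1,2)); (1%N,Lab1 (1,3)); (1%N,Lab1 (1,4)); (1%N,Lab1 (1,0)); (1%N,Fin 6 0 3); (1%N,Lab1 (1,2)); (1%N,Lab1 (1,3)); (1%N,Lab1 (1,4)); (1%N,Lab1 (1,0)); (1%N,Lab1 (1,1)); (1%N,Fin 6 0 5); (1%N,Lab1 (1,3)); (1%N,Lab1 (1,4)); (1%N,Lab1 (1,0)); (1%N,Lab1 (1,1)); (1%N,Lab1 (1,2)); (1%N,Fin 6 0 4); (1%N,Lab1 (1,4)); (1%N,Lab1 (1,0)); (1%N,Lab1 (1,1)); (1%N,Lab1 (1,2)); (1%N,Lab1 (1,3)); (1%N,Fin 6 0 1); (1%N,Fin 7 0 2); (1%N,Lab1 (1,3)); (1%N,Lab1 (1,1)); (1%N,Lab1 (1,4)); (1%N,Lab1 (1,2)); (1%N,Lab1 (1,0)); (1%N,Lab1 (1,3)); (1%N,Fin 7 0 3); (1%N,Lab1 (1,4)); (1%N,Lab1 (1,2)); (1%N,Lab1 (1,0)); (1%N,Lab1 (1,3)); (1%N,Lab1 (1,1)); (1%N,Lab1 (1,4)); (1%N,Fin 7 0 5); (1%N,Lab1 (1,0)); (1%N,Fin 7 0 4); (1%N,Lab1 (1,1)); (1%N,Lab1 (1,4)); (1%N,Lab1 (1,2)); (1%N,Lab1 (1,0));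 (1%N,Lab1 (1,3)); (1%N,Lab1 (1,1)); (1%N,Fin 7 0 1); (1%N,Lab1 (1,2)); (1%N,Fin 8 0 2); (1%N,Lab1 (1,2)); (1%N,Lab1 (1,4)); (1%N,Lab1 (1,1)); (1%N,Lab1 (1,3)); (1%N,Lab1 (1,0)); (1%N,Lab1 (1,2)); (1%N,Lab1 (1,4)); (1%N,Fin 8 0 3); (1%N,Lab1 (1,3)); (1%N,Lab1 (1,0)); (1%N,Fin 8 0 5); (1%N,Lab1 (1,4)); (1%N,Lab1 (1,1)); (1%N,Lab1 (1,3)); (1%N,Lab1 (1,0)); (1%N,Lab1 (1,2)); (1%N,Lab1 (1,4)); (1%N,Lab1 (1,1)); (1%N,Fin 8 0 4); (1%N,Lab1 (1,0)); (1%N,Lab1 (1,2)); (1%N,Fin 8 0 1); (1%N,Lab1 (1,1)); (1%N,Lab1 (1,3)); (1%N,Fin 9 0 2); (1%N,Lab1 (1,4)); (1%N,Lab1 (1,3)); (1%N,Lab1 (1,2)); (1%N,Lab1 (1,1)); (1%N,Lab1 (1,0)); (1%N,Lab1 (1,4)); (1%N,Lab1 (1,3)); (1%N,Lab1 (1,2)); (1%N,Fin 9 0 3); (1%N,Lab1 (1,0)); (1%N,Lab1 (1,4)); (1%N,Lab1 (1,3)); (1%N,Fin 9 0 5); (1%N,Lab1 (1,1)); (1%N,Lab1 (1,0)); (1%N,Lab1 (1,4)); (1%N,Fin 9 0 4); (1%N,Lab1 (1,2)); (1%N,Lab1 (1,1)); (1%N,Lab1 (1,0)); (1%N,Fin 9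 0 1); (1%N,Lab1 (1,3)); (1%N,Lab1 (1,2)); (1%N,Lab1 (1,1)); (1%N,Fin 10 2 0); (1%N,Fin 10 2 6); (1%N,Fin 10 2 15); (1%N,Fin 10 2 10); (1%N,Fin 10 2 3); (1%N,Lab1 (1,0)); (1%N,Lab1 (1,1)); (1%N,Lab1 (1,2)); (1%N,Lab1 (1,3)); (1%N,Lab1 (1,4)); (1%N,Lab1 (1,0)); (1%N,Lab1 (1,1)); (1%N,Lab1 (1,2)); (1%N,Lab1 (1,3)); (1%N,Lab1 (1,4)); (1%N,Lab1 (1,0)); (1%N,Lab1 (1,1)); (1%N,Lab1 (1,2)); (1%N,Lab1 (1,3)); (1%N,Lab1 (1,4)); (1%N,Lab1 (1,0)); (1%N,Lab1 (1,1)); (1%N,Lab1 (1,2)); (1%N,Lab1 (1,3)); (1%N,Lab1 (1,4)); (1%N,Lab1 (0,1)); (1%N,Fin 6 0 0); (1%N,Fin 7 0 0); (1%N,Fin 8 0 0); (1%N,Fin 9 0 0); (1%N,Fin 10 2 1)].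
(* H25_4 *)
Definition node5_6 : node := Node
 [:: ([::1],[::]); ([::],[::25]); ([::],[::-4;1])]
 [:: ([::[::1];[::];[::]],false); ([::[::];[::];[::1]],true); ([::[::];[::1];[::]],true)]
 (unpar [::1;0;2;7;9;8;10;13;15;17;16;19;18;20;23;24;27;29;31;30;33;35;37;38;41;43;42;49;51;52;55;57;56;61;63;62;64;67;69;70;73;75;77;76;81;83;85;86;89;91;90;99;100;103;107;108;111;113;117]%N)
 (untr [::150;250;250;350;53;53;450;153;550;650;353;750;850;453;950;553;1050;1150;1250;1350;653;1450;1550;853;753;1650;1750;953;1850;1053;1950;2050;2150;1253;2250;2248;2350;2354;1153;2450;2550;1553;2650;2750;1353;1755;1453;1849;2850;1953;2950;2954;1653;3050;3150;2153;3250;3350;2053;2549;3450;2653;3550;3650;2453;3750;3850;2853;3950;3946;2753;4050;4150;3153;4250;3253;4350;4450;3053;3447;4550;3553;4650;4652;4750;4750;3353;4850;4950;3853;5050;5150;3653;4151;3753;4253;5155;4353;5250;5248;4053;5350;5450;4553;4453;4955;5550;5053;4848;5650;5750;5752;5850;5453;5353;5551;5950;5946;5653;5847])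
 10
 [::Model 25 [::[::4]] [::[::-6]] [::0] [::19]]
 [::(1%N,Lab3 1 (0,1) [::]); (1%N,Fin 7 0 22); (1%N,Fin 7 0 57); (1%N,Fin 7 0 46); (1%N,Fin 7 0 39); (25%N,Lab1 (0,1)); (1%N,Fin 7 0 0)].
(* H25_9 *)
Definition node5_7 : node := Node
 [:: ([::1],[::]); ([::],[::25]); ([::],[::-9;1])]
 [:: ([::[::1];[::];[::]],false); ([::[::];[::];[::1]],true); ([::[::];[::1];[::]],true)]
 (unpar [::1;0;2;7;9;8;10;13;15;17;16;19;18;20;23;24;27;29;31;30;33;35;37;38;41;43;42;49;51;52;55;57;56;61;63;62;64;67;69;70;73;75;77;76;81;83;85;86;89;91;90;99;100;103;107;108;111;113;117]%N)
 (untr [::150;250;250;350;53;53;450;153;550;650;353;750;850;453;950;553;1050;1150;1250;1350;653;1450;1550;853;753;1650;1750;953;1850;1053;1950;2050;2150;1253;2250;2252;2350;2350;1153;2450;2550;1553;2650;2750;1353;1751;1453;1853;2850;1953;2950;2952;1653;3050;3150;2153;3250;3350;2053;2551;3450;2653;3550;3650;2453;3750;3850;2853;3950;3948;2753;4050;4150;3153;4250;3253;4350;4450;3053;3455;4550;3553;4650;4654;4750;4748;3353;4850;4950;3853;5050;5150;3653;4149;3753;4255;5155;4353;5250;5254;4053;5350;5450;4553;4453;4949;5550;5053;4848;5650;5750;5746;5850;5453;5353;5547;5950;5946;5653;5847])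
 10
 [::Model 25 [::[::9]] [::[::-11]] [::0] [::14]]
 [::(1%N,Lab3 1 (0,1) [::]); (1%N,Fin 8 0 29); (1%N,Fin 8 0 47); (1%N,Fin 8 0 52); (1%N,Fin 8 0 23); (25%N,Lab1 (0,1)); (1%N,Fin 8 0 0)].
(* H25_14 *)
Definition node5_8 : node := Node
 [:: ([::1],[::]); ([::],[::25]); ([::],[::-14;1])]
 [:: ([::[::1];[::];[::]],false); ([::[::];[::];[::1]],true); ([::[::];[::1];[::]],true)]
 (unpar [::1;0;2;7;9;8;10;13;15;17;16;19;18;20;23;24;27;29;31;30;33;35;37;38;41;43;42;49;51;52;55;57;56;61;63;62;64;67;69;70;73;75;77;76;81;83;85;86;89;91;90;99;100;103;107;108;111;113;117]%N)
 (untr [::150;250;250;350;53;53;450;153;550;650;353;750;850;453;950;553;1050;1150;1250;1350;653;1450;1550;853;753;1650;1750;953;1850;1053;1950;2050;2150;1253;2250;2250;2350;2352;1153;2450;2550;1553;2650;2750;1353;1753;1453;1851;2850;1953;2950;2948;1653;3050;3150;2153;3250;3350;2053;2555;3450;2653;3550;3650;2453;3750;3850;2853;3950;3952;2753;4050;4150;3153;4250;3253;4350;4450;3053;3451;4550;3553;4650;4648;4750;4754;3353;4850;4950;3853;5050;5150;3653;4155;3753;4249;5155;4353;5250;5246;4053;5350;5450;4553;4453;4947;5550;5053;4848;5650;5750;5754;5850;5453;5353;5549;5950;5946;5653;5847])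
 10
 [::Model 25 [::[::-11]] [::[::9]] [::0] [::9]]
 [::(1%N,Lab3 1 (0,1) [::]); (1%N,Fin 9 0 29); (1%N,Fin 9 0 23); (1%N,Fin 9 0 47); (1%N,Fin 9 0 22); (25%N,Lab1 (0,1)); (1%N,Fin 9 0 0)].
(* H25_19 *)
Definition node5_9 : node := Node
 [:: ([::1],[::]); ([::],[::25]); ([::],[::-19;1])]
 [:: ([::[::1];[::];[::]],false); ([::[::];[::];[::1]],true); ([::[::];[::1];[::]],true)]
 (unpar [::1;0;2;7;9;8;10;13;15;17;16;19;18;20;23;24;27;29;31;30;33;35;37;38;41;43;42;49;51;52;55;57;56;61;63;62;64;67;69;70;73;75;77;76;81;83;85;86;89;91;90;99;100;103;107;108;111;113;117]%N)
 (untr [::150;250;250;350;53;53;450;153;550;650;353;750;850;453;950;553;1050;1150;1250;1350;653;1450;1550;853;753;1650;1750;953;1850;1053;1950;2050;2150;1253;2250;2254;2350;2348;1153;2450;2550;1553;2650;2750;1353;1749;1453;1855;2850;1953;2950;2946;1653;3050;3150;2153;3250;3350;2053;2547;3450;2653;3550;3650;2453;3750;3850;2853;3950;3954;2753;4050;4150;3153;4250;3253;4350;4450;3053;3449;4550;3553;4650;4650;4750;4752;3353;4850;4950;3853;5050;5150;3653;4153;3753;4251;5155;4353;5250;5252;4053;5350;5450;4553;4453;4951;5550;5053;4848;5650;5750;5748;5850;5453;5353;5555;5950;5946;5653;5847])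
 10
 [::Model 25 [::[::-6]] [::[::4]] [::0] [::4]]
 [::(5%N,Lab3 1 (0,1) [::]); (25%N,Lab1 (0,1)); (1%N,Lab3 1 (0,1) [::])].
(* tI5 *)
Definition node5_10 : node := Node
 [:: ([::1;-1;1;-1;1],[::]); ([::],[::1;-1;1;-1;1])]
 [:: ([::[::1];[::]],false); ([::[::];[::1]],true)]
 (unpar [::1;0;3;2;5;6;9;11;10;13;15;14;16;19;21;20;22;25;27;29;28;30;33;35;37;36;38;40;45;47;46;48;50;55;57;58;60;65;67;69;68;70;73;75;77;76;78;80;85;87;86;88;90;97;99;107;108;110;112]%N)
 (untr [::150;250;350;450;550;53;53;650;750;153;850;950;1050;353;1150;1250;253;1350;1450;553;1550;1650;453;1750;1850;753;1950;853;2050;2150;653;2250;2350;1053;2450;1153;2550;2650;2647;2750;953;2850;2253;1453;2950;1553;3050;3150;3147;3250;1253;3350;1346;1853;3450;1953;3550;2053;2150;3650;1653;3750;1746;2353;3850;2453;3950;2553;4050;4150;4147;4250;4350;2953;4450;3053;4550;4650;4647;4750;2753;4850;2846;3453;4950;3553;5050;5150;5147;5250;3253;5350;3346;3853;4846;3953;5450;4053;5550;5046;3653;4947;3746;4353;5346;4453;5650;4553;4747;5750;4253;5850;5247;5950;5846;5453;5955;5553;5752;5653])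
 10
 [::Model 5 [::[::0;0;-1];[::1;0;2];[::0;1;2]] [::[::2;1;0];[::2;0;1];[::-1;0;0]] [::1;3;1] [::1;0;0];Model 5 [::[::0;0;-1];[::1;0;2];[::0;1;2]] [::[::2;1;0];[::2;0;1];[::-1;0;0]] [::2;4;1] [::1;0;0];Model 5 [::[::-2;1;0];[::-1;0;0];[::0;0;-1]] [::[::0;-1;0];[::1;-2;0];[::0;0;-1]] [::0;1;0] [::0;0;4]]
 [::(6%N,Lab1 (0,1))].
Definition nodes5 : seq node := [:: node5_0; node5_1; node5_2; node5_3; node5_4; node5_5; node5_6; node5_7; node5_8; node5_9; node5_10].

(* root7 *)
Definition node7_0 : node := Node
 [:: ([::1],[::]); ([::],[::1])]
 [:: ([::[::1];[::]],false); ([::[::];[::1]],true)]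
 (unpar [::]%N)
 (untr [::])
 1
 [::]
 [::(1%N,Fin 1 0 2); (1%N,Fin 1 0 3); (1%N,Fin 1 0 7); (1%N,Fin 1 0 5); (1%N,Fin 1 0 6); (1%N,Fin 1 0 4); (1%N,Fin 1 0 1); (1%N,Fin 1 0 0)].
(* H70 *)
Definition node7_1 : node := Node
 [:: ([::1],[::]); ([::],[::7]); ([::],[::1;1])]
 [:: ([::[::1];[::];[::]],false); ([::[::];[::];[::1]],true); ([::[::];[::1];[::]],true)]
 (unpar [::1;0;2;7;9;8;10;13;15;17;16;19;18;20;23;27;31;32;34;37;39;41;43]%N)
 (untr [::150;250;250;350;51;51;450;151;550;650;351;750;850;451;950;551;1050;1150;1250;1350;651;1450;1550;851;751;1551;1650;951;1351;1051;1750;1250;1450;1850;1151;1950;2050;1651;2150;1751;2250;2250;2350;2350;1851;2051;1951;2151])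
 2
 [::Model 7 [::[::-1]] [::[::-1]] [::0] [::1]]
 [::(1%N,Lab3 1 (0,1) [::]); (1%N,Fin 3 0 3); (1%N,Fin 2 0 22); (1%N,Fin 2 0 23); (1%N,Fin 3 0 23); (1%N,Fin 4 0 11); (1%N,Fin 3 0 22); (49%N,Lab1 (0,1)); (1%N,Fin 2 0 0)].
(* H71_0 *)
Definition node7_2 : node := Node
 [:: ([::1],[::]); ([::],[::7]); ([::],[::1;2;1])]
 [:: ([::[::1];[::];[::]],false); ([::[::];[::];[::1]],true); ([::[::];[::1];[::]],true)]
 (unpar [::1;0;2;7;9;8;10;13;15;17;16;19;18;20;23;27;31;32;34;37;39;41;43]%N)
 (untr [::150;250;250;350;53;53;450;153;550;650;353;750;850;453;950;553;1050;1150;1250;1350;653;1450;1550;853;753;1547;1650;953;1357;1053;1750;1256;1446;1850;1153;1950;2050;1653;2150;1753;2250;2246;2350;2352;1853;2057;1953;2151])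
 14
 [::Model 7 [::[::0;-1];[::1;-2]] [::[::-2;1];[::-1;0]] [::0;0] [::1;0]]
 [::(1%N,Fin 3 0 3); (6%N,Lab3 7 (0,1) [::X;Y;X;Y;X;X;Y;X;Y;X;X;Y;X;Y;X;X]); (49%N,Lab1 (0,1)); (1%N,Lab3 7 (0,1) [::X;Y;X;Y;X;X;Y;X;Y;X;X;Y;X;Y;X;X])].
(* H71_1 *)
Definition node7_3 : node := Node
 [:: ([::1],[::0;-1]); ([::],[::7]); ([::],[::1;2;1])]
 [:: ([::[::1];[::];[::]],false); ([::[::];[::];[::1]],true); ([::[::];[::1];[::]],true)]
 (unpar [::1;0;3;5;9;8;10;13;15;17;16;19;18;20;23;27;31;32;34;37;39;41;43]%N)
 (untr [::150;250;350;356;450;53;53;147;550;650;253;750;850;453;950;553;1050;1150;1250;1350;653;1450;1550;853;753;1553;1650;953;1355;1053;1750;1250;1448;1850;1153;1950;2050;1653;2150;1753;2250;2244;2350;2348;1853;2045;1953;2155])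
 14
 [::Model 7 [::[::0;-1];[::1;-2]] [::[::-2;1];[::-1;0]] [::0;1] [::1;0]]
 [::(1%N,Fin 4 0 4); (6%N,Lab3 7 (1,6) [::X;Y;X]); (49%N,Lab1 (1,6)); (1%N,Lab3 7 (1,6) [::X;Y;X])].
(* H71_2 *)
Definition node7_4 : node := Node
 [:: ([::1],[::0;-2]); ([::],[::7]); ([::],[::1;2;1])]
 [:: ([::[::1];[::];[::]],false); ([::[::];[::];[::1]],true); ([::[::];[::1];[::]],true)]
 (unpar [::1;0;3;2;5;6;9;11;10;13;15;16;19;21;20;25;27;26;32;37;39;41;43]%N)
 (untr [::150;250;350;450;550;53;53;650;750;153;850;950;1050;353;1150;1154;253;1250;1350;553;1450;1550;453;749;1650;853;1750;1850;653;1751;1252;1053;1551;1950;953;1452;2050;1353;2150;1653;2250;2254;2350;2354;1853;2049;1953;2149])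
 14
 [::Model 7 [::[::0;-1];[::1;-2]] [::[::-2;1];[::-1;0]] [::0;2] [::1;0]]
 [::(1%N,Lab3 1 (1,3) [::]); (56%N,Lab1 (1,3))].
Definition nodes7 : seq node := [:: node7_0; node7_1; node7_2; node7_3; node7_4].


Lemma tree3 : treechk 3 nodes3 1458. Proof. by vm_compute. Qed.
Lemma tree5 : treechk 5 nodes5 18750. Proof. by vm_compute. Qed.
Lemma tree7 : treechk 7 nodes7 2058. Proof. by vm_compute. Qed.


Local Close Scope Z_scope.

(** * Identification with the listed subgroups *)

Lemma idealP (gs : seq Laurent) (x : Laurent) : x \in ideal gs <->
  exists c : nat -> Laurent, x = \sum_(i < size gs) c i * nth 0 gs i.
Proof.
split=> [/asboolP[c ->]|[c ->]].
  by exists (fun i => if insub i is Some k then c k else 0); apply: eq_bigr => i _; rewrite valK.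
by apply/asboolP; exists (fun i : 'I_(size gs) => c i).
Qed.

(** The stabilizer of a pair is the group of the kernel of the map of Lambda^2
    to A given by the pair. *)
Lemma HN_St (A : lmodType Laurent) (a : A * A) (M : V -> Prop) :
  (forall u, M u <-> u 0 0 *: a.1 + u 1 0 *: a.2 = 0) -> HN M = St a.
Proof.
move=> hM.
have l1 : lift ord0 ord0 = 1 :> 'I_2 by exact: val_inj.
have bE (b : M2) (u : V) : ((b - 1) *m u) 0 0 *: a.1 + ((b - 1) *m u) 1 0 *: a.2 =
    u 0 0 *: ((bact a b).1 - a.1) + u 1 0 *: ((bact a b).2 - a.2).
  have e k : ((b - 1) *m u) k 0 = u 0 0 * b k 0 + u 1 0 * b k 1 - u k 0.
    by rewrite mulmxBl mul1mx !mxE !big_ord_recl !big_ord0 l1 addr0 ![b _ _ * _]mulrC.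
  rewrite !e /bact /= !scalerBl !scalerDl !scalerBr !scalerDr !scalerA.
  by rewrite [LHS]addrACA [RHS]addrACA; congr (_ + _); exact: addrACA.
apply/seteqP; split=> b [Bb hb]; split=> //.
  have e k : (if k == 0 :> 'I_2 then (bact a b).1 - a.1 else (bact a b).2 - a.2) = 0.
    have /hM := hb (delta_mx k 0); rewrite bE !mxE eqxx !andbT.
    have [->|->] : k = 0 \/ k = 1 by case: k => [[|[|]]] //= hj; [left|right]; exact: val_inj.
      by rewrite /= scale1r scale0r addr0.
    by rewrite /= scale1r scale0r add0r.
  have := e 0; have := e 1; rewrite /= => /eqP; rewrite subr_eq0 => /eqP e2.
  by move/eqP; rewrite subr_eq0 => /eqP e1; rewrite /bact e1 e2 -surjective_pairing.
by move=> u; apply/hM; rewrite bE hb !subrr !scaler0 addr0.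
Qed.

Definition ringG (q : pol) (ps : seq pol) : seq pvec := ([:: 1%bZ], q) :: [seq ([::], r) | r <- ps].

Section Projection.
Variables (L : comNzRingType) (U : lmodType L) (rs : seq U).

Lemma qprojZ a u : a *: qproj rs u = qproj rs (a *: u).
Proof. exact: quot_scaleE. Qed.
Lemma qprojD u v : qproj rs u + qproj rs v = qproj rs (u + v).
Proof. exact/esym/quot_piD. Qed.
Lemma qproj0 : qproj rs 0 = 0.
Proof. by rewrite -(scale0r (0 : U)) -qprojZ scale0r. Qed.
Lemma qproj_eq0 u : qproj rs u = 0 <-> u \in span_pred rs.
Proof.
rewrite -qproj0; split=> [/eqP|h]; first by rewrite quot_eq subr0.
by apply/eqP; rewrite quot_eq subr0.
Qed.
Lemma qproj_surj (x : quotmod rs) : exists v, x = qproj rs v.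
Proof. exact: quot_surj. Qed.
End Projection.

Lemma qsum (gs : seq Laurent) (a b x : Laurent) :
  a *: (qpair gs x 1).1 + b *: (qpair gs x 1).2 = 0 <-> a * x + b \in ideal gs.
Proof.
have -> : a *: (qpair gs x 1).1 + b *: (qpair gs x 1).2 = @qproj Laurent Laurent^o gs (a * x + b).
  by rewrite /qpair /= !qprojZ qprojD; congr qproj; rewrite [b *: _]mulr1.
exact: qproj_eq0.
Qed.

Lemma ringG_mem q ps x (u : V) : lp q = - x ->
  @inM (map pv (ringG q ps)) 1 u <-> u 0 0 * x + u 1 0 \in ideal (map lp ps).
Proof.
move=> hq; have p10 : pv ([:: 1%bZ], q) 0 0 = 1 by rewrite mxE /= zr1 mulr0 addr0.
have p11 : pv ([:: 1%bZ], q) 1 0 = - x by rewrite mxE /= hq.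
have s0 (c : nat -> 'rV[Laurent]_1) : \sum_(l < size ps) (nth 0 [seq pv r | r <- [seq ([::], r) | r <- ps]] l *m c l.+1) 0 0 = 0.
  apply: big1 => l _; rewrite -map_comp (nth_map [::]) // !mxE big_ord_recl big_ord0 !mxE /=.
  by rewrite mul0r addr0.
have s1 (c : nat -> 'rV[Laurent]_1) : \sum_(l < size ps) (nth 0 [seq pv r | r <- [seq ([::], r) | r <- ps]] l *m c l.+1) 1 0 =
    \sum_(l < size ps) c l.+1 0 0 * nth 0 (map lp ps) l.
  apply: eq_bigr => l _; rewrite -map_comp !(nth_map [::]) // !mxE big_ord_recl big_ord0 !mxE /=.
  by rewrite addr0 mulrC.
have m1 (a : V) (b : 'rV[Laurent]_1) i : (a *m b) i 0 = a i 0 * b 0 0 by rewrite mxE big_ord1.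
have e01 (c : nat -> 'rV[Laurent]_1) :
    (lincomb (map pv (ringG q ps)) c 0 0 = c 0%N 0 0) *
    (lincomb (map pv (ringG q ps)) c 1 0 = - x * c 0%N 0 0 + \sum_(l < size ps) c l.+1 0 0 * nth 0 (map lp ps) l).
  have dE (A B : V) k : (A + B) k 0 = A k 0 + B k 0 by rewrite mxE.
  rewrite /= lincomb_cons !dE !m1 p10 p11 mul1r /lincomb !size_map !summxE s0 s1.
  by rewrite addr0.
rewrite idealP size_map; split=> [[c ->]|[c hc]].
  by exists (fun l => c l.+1 0 0); rewrite !e01; ring.
pose c' l : 'rV[Laurent]_1 := if l is l'.+1 then (c l')%:M else (u 0 0)%:M.
have c'E l : c' l.+1 0 0 = c l by rewrite mxE eqxx mulr1n.
have c'0 : c' 0%N 0 0 = u 0 0 by rewrite mxE eqxx mulr1n.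
exists c'; apply/colP => i.
have [->|->] : i = 0 \/ i = 1 by case: i => [[|[|]]] //= hj; [left|right]; exact: val_inj.
  by rewrite e01 c'0.
rewrite e01 c'0 (eq_bigr (fun l : 'I_(size ps) => c l * nth 0 (map lp ps) l)); last by move=> l _; rewrite c'E.
by rewrite -hc; ring.
Qed.

Lemma ring_St q ps x gs : lp q = - x -> gs = map lp ps ->
  HN (@inM (map pv (ringG q ps)) 1) = St (qpair gs x 1).
Proof. by move=> hq ->; apply: HN_St => u; rewrite qsum; exact: ringG_mem. Qed.

Lemma epairs_x1 gs x : epairs (qpair gs x 1).
Proof.
move=> y; have [v ->] := qproj_surj y; exists 0, v.
by rewrite scale0r add0r /qpair /= qprojZ; congr qproj; exact/esym/mulr1.
Qed.

Lemma pair_act (A : lmodType Laurent) (u y z a b c d : Laurent) (r1 r2 : A) :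
  y *: (u *: (a *: r1 + b *: r2)) + z *: (u *: (c *: r1 + d *: r2)) =
  u *: ((a * y + c * z) *: r1 + (b * y + d * z) *: r2).
Proof.
rewrite !scalerDr !scalerA addrACA -!scalerDl.
by congr (_ *: _ + _ *: _); ring.
Qed.

(* The multiples of (e, 1) in the orbit of (x, 1) are the vertices of the table
   at which the first entry is e times the second one. *)
Definition orbchk (nd0 : node) (qe : pol) : bool :=
  if nM nd0 is f :: _ then
    let st := fstates f (nP nd0) in
    all (fun i => ~~ fzero f (nth (f0 f) st i) ([:: 1%bZ], qe)) (seq.iota 0 (nN nd0))
  else false.

(** If (x, 1) is a multiple of (e, 1) b then b^-1 maps (1, -e) into the module
    of the node, which happens at a vertex of the table if it ever does. *)
Lemma orbchkP nd0 q ps x qe e : nodeok nd0 -> nG nd0 = ringG q ps -> lp q = - x ->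
  lp qe = - e -> orbchk nd0 qe ->
  ~ same_orbit (qpair (map lp ps) e 1) (qpair (map lp ps) x 1).
Proof.
move=> ok GE hq he hc [b [u [Bb _ eb]]]; set gs := map lp ps in eb.
pose y : V := pv ([:: 1%bZ], qe).
have y0 : y 0 0 = 1 by rewrite mxE /= zr1 mulr0 addr0.
have y1 : y 1 0 = - e by rewrite mxE /= he.
have yM : @inM (map pv (nG nd0)) 1 (b^-1 *m y).
  rewrite GE (ringG_mem _ _ hq) -qsum eb /= /bact /=.
  have : b *m (b^-1 *m y) = y by rewrite mulmxA [b *m _](mulrV (Bu3_unit Bb)) mul1mx.
  move: (b^-1 *m y) => z bz.
  have l1 : lift ord0 ord0 = 1 :> 'I_2 by exact: val_inj.
  have bz0 : b 0 0 * z 0 0 + b 0 1 * z 1 0 = 1.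
    by rewrite -y0 -[in RHS]bz mxE !big_ord_recl big_ord0 l1 addr0.
  have bz1 : b 1 0 * z 0 0 + b 1 1 * z 1 0 = - e.
    by rewrite -y1 -[in RHS]bz mxE !big_ord_recl big_ord0 l1 addr0.
  set r1 := @qproj Laurent Laurent^o gs e; set r2 := @qproj Laurent Laurent^o gs 1.
  have -> : z 0 0 *: (u *: (b 0 0 *: r1 + b 1 0 *: r2)) + z 1 0 *: (u *: (b 0 1 *: r1 + b 1 1 *: r2)) =
      u *: ((b 0 0 * z 0 0 + b 0 1 * z 1 0) *: r1 + (b 1 0 * z 0 0 + b 1 1 * z 1 0) *: r2).
    exact: pair_act.
  rewrite bz0 bz1; have -> : 1 *: r1 + - e *: r2 = 0.
    apply/(qsum gs 1 (- e) e); rewrite mul1r subrr; apply/idealP; exists (fun=> 0); by rewrite big1 // => l _; rewrite mul0r.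
  by rewrite scaler0.
have [w [n [m ew]]] := Bu3_word (Bu3_inv Bb).
have sv : size (nseq (size (nG nd0)) Z0) = size (nG nd0) by rewrite size_nseq.
have tr x' k : (k < nN nd0)%N -> inM (map pv (nG nd0)) (t ^+ nen nd0 x' k *: (nW nd0 k * letter x') -
    t ^+ nem nd0 x' k *: nW nd0 (nnx nd0 x' k)).
  by move=> kN; exact: psi_inM (@ntransP 2 nd0 ok _ x' k sv kN).
have [a1 [b1]] := table_run (N := nN nd0) (nnxN ok) tr w (isT : (0 < nN nd0)%N).
set k := foldl _ _ _; rewrite nW0 mul1r => hw.
have kN : (k < nN nd0)%N by rewrite /k; elim: (w) 0%N (isT : (0 < nN nd0)%N) => //= y' w' IH' i /(nnxN ok y') /IH'.
have sM := inM_submod (map pv (nG nd0)).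
have kM : @inM (map pv (nG nd0)) 1 (nW nd0 k *m y).
  apply: (submod_t (n := b1) sM); rewrite scalemxAl.
  have -> : (t ^+ b1 *: nW nd0 k) *m y = (t ^+ a1 *: wmat w) *m y -
     (t ^+ a1 *: wmat w - t ^+ b1 *: nW nd0 k) *m y by rewrite -mulmxBl opprB addrC subrK.
  apply: (submodB sM); last exact: inM_mul.
  rewrite -scalemxAl; apply: (submodZ sM); apply: (submod_t (n := m) sM).
  by rewrite scalemxAl -ew -scalemxAl; exact: submodZ.
move: hc; rewrite /orbchk; case/and5P: (ok) => _ _ _ _ /andP[]; case: (nM nd0) => // f fs _ /andP[hf _].
move=> /allP/(_ k); rewrite mem_iota add0n => /(_ kN)/negP; apply.
case/and3P: (hf) => mok _ _; have uT := mT_unit mok (nmS hf).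
have [ss es] := fstatesP mok (nmS hf) (nP nd0) k.
apply/(fzeroP mok (nmS hf) _ ss); rewrite es -(Fh_mul uT) -nW_pm.
exact: (inM_sub (fker_submod hf) (fker_gen hf) kM).
Qed.

Lemma other_x1 nd0 q ps x (es : seq (pol * Laurent)) gs excl : nodeok nd0 -> nG nd0 = ringG q ps ->
  lp q = - x -> gs = map lp ps -> excl = [seq (e.2, 1) | e <- es] ->
  (forall e, e \in es -> lp e.1 = - e.2 /\ orbchk nd0 e.1) ->
  other_orbit excl (qpair gs x 1).
Proof.
move=> ok GE hq -> -> hes; split=> [|e /mapP[e' ee ->]]; first exact: epairs_x1.
by have [h1 h2] := hes _ ee; exact: (orbchkP ok GE hq h1 h2).
Qed.


Lemma inM_mem (G : seq pvec) y : y \in G -> @inM (map pv G) 1 (pv y).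
Proof.
move=> yG; have := @inM_gen (map pv G) (index y G).
rewrite size_map index_mem => /(_ yG); by rewrite (nth_map ([::], [::])) ?index_mem // nth_index.
Qed.

Lemma inM_sub_mem (G : seq pvec) (M : V -> Prop) u : submod M ->
  (forall y, y \in G -> M (pv y)) -> @inM (map pv G) 1 u -> M u.
Proof.
move=> sM hG; apply: (inM_sub sM) => l; rewrite size_map => lG.
by rewrite (nth_map ([::], [::])) //; apply: hG; exact: mem_nth.
Qed.

Lemma ideal0 gs : 0 \in ideal gs.
Proof. by apply/idealP; exists (fun=> 0); rewrite big1 // => l _; rewrite mul0r. Qed.
Lemma idealD gs x y : x \in ideal gs -> y \in ideal gs -> x + y \in ideal gs.
Proof.
move=> /idealP[c ->] /idealP[d ->]; apply/idealP; exists (fun i => c i + d i).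
by rewrite -big_split; apply: eq_bigr => i _; rewrite mulrDl.
Qed.
Lemma idealM gs a x : x \in ideal gs -> a * x \in ideal gs.
Proof.
move=> /idealP[c ->]; apply/idealP; exists (fun i => a * c i).
by rewrite mulr_sumr; apply: eq_bigr => i _; rewrite mulrA.
Qed.
Lemma ideal_gen gs i : (i < size gs)%N -> nth 0 gs i \in ideal gs.
Proof.
move=> h; apply/idealP; exists (fun j => (j == i)%:R); rewrite (bigD1 (Ordinal h)) //= eqxx mul1r.
by rewrite big1 ?addr0 // => j; rewrite -val_eqE /= => /negPf->; rewrite mul0r.
Qed.

Definition sqG (ps : seq pol) : seq pvec := [seq (r, [::]) | r <- ps] ++ [seq ([::], r) | r <- ps].

(** A square matrix satisfies the congruence when both columns of h - 1 do. *)
Lemma sq_congr ps gs : gs = map lp ps ->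
  HN (@inM (map pv (sqG ps)) 1) = congr_subgroup gs.
Proof.
move=> ->; set gs' := map lp ps.
have mem (u : V) : @inM (map pv (sqG ps)) 1 u <-> u 0 0 \in ideal gs' /\ u 1 0 \in ideal gs'.
  have gp r : r \in ps -> lp r \in ideal gs'.
    move=> rp; have := @ideal_gen gs' (index r ps); rewrite size_map index_mem => /(_ rp).
    by rewrite (nth_map [::]) ?index_mem // nth_index.
  split.
    apply: (inM_sub_mem (M := fun u : V => u 0 0 \in ideal gs' /\ u 1 0 \in ideal gs')).
      split=> [|x y [h1 h2] [h3 h4]|a x [h1 h2]]; rewrite !mxE; split;
        by [exact: ideal0|exact: idealD|exact: idealM].
    by move=> y; rewrite mem_cat => /orP[] /mapP[r rp ->]; rewrite !mxE /=; split;
      by [exact: gp|exact: ideal0].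
  move=> [/idealP[c hc] /idealP[d hd]]; rewrite size_map in hc hd.
  have sM := inM_submod (map pv (sqG ps)).
  have -> : u = \sum_(i < size ps) c i *: pv (nth [::] ps i, [::]) + \sum_(i < size ps) d i *: pv ([::], nth [::] ps i).
    apply/colP => i; rewrite mxE !summxE.
    have [->|->] : i = 0 \/ i = 1 by case: i => [[|[|]]] //= hj; [left|right]; exact: val_inj.
      rewrite hc [X in _ + X]big1 ?addr0 => [|l _]; last by rewrite !mxE /= mulr0.
      by apply: eq_bigr => l _; rewrite !mxE /= (nth_map [::]).
    rewrite hd [X in X + _]big1 ?add0r => [|l _]; last by rewrite !mxE /= mulr0.
    by apply: eq_bigr => l _; rewrite !mxE /= (nth_map [::]).
  apply: (submodD sM); apply: (submod_sum sM) => l; apply: (submodZ sM); apply: inM_mem; rewrite mem_cat.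
    by rewrite (map_f (fun r => (r, [::] : pol))) ?mem_nth.
  by rewrite (map_f (fun r => ([::] : pol, r))) ?mem_nth ?orbT.
apply/seteqP; split=> b [Bb hb]; split=> //.
  move=> i j; have /mem := hb (delta_mx j 0); rewrite -colE !mxE => -[h0 h1].
  by have [->|->] : i = 0 \/ i = 1 by case: i => [[|[|]]] //= hj; [left|right]; exact: val_inj.
move=> u; apply/mem; rewrite !mxE !big_ord_recl !big_ord0 !addr0.
by split; apply: idealD; rewrite mulrC; apply: idealM; exact: hb.
Qed.

Definition Wrel : seq (Laurent^o * Laurent^o)%type :=
  [:: (t + 1, 0); (9%:R, 0); (0, 3%:R); (3%:R, t + 1)].

Lemma span_gen (U : lmodType Laurent) (rs : seq U) i : (i < size rs)%N -> nth 0 rs i \in span_pred rs.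
Proof.
move=> h; apply/asboolP; exists (fun j => (j == Ordinal h)%:R); rewrite (bigD1 (Ordinal h)) //= eqxx scale1r.
by rewrite big1 ?addr0 // => j /negPf->; rewrite scale0r.
Qed.

(* swap tells whether the pair is (e1, e2) or (e2, e1). *)
Definition Wf (swap : bool) (u : V) : (Laurent^o * Laurent^o)%type :=
  if swap then (u 1 0, u 0 0) else (u 0 0, u 1 0).
Definition Wr (swap : bool) : Wmod * Wmod :=
  if swap then (qproj Wrel (0, 1), qproj Wrel (1, 0)) else (qproj Wrel (1, 0), qproj Wrel (0, 1)).

Lemma W_St (swap : bool) (G : seq pvec) :
  (forall y, y \in G -> Wf swap (pv y) \in span_pred Wrel) ->
  (forall u, Wf swap u \in Wrel -> @inM (map pv G) 1 u) ->
  listed (HN (@inM (map pv G) 1)).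
Proof.
set f := Wf swap; set r := Wr swap.
move=> hG hrel; have sM := inM_submod (map pv G).
have phiE (u : V) : u 0 0 *: r.1 + u 1 0 *: r.2 = @qproj _ (Laurent^o * Laurent^o)%type Wrel (f u).
  rewrite /r /f /Wr /Wf; case: (swap); rewrite /= !qprojZ qprojD; congr qproj; congr (_, _) => /=;
    by rewrite ?[_ *: 1]mulr1 ?[_ *: 0]mulr0 ?add0r ?addr0.
have fD x y : f (x + y) = f x + f y by rewrite /f /Wf; case: (swap); rewrite !mxE.
have fZ a x : f (a *: x) = a *: (f x : Laurent^o * Laurent^o)%type by rewrite /f /Wf; case: (swap); rewrite !mxE.
have finj x y : f x = f y -> x = y.
  move=> e; apply/colP => i.
  have [->|->] : i = 0 \/ i = 1 by case: i => [[|[|]]] //= hj; [left|right]; exact: val_inj.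
    by move: e; rewrite /f /Wf; case: (swap) => -[].
  by move: e; rewrite /f /Wf; case: (swap) => -[].
have fsurj (w : (Laurent^o * Laurent^o)%type) : exists x, f x = w.
  exists (\col_i if swap == (i == 0) then w.2 else w.1).
  by rewrite /f /Wf; case: (swap); rewrite !mxE /=; case: w.
have -> : HN (@inM (map pv G) 1) = St r.
  apply: HN_St => u; rewrite phiE; split.
    apply: (inM_sub_mem (M := fun u => @qproj _ (Laurent^o * Laurent^o)%type Wrel (f u) = 0)) => [|y yG].
      split=> [|x y hx hy|a x hx].
      - by apply/qproj_eq0; rewrite /f /Wf; case: (swap); rewrite !mxE; exact: rpred0.
      - by rewrite fD -qprojD hx hy addr0.
      - by rewrite fZ -qprojZ hx scaler0.
    by apply/qproj_eq0; exact: hG.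
  move/qproj_eq0 => /asboolP[c hc].
  have hx i : exists x, f x = Wrel`_i by exact: fsurj.
  have {hx}[x hx] := choice hx.
  have -> : u = \sum_(i < size Wrel) c i *: x i.
    apply: finj; rewrite hc; have f0 : f 0 = 0 by rewrite /f /Wf; case: (swap); rewrite !mxE.
    rewrite (big_morph f fD f0); apply: eq_bigr => i _; by rewrite fZ hx.
  apply: (submod_sum sM) => i; apply: (submodZ sM); apply: hrel; rewrite hx; exact: mem_nth.
apply: tH_9 => w; have [[a b] ->] := qproj_surj w.
have key a' b' : @qproj _ (Laurent^o * Laurent^o)%type Wrel (a', b') = a' *: qproj Wrel (1, 0) + b' *: qproj Wrel (0, 1).
  rewrite !qprojZ qprojD; congr qproj; congr (_, _) => /=;
    by rewrite ?[_ *: 1]mulr1 ?[_ *: 0]mulr0 ?add0r ?addr0.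
rewrite key /r /Wr; case: (swap).
  exists b, a; exact: addrC.
exists a, b; exact: erefl.
Qed.

Lemma zr_pos q : zr Laurent (Zpos q) = (Pos.to_nat q)%:R. Proof. by []. Qed.
Lemma zr_neg q : zr Laurent (Zneg q) = - (Pos.to_nat q)%:R.
Proof. by rewrite -[Zneg q]/(Z.opp (Zpos q)) zrN. Qed.



Ltac lpeq := rewrite /Phi6 /Phi10 /lam /lp /= ?zr_pos ?zr_neg ?zr0 /Pos.to_nat /=; ring.
Ltac gseq := rewrite /genZ /genF /=; repeat (apply: (f_equal2 cons); [lpeq|]); reflexivity.

Lemma listed_ring G q ps x gs : G = ringG q ps -> lp q = - x ->
  gs = map lp ps -> listed (St (qpair gs x 1)) -> listed (HN (@inM (map pv G) 1)).
Proof. by move=> -> hq hgs; rewrite (ring_St hq hgs). Qed.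

Lemma listed_sq G ps gs : G = sqG ps -> gs = map lp ps ->
  listed (congr_subgroup gs) -> listed (HN (@inM (map pv G) 1)).
Proof. by move=> -> hgs; rewrite (sq_congr hgs). Qed.

Lemma other_excl1 nd0 q ps x gs : nodeok nd0 -> nG nd0 = ringG q ps -> lp q = - x ->
  gs = map lp ps -> orbchk nd0 [::] -> other_orbit [:: (0, 1)] (qpair gs x 1).
Proof.
move=> ok GE hq hgs h; apply: (@other_x1 nd0 q ps x [:: ([::], 0)]) => // e.
by rewrite inE => /eqP ->; split=> //; rewrite /= oppr0.
Qed.

Lemma other_excl2 nd0 q ps x gs : nodeok nd0 -> nG nd0 = ringG q ps -> lp q = - x ->
  gs = map lp ps -> orbchk nd0 [::] -> orbchk nd0 [:: 1%bZ; 1%bZ] ->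
  other_orbit [:: (0, 1); (lam, 1)] (qpair gs x 1).
Proof.
move=> ok GE hq hgs h0 h1.
apply: (@other_x1 nd0 q ps x [:: ([::], 0); ([:: 1%bZ; 1%bZ], lam)]) => // e.
by rewrite !inE => /orP[]/eqP ->; split=> //=; [rewrite oppr0|lpeq].
Qed.

Lemma pv_eq (u : V) (a b : pol) : u 0 0 = lp a -> u 1 0 = lp b -> u = pv (a, b).
Proof.
move=> h0 h1; apply/colP => i; rewrite mxE /=.
by have [->|->] : i = 0 \/ i = 1 by case: i => [[|[|]]] //= hj; [left|right]; exact: val_inj.
Qed.

Lemma W_mem (a b : Laurent) k : (k < 4)%N -> a = (nth 0 Wrel k).1 -> b = (nth 0 Wrel k).2 ->
  ((a, b) : (Laurent^o * Laurent^o)%type) \in span_pred Wrel.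
Proof.
move=> k4 -> ->; rewrite -surjective_pairing.
exact: (@span_gen (Laurent^o * Laurent^o)%type Wrel).
Qed.

Lemma W_node_true : listed (HN (@inM (map pv (nG node3_14)) 1)).
Proof.
apply: (W_St (swap := true)) => [y yG|u].
  have E a b : Wf true (pv (a, b)) = (lp b, lp a) by rewrite /Wf !mxE.
  have : [|| y == ([:: 1%bZ; 1%bZ], [:: 3%bZ]), y == ([:: 3%bZ], [::]) | y == ([::], [:: 1%bZ; 1%bZ])] by move: yG; rewrite !inE.
  move=> /or3P[]/eqP->; rewrite E.
  - by apply: (@W_mem _ _ 3) => //; lpeq.
  - by apply: (@W_mem _ _ 2) => //; lpeq.
  - by apply: (@W_mem _ _ 0) => //; lpeq.
have sM := inM_submod (map pv (nG node3_14)).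
have g0 : @inM (map pv (nG node3_14)) 1 (pv ([:: 1%bZ; 1%bZ], [:: 3%bZ])) by exact: inM_mem.
have g1 : @inM (map pv (nG node3_14)) 1 (pv ([:: 3%bZ], [::])) by exact: inM_mem.
have g2 : @inM (map pv (nG node3_14)) 1 (pv ([::], [:: 1%bZ; 1%bZ])) by exact: inM_mem.
rewrite /Wf !inE !xpair_eqE => /or4P[] /andP[/eqP h1 /eqP h0].
- by rewrite (@pv_eq u [::] [:: 1%bZ; 1%bZ]) // ?h0 ?h1; lpeq.
- have -> : u = 3%:R *: pv ([:: 1%bZ; 1%bZ], [:: 3%bZ]) - (t + 1) *: pv ([:: 3%bZ], [::]).
    rewrite (@pv_eq u [::] [:: 9%bZ]) ?h0 ?h1; [|lpeq|lpeq].
    by apply/colP => i; rewrite !mxE /=; case: ifP => _; lpeq.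
  by apply: (submodB sM); exact: submodZ.
- by rewrite (@pv_eq u [:: 3%bZ] [::]) // ?h0 ?h1; lpeq.
- by rewrite (@pv_eq u [:: 1%bZ; 1%bZ] [:: 3%bZ]) // ?h0 ?h1; lpeq.
Qed.

Lemma W_node_false : listed (HN (@inM (map pv (nG node3_15)) 1)).
Proof.
apply: (W_St (swap := false)) => [y yG|u].
  have E a b : Wf false (pv (a, b)) = (lp a, lp b) by rewrite /Wf !mxE.
  have : [|| y == ([:: 3%bZ], [:: 1%bZ; 1%bZ]), y == ([::], [:: 3%bZ]) | y == ([:: 1%bZ; 1%bZ], [::])] by move: yG; rewrite !inE.
  move=> /or3P[]/eqP->; rewrite E.
  - by apply: (@W_mem _ _ 3) => //; lpeq.
  - by apply: (@W_mem _ _ 2) => //; lpeq.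
  - by apply: (@W_mem _ _ 0) => //; lpeq.
have sM := inM_submod (map pv (nG node3_15)).
have g0 : @inM (map pv (nG node3_15)) 1 (pv ([:: 3%bZ], [:: 1%bZ; 1%bZ])) by exact: inM_mem.
have g1 : @inM (map pv (nG node3_15)) 1 (pv ([::], [:: 3%bZ])) by exact: inM_mem.
have g2 : @inM (map pv (nG node3_15)) 1 (pv ([:: 1%bZ; 1%bZ], [::])) by exact: inM_mem.
rewrite /Wf !inE !xpair_eqE => /or4P[] /andP[/eqP h0 /eqP h1].
- by rewrite (@pv_eq u [:: 1%bZ; 1%bZ] [::]) // ?h0 ?h1; lpeq.
- have -> : u = 3%:R *: pv ([:: 3%bZ], [:: 1%bZ; 1%bZ]) - (t + 1) *: pv ([::], [:: 3%bZ]).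
    rewrite (@pv_eq u [:: 9%bZ] [::]) ?h0 ?h1; [|lpeq|lpeq].
    by apply/colP => i; rewrite !mxE /=; case: ifP => _; lpeq.
  by apply: (submodB sM); exact: submodZ.
- by rewrite (@pv_eq u [::] [:: 3%bZ]) // ?h0 ?h1; lpeq.
- by rewrite (@pv_eq u [:: 3%bZ] [:: 1%bZ; 1%bZ]) // ?h0 ?h1; lpeq.
Qed.

Lemma listed3_1 : listed (HN (@inM (map pv (nG node3_1)) 1)).
Proof.
apply: (listed_ring (q := [::]) (ps := [:: [::(3)%bZ]; [::(1)%bZ;(1)%bZ]]) (x := 0) (gs := genZ 3 (-1))) => //; [lpeq|gseq|exact: H_3_0].
Qed.
Lemma listed3_2 : listed (HN (@inM (map pv (nG node3_2)) 1)).
Proof.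
apply: (listed_ring (q := [::(0)%bZ;(-1)%bZ]) (ps := [:: [::(3)%bZ]; [::(1)%bZ;(2)%bZ;(1)%bZ]]) (x := t) (gs := genF 3 2)) => //; [lpeq|gseq|apply: H_3_1; apply: (@other_excl2 node3_2 [::(0)%bZ;(-1)%bZ] [:: [::(3)%bZ]; [::(1)%bZ;(2)%bZ;(1)%bZ]]); [exact: (nodeokP (j := 2) tree3 isT isT)|by []|lpeq|gseq|by vm_compute|by vm_compute]].
Qed.
Lemma listed3_3 : listed (HN (@inM (map pv (nG node3_3)) 1)).
Proof.
apply: (listed_ring (q := [::]) (ps := [:: [::(1)%bZ;(-1)%bZ;(1)%bZ]]) (x := 0) (gs := [:: Phi6])) => //; [lpeq|gseq|exact: I1_3_1].
Qed.
Lemma listed3_4 : listed (HN (@inM (map pv (nG node3_4)) 1)).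
Proof.
apply: (listed_ring (q := [::(1)%bZ;(1)%bZ]) (ps := [:: [::(1)%bZ;(-1)%bZ;(1)%bZ]]) (x := lam) (gs := [:: Phi6])) => //; [lpeq|gseq|exact: I2_3_1].
Qed.
Lemma listed3_5 : listed (HN (@inM (map pv (nG node3_5)) 1)).
Proof.
apply: (listed_sq (ps := [:: [::(3)%bZ]; [::(1)%bZ;(1)%bZ]]) (gs := [:: 3%:R; t + 1])) => //; [gseq|exact: tH_3].
Qed.
Lemma listed3_6 : listed (HN (@inM (map pv (nG node3_6)) 1)).
Proof.
apply: (listed_ring (q := [::]) (ps := [:: [::(9)%bZ]; [::(-2)%bZ;(1)%bZ]]) (x := 0) (gs := genZ 9 2)) => //; [lpeq|gseq|exact: (@H_9 2 isT isT)].
Qed.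
Lemma listed3_7 : listed (HN (@inM (map pv (nG node3_7)) 1)).
Proof.
apply: (listed_ring (q := [::]) (ps := [:: [::(9)%bZ]; [::(-5)%bZ;(1)%bZ]]) (x := 0) (gs := genZ 9 5)) => //; [lpeq|gseq|exact: (@H_9 5 isT isT)].
Qed.
Lemma listed3_8 : listed (HN (@inM (map pv (nG node3_8)) 1)).
Proof.
apply: (listed_sq (ps := [:: [::(1)%bZ;(-1)%bZ;(1)%bZ]]) (gs := [:: Phi6])) => //; [gseq|exact: tI_3].
Qed.
Lemma listed3_9 : listed (HN (@inM (map pv (nG node3_9)) 1)).
Proof.
apply: (listed_ring (q := [::]) (ps := [:: [::(9)%bZ]; [::(1)%bZ;(1)%bZ]]) (x := 0) (gs := genZ 9 (-1))) => //; [lpeq|gseq|exact: H_9_0].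
Qed.
Lemma listed3_10 : listed (HN (@inM (map pv (nG node3_10)) 1)).
Proof.
apply: (listed_ring (q := [::(0)%bZ;(-1)%bZ]) (ps := [:: [::(9)%bZ]; [::(3)%bZ;(3)%bZ]; [::(1)%bZ;(2)%bZ;(1)%bZ]]) (x := t) (gs := [:: 9%:R; 3%:R * (t + 1); (t + 1) ^+ 2])) => //; [lpeq|gseq|apply: H_9_1; apply: (@other_excl2 node3_10 [::(0)%bZ;(-1)%bZ] [:: [::(9)%bZ]; [::(3)%bZ;(3)%bZ]; [::(1)%bZ;(2)%bZ;(1)%bZ]]); [exact: (nodeokP (j := 10) tree3 isT isT)|by []|lpeq|gseq|by vm_compute|by vm_compute]].
Qed.
Lemma listed3_11 : listed (HN (@inM (map pv (nG node3_11)) 1)).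
Proof.
apply: (listed_ring (q := [::(0)%bZ;(-1)%bZ]) (ps := [:: [::(3)%bZ]; [::(1)%bZ;(3)%bZ;(3)%bZ;(1)%bZ]]) (x := t) (gs := genF 3 3)) => //; [lpeq|gseq|apply: H'_9_1; apply: (@other_excl2 node3_11 [::(0)%bZ;(-1)%bZ] [:: [::(3)%bZ]; [::(1)%bZ;(3)%bZ;(3)%bZ;(1)%bZ]]); [exact: (nodeokP (j := 11) tree3 isT isT)|by []|lpeq|gseq|by vm_compute|by vm_compute]].
Qed.
Lemma listed3_12 : listed (HN (@inM (map pv (nG node3_12)) 1)).
Proof.
apply: (listed_ring (q := [::]) (ps := [:: [::(3)%bZ;(-3)%bZ;(3)%bZ]; [::(1)%bZ;(0)%bZ;(0)%bZ;(1)%bZ]]) (x := 0) (gs := [:: 3%:R * Phi6; t ^+ 3 + 1])) => //; [lpeq|gseq|exact: I1_9_1].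
Qed.
Lemma listed3_13 : listed (HN (@inM (map pv (nG node3_13)) 1)).
Proof.
apply: (listed_ring (q := [::(1)%bZ;(1)%bZ]) (ps := [:: [::(3)%bZ;(-3)%bZ;(3)%bZ]; [::(1)%bZ;(0)%bZ;(0)%bZ;(1)%bZ]]) (x := lam) (gs := [:: 3%:R * Phi6; t ^+ 3 + 1])) => //; [lpeq|gseq|exact: I2_9_1].
Qed.
Lemma listed3_14 : listed (HN (@inM (map pv (nG node3_14)) 1)).
Proof.
exact: W_node_true.
Qed.
Lemma listed3_15 : listed (HN (@inM (map pv (nG node3_15)) 1)).
Proof.
exact: W_node_false.
Qed.
Lemma listed3_16 : listed (HN (@inM (map pv (nG node3_16)) 1)).
Proof.
apply: (listed_ring (q := [::(0)%bZ;(-1)%bZ]) (ps := [:: [::(9)%bZ]; [::(1)%bZ;(2)%bZ;(1)%bZ]]) (x := t) (gs := [:: 9%:R; (t + 1) ^+ 2])) => //; [lpeq|gseq|apply: H_9_2; apply: (@other_excl2 node3_16 [::(0)%bZ;(-1)%bZ] [:: [::(9)%bZ]; [::(1)%bZ;(2)%bZ;(1)%bZ]]); [exact: (nodeokP (j := 16) tree3 isT isT)|by []|lpeq|gseq|by vm_compute|by vm_compute]].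
Qed.
Lemma listed3_17 : listed (HN (@inM (map pv (nG node3_17)) 1)).
Proof.
apply: (listed_ring (q := [::(-1)%bZ;(-3)%bZ]) (ps := [:: [::(9)%bZ]; [::(1)%bZ;(2)%bZ;(1)%bZ]]) (x := 1%:R + 3%:R * t) (gs := [:: 9%:R; (t + 1) ^+ 2])) => //; [lpeq|gseq|apply: H_9_2; apply: (@other_excl2 node3_17 [::(-1)%bZ;(-3)%bZ] [:: [::(9)%bZ]; [::(1)%bZ;(2)%bZ;(1)%bZ]]); [exact: (nodeokP (j := 17) tree3 isT isT)|by []|lpeq|gseq|by vm_compute|by vm_compute]].
Qed.
Lemma listed3_18 : listed (HN (@inM (map pv (nG node3_18)) 1)).
Proof.
apply: (listed_ring (q := [::(-1)%bZ;(-4)%bZ]) (ps := [:: [::(9)%bZ]; [::(1)%bZ;(2)%bZ;(1)%bZ]]) (x := 1%:R + 4%:R * t) (gs := [:: 9%:R; (t + 1) ^+ 2])) => //; [lpeq|gseq|apply: H_9_2; apply: (@other_excl2 node3_18 [::(-1)%bZ;(-4)%bZ] [:: [::(9)%bZ]; [::(1)%bZ;(2)%bZ;(1)%bZ]]); [exact: (nodeokP (j := 18) tree3 isT isT)|by []|lpeq|gseq|by vm_compute|by vm_compute]].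
Qed.
Lemma listed3_19 : listed (HN (@inM (map pv (nG node3_19)) 1)).
Proof.
apply: (listed_ring (q := [::(0)%bZ;(-1)%bZ]) (ps := [:: [::(3)%bZ]; [::(1)%bZ;(4)%bZ;(6)%bZ;(4)%bZ;(1)%bZ]]) (x := t) (gs := genF 3 4)) => //; [lpeq|gseq|apply: H'_9_2; apply: (@other_excl2 node3_19 [::(0)%bZ;(-1)%bZ] [:: [::(3)%bZ]; [::(1)%bZ;(4)%bZ;(6)%bZ;(4)%bZ;(1)%bZ]]); [exact: (nodeokP (j := 19) tree3 isT isT)|by []|lpeq|gseq|by vm_compute|by vm_compute]].
Qed.
Lemma listed3_20 : listed (HN (@inM (map pv (nG node3_20)) 1)).
Proof.
apply: (listed_ring (q := [::(0)%bZ;(0)%bZ;(0)%bZ;(-2)%bZ]) (ps := [:: [::(3)%bZ]; [::(1)%bZ;(4)%bZ;(6)%bZ;(4)%bZ;(1)%bZ]]) (x := 2%:R * t ^+ 3) (gs := genF 3 4)) => //; [lpeq|gseq|apply: H'_9_2; apply: (@other_excl2 node3_20 [::(0)%bZ;(0)%bZ;(0)%bZ;(-2)%bZ] [:: [::(3)%bZ]; [::(1)%bZ;(4)%bZ;(6)%bZ;(4)%bZ;(1)%bZ]]); [exact: (nodeokP (j := 20) tree3 isT isT)|by []|lpeq|gseq|by vm_compute|by vm_compute]].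
Qed.
Lemma listed3_21 : listed (HN (@inM (map pv (nG node3_21)) 1)).
Proof.
apply: (listed_ring (q := [::(-1)%bZ;(-1)%bZ]) (ps := [:: [::(3)%bZ]; [::(1)%bZ;(4)%bZ;(6)%bZ;(4)%bZ;(1)%bZ]]) (x := 1%:R + t) (gs := genF 3 4)) => //; [lpeq|gseq|apply: H'_9_2; apply: (@other_excl2 node3_21 [::(-1)%bZ;(-1)%bZ] [:: [::(3)%bZ]; [::(1)%bZ;(4)%bZ;(6)%bZ;(4)%bZ;(1)%bZ]]); [exact: (nodeokP (j := 21) tree3 isT isT)|by []|lpeq|gseq|by vm_compute|by vm_compute]].
Qed.
Lemma listed3_22 : listed (HN (@inM (map pv (nG node3_22)) 1)).
Proof.
apply: (listed_ring (q := [::]) (ps := [:: [::(27)%bZ]; [::(-2)%bZ;(1)%bZ]]) (x := 0) (gs := genZ 27 2)) => //; [lpeq|gseq|exact: (@H_27 2 isT isT)].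
Qed.
Lemma listed3_23 : listed (HN (@inM (map pv (nG node3_23)) 1)).
Proof.
apply: (listed_ring (q := [::]) (ps := [:: [::(27)%bZ]; [::(-5)%bZ;(1)%bZ]]) (x := 0) (gs := genZ 27 5)) => //; [lpeq|gseq|exact: (@H_27 5 isT isT)].
Qed.
Lemma listed3_24 : listed (HN (@inM (map pv (nG node3_24)) 1)).
Proof.
apply: (listed_ring (q := [::]) (ps := [:: [::(27)%bZ]; [::(-11)%bZ;(1)%bZ]]) (x := 0) (gs := genZ 27 11)) => //; [lpeq|gseq|exact: (@H_27 11 isT isT)].
Qed.
Lemma listed3_25 : listed (HN (@inM (map pv (nG node3_25)) 1)).
Proof.
apply: (listed_ring (q := [::]) (ps := [:: [::(27)%bZ]; [::(-14)%bZ;(1)%bZ]]) (x := 0) (gs := genZ 27 14)) => //; [lpeq|gseq|exact: (@H_27 14 isT isT)].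
Qed.
Lemma listed3_26 : listed (HN (@inM (map pv (nG node3_26)) 1)).
Proof.
apply: (listed_ring (q := [::]) (ps := [:: [::(27)%bZ]; [::(-20)%bZ;(1)%bZ]]) (x := 0) (gs := genZ 27 20)) => //; [lpeq|gseq|exact: (@H_27 20 isT isT)].
Qed.
Lemma listed3_27 : listed (HN (@inM (map pv (nG node3_27)) 1)).
Proof.
apply: (listed_ring (q := [::]) (ps := [:: [::(27)%bZ]; [::(-23)%bZ;(1)%bZ]]) (x := 0) (gs := genZ 27 23)) => //; [lpeq|gseq|exact: (@H_27 23 isT isT)].
Qed.
Lemma listed3_28 : listed (HN (@inM (map pv (nG node3_28)) 1)).
Proof.
apply: (listed_ring (q := [::]) (ps := [:: [::(3)%bZ;(-3)%bZ;(3)%bZ]; [::(1)%bZ;(-2)%bZ;(3)%bZ;(-2)%bZ;(1)%bZ]]) (x := 0) (gs := [:: 3%:R * Phi6; Phi6 ^+ 2])) => //; [lpeq|gseq|exact: I1_9_2].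
Qed.
Lemma listed3_29 : listed (HN (@inM (map pv (nG node3_29)) 1)).
Proof.
apply: (listed_ring (q := [::(1)%bZ;(1)%bZ]) (ps := [:: [::(3)%bZ;(-3)%bZ;(3)%bZ]; [::(1)%bZ;(-2)%bZ;(3)%bZ;(-2)%bZ;(1)%bZ]]) (x := lam) (gs := [:: 3%:R * Phi6; Phi6 ^+ 2])) => //; [lpeq|gseq|exact: I2_9_2].
Qed.

Lemma nodes_listed3 k : (0 < k < size nodes3)%N ->
  listed (HN (@inM (map pv (nG (nth node0 nodes3 k))) 1)).
Proof.
case: k => // k; case: k => [_|k]; first exact: listed3_1.
case: k => [_|k]; first exact: listed3_2.
case: k => [_|k]; first exact: listed3_3.
case: k => [_|k]; first exact: listed3_4.
case: k => [_|k]; first exact: listed3_5.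
case: k => [_|k]; first exact: listed3_6.
case: k => [_|k]; first exact: listed3_7.
case: k => [_|k]; first exact: listed3_8.
case: k => [_|k]; first exact: listed3_9.
case: k => [_|k]; first exact: listed3_10.
case: k => [_|k]; first exact: listed3_11.
case: k => [_|k]; first exact: listed3_12.
case: k => [_|k]; first exact: listed3_13.
case: k => [_|k]; first exact: listed3_14.
case: k => [_|k]; first exact: listed3_15.
case: k => [_|k]; first exact: listed3_16.
case: k => [_|k]; first exact: listed3_17.
case: k => [_|k]; first exact: listed3_18.
case: k => [_|k]; first exact: listed3_19.
case: k => [_|k]; first exact: listed3_20.
case: k => [_|k]; first exact: listed3_21.
case: k => [_|k]; first exact: listed3_22.
case: k => [_|k]; first exact: listed3_23.
case: k => [_|k]; first exact: listed3_24.
case: k => [_|k]; first exact: listed3_25.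
case: k => [_|k]; first exact: listed3_26.
case: k => [_|k]; first exact: listed3_27.
case: k => [_|k]; first exact: listed3_28.
case: k => [_|k]; first exact: listed3_29.
by [].
Qed.

Lemma listed5_1 : listed (HN (@inM (map pv (nG node5_1)) 1)).
Proof.
apply: (listed_ring (q := [::]) (ps := [:: [::(5)%bZ]; [::(1)%bZ;(1)%bZ]]) (x := 0) (gs := genZ 5 (-1))) => //; [lpeq|gseq|exact: H_5_0].
Qed.
Lemma listed5_2 : listed (HN (@inM (map pv (nG node5_2)) 1)).
Proof.
apply: (listed_ring (q := [::(0)%bZ;(-1)%bZ]) (ps := [:: [::(5)%bZ]; [::(1)%bZ;(2)%bZ;(1)%bZ]]) (x := t) (gs := genF 5 2)) => //; [lpeq|gseq|apply: H_5_1; apply: (@other_excl1 node5_2 [::(0)%bZ;(-1)%bZ] [:: [::(5)%bZ]; [::(1)%bZ;(2)%bZ;(1)%bZ]]); [exact: (nodeokP (j := 2) tree5 isT isT)|by []|lpeq|gseq|by vm_compute]].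
Qed.
Lemma listed5_3 : listed (HN (@inM (map pv (nG node5_3)) 1)).
Proof.
apply: (listed_ring (q := [::(-1)%bZ;(-2)%bZ]) (ps := [:: [::(5)%bZ]; [::(1)%bZ;(2)%bZ;(1)%bZ]]) (x := 1%:R + 2%:R * t) (gs := genF 5 2)) => //; [lpeq|gseq|apply: H_5_1; apply: (@other_excl1 node5_3 [::(-1)%bZ;(-2)%bZ] [:: [::(5)%bZ]; [::(1)%bZ;(2)%bZ;(1)%bZ]]); [exact: (nodeokP (j := 3) tree5 isT isT)|by []|lpeq|gseq|by vm_compute]].
Qed.
Lemma listed5_4 : listed (HN (@inM (map pv (nG node5_4)) 1)).
Proof.
apply: (listed_ring (q := [::]) (ps := [:: [::(1)%bZ;(-1)%bZ;(1)%bZ;(-1)%bZ;(1)%bZ]]) (x := 0) (gs := [:: Phi10])) => //; [lpeq|gseq|exact: I_5_1].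
Qed.
Lemma listed5_5 : listed (HN (@inM (map pv (nG node5_5)) 1)).
Proof.
apply: (listed_sq (ps := [:: [::(5)%bZ]; [::(1)%bZ;(1)%bZ]]) (gs := [:: 5%:R; t + 1])) => //; [gseq|exact: tH_5].
Qed.
Lemma listed5_6 : listed (HN (@inM (map pv (nG node5_6)) 1)).
Proof.
apply: (listed_ring (q := [::]) (ps := [:: [::(25)%bZ]; [::(-4)%bZ;(1)%bZ]]) (x := 0) (gs := genZ 25 4)) => //; [lpeq|gseq|exact: (@H_25 4 isT isT)].
Qed.
Lemma listed5_7 : listed (HN (@inM (map pv (nG node5_7)) 1)).
Proof.
apply: (listed_ring (q := [::]) (ps := [:: [::(25)%bZ]; [::(-9)%bZ;(1)%bZ]]) (x := 0) (gs := genZ 25 9)) => //; [lpeq|gseq|exact: (@H_25 9 isT isT)].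
Qed.
Lemma listed5_8 : listed (HN (@inM (map pv (nG node5_8)) 1)).
Proof.
apply: (listed_ring (q := [::]) (ps := [:: [::(25)%bZ]; [::(-14)%bZ;(1)%bZ]]) (x := 0) (gs := genZ 25 14)) => //; [lpeq|gseq|exact: (@H_25 14 isT isT)].
Qed.
Lemma listed5_9 : listed (HN (@inM (map pv (nG node5_9)) 1)).
Proof.
apply: (listed_ring (q := [::]) (ps := [:: [::(25)%bZ]; [::(-19)%bZ;(1)%bZ]]) (x := 0) (gs := genZ 25 19)) => //; [lpeq|gseq|exact: (@H_25 19 isT isT)].
Qed.
Lemma listed5_10 : listed (HN (@inM (map pv (nG node5_10)) 1)).
Proof.
apply: (listed_sq (ps := [:: [::(1)%bZ;(-1)%bZ;(1)%bZ;(-1)%bZ;(1)%bZ]]) (gs := [:: Phi10])) => //; [gseq|exact: tI_5].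
Qed.

Lemma nodes_listed5 k : (0 < k < size nodes5)%N ->
  listed (HN (@inM (map pv (nG (nth node0 nodes5 k))) 1)).
Proof.
case: k => // k; case: k => [_|k]; first exact: listed5_1.
case: k => [_|k]; first exact: listed5_2.
case: k => [_|k]; first exact: listed5_3.
case: k => [_|k]; first exact: listed5_4.
case: k => [_|k]; first exact: listed5_5.
case: k => [_|k]; first exact: listed5_6.
case: k => [_|k]; first exact: listed5_7.
case: k => [_|k]; first exact: listed5_8.
case: k => [_|k]; first exact: listed5_9.
case: k => [_|k]; first exact: listed5_10.
by [].
Qed.

Lemma listed7_1 : listed (HN (@inM (map pv (nG node7_1)) 1)).
Proof.
apply: (listed_ring (q := [::]) (ps := [:: [::(7)%bZ]; [::(1)%bZ;(1)%bZ]]) (x := 0) (gs := genZ 7 (-1))) => //; [lpeq|gseq|exact: H_7_0].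
Qed.
Lemma listed7_2 : listed (HN (@inM (map pv (nG node7_2)) 1)).
Proof.
apply: (listed_ring (q := [::]) (ps := [:: [::(7)%bZ]; [::(1)%bZ;(2)%bZ;(1)%bZ]]) (x := 0) (gs := genF 7 2)) => //; [lpeq|gseq|apply: H_7_1; exact: epairs_x1].
Qed.
Lemma listed7_3 : listed (HN (@inM (map pv (nG node7_3)) 1)).
Proof.
apply: (listed_ring (q := [::(0)%bZ;(-1)%bZ]) (ps := [:: [::(7)%bZ]; [::(1)%bZ;(2)%bZ;(1)%bZ]]) (x := t) (gs := genF 7 2)) => //; [lpeq|gseq|apply: H_7_1; exact: epairs_x1].
Qed.
Lemma listed7_4 : listed (HN (@inM (map pv (nG node7_4)) 1)).
Proof.
apply: (listed_ring (q := [::(0)%bZ;(-2)%bZ]) (ps := [:: [::(7)%bZ]; [::(1)%bZ;(2)%bZ;(1)%bZ]]) (x := 2%:R * t) (gs := genF 7 2)) => //; [lpeq|gseq|apply: H_7_1; exact: epairs_x1].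
Qed.

Lemma nodes_listed7 k : (0 < k < size nodes7)%N ->
  listed (HN (@inM (map pv (nG (nth node0 nodes7 k))) 1)).
Proof.
case: k => // k; case: k => [_|k]; first exact: listed7_1.
case: k => [_|k]; first exact: listed7_2.
case: k => [_|k]; first exact: listed7_3.
case: k => [_|k]; first exact: listed7_4.
by [].
Qed.


(** * Primes from 11 on *)

Section LargePrime.
Variable p : nat.
Hypotheses (pp : prime p) (p11 : (11 <= p)%N).
Variables (H : set M2) (Hsub : is_subgroup H) (v : 'rV['F_p]_2).
Hypothesis v0 : v != 0.
Hypothesis vH : forall h, H h -> v *m map_mx (evp p) h = v.
Variables (C : finType) (E : coset_system (cimage H) C).

Definition sgneq (a b : 'rV['F_p]_2) := a = b \/ a = - b.
Definition lrow (g : 'M[int]_2) : 'rV['F_p]_2 := v *m map_mx intr g.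

Lemma lrowM g h : lrow (g * h) = lrow g *m map_mx intr h.
Proof. by rewrite /lrow -mulmxA -map_mxM. Qed.

Lemma sgneqM a b (h : 'M['F_p]_2) : sgneq a b -> sgneq (a *m h) (b *m h).
Proof. by case=> ->; [left|right]; rewrite ?mulNmx. Qed.
Lemma sgneq_trans a b c : sgneq a b -> sgneq b c -> sgneq a c.
Proof. by case=> -> [->|->]; [left|right|right|left]; rewrite ?opprK. Qed.

Lemma lrow_K k g : cimage H k -> sgneq (lrow (k * g)) (lrow g).
Proof.
case=> h Hh e; rewrite lrowM.
have vh : v *m map_mx intr (map_mx ev h) = v by rewrite -[RHS](vH Hh) -map_mx_comp.
by case: e => ->; [left|right]; rewrite /lrow ?map_mxN ?mulmxN ?mulNmx vh.
Qed.

Lemma lrow_cls g : SL2Z g -> sgneq (lrow (rep E (cls E g))) (lrow g).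
Proof.
move=> Sg; set r := rep E _; have Sr : SL2Z r := rep_SL E _.
have Kr : cimage H (r * g^-1) by apply/(clsP E Sr Sg); rewrite repK.
by have := lrow_K g Kr; rewrite mulrVK ?SL2Z_unit.
Qed.

Lemma lrow_perm h (Sh : SL2Z h) c :
  sgneq (lrow (rep E (cperm E Sh c))) (lrow (rep E c) *m map_mx intr h).
Proof. by rewrite cpermE -lrowM; apply: lrow_cls; exact: SL2ZM (rep_SL E c) Sh. Qed.

Definition xc (c : C) := lrow (rep E c) 0 0.
Definition yc (c : C) := lrow (rep E c) 0 1.

Lemma sgn_coord a b (h : 'M[int]_2) : sgneq a (b *m map_mx intr h) ->
  exists2 e : 'F_p, e = 1 \/ e = -1 &
  a 0 0 = e * (b 0 0 * (h 0 0)%:~R + b 0 1 * (h 1 0)%:~R) /\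
  a 0 1 = e * (b 0 0 * (h 0 1)%:~R + b 0 1 * (h 1 1)%:~R).
Proof.
have l1 : lift ord0 ord0 = 1 :> 'I_2 by exact: val_inj.
by case=> ->; [exists 1; [by left|]|exists (-1); [by right|]];
  rewrite !mxE !big_ord_recl !big_ord0 l1 !mxE !addr0 ?mul1r ?mulN1r.
Qed.

Lemma xy_neq0 c : xc c = 0 -> yc c = 0 -> False.
Proof.
move=> x0 y0; have Sr := SL2Z_unit (rep_SL E c).
have l0 : lrow (rep E c) = 0.
  apply/rowP => j; rewrite [RHS]mxE.
  by have [->|->] : j = 0 \/ j = 1 by case: j => [[|[|]]] //= hj; [left|right]; exact: val_inj.
move/eqP: v0; apply; have := lrowM (rep E c) (rep E c)^-1.
by rewrite mulrV // l0 mul0mx /lrow map_mx1 mulmx1.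
Qed.

Lemma xyS c : exists2 e : 'F_p, e = 1 \/ e = -1 &
  xc (cperm E SL2Z_S c) = e * (- yc c) /\ yc (cperm E SL2Z_S c) = e * xc c.
Proof.
have [s00 s01 s10 s11] : [/\ matS 0 0 = 0, matS 0 1 = 1, matS 1 0 = -1 & matS 1 1 = 0].
  by rewrite ev_BY; split; rewrite !mxE.
have [e he [e1 e2]] := sgn_coord (lrow_perm SL2Z_S c); exists e => //.
rewrite s00 s10 rmorph0 rmorphN1 in e1; rewrite s01 s11 rmorph0 rmorph1 in e2.
by split; [rewrite /xc e1|rewrite /yc e2]; rewrite -/(xc c) -/(yc c); ring.
Qed.

Lemma xyU c : exists2 e : 'F_p, e = 1 \/ e = -1 &
  xc (cperm E SL2Z_U c) = e * (- yc c) /\ yc (cperm E SL2Z_U c) = e * (xc c + yc c).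
Proof.
have [s00 s01 s10 s11] : [/\ matU 0 0 = 0, matU 0 1 = 1, matU 1 0 = -1 & matU 1 1 = 1].
  by rewrite ev_BX; split; rewrite !mxE.
have [e he [e1 e2]] := sgn_coord (lrow_perm SL2Z_U c); exists e => //.
rewrite s00 s10 rmorph0 rmorphN1 in e1; rewrite s01 s11 rmorph1 in e2.
by split; [rewrite /xc e1|rewrite /yc e2]; rewrite -/(xc c) -/(yc c); ring.
Qed.

Local Notation P := (cperm E (SL2ZM SL2Z_S SL2Z_U)).
Lemma xyP k c : exists2 e : 'F_p, e = 1 \/ e = -1 &
  xc (iter k P c) = e * xc c /\ yc (iter k P c) = e * (yc c - k%:R * xc c).
Proof.
elim: k => [|k [e he [IHx IHy]]].
  by exists 1; [left|rewrite /= mul0r subr0 !mul1r].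
rewrite iterS; set d := iter k P c in IHx IHy *.
have -> : P d = cperm E SL2Z_U (cperm E SL2Z_S d) by rewrite cperm_SU.
have [a ha [a1 a2]] := xyS d; have [b hb [b1 b2]] := xyU (cperm E SL2Z_S d).
exists (- (a * b * e)).
  by case: ha hb he => -> [] -> [] ->; rewrite ?mulrNN ?mulrN ?mulNr ?mulr1 ?opprK; auto.
by rewrite b1 b2 a1 a2 IHx IHy -[k.+1]addn1 natrD; split; ring.
Qed.

Lemma nat_neq0 n : (0 < n < p)%N -> n%:R != 0 :> 'F_p.
Proof.
move=> /andP[n0 np]; rewrite -(dvdn_pcharf (pchar_Fp pp)).
by apply/negP => /(dvdn_leq n0); rewrite leqNgt np.
Qed.

Lemma no_fixS c : cperm E SL2Z_S c != c.
Proof.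
apply/eqP => h; have [e he [e1 e2]] := xyS c; rewrite h in e1 e2.
have d2 : (2%:R : 'F_p) != 0 by apply: nat_neq0; lia.
have e21 : e * e = 1 by case: he => ->; rewrite ?mulrNN mulr1.
have x0 : xc c = 0.
  have h1 : xc c = - xc c by rewrite {1}e1 e2 mulrN mulrA e21 mul1r.
  have : 2%:R * xc c = 0 by rewrite mulr_natl mulr2n {2}h1 subrr.
  by move/eqP; rewrite mulf_eq0 (negPf d2) => /eqP.
by apply: (xy_neq0 x0); rewrite e2 x0 mulr0.
Qed.

Lemma no_fixU c : cperm E SL2Z_U c != c.
Proof.
apply/eqP => h; have [e he [e1 e2]] := xyU c; rewrite h in e1 e2.
have d3 : (3%:R : 'F_p) != 0 by apply: nat_neq0; lia.
case: he => he; rewrite he ?mul1r ?mulN1r ?opprK in e1 e2.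
  have x0 : xc c = 0 by apply: (@addIr _ (yc c)); rewrite add0r -e2.
  by apply: (xy_neq0 x0); apply: oppr_inj; rewrite -e1 x0 oppr0.
have y0 : yc c = 0.
  have : 3%:R * yc c = 0.
    have -> : 3%:R * yc c = yc c + (xc c + yc c) by rewrite e1; ring.
    by rewrite {1}e2 addNr.
  by move/eqP; rewrite mulf_eq0 (negPf d3) => /eqP.
by apply: (xy_neq0 _ y0); rewrite e1.
Qed.

Lemma U3 c : iter 3 (cperm E SL2Z_U) c = c.
Proof.
rewrite /= !cpermE; have SU := SL2Z_U; have Sc := rep_SL E c.
have Sr d := rep_SL E d.
rewrite (cls_mul E (SL2ZM Sc SU) SU) (cls_mul E (SL2ZM (SL2ZM Sc SU) SU) SU).
have -> : rep E c * matU * matU * matU = - rep E c.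
  rewrite -!mulrA; have -> : matU * (matU * matU) = - 1; last by rewrite mulrN1.
  have := congr1 (map_mx ev) BX3; rewrite !ev_mul -/matU ev_scale => e.
  by rewrite mulrA e map_mx1 (_ : (-1) ^+ 3 = -1 :> int) // scaleN1r.
have -> : cls E (- rep E c) = cls E (rep E c); last by rewrite repK.
apply/(clsP E (SL2ZN Sc) Sc); rewrite mulNr mulrV ?SL2Z_unit //.
exact: cimageN (cimage1 Hsub).
Qed.

Definition C0 := [set c | xc c == 0]%SET.

(** Distinct pairs of a coset c over (0, y) and a residue k give distinct cosets
    c S (SU)^k over vectors with nonzero first coordinate. *)
Lemma card_C0 : ((p + 1) * #|C0| <= #|C|)%N.
Proof.
pose f (a : C * 'I_p) := iter a.2 P (cperm E SL2Z_S a.1).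
have fx a : a.1 \in C0 -> exists2 e : 'F_p, e = 1 \/ e = -1 &
    yc a.1 != 0 /\ xc (f a) = e * yc a.1 /\ yc (f a) = - (e * (a.2%:R * yc a.1)).
  case: a => c k; rewrite inE /= => /eqP x0.
  have y0 : yc c != 0 by apply/eqP => /(xy_neq0 x0).
  have [a ha [a1 a2]] := xyS c; have [b hb [b1 b2]] := xyP k (cperm E SL2Z_S c).
  exists (- (a * b)); first by case: ha hb => -> [] ->; rewrite ?mulrNN ?mulrN ?mulNr ?mulr1 ?opprK; auto.
  by rewrite /f /= b1 b2 a1 a2 x0; split=> //; split; ring.
have sub : f @: finset.setX C0 [set: 'I_p]%SET \subset (~: C0)%SET.
  apply/fintype.subsetP => d /imsetP[a ha ->]; move: ha; rewrite !inE andbT => ac.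
  have aC : a.1 \in C0 by rewrite inE.
  have [e he [y0 [h1 _]]] := fx a aC.
  by rewrite h1 mulf_neq0 //; case: he => ->; rewrite ?oppr_eq0 oner_eq0.
have inj : {in finset.setX C0 [set: 'I_p]%SET &, injective f}.
  move=> [c k] [d l]; rewrite !inE /= !andbT => xc0 xd0 e.
  have cC : (c, k).1 \in C0 by rewrite inE.
  have dC : (d, l).1 \in C0 by rewrite inE.
  have [a ha [ya [a1 a2]]] := fx _ cC; have [b hb [yb [b1 b2]]] := fx _ dC.
  rewrite -e a1 /= in b1; rewrite -e a2 /= in b2; rewrite /= in ya.
  have a0 : a != 0 by case: ha => ->; rewrite ?oppr_eq0 oner_eq0.
  have kl : k%:R = l%:R :> 'F_p.
    apply: (mulIf (mulf_neq0 a0 ya)); transitivity (a * (k%:R * yc c)); first by ring.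
    rewrite (oppr_inj b2) b1; ring.
  have {}kl : k = l.
    apply: val_inj; have := congr1 val kl; rewrite /= !(val_Fp_nat pp) !modn_small //.
  have ij n : injective (iter n P) by elim: n => // n IH x y /= /perm_inj/IH.
  by move: e; rewrite /f /= kl => /ij/perm_inj ->.
have := subset_leq_card sub; rewrite card_in_imset // finset.cardsX cardsT card_ord.
by move=> h; rewrite -(finset.cardsC C0) mulnDl mul1n addnC leq_add2l mulnC.
Qed.

Theorem large_prime_bound :
  (#|porbits (cperm E SL2Z_S)| + #|porbits (cperm E SL2Z_U)| + #|porbits P| <= #|C|)%N.
Proof.
have all c : c \in enum C by rewrite mem_enum.
have bS := @porbits_bound C C id (enum C) all (cperm E SL2Z_S) (cperm E SL2Z_S) (fun=> 2%N) 2.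
have bU := @porbits_bound C C id (enum C) all (cperm E SL2Z_U) (cperm E SL2Z_U) (fun=> 3%N) 3.
have bP := @porbits_bound C C id (enum C) all P P (fun c => if c \in C0 then 1%N else p) p.
have {bS} bS : (2 * #|porbits (cperm E SL2Z_S)| <= #|C|)%N.
  apply: leq_trans (bS _ _) _ => // [c _|]; last by rewrite sum_nat_const muln1.
  by split=> // -[|[|k]] // _; exact: no_fixS.
have {bU} bU : (3 * #|porbits (cperm E SL2Z_U)| <= #|C|)%N.
  apply: leq_trans (bU _ _) _ => // [c _|]; last by rewrite sum_nat_const muln1.
  split=> // -[|[|[|k]]] // _; first exact: no_fixU.
  apply/eqP => h; have := U3 c; rewrite iterS h => h3.
  by have := no_fixU c; rewrite h3 eqxx.
have {bP} bP : (p * #|porbits P| <= #|C| + (p - 1) * #|C0|)%N.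
  apply: leq_trans (bP _ _) _ => // [c _|].
    split=> //; first by case: ifP => //; lia.
      by case: ifP => // _; rewrite dvd1n.
    move=> k; case: ifP => [_|]; first by case: k => [|[|k]].
    rewrite inE => /negbT x0 kp; apply/eqP => h.
    have [e he [h1 h2]] := xyP k c; rewrite h in h1 h2.
    have e1 : e = 1 by apply: (mulIf x0); rewrite mul1r -h1.
    have : k%:R * xc c = 0 by move: h2; rewrite e1 mul1r => /eqP; rewrite -subr_eq0 opprB addrC subrK => /eqP.
    by move/eqP; rewrite mulf_eq0 (negPf x0) orbF (negPf (nat_neq0 kp)).
  rewrite (bigID (fun c => c \in C0)) /= addnC.
  rewrite (eq_bigr (fun=> 1%N)); last by move=> c /negPf->; rewrite divnn prime_gt0.
  rewrite [X in (_ + X)%N](eq_bigr (fun=> p)); last by move=> c ->; rewrite divn1.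
  rewrite !sum_nat_const muln1.
  have := finset.cardsC C0; have -> : #|[pred c | c \notin C0]| = #|~: C0|%SET by apply: eq_card => c; rewrite !inE.
  by move=> <-; nia.
have := card_C0; move: #|C0| #|C| #|porbits P| bS bU bP => z n q; move: #|_| #|_| => a b.
by move: p11; clear; nia.
Qed.

End LargePrime.


(** * The theorem *)

Lemma root_row p (v : seq Z) (D : M2) : size v = 2 ->
  Psi (map pv [:: ([:: 1%bZ], [::]); ([::], [:: 1%bZ])]) (zf p v) D 0 ->
  row2 (zf p v 0) (zf p v 1) *m map_mx (evp p) D = 0.
Proof.
move=> sv [c -> e]; rewrite [RHS]e /lincomb /psic /= !big_ord_recl !big_ord0 /= !addr0.
rewrite map_mxD !map_mxM mulmxDr !mulmxA.
have u0 a b : pv (a, b) 0 0 = lp a by rewrite mxE.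
have u1 a b : pv (a, b) 1 0 = lp b by rewrite mxE.
have sc (x : 'rV['F_p]_2) (u : V) : x *m map_mx (evp p) u = (x 0 0 * evp p (u 0 0) + x 0 1 * evp p (u 1 0))%:M.
  have l1 : lift ord0 ord0 = 1 :> 'I_2 by exact: val_inj.
  apply/rowP => j; rewrite (ord1 j) !mxE !big_ord_recl big_ord0 l1 !mxE addr0 eqxx mulr1n //.
rewrite !sc !u0 !u1 !mul_scalar_mx /lp /= !zr1 !mulr0 !addr0 !rmorph0 !rmorph1 !mxE /=.
by rewrite !mulr1 !mulr0 addr0 add0r.
Qed.

Lemma below_root (G : seq pvec) (K : V -> Prop) h : nth ([::], [::]) G 0 = ([:: 1%bZ], [::]) ->
  nth ([::], [::]) G 1 = ([::], [:: 1%bZ]) -> (1 < size G)%N -> HN K h ->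
  HN (@inM (map pv G) 1) (1^-1 * h * 1).
Proof.
move=> g0 g1 sG [Bh _]; rewrite invr1 mul1r mulr1; split=> // u.
have sM := inM_submod (map pv G).
have -> : (h - 1) *m u = ((h - 1) *m u) 0 0 *: pv (nth ([::], [::]) G 0) +
    ((h - 1) *m u) 1 0 *: pv (nth ([::], [::]) G 1).
  move: ((h - 1) *m u) => w; rewrite g0 g1; apply/colP => i.
  have [->|->] : i = 0 \/ i = 1 by case: i => [[|[|]]] //= hj; [left|right]; exact: val_inj.
    by rewrite !mxE /= zr1; ring.
  by rewrite !mxE /= zr1; ring.
by apply: (submodD sM); apply: (submodZ sM); apply: inM_mem; apply: mem_nth => //; exact: ltnW.
Qed.

Theorem theorem1p3 (R : realType) (p : nat) (p_prime : prime p) (p_neq2 : p <> 2%N)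
  (A : lmodType Laurent)
  (A_local : local_module (ideal [:: p%:R; t + 1]) A)
  (phi : {linear 'cV[Laurent]_2 -> A})
  (phi_surj : forall a : A, exists u : 'cV[Laurent]_2, phi u = a)
  (genus0 : genus_zero R (Hgrp phi)) :
  exists2 K, listed K & conj_Bu3 (Hgrp phi) K.
Proof.
have [[a0 a00] [n kill]] := A_local; have [Hsub Hfin Hgen] := genus0.
pose K (u : V) := phi u = 0.
have HK : Hgrp phi = HN K by [].
have phiD u w : phi (u + w) = phi u + phi w by exact: linearD.
have phiB u w : phi (u - w) = phi u - phi w by exact: linearB.
have phiZ a u : phi (a *: u) = a *: phi u by exact: linearZZ.
have sK : submod K.
  split=> [|u w hu hw|a u hu]; rewrite /K; first exact: linear0.
    by rewrite phiD (hu : phi u = 0) (hw : phi w = 0) addr0.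
  by rewrite phiZ (hu : phi u = 0) scaler0.
have killK x : ideal_pow (ideal [:: p%:R; t + 1]) n x -> forall u, K (x *: u).
  by move=> hx u; rewrite /K phiZ kill.
have Knz : ~ forall u, K u.
  by move=> h; have [u e] := phi_surj a0; move: a00; rewrite -e h eqxx.
rewrite HK in Hsub Hfin Hgen *.
have [C [E]] := cimage_cosets Hsub Hfin.
have eul := genus0_euler E (cimage_SL Hsub) (cimage1 Hsub) (cimageM Hsub) (cimageV Hsub)
  (cimageN (H := HN K)) Hgen.
have big : (#|C| < #|porbits (cperm E SL2Z_S)| + #|porbits (cperm E SL2Z_U)| +
   #|porbits (cperm E (SL2ZM SL2Z_S SL2Z_U))|)%N by rewrite eul addn2 ltnS leqnSn.
have noroot : ~ conj_Bu3 (HN K) (HN (@inM (map pv [:: ([:: 1%bZ], [::]); ([::], [:: 1%bZ])]) 1)).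
  move=> [g Bg e]; have ug := Bu3_unit Bg.
  have tK : HN K t%:M.
    rewrite e; exists t%:M; last by rewrite -scalemx1 -scalerAr mulr1 -scalerAl mulVr.
    have := @below_root [:: ([:: 1%bZ], [::]); ([::], [:: 1%bZ])] (fun=> True) t%:M erefl erefl isT.
    by rewrite invr1 mul1r mulr1; apply; split; [exact: Bu3_t|].
  apply: Knz => u; have [_ hu] := tK.
  have tu (w : V) : (t + 1) *: phi w = 2%:R *: phi w.
    have := hu w; rewrite /K mulmxBl mul_scalar_mx mul1mx phiB phiZ => /eqP; rewrite subr_eq0 => /eqP ew.
    by rewrite scalerDl scale1r ew -mulr2n scaler_nat.
  have tn k (w : V) : (t + 1) ^+ k *: phi w = 2%:R ^+ k *: phi w.
    elim: k => [|k IH]; first by rewrite !expr0.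
    by rewrite exprS -scalerA IH scalerA mulrC -scalerA tu scalerA -exprSr.
  have pw x : x \in ideal [:: p%:R; t + 1] -> phi (x ^+ n *: u) = 0.
    move=> xI; apply: killK; exists 1%N, (fun=> 1), (fun _ _ => x); split=> //.
    by rewrite big_ord_recl big_ord0 addr0 mul1r prodr_const card_ord.
  have e2 : phi (2%:R ^+ n *: u) = 0.
    by rewrite phiZ -tn -phiZ; apply: pw; exact: (@ideal_gen [:: p%:R; t + 1] 1).
  have ep : phi (p%:R ^+ n *: u) = 0 by apply: pw; exact: (@ideal_gen [:: p%:R; t + 1] 0).
  have cop : coprime (2 ^ n) (p ^ n).
    apply: coprimeXl; apply: coprimeXr; rewrite prime_coprime // dvdn_prime2 //.
    by apply/eqP => h; case: p_neq2.
  have n20 : (0 < 2 ^ n)%N by rewrite expn_gt0.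
  have [a b eab _] := egcdnP (p ^ n) n20; move: eab; rewrite (eqP cop) => eab.
  rewrite /K -[u]scale1r; have -> : (1 : Laurent) = a%:R * 2%:R ^+ n - b%:R * p%:R ^+ n.
    by rewrite -!natrX -!natrM eab natrD addrC addKr.
  by rewrite scalerBl -!scalerA phiB (phiZ a%:R) (phiZ b%:R) e2 ep !scaler0 subrr.
have small nodes D : treechk p nodes D -> nG (nth node0 nodes 0) = [:: ([:: 1%bZ], [::]); ([::], [:: 1%bZ])] ->
    (0 < size nodes)%N ->
    (forall k, (0 < k < size nodes)%N -> listed (HN (@inM (map pv (nG (nth node0 nodes k))) 1))) ->
    exists2 K', listed K' & conj_Bu3 (HN K) K'.
  move=> chk G0 s0 hl.
  have [|k kn hk] := @tree_sound p p_prime nodes D chk K n sK killK Hsub C E big 0%N 1 s0 Bu31.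
    by rewrite G0 => h; apply: below_root.
  case: k kn hk => [|k] kn hk; first by case: noroot; rewrite -G0.
  by eexists; [exact: (hl k.+1)|exact: hk].
have [p7|p7] := leqP p 7.
  have : p \in [:: 3; 5; 7]%N.
    by move: p_prime p_neq2 p7; case: (p) => [|[|[|[|[|[|[|[|p']]]]]]]].
  rewrite !inE => /or3P[]/eqP pE; subst p.
  - exact: (small _ _ tree3 erefl isT nodes_listed3).
  - exact: (small _ _ tree5 erefl isT nodes_listed5).
  - exact: (small _ _ tree7 erefl isT nodes_listed7).
have p11 : (11 <= p)%N.
  rewrite leqNgt; apply/negP => p10; move: p_prime.
  have : p \in [:: 8; 9; 10]%N by rewrite !inE; move: p7 p10; lia.
  by rewrite !inE => /or3P[]/eqP->.
have [/noroot//|[w [wp sw _ hw]]] := node_step p_prime sK killK Bu31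
  (fun h => @below_root [:: ([:: 1%bZ], [::]); ([::], [:: 1%bZ])] K h erefl erefl isT).
have v0 : row2 (zf p w 0) (zf p w 1) != 0.
  apply/eqP => /rowP e; have := e 0; have := e 1; rewrite !mxE /= => e1 e0.
  have one : (1 : 'F_p) != 0 by exact: oner_neq0.
  have pE r : proj p r.+1 = [seq 1%bZ :: x | x <- vecs p r] ++ [seq Z0 :: x | x <- proj p r] by [].
  move: wp; rewrite [size _]/= pE mem_cat => /orP[/mapP[x _ wE]|/mapP[x xp wE]].
    by move: e0; rewrite wE /zf [nth _ _ _]/= zr1 => e0; rewrite e0 eqxx in one.
  move: xp; rewrite pE mem_cat => /orP[/mapP[y _ xE]|/mapP[y]]; last by rewrite in_nil.
  by move: e1; rewrite wE xE /zf [nth _ _ _]/= zr1 => e1; rewrite e1 eqxx in one.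
have vH h : HN K h -> row2 (zf p w 0) (zf p w 1) *m map_mx (evp p) h = row2 (zf p w 0) (zf p w 1).
  move=> /hw[_]; rewrite invr1 mul1r mulr1 => /(root_row sw).
  rewrite map_mxB map_mx1 mulmxBr mulmx1 => /eqP; rewrite subr_eq0 => /eqP //.
have := large_prime_bound p_prime p11 Hsub v0 vH E.
by rewrite leqNgt big.
Qed.
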